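(* Let $r\ge2$ and $n\ge 2$ be integers. The group $\Lambda_{r,n}$ (the $n$-fold central product of the free two-step nilpotent group of rank $r$) has a quadratic Dehn function, i.e. $\delta_{\Lambda_{r,n}}(\ell)\sim \ell^2$.
   Context: $\Lambda_r=\langle g_1,\dots,g_r\mid [g_i,[g_j,g_k]]=1,\ 1\le i,j,k\le r\rangle$ is the free two-step nilpotent group on $r$ generators. For a two-step nilpotent group $G$ with center $Z$, the $n$-fold central product $G^{\times_Z n}$ is the quotient of $G^n$ obtained by identifying the centers of all $n$ factors via $(z,1,1,\dots)\sim(1,z,1,\dots)\sim(1,1,z,\dots)\sim\cdots$ for all $z\in Z$. Define $\Lambda_{r,n}=(\Lambda_r)^{\times_Z n}$. Dehn function. For a simply-connected riemannian manifold or simplicial complex $X$ and a Lipschitz closed curve $f:S^1\to X$, let $\delta_X(f)$ be the infimum of the areas of Lipschitz discs $g:D^2\to X$ with $g|_{S^1}=f$, and let $\delta_X(\ell)=\sup\{\delta_X(f)\mid \operatorname{length}(f)\le \ell\}$. If a group $\Gamma$ acts geometrically (cocompactly, properly discontinuously, by isometries) on such an $X$, then $\delta_\Gamma$ is the $\sim$-class of $\delta_X$, which does not depend on $X$. For $f,g:\mathbb{R}^+\to\mathbb{R}^+$, $f\precsim g$ means there is a constant $c$ with $f(x)\le c\,g(cx+c)+cx+c$ for all $x$; $f\sim g$ means $f\precsim g$ and $g\precsim f$. *)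

(* Defs.v *)
From HB Require Import structures.
From mathcomp Require Import all_boot all_order all_algebra.
From mathcomp Require Import generic_quotient.
From mathcomp Require Import finmap.
From mathcomp Require Import all_classical all_reals all_analysis.
From mathcomp Require Import lra.

Set Implicit Arguments.
Unset Strict Implicit.
Unset Printing Implicit Defensive.

Import Order.TTheory GRing.Theory Num.Theory.
Import numFieldNormedType.Exports.

Local Open Scope classical_set_scope.
Local Open Scope ring_scope.

Section GroupQuotient.
Local Open Scope group_scope.
Local Open Scope quotient_scope.
Variables (M : starMonoidType) (S : M -> M -> Prop).

(* The smallest congruence on M that contains S and turns the involution of M
   into an inverse: for M the words in letters and formal inverses this is the
   congruence of a group presentation, for M a group the quotient is M modulo
   the normal closure of the x^-1 * y with S x y. *)
Inductive gcongr : M -> M -> Prop :=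
| gcongr_rel x y of S x y : gcongr x y
| gcongrVg x : gcongr (x^-1 * x) 1
| gcongr_refl x : gcongr x x
| gcongr_sym x y of gcongr x y : gcongr y x
| gcongr_trans x y z of gcongr x y & gcongr y z : gcongr x z
| gcongrM x x' y y' of gcongr x x' & gcongr y y' : gcongr (x * y) (x' * y').

Definition gcongrb : rel M := fun x y => `[< gcongr x y >].

Lemma gcongrb_refl : reflexive gcongrb.
Proof. by move=> x; apply/asboolP; exact: gcongr_refl. Qed.

Lemma gcongrb_sym : symmetric gcongrb.
Proof.
by move=> x y; apply/asboolP/asboolP => ?; exact: gcongr_sym.
Qed.

Lemma gcongrb_trans : transitive gcongrb.
Proof.
by move=> y x z /asboolP xy /asboolP yz; apply/asboolP; exact: gcongr_trans yz.
Qed.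

Canonical gcongrb_equiv :=
  EquivRel gcongrb gcongrb_refl gcongrb_sym gcongrb_trans.

Definition gquot := {eq_quot gcongrb}.

HB.instance Definition _ := Choice.on gquot.
HB.instance Definition _ := Quotient.on gquot.

Lemma gquotP x y : \pi_gquot x = \pi_gquot y <-> gcongr x y.
Proof. by split=> [/eqmodP/asboolP//|xy]; apply/eqmodP/asboolP. Qed.

Lemma gcongr_repr x : gcongr (repr (\pi_gquot x)) x.
Proof. by apply/gquotP; rewrite reprK. Qed.

Lemma gcongrgV x : gcongr (x * x^-1) 1.
Proof. by have := gcongrVg x^-1; rewrite invgK. Qed.

Lemma gcongrV x y : gcongr x y -> gcongr x^-1 y^-1.
Proof.
move=> xy; apply: (@gcongr_trans _ (x^-1 * (y * y^-1))).
  rewrite -{1}[x^-1]mulg1; apply: gcongrM; first exact: gcongr_refl.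
  exact/gcongr_sym/gcongrgV.
apply: (@gcongr_trans _ (x^-1 * (x * y^-1))).
  apply: gcongrM; first exact: gcongr_refl.
  by apply: gcongrM; [exact: gcongr_sym|exact: gcongr_refl].
rewrite mulgA -{2}[y^-1]mul1g; apply: gcongrM; first exact: gcongrVg.
exact: gcongr_refl.
Qed.

Definition gquot_one : gquot := \pi_gquot 1.
Definition gquot_inv (u : gquot) : gquot := \pi_gquot (repr u)^-1.
Definition gquot_mul (u v : gquot) : gquot := \pi_gquot (repr u * repr v).

Lemma gquot_piV x : gquot_inv (\pi x) = \pi_gquot x^-1.
Proof. by apply/gquotP/gcongrV/gcongr_repr. Qed.

Lemma gquot_piM x y : gquot_mul (\pi x) (\pi y) = \pi_gquot (x * y).
Proof. by apply/gquotP/gcongrM; exact: gcongr_repr. Qed.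

Lemma gquot_mulA : associative gquot_mul.
Proof.
by elim/quotW => x; elim/quotW => y; elim/quotW => z; rewrite !gquot_piM mulgA.
Qed.

Lemma gquot_mul1g : left_id gquot_one gquot_mul.
Proof. by elim/quotW => x; rewrite gquot_piM mul1g. Qed.

Lemma gquot_mulg1 : right_id gquot_one gquot_mul.
Proof. by elim/quotW => x; rewrite gquot_piM mulg1. Qed.

Lemma gquot_mulVg : left_inverse gquot_one gquot_inv gquot_mul.
Proof.
by elim/quotW => x; rewrite gquot_piV gquot_piM; apply/gquotP/gcongrVg.
Qed.

Lemma gquot_mulgV : right_inverse gquot_one gquot_inv gquot_mul.
Proof.
by elim/quotW => x; rewrite gquot_piV gquot_piM; apply/gquotP/gcongrgV.
Qed.

HB.instance Definition _ := isGroup.Build gquot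
  gquot_mulA gquot_mul1g gquot_mulg1 gquot_mulVg gquot_mulgV.

End GroupQuotient.

(* (a, false) is the letter a and (a, true) its formal inverse. *)
Definition words (A : choiceType) := seq (A * bool).

Section Words.
Variable A : choiceType.
Implicit Types u v : words A.

HB.instance Definition _ := Choice.on (words A).

Definition wordV u : words A := rev [seq (x.1, ~~ x.2) | x <- u].

Lemma wordVK : involutive wordV.
Proof.
move=> u; rewrite /wordV map_rev revK -map_comp -[RHS]map_id.
by apply: eq_map => -[a b] /=; rewrite negbK.
Qed.

Lemma wordVM u v : wordV (u ++ v) = wordV v ++ wordV u.
Proof. by rewrite /wordV map_cat rev_cat. Qed.

HB.instance Definition _ :=
  isStarMonoid.Build (words A) (@catA _) (@cat0s _) wordVK wordVM.

Definition letter (a : A) : words A := [:: (a, false)].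

End Words.

Inductive nilpotent2_rel (r : nat) : words 'I_r -> words 'I_r -> Prop :=
| Nilpotent2Rel (i j k : 'I_r) :
    nilpotent2_rel (commg (letter i) (commg (letter j) (letter k))) 1%g.

Definition free_nilpotent2 (r : nat) : groupType := gquot (@nilpotent2_rel r).

Section CentralPower.
Local Open Scope group_scope.
Variables (G : groupType) (n : nat).

Definition at_factor (i : 'I_n) (z : G) : {ffun 'I_n -> G} :=
  [ffun j => if j == i then z else 1].

Inductive central_rel : {ffun 'I_n -> G} -> {ffun 'I_n -> G} -> Prop :=
| CentralRel (i j : 'I_n) (z : G) of (forall g, commute z g) :
    central_rel (at_factor i z) (at_factor j z).

Definition central_power : groupType := gquot central_rel.

End CentralPower.

Definition Lambda (r n : nat) : groupType := central_power (free_nilpotent2 r) n.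

Record complex (V : choiceType) := Complex {
  face : pred {fset V};
  face_neq0 : forall s, face s -> s != fset0;
  face_sub : forall s t, face s -> (t `<=` s)%fset -> t != fset0 -> face t }.

Section Realization.
Variables (R : realType) (V : choiceType) (K : complex V).

Definition barycentric : pred {fsfun V -> R with 0} := fun x =>
  [&& face K (finsupp x), all (fun v => 0 <= x v) (finsupp x)
    & \sum_(v <- finsupp x) x v == 1].

Record realization := Realization {
  bary :> {fsfun V -> R with 0};
  baryP : barycentric bary }.

HB.instance Definition _ := [isSub for bary].
HB.instance Definition _ := [Choice of realization by <:].

(* The Euclidean distance of the ambient space R^(V): every simplex is a
   standard Euclidean simplex (of edge length sqrt 2).  It induces the topology
   of the realization; the metric proper is path_dist below. *)
Definition bary_dist (x y : realization) : R :=
  Num.sqrt (\sum_(v <- (finsupp x `|` finsupp y)%fset) (x v - y v) ^+ 2).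

Lemma bary_distE (U : {fset V}) (x y : realization) :
  (finsupp x `<=` U)%fset -> (finsupp y `<=` U)%fset ->
  bary_dist x y = Num.sqrt (\sum_(v <- U) (x v - y v) ^+ 2).
Proof.
move=> xU yU; congr Num.sqrt.
have sU : (finsupp x `|` finsupp y `<=` U)%fset by rewrite fsubUset xU.
rewrite -(big_fset_incl _ sU)// => v vU.
rewrite in_fsetU negb_or => /andP[vx vy].
by rewrite !fsfun_dflt// subrr expr0n.
Qed.

Lemma minkowski2 (a b c d : R) :
  Num.sqrt ((a + c) ^+ 2 + (b + d) ^+ 2) <=
  Num.sqrt (a ^+ 2 + b ^+ 2) + Num.sqrt (c ^+ 2 + d ^+ 2).
Proof.
set p := Num.sqrt (a ^+ 2 + _); set q := Num.sqrt (c ^+ 2 + _).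
have p0 : 0 <= p := sqrtr_ge0 _; have q0 : 0 <= q := sqrtr_ge0 _.
have pE : p ^+ 2 = a ^+ 2 + b ^+ 2 by rewrite sqr_sqrtr// addr_ge0 ?sqr_ge0.
have qE : q ^+ 2 = c ^+ 2 + d ^+ 2 by rewrite sqr_sqrtr// addr_ge0 ?sqr_ge0.
rewrite -[leRHS]ger0_norm ?addr_ge0// -sqrtr_sqr ler_wsqrtr//.
have le_pq : a * c + b * d <= p * q.
  apply: le_trans (ler_norm _) _.
  rewrite -ler_sqr ?nnegrE ?mulr_ge0// real_normK ?num_real//.
  rewrite [leRHS]exprMn pE qE -subr_ge0.
  by have := sqr_ge0 (a * d - b * c); lra.
by rewrite [leRHS]sqrrD pE qE; lra.
Qed.

Lemma minkowski (s : seq V) (f g : V -> R) :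
  Num.sqrt (\sum_(v <- s) (f v + g v) ^+ 2) <=
  Num.sqrt (\sum_(v <- s) f v ^+ 2) + Num.sqrt (\sum_(v <- s) g v ^+ 2).
Proof.
elim: s => [|v s IH]; first by rewrite !big_nil sqrtr0 addr0.
rewrite !big_cons; set F := \sum_(v <- s) f v ^+ 2 in IH *.
set G := \sum_(v <- s) g v ^+ 2 in IH *.
have F0 : 0 <= F by apply: sumr_ge0 => *; exact: sqr_ge0.
have G0 : 0 <= G by apply: sumr_ge0 => *; exact: sqr_ge0.
rewrite -{1}(sqr_sqrtr F0) -{1}(sqr_sqrtr G0).
apply: le_trans (minkowski2 _ _ _ _); rewrite ler_wsqrtr// lerD2l.
rewrite -[leLHS]sqr_sqrtr; last by apply: sumr_ge0 => *; exact: sqr_ge0.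
by rewrite ler_sqr ?nnegrE ?addr_ge0 ?sqrtr_ge0.
Qed.

Lemma bary_distxx x : bary_dist x x = 0.
Proof.
by rewrite /bary_dist big1 ?sqrtr0// => v _; rewrite subrr expr0n.
Qed.

Lemma bary_dist_eq0 x y : bary_dist x y = 0 -> x = y.
Proof.
move=> /eqP; rewrite sqrtr_eq0 => le0; apply/val_inj/fsfunP => v.
have [vU|] := boolP (v \in (finsupp x `|` finsupp y)%fset); last first.
  by rewrite in_fsetU negb_or => /andP[vx vy]; rewrite !fsfun_dflt.
apply/eqP; rewrite -subr_eq0 -sqrf_eq0 eq_le sqr_ge0 andbT.
apply: le_trans le0; rewrite (big_fsetD1 v vU)/= lerDl.
by apply: sumr_ge0 => *; exact: sqr_ge0.
Qed.

Lemma bary_dist_sym x y : bary_dist x y = bary_dist y x.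
Proof.
rewrite /bary_dist fsetUC; congr Num.sqrt.
by apply: eq_bigr => v _; rewrite -sqrrN opprB.
Qed.

Lemma bary_dist_triangle y x z :
  bary_dist x z <= bary_dist x y + bary_dist y z.
Proof.
pose U := (finsupp x `|` finsupp y `|` finsupp z)%fset.
have xU : (finsupp x `<=` U)%fset by rewrite /U -fsetUA fsubsetUl.
have yU : (finsupp y `<=` U)%fset by rewrite fsubsetU// fsubsetUr.
have zU : (finsupp z `<=` U)%fset by rewrite fsubsetUr.
rewrite !(@bary_distE U)//; apply: le_trans (minkowski _ _ _).
by under eq_bigr => v do rewrite -(subrKA (y v)).
Qed.

HB.instance Definition _ := @isMetric.Build R realization bary_dist
  bary_distxx bary_dist_eq0 bary_dist_sym bary_dist_triangle.

End Realization.

Arguments realization R {V} K.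

Section Dehn.
Variables (R : realType) (V : choiceType) (K : complex V).
Local Notation X := (realization R K).
Local Open Scope ereal_scope.

Definition curve_length (a b : R) (c : R -> X) : \bar R :=
  ereal_sup [set (\sum_(0 <= i < size s)
                    mdist (c (nth b (a :: s) i)) (c (nth b (a :: s) i.+1)))%:E
            | s in itv_partition a b].

Definition path_between (x y : X) (c : R -> X) : Prop :=
  [/\ {within `[0%R, 1%R], continuous c}, c 0%R = x & c 1%R = y].

(* The length metric of the complex. *)
Definition path_dist (x y : X) : \bar R :=
  ereal_inf [set curve_length 0%R 1%R c | c in path_between x y].

Definition simply_connected : Prop :=
  [/\ exists x : X, True,
      forall x y : X, exists c, path_between x y c
    & forall (x : X) (c : R -> X), path_between x x c ->
        exists H : R * R -> X,
          [/\ {within [set p | p.1 \in `[0%R, 1%R] /\ p.2 \in `[0%R, 1%R]],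
                 continuous H},
              forall t, t \in `[0%R, 1%R] -> H (0%R, t) = c t,
              forall t, t \in `[0%R, 1%R] -> H (1%R, t) = x
            & forall s, s \in `[0%R, 1%R] -> H (s, 0%R) = x /\ H (s, 1%R) = x]].

Definition circle : set (R * R) := [set p | (p.1 ^+ 2 + p.2 ^+ 2)%R = 1%R].
Definition disc : set (R * R) := [set p | (p.1 ^+ 2 + p.2 ^+ 2 <= 1)%R].

Definition lipschitz_map (A : set (R * R)) (f : R * R -> X) : Prop :=
  exists L : R, forall p q, A p -> A q ->
    path_dist (f p) (f q) <= (L * `|p - q|%R)%:E.

Definition loop_length (f : R * R -> X) : \bar R :=
  curve_length 0%R (2 * pi)%R (fun t => f (cos t, sin t)).

(* A Lipschitz map has partial derivatives almost everywhere, and at such a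
   point only finitely many of them are nonzero: a barycentric coordinate that
   vanishes at the point is minimal there. *)
Definition partial1 (g : R * R -> X) (p : R * R) (v : V) : R :=
  derive1 (fun t => g (t, p.2) v) p.1.
Definition partial2 (g : R * R -> X) (p : R * R) (v : V) : R :=
  derive1 (fun t => g (p.1, t) v) p.2.

Definition jacobian (g : R * R -> X) (p : R * R) : R :=
  let E := (\sum_(v \in [set: V]) partial1 g p v ^+ 2)%R in
  let F := (\sum_(v \in [set: V]) partial1 g p v * partial2 g p v)%R in
  let G := (\sum_(v \in [set: V]) partial2 g p v ^+ 2)%R in
  Num.sqrt (E * G - F ^+ 2)%R.

Definition area (g : R * R -> X) : \bar R :=
  \int[(@lebesgue_measure R \x @lebesgue_measure R)%E]_(p in disc)
    (jacobian g p)%:E.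

Definition filling_area (f : R * R -> X) : \bar R :=
  ereal_inf [set area g | g in
    [set g | lipschitz_map disc g /\ forall p, circle p -> g p = f p]].

Definition dehn (l : R) : \bar R :=
  ereal_sup [set filling_area f | f in
    [set f | lipschitz_map circle f /\ loop_length f <= l%:E]].

End Dehn.

Definition geometric_action (R : realType) (V : choiceType) (K : complex V)
    (G : groupType) (act : G -> realization R K -> realization R K) : Prop :=
  [/\ forall x, act 1%g x = x /\
        forall g h, act (g * h)%g x = act g (act h x),
      forall g x y, path_dist (act g x) (act g y) = path_dist x y,
      forall C, compact C ->
        finite_set [set g | (act g @` C) `&` C !=set0]
    & exists2 C, compact C & \bigcup_g (act g @` C) = setT].

Definition geometric_model (R : realType) (V : choiceType) (K : complex V)
    (G : groupType) : Prop :=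
  simply_connected R K /\
  exists act : G -> realization R K -> realization R K, geometric_action act.

(* Growth functions are considered on [0, +oo[ only; an infinite value is
   never dominated by a finite one. *)
Definition dominated (R : realType) (f g : R -> \bar R) : Prop :=
  exists2 c : R, 0 < c & forall x, 0 <= x ->
    (f x <= c%:E * g (c * x + c)%R + (c * x + c)%:E)%E.

Definition growth_equiv (R : realType) (f g : R -> \bar R) : Prop :=
  dominated f g /\ dominated g f.

(* f belongs to the Dehn function of G, a class of functions that does not
   depend on the complex on which G acts: some complex carries a geometric
   action of G, and f is equivalent to the Dehn function of every such one. *)
Definition group_dehn_equiv (R : realType) (G : groupType) (f : R -> \bar R)
    : Prop :=
  (exists (V : choiceType) (K : complex V), geometric_model R K G) /\
  (forall (V : choiceType) (K : complex V), geometric_model R K G ->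
     growth_equiv (@dehn R V K) f).

(* Main.v *)
(** Upper bound.  A word in the generators of all factors can be sorted by factor at
quadratic cost, because generators of different factors commute.  The commutators left
over are central and can be moved to another factor, where [g1 * h1] and [g2 * h2] with
suitable [g1, g2] in one factor and [h1, h2] in another one commute; so the powers of a
commutator can be multiplied at quadratic cost by recursively bisecting the exponents.
Hence a word of length [l] that represents 1 has area [O(l^2)].  In a geometric model,
a loop of length [l] is cut into unit pieces, each close to the path of a generator;
the pieces are homotopic to a word through bounded fillings, and each relator has a
bounded filling.

Lower bound.  Let [x] and [y] be generators of different factors.  The loops along
[x^m], [y^m], [x^-m], [y^-m] have length [O(m)].  The exponents of [x] and of [y], extended
affinely over the simplices, map the model to the plane; by Stokes' theorem and Rademacher's
theorem in one variable, the image of any Lipschitz filling covers a square of side [~ m],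
while the Jacobian of the map is bounded.

A geometric model is the Rips complex of the word metric at scale 8: an edge loop spells a
word that represents 1, and each relator of the presentation behind the upper bound
spans a simplex. *)

Require Import Defs.
From HB Require Import structures.
From mathcomp Require Import all_boot all_order all_algebra.
From mathcomp Require Import generic_quotient finmap.
From mathcomp Require Import all_classical all_reals all_analysis.
From mathcomp Require Import measurable_realfun.
From mathcomp Require Import ring lra zify.

Set Implicit Arguments.
Unset Strict Implicit.
Unset Printing Implicit Defensive.

Import Order.TTheory GRing.Theory Num.Theory.
Import numFieldNormedType.Exports.

Local Open Scope classical_set_scope.
Local Open Scope ring_scope.

(** * Lipschitz functions of one and two variables *)

(** Two obstacles shape the proof. First, [area] integrates a Jacobian made of pointwise partial
    derivatives, with default value 0 where they do not exist, and its measurability is not at hand.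
    Upper bounds are therefore carried by certificates ([cert]), which cut a square into boxes with
    known Lipschitz constants and regions where the Jacobian vanishes pointwise. Reparametrization
    and backtracking are of the second kind, so free reduction of words costs area 0. The lower
    bound passes to the limit in finite differences, which are continuous. Second, the complex is
    arbitrary: local finiteness, a bound on the dimension and uniform filling constants are
    extracted from the proper cocompact action, which is isometric for the path metric while the
    topology comes from the Euclidean one. The word problem is treated apart, for an abstract area
    predicate on a group, with costs in units of [L * L] for a power of two [L]. A cost at scale [L]
    counts for a quarter at scale [2 * L], which is why both recursions on the scale close. *)

Section LipschitzDerivable.
Context {R : realType}.
Local Notation mu := (@lebesgue_measure R).

(** Both measures are infima over covers by half-open intervals, and on each interval the increment
    of [G] is at most [K] times the length. *)
Lemma stieltjes_le_lebesgue (G : cumulative R R) (K : R) : 0 < K ->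
  (forall x y, x <= y -> G y - G x <= K * (y - x)) ->
  forall A : set R,
    (lebesgue_stieltjes_measure G A <= K%:E * mu A)%E.
Proof.
move=> K0 GK A; rewrite -lee_pdivrMl//.
rewrite /lebesgue_measure /lebesgue_stieltjes_measure.
rewrite /measure_extension.
apply: le_ereal_inf_tmp => _ [B [mB AB] <-].
rewrite lee_pdivrMl// -nneseriesZl//.
apply: (@le_trans _ _ (\sum_(k <oo) wlength G (B k))%E).
  by apply: ereal_inf_lbound; exists B.
apply: lee_nneseries => [k _ _|k _ /=]; first exact: wlength_ge0.
have /ocitvP[->|[[a b] /= ab ->]] := mB k; first by rewrite !wlength0 mule0.
rewrite !wlength_itv_bnd ?(ltW ab)//=.
by rewrite -EFinM lee_fin GK ?(ltW ab).
Qed.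

Lemma lipschitz_ae_derivable_itv (F : R -> R) (L a b : R) : a < b ->
  (forall x y, x <= y -> `|F y - F x| <= L * (y - x)) ->
  {ae mu, forall x, x \in `]a, b[ -> derivable F x 1}.
Proof.
move=> ab FL.
have L0 : 0 <= L.
  have := FL 0 1 ler01; rewrite subr0 mulr1; exact: le_trans.
(* Freezing [F] outside of [a, b] gives a function with finite limits at both infinities, hence a
   finite Stieltjes measure. *)
pose c (x : R) := Num.max a (Num.min b x).
have c_mono x y : x <= y -> c x <= c y.
  by move=> xy; rewrite /c le_max2// le_min2.
have c_lip x y : x <= y -> c y - c x <= y - x.
  move=> xy; rewrite /c !maxEle !minEle.
  by repeat case: ifPn; rewrite -?ltNge; lra.
have ca : c a = a by rewrite /c minEle maxEle; repeat case: ifPn; rewrite -?ltNge; lra.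
have cb : c b = b by rewrite /c minEle maxEle; repeat case: ifPn; rewrite -?ltNge; lra.
have c_id x : a <= x -> x <= b -> c x = x.
  by move=> ax xb; rewrite /c minEle maxEle; repeat case: ifPn; rewrite -?ltNge; lra.
have cle x : x <= a -> c x = a.
  by move=> ax; rewrite /c minEle maxEle; repeat case: ifPn; rewrite -?ltNge; lra.
have cge x : b <= x -> c x = b.
  by move=> ax; rewrite /c minEle maxEle; repeat case: ifPn; rewrite -?ltNge; lra.
(* The slope [L + 1] dominates that of [F], so the sum increases by the positive amount [S];
   dividing by [S] makes the limits 0 and 1. *)
pose S := F b - F a + (L + 1) * (b - a).
have S0 : 0 < S.
  have := FL _ _ (ltW ab); by rewrite ler_norml => /andP[+ _]; rewrite /S; nra.
pose G x := (F (c x) - F a + (L + 1) * (c x - a)) / S.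
have Gdiff x y : x <= y -> 0 <= G y - G x <= (2 * L + 1) / S * (y - x).
  move=> xy; rewrite /G -mulrBl.
  have := FL _ _ (c_mono _ _ xy); rewrite ler_norml => /andP[h1 h2].
  have := c_lip _ _ xy; have := c_mono _ _ xy => h3 h4.
  rewrite divr_ge0 ?(ltW S0)//=; last by nra.
  rewrite mulrAC ler_pM2r ?invr_gt0//. nra.
have G_nd : nondecreasing G.
  by move=> x y /Gdiff/andP[+ _]; rewrite subr_ge0.
have K0 : 0 < (2 * L + 1) / S by rewrite divr_gt0//; lra.
have G_ct : continuous G.
  move=> x; apply/cvgrPdist_le => e e0; near=> t.
  have -> : `|G x - G t| = G (Num.max x t) - G (Num.min x t).
    case: (leP x t) => xt; first by rewrite distrC ger0_norm ?subr_ge0 ?G_nd.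
    by rewrite ger0_norm ?subr_ge0 ?G_nd// ltW.
  have : Num.min x t <= Num.max x t by case: (leP x t) => // /ltW.
  move=> /Gdiff/andP[_ /le_trans]; apply.
  rewrite -ler_pdivlMl//.
  have -> : Num.max x t - Num.min x t = `|x - t|.
    by case: (leP x t) => xt; [rewrite ler0_norm ?subr_le0//|rewrite gtr0_norm ?subr_gt0//]; lra.
  by near: t; apply: cvgr_dist_le => //; rewrite mulr_gt0 ?invr_gt0.
have GNy : G @ -oo --> (0 : R).
  apply: cvg_near_cst.
  by near=> x; rewrite /G cle ?subrr ?mulr0 ?addr0 ?mul0r//; near: x; exact: nbhs_ninfty_le.
have Gy : G @ +oo --> (1 : R).
  apply: cvg_near_cst.
  near=> x; rewrite /G cge ?divff ?gt_eqF//; near: x; exact: nbhs_pinfty_ge.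
pose Gc : cumulativeBounded (0 : R) (1 : R) := HB.pack G
  (isCumulative.Build _ _ _ G G_nd (right_continuousW G_ct))
  (isCumulativeBounded.Build _ _ _ G GNy Gy).
pose nu := lebesgue_stieltjes_measure Gc.
have nuK A : (nu A <= ((2 * L + 1) / S)%:E * mu A)%E.
  by apply: stieltjes_le_lebesgue => // x y /Gdiff/andP[].
have dom : nu `<< mu.
  apply/null_content_dominatesP => A mA A0.
  by apply/eqP; rewrite eq_le measure_ge0 andbT (le_trans (nuK A))// A0 mule0.
have [f [f0 ffin intf nuf]] := @radon_nikodym_sigma_finite _ _ _ mu nu dom.
pose h := fine \o f.
have hE : EFin \o h = f by apply/funext => x /=; rewrite fineK.
have inth : mu.-integrable setT (EFin \o h) by rewrite hE.
have loch : locally_integrable setT h.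
  by apply: open_integrable_locally => //; exact: openT.
have inty y : mu.-integrable [set` Interval (BRight a) (BRight y)] (EFin \o h).
  by apply: integrableS inth => //; exact: measurable_itv.
have := FTC1 inty loch.
apply: filterS; first exact: (ae_filter_ringOfSetsType mu).
move=> x hx; rewrite in_itv/= => /andP[ax xb]; move: hx.
move=> /(_ ax)[+ _]; set I := (fun y => _) => dI.
(* On the open interval, [F] is an affine function plus [S] times the primitive of the density, and
   [FTC1] differentiates the primitive almost everywhere. *)
have hF y : y \in `]a, b[ -> F y = S * I y + (F a + (L + 1) * a - (L + 1) * y).
  rewrite in_itv/= => /andP[ay yb].
  have -> : I y = G y.
    rewrite /I /Rintegral.
    have -> : (\int[mu]_(t in [set` `]a, y]]) (h t)%:E = nu [set` `]a, y]])%E.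
      by apply: etrans (esym (nuf _ (measurable_itv _))); apply: eq_integral => t _; rewrite -hE.
    rewrite /nu /lebesgue_stieltjes_measure /measure_extension.
    rewrite measurable_mu_extE/=; last exact: is_ocitv.
    by rewrite wlength_itv_bnd ?ltW//= {2}/G cle// !subrr mulr0 addr0 mul0r subr0.
  rewrite /G c_id ?ltW// mulrC divfK ?gt_eqF//; lra.
apply: (@near_eq_derivable _ R^o R^o (fun y => S * I y + (F a + (L + 1) * a - (L + 1) * y))).
  near=> y; apply/esym/hF.
  by near: y; apply: near_in_itvoo; rewrite in_itv/= ax.
apply: derivableD; first exact: derivableM.
apply: derivableB; first exact: derivable_cst.
by apply: derivableM; [exact: derivable_cst|exact: derivable_id].
Unshelve. all: by end_near. Qed.
End LipschitzDerivable.

Section LipschitzDerivableT.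
Context {R : realType}.
Local Notation mu := (@lebesgue_measure R).

(* The Stieltjes measure of [F] plus a linear function is absolutely continuous,
   and [F] is differentiable at the Lebesgue points of its density. *)
Lemma lipschitz_ae_derivable (F : R -> R) (L : R) :
  (forall x y, x <= y -> `|F y - F x| <= L * (y - x)) ->
  {ae mu, forall x, derivable F x 1}.
Proof.
move=> FL.
pose A n := ~` [set x : R | x \in `](- n.+1%:R)%R, n.+1%:R[ -> derivable F x 1].
have AN n : mu.-negligible (A n).
  apply: (@lipschitz_ae_derivable_itv _ F L) => //.
  by rewrite (lt_trans (y := 0)) ?oppr_lt0.
suff : ~` [set x | derivable F x 1] `<=` \bigcup_n A n.
  move/(@negligibleS _ _ _ mu); apply => /=.
  exact: negligible_bigcup.
move=> x /= nx; exists (Num.truncn `|x|) => //= h; apply: nx; apply: h.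
by rewrite in_itv/= -ltr_norml -truncn_le_nat.
Qed.

End LipschitzDerivableT.

(** * Measurability and null sets in the plane *)

Section PlaneMeasure.
Context {R : realType}.
Local Notation mu := (@lebesgue_measure R).
Local Notation mu2 := (product_measure1 (@lebesgue_measure R) (@lebesgue_measure R)).

Import HBNNSimple.

(** The integral of a nonnegative function is a supremum over the simple functions below it, so it
    is monotone on arbitrary functions. The Jacobian of a filling is compared in this way. *)
Lemma ge0_le_lower_integral d (T : measurableType d)
    (m : {measure set T -> \bar R}) (D : set T) (f g : T -> \bar R) :
  (forall x, D x -> (0 <= f x)%E) -> (forall x, D x -> (f x <= g x)%E) ->
  (\int[m]_(x in D) f x <= \int[m]_(x in D) g x)%E.
Proof.
move=> f0 fg; rewrite !(integral_mkcond D).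
have f0' x : (0 <= (f \_ D) x)%E by apply: erestrict_ge0.
have g0' x : (0 <= (g \_ D) x)%E.
  by apply: erestrict_ge0 => t Dt; exact: le_trans (f0 _ Dt) (fg _ Dt).
rewrite !ge0_integralTE//; apply: ereal_sup_le => _ [h hf <-].
exists h => // x.
apply: le_trans (hf x) _; rewrite !patchE; case: ifPn => // /[!inE]; exact: fg.
Qed.

(** Measurability refers to the product sigma-algebra, so an open set is written as a countable
    union of rational boxes. *)
Lemma open_measurable2 (U : set (R * R)) : open U -> measurable U.
Proof.
move=> oU.
pose box (q : (rat * rat) * (rat * rat)) : set (R * R) :=
  `]ratr q.1.1, ratr q.1.2[ `*` `]ratr q.2.1, ratr q.2.2[.
have -> : U = \bigcup_(q in [set q | box q `<=` U]) box q.
  apply/seteqP; split=> [p Up|p [q qU]]; last exact: qU.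
  have /nbhs_ballP[e /= e0 eU] := open_nbhs_nbhs (conj oU Up).
  have q1 (x : R) : exists q : rat * rat, ratr q.1 < x < ratr q.2 /\
      (forall y, ratr q.1 < y < ratr q.2 -> ball x e y).
    have [a] : exists q, ratr q \in `](x - e), x[ by apply: rat_in_itvoo; rewrite ltrBlDr ltrDl.
    rewrite in_itv/= => /andP[a1 a2].
    have [b] : exists q, ratr q \in `]x, x + e[ by apply: rat_in_itvoo; rewrite ltrDl.
    rewrite in_itv/= => /andP[b1 b2].
    exists (a, b); split=> /=; first by rewrite a2.
    move=> y /andP[ay yb]; rewrite /ball/= ltr_distlC.
    by rewrite (lt_trans a1 ay) (lt_trans yb b2).
  have [qx [qx1 qx2]] := q1 p.1; have [qy [qy1 qy2]] := q1 p.2.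
  exists (qx, qy); last by split; rewrite /= in_itv/=.
  move=> z [/= z1 z2]; apply: eU; split; [apply: qx2|apply: qy2].
    by move: z1; rewrite in_itv.
  by move: z2; rewrite in_itv.
rewrite bigcup_mkcond; apply: countable_bigcupT_measurable; first exact: countableP.
move=> q.
case: ifP => // _; apply: measurableX; exact: measurable_itv.
Qed.

Lemma closed_measurable2 (U : set (R * R)) : closed U -> measurable U.
Proof.
move=> cU; rewrite -[U]setCK; apply: measurableC; apply: open_measurable2.
by rewrite openC.
Qed.

Lemma continuous_measurable2 (f : R * R -> R) : continuous f ->
  measurable_fun setT f.
Proof.
move=> cf; apply: (measurability _ (measurable_realfun.RGenOpens.measurableE R)) => _ [_ [a [b ->] <-]].
apply: measurableI => //; apply: open_measurable2.
by move/continuousP : cf; apply; exact: interval_open.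
Qed.

(** The product measure integrates over the x-sections; by uniqueness it has the same value through
    the y-sections. *)
Lemma null_ysections (A : set (R * R)) : measurable A ->
  (forall y, mu (ysection A y) = 0%E) -> mu2 A = 0%E.
Proof.
move=> mA A0.
have -> : mu2 A = (mu \x^ mu)%E A.
  by apply: product_measure_unique => //= ? ? ? ?; rewrite product_measure2E.
by apply: integral0_eq => y _ /=.
Qed.

Lemma null_xsections (A : set (R * R)) : measurable A ->
  (forall x, mu (xsection A x) = 0%E) -> mu2 A = 0%E.
Proof.
by move=> mA A0; rewrite /product_measure1; apply: integral0_eq => x _ /=.
Qed.

Definition lip2 (L : R) (U : R * R -> R) := forall p q,
  `|U p - U q| <= L * (`|p.1 - q.1| + `|p.2 - q.2|).

Lemma lip2_ge0 L U : lip2 L U -> 0 <= L.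
Proof.
by move=> /(_ (1, 0) (0, 0))/=; rewrite !subr0 normr1 normr0 addr0 mulr1; exact: le_trans.
Qed.

Lemma lip2_continuous L U : lip2 L U -> continuous U.
Proof.
move=> UL p; apply/cvgrPdist_le => e e0.
have L0 := lip2_ge0 UL.
have d0 : 0 < e / (2 * L + 1) by rewrite divr_gt0//; lra.
near=> q; apply: le_trans (UL _ _) _.
have [q1 q2] : ball p (e / (2 * L + 1)) q.
  by near: q; exists (ball p.1 (e / (2 * L + 1)), ball p.2 (e / (2 * L + 1)));
    [split; exact: nbhsx_ballx|].
move: q1 q2; rewrite /ball/= !ltr_pdivlMr; nra.
Unshelve. all: by end_near. Qed.

Lemma lip2_shift (a b : R) L U : lip2 L U ->
  lip2 L (fun p => U (p.1 + a, p.2 + b)).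
Proof.
move=> UL p q; apply: le_trans (UL _ _) _ => /=.
have e (x y z : R) : x + z - (y + z) = x - y by lra.
by rewrite !e.
Qed.

Lemma lip2_shift1 (a : R) L U : lip2 L U -> lip2 L (fun p => U (p.1 + a, p.2)).
Proof.
move=> /(lip2_shift a 0) UL p q; apply: le_trans (UL p q).
by rewrite !addr0.
Qed.

Lemma lip2_swap L U : lip2 L U -> lip2 L (fun p => U (p.2, p.1)).
Proof.
by move=> UL p q; apply: le_trans (UL _ _) _ => /=; rewrite addrC.
Qed.

(** The Cauchy form replaces the unknown limit by countable quantifiers over [k] and [m], from which
    measurability in the base point can be read. *)
Lemma derivable1_cauchyP (f : R -> R) (x : R) :
  derivable f x 1 <->
  (forall k : nat, exists m : nat, forall h h' : R,
     0 < `|h| < m.+1%:R^-1 -> 0 < `|h'| < m.+1%:R^-1 ->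
     `|h^-1 * (f (x + h) - f x) - h'^-1 * (f (x + h') - f x)| <= k.+1%:R^-1).
Proof.
pose q (h : R) : R := h^-1 *: (f (h *: 1 + x) - f x).
have qE h : q h = h^-1 * (f (x + h) - f x).
  by rewrite /q (_ : h *: 1 = h) ?(addrC h)//; exact: mulr1.
split=> [|H].
  move/cvg_ex => [l ql] k.
  have k0 : 0 < k.+1%:R^-1 / 2 :> R by rewrite divr_gt0.
  have /= := (cvgrPdist_lt _ _).1 ql _ k0.
  move=> -[e /= e0 eH].
  have [m me] := ltr_add_invr (e0 : 0 < e); rewrite add0r in me.
  exists m => h h' /andP[h0 hm] /andP[h'0 h'm].
  rewrite -!qE [leRHS]splitr.
  have -> : q h - q h' = (l - q h') - (l - q h) by lra.
  apply: (le_trans (ler_normB _ _)); apply: lerD; apply/ltW/eH.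
  - by rewrite /= sub0r normrN (lt_trans h'm).
  - by rewrite -normr_gt0.
  - by rewrite /= sub0r normrN (lt_trans hm).
  - by rewrite -normr_gt0.
apply/cauchy_cvgP; apply: cauchy_exP => e e0.
have [k ke] := ltr_add_invr (e0 : 0 < e); rewrite add0r in ke.
have [m mH] := H k.
have m0 : 0 < m.+1%:R^-1 / 2 :> R by rewrite divr_gt0.
exists (q (m.+1%:R^-1 / 2)).
suff : \forall h \near (0 : R)^', ball (q (m.+1%:R^-1 / 2)) e (q h) by [].
near=> h; rewrite /ball/= !qE (le_lt_trans _ ke)//; apply: mH.
  by rewrite gtr0_norm// m0 ltr_pdivrMr// ltr_pMr// ltr1n.
apply/andP; split; first by rewrite normr_gt0; near: h; exact: nbhs_dnbhs_neq.
near: h; apply: dnbhs0_lt; by rewrite invr_gt0.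
Unshelve. all: by end_near. Qed.

(** For fixed [k] and [m] the increments range over an uncountable set, but each condition is closed
    in [p], hence so is their intersection. *)
Lemma measurable_derivable1 (U : R * R -> R) (L : R) : lip2 L U ->
  measurable [set p : R * R | derivable (fun t => U (t, p.2)) p.1 1].
Proof.
move=> UL; have cU := lip2_continuous UL.
pose C (k : nat) (h h' : R) := [set p : R * R |
  `|h^-1 * (U (p.1 + h, p.2) - U p) - h'^-1 * (U (p.1 + h', p.2) - U p)|
  <= k.+1%:R^-1].
have -> : [set p : R * R | derivable (fun t => U (t, p.2)) p.1 1] =
  \bigcap_k \bigcup_m \bigcap_(h in [set h : R * R |
    0 < `|h.1| < m.+1%:R^-1 /\ 0 < `|h.2| < m.+1%:R^-1]) C k h.1 h.2.
  apply/seteqP; split=> [[x y] /= /derivable1_cauchyP H k _|[x y] H].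
    by have [m mH] := H k; exists m => // -[h h'] /= [h0 h'0]; exact: mH.
  apply/derivable1_cauchyP => k; have [m _ mH] := H k Logic.I.
  by exists m => h h' h0 h'0; exact: (mH (h, h')).
apply: bigcapT_measurable => k; apply: bigcupT_measurable => m.
apply: closed_measurable2; apply: closed_bigI => -[h h'] _ /=.
have c1 (g : R) : continuous (fun p : R * R => g^-1 * (U (p.1 + g, p.2) - U p)).
  move=> p; apply: cvgM; first exact: cvg_cst.
  apply: cvgB; last exact: cU.
  exact: (lip2_continuous (lip2_shift1 g UL)).
rewrite [X in closed X](_ : _ = (fun p => `|h^-1 * (U (p.1 + h, p.2) - U p) -
    h'^-1 * (U (p.1 + h', p.2) - U p)|) @^-1` [set x | x <= k.+1%:R^-1]); last by [].
apply: preimage_closed; last exact: closed_le.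
move=> p _; apply: cvg_norm; apply: cvgB; exact: c1.
Qed.

Lemma measurable_derivable2 (U : R * R -> R) (L : R) : lip2 L U ->
  measurable [set p : R * R | derivable (fun t => U (p.1, t)) p.2 1].
Proof.
move=> /lip2_swap/measurable_derivable1 mU.
have ms : measurable_fun [set: R * R] (fun p : R * R => (p.2, p.1)).
  exact: measurable_fun_pair.
by have := ms measurableT _ mU; rewrite setTI.
Qed.

(** Each horizontal line meets the exceptional set in a null set, by [lipschitz_ae_derivable]. *)
Lemma lip2_derivable1_null (U : R * R -> R) (L : R) : lip2 L U ->
  mu2 (~` [set p : R * R | derivable (fun t => U (t, p.2)) p.1 1]) = 0%E.
Proof.
move=> UL; apply: null_ysections; first by apply: measurableC; apply: (measurable_derivable1 UL).
move=> y; apply/negligibleP.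
  by apply: measurable_ysection; apply: measurableC; apply: (measurable_derivable1 UL).
have := @lipschitz_ae_derivable R (fun t => U (t, y)) L.
rewrite /almost_everywhere/=; case.
  move=> s t st; apply: le_trans (UL _ _) _.
  by rewrite /= subrr normr0 addr0 ger0_norm ?subr_ge0.
move=> A [mA A0 sA]; exists A; split => // x /=.
by rewrite /ysection/= inE => /= nd; apply: sA.
Qed.

Lemma lip2_derivable2_null (U : R * R -> R) (L : R) : lip2 L U ->
  mu2 (~` [set p : R * R | derivable (fun t => U (p.1, t)) p.2 1]) = 0%E.
Proof.
move=> UL; apply: null_xsections; first by apply: measurableC; apply: (measurable_derivable2 UL).
move=> y; apply/negligibleP.
  by apply: measurable_xsection; apply: measurableC; apply: (measurable_derivable2 UL).
have := @lipschitz_ae_derivable R (fun t => U (y, t)) L.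
rewrite /almost_everywhere/=; case.
  move=> s t st; apply: le_trans (UL _ _) _.
  by rewrite /= subrr normr0 add0r ger0_norm ?subr_ge0.
move=> A [mA A0 sA]; exists A; split => // x /=.
by rewrite /xsection/= inE => /= nd; apply: sA.
Qed.

End PlaneMeasure.

(** * Integrals of differences over a box *)

Section Stokes.
Context {R : realType}.
Local Notation mu := (@lebesgue_measure R).
Local Notation mu2 := (product_measure1 (@lebesgue_measure R) (@lebesgue_measure R)).
Local Notation I3 := (`[(- 3 : R), 3]%classic).
Local Notation B3 := (I3 `*` I3).

Lemma continuous_integrable_itv (f : R -> R) (a b : R) : continuous f ->
  mu.-integrable `[a, b] (EFin \o f).
Proof.
move=> cf; apply: continuous_compact_integrable; first exact: segment_compact.
exact: continuous_subspaceT.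
Qed.

(** The integral telescopes to the integrals of [f] over two intervals of length [h] near the ends
    of the box, where [f] is constant. *)
Lemma integral_difference (f : R -> R) (c0 c1 h : R) : continuous f ->
  (forall x, x <= -2 -> f x = c0) -> (forall x, 2 <= x -> f x = c1) ->
  0 < h -> h < 1 ->
  (\int[mu]_(x in I3) (f (x + h) - f x)%:E = (h * (c1 - c0))%:E)%E.
Proof.
move=> cf f0 f1 h0 h1.
(* The primitive starts at -5 to leave room for the shift by [h < 1] around [-3, 3], with every
   point used in the interior. *)
pose P (y : R) : R := \int[mu]_(t in `[-5, y]) f t.
have dP (y : R) : -5 < y -> y < 5 -> derivable P y 1 /\ derive1 P y = f y.
  move=> y1 y2; apply: (@continuous_FTC1 _ f (BLeft (-5)) y 5) => //; last exact: cf.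
  exact: continuous_integrable_itv.
have shift_der (y : R) : -5 < y + h -> y + h < 5 ->
    is_derive y 1 (fun z : R => P (z + h)) (f (y + h)).
  move=> y1 y2; have [d1 d2] := dP _ y1 y2.
  have : is_derive (y + h) 1 P (f (y + h)).
    by apply: DeriveDef; [exact: d1|rewrite -derive1E].
  move=> dPy.
  have ds : is_derive y 1 (fun z : R => z + h) (1 + 0) by exact: is_deriveD.
  have := @is_derive1_comp R P (fun z : R => z + h) y _ _ dPy ds.
  by rewrite addr0 mulr1; apply.
have dQ (y : R) : -4 < y -> y < 4 -> is_derive y 1 (fun z : R => P (z + h) - P z) (f (y + h) - f y).
  move=> y1 y2; have [d1 d2] := dP y ltac:(lra) ltac:(lra).
  have d3 := shift_der y ltac:(lra) ltac:(lra).
  have dPy : is_derive y 1 P (f y) by apply: DeriveDef; [exact: d1|rewrite -derive1E].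
  exact: is_deriveB d3 dPy.
have cQ (y : R) : -4 < y -> y < 4 -> {for y, continuous (fun z : R => P (z + h) - P z)}.
  move=> y1 y2; apply: differentiable_continuous; apply/derivable1_diffP.
  by apply: ex_derive; exact: dQ.
rewrite (@continuous_FTC2 _ _ (fun z : R => P (z + h) - P z)); first last.
- move=> x; rewrite in_itv/= => /andP[x1 x2].
  rewrite derive1E; apply: derive_val; apply: dQ; lra.
- split.
  + move=> x; rewrite in_itv/= => /andP[x1 x2].
    by apply: ex_derive; apply: dQ; lra.
  + by apply: cvg_at_right_filter; apply: cQ; lra.
  + by apply: cvg_at_left_filter; apply: cQ; lra.
- apply: continuous_subspaceT => x; apply: cvgB; last exact: cf.
  apply: continuous_comp; last exact: cf.
  by apply: cvgD; [exact: cvg_id|exact: cvg_cst].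
- lra.
have mvt (a : R) c : -4 < a -> a < 4 -> (forall x, a < x -> x < a + h -> f x = c) ->
    P (a + h) - P a = h * c.
  move=> a1 a2 fc.
  have [|||x] := @MVT _ P f a (a + h).
  - lra.
  - move=> x; rewrite in_itv/= => /andP[x1 x2].
    have [d1 d2] := dP x ltac:(lra) ltac:(lra).
    by apply: DeriveDef; [exact: d1|rewrite -derive1E].
  - apply: derivable_within_continuous => x; rewrite in_itv/= => /andP[x1 x2].
    by have [] := dP x ltac:(lra) ltac:(lra).
  rewrite in_itv/= => /andP[x1 x2] ->.
  by rewrite fc// addrAC subrr add0r mulrC.
rewrite (mvt 3 c1)//; [|lra|lra|by move=> x ? ?; apply: f1; lra].
rewrite (mvt (-3) c0)//; [|lra|lra|by move=> x ? ?; apply: f0; lra].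
by rewrite -EFinB mulrBr.
Qed.

Lemma continuous_integrable_box (f : R * R -> R) : continuous f ->
  mu2.-integrable B3 (EFin \o f).
Proof.
move=> cf.
have mB : measurable B3 by apply: measurableX; exact: measurable_itv.
have [M fM] : exists M, forall p, B3 p -> `|f p| <= M.
  have cB : compact B3 by apply: compact_setX; exact: segment_compact.
  have : compact ((fun p => `|f p|) @` B3).
    apply: continuous_compact => //; apply: continuous_subspaceT => p.
    by apply: cvg_norm; exact: cf.
  move=> /compact_bounded[M [_ /(_ (M + 1))]].
  rewrite ltrDl => /(_ ltr01) H; exists (M + 1) => p Bp.
  by have := H `|f p| (ex_intro2 _ _ p Bp erefl); rewrite /= normr_id.
apply: measurable_bounded_integrable => //.
- have E : mu2 B3 = (mu I3 * mu I3)%E.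
    by apply: product_measure1E; exact: measurable_itv.
  change (mu2 B3 < +oo)%E; rewrite E.
  by rewrite lebesgue_measure_itv/=; case: ifP; rewrite -?EFinB -?EFinM ?mule0 ltry.
- exact: measurable_funTS (continuous_measurable2 cf).
- exists M; split; first by rewrite num_real.
  by move=> x Mx p Bp /=; rewrite (le_trans (fM _ Bp))// ltW.
Qed.

Lemma fubini_box (f : R * R -> R) : continuous f ->
  (\int[mu2]_(p in B3) (f p)%:E = \int[mu]_(x in I3) \int[mu]_(y in I3) (f (x, y))%:E)%E /\
  (\int[mu2]_(p in B3) (f p)%:E = \int[mu]_(y in I3) \int[mu]_(x in I3) (f (x, y))%:E)%E.
Proof.
move=> cf.
have mB : measurable B3 by apply: measurableX; exact: measurable_itv.
have intf := continuous_integrable_box cf.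
have intf' : mu2.-integrable setT ((EFin \o f) \_ B3) by rewrite -integrable_mkcond.
split.
- rewrite integral_mkcond/= -(integral12_prod_meas1 intf').
  rewrite [RHS]integral_mkcond; apply: eq_integral => x _.
  rewrite /fubini_F patchE; case: ifPn => [xI|xI].
    rewrite [RHS]integral_mkcond; apply: eq_integral => y _.
    by rewrite !patchE in_setX xI.
  by rewrite integral0_eq// => y _; rewrite patchE in_setX (negbTE xI).
- rewrite integral_mkcond/= -(integral21_prod_meas1 intf').
  rewrite [RHS]integral_mkcond; apply: eq_integral => x _.
  rewrite /fubini_G patchE; case: ifPn => [xI|xI].
    rewrite [RHS]integral_mkcond; apply: eq_integral => y _.
    by rewrite !patchE in_setX xI andbT.
  by rewrite integral0_eq// => y _; rewrite patchE in_setX (negbTE xI) andbF.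
Qed.

Lemma integral_box_difference1 (W : R * R -> R) (h : R) : continuous W ->
  (forall x y, 2 <= x -> W (x, y) = W (3, y)) ->
  (forall x y, x <= -2 -> W (x, y) = W (-3, y)) -> 0 < h -> h < 1 ->
  (\int[mu2]_(p in B3) (W ((p.1 + h)%R, p.2) - W p)%:E =
   \int[mu]_(y in I3) (h * (W (3, y) - W (-3, y)))%:E)%E.
Proof.
move=> cW W1 W0 h0 h1.
have cx y : continuous (fun x => W (x, y)).
  by move=> x; apply: (cvg_comp2 cvg_id (cvg_cst y) (h := fun a b => W (a, b))) => /=;
    have := cW (x, y); rewrite (_ : (fun q : R * R => W (q.1, q.2)) = W)//;
    apply/funext => -[].
have cWh : continuous (fun p : R * R => W (p.1 + h, p.2) - W p).
  move=> p; apply: cvgB; last exact: cW.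
  apply: (@cvg_comp2 _ _ _ _ (nbhs p) (nbhs (p.1 + h)) (nbhs p.2) (nbhs (W (p.1 + h, p.2)))
    _ _ _ (fun q : R * R => q.1 + h) snd (fun a b => W (a, b))) => /=.
  - by apply: cvgD; [exact: cvg_fst|exact: cvg_cst].
  - exact: cvg_snd.
  - have := cW (p.1 + h, p.2); rewrite (_ : (fun q : R * R => W (q.1, q.2)) = W)//.
    by apply/funext => -[].
rewrite (fubini_box cWh).2; apply: eq_integral => y _ /=.
by rewrite (@integral_difference (fun x => W (x, y)) (W (-3, y)) (W (3, y)))// => x xx;
  [rewrite W0|rewrite W1].
Qed.

Lemma integral_box_difference2 (W : R * R -> R) (h : R) : continuous W ->
  (forall x y, 2 <= y -> W (x, y) = W (x, 3)) ->
  (forall x y, y <= -2 -> W (x, y) = W (x, -3)) -> 0 < h -> h < 1 ->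
  (\int[mu2]_(p in B3) (W (p.1, (p.2 + h)%R) - W p)%:E =
   \int[mu]_(x in I3) (h * (W (x, 3) - W (x, -3)))%:E)%E.
Proof.
move=> cW W1 W0 h0 h1.
have cy x : continuous (fun y => W (x, y)).
  by move=> y; apply: (cvg_comp2 (cvg_cst x) cvg_id (h := fun a b => W (a, b))) => /=;
    have := cW (x, y); rewrite (_ : (fun q : R * R => W (q.1, q.2)) = W)//;
    apply/funext => -[].
have cWh : continuous (fun p : R * R => W (p.1, p.2 + h) - W p).
  move=> p; apply: cvgB; last exact: cW.
  apply: (@cvg_comp2 _ _ _ _ (nbhs p) (nbhs p.1) (nbhs (p.2 + h)) (nbhs (W (p.1, p.2 + h)))
    _ _ _ fst (fun q : R * R => q.2 + h) (fun a b => W (a, b))) => /=.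
  - exact: cvg_fst.
  - by apply: cvgD; [exact: cvg_snd|exact: cvg_cst].
  - have := cW (p.1, p.2 + h); rewrite (_ : (fun q : R * R => W (q.1, q.2)) = W)//.
    by apply/funext => -[].
rewrite (fubini_box cWh).1; apply: eq_integral => x _ /=.
by rewrite (@integral_difference (fun y => W (x, y)) (W (x, -3)) (W (x, 3)))// => y yy;
  [rewrite W0|rewrite W1].
Qed.

Lemma cvg_difference_quotient (f : R -> R) (x : R) (u : nat -> R) :
  derivable f x 1 -> (forall n, u n != 0) -> u n @[n --> \oo] --> 0 ->
  (u n)^-1 * (f (x + u n) - f x) @[n --> \oo] --> derive1 f x.
Proof.
move=> df u0 uc.
have : (fun h : R => h^-1 * (f (x + h) - f x)) @ 0^' --> derive1 f x.
  rewrite derive1E; apply: cvg_trans df; apply: near_eq_cvg; near=> h.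
  congr (_ * (f _ - _)); rewrite /= addrC; congr (_ + _); exact: mulr1.
move=> /cvgrPdist_lt H; apply/cvgrPdist_lt => e e0.
have [d /= d0 dH] := H _ e0.
move/cvgrPdist_lt : uc => /(_ _ d0)[N _ NH].
exists N => // n Nn; apply: dH => //=; exact: NH.
Unshelve. all: by end_near. Qed.

End Stokes.

(** * Stokes' theorem for a Lipschitz map of the plane with constant boundary coordinates *)

Section SquareArea.
Context {R : realType}.
Local Notation mu := (@lebesgue_measure R).
Local Notation mu2 := (product_measure1 (@lebesgue_measure R) (@lebesgue_measure R)).
Local Notation I3 := (`[(- 3 : R), 3]%classic).
Local Notation B3 := (I3 `*` I3).

Variables (U1 U2 : R * R -> R) (L a0 a1 b0 b1 : R).
Hypotheses (L1 : lip2 L U1) (L2 : lip2 L U2).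
Hypothesis U1l : forall x y, x <= -1 -> U1 (x, y) = a0.
Hypothesis U1r : forall x y, 1 <= x -> U1 (x, y) = a1.
Hypothesis U2b : forall x y, y <= -1 -> U2 (x, y) = b0.
Hypothesis U2t : forall x y, 1 <= y -> U2 (x, y) = b1.
Hypothesis U1b : forall x y, y <= -1 -> U1 (x, y) = U1 (x, -1).
Hypothesis U1t : forall x y, 1 <= y -> U1 (x, y) = U1 (x, 1).
Hypothesis U2l : forall x y, x <= -1 -> U2 (x, y) = U2 (-1, y).
Hypothesis U2r : forall x y, 1 <= x -> U2 (x, y) = U2 (1, y).

(** Determinants of the forward and of the backward differences at [p]: twice the oriented areas of
    two image triangles. They involve values of the functions only, and are continuous in [p]. *)
Let Jp h (p : R * R) := (U1 (p.1 + h, p.2) - U1 p) * (U2 (p.1, p.2 + h) - U2 p) -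
  (U2 (p.1 + h, p.2) - U2 p) * (U1 (p.1, p.2 + h) - U1 p).
Let Jm h (p : R * R) := (U1 p - U1 (p.1 - h, p.2)) * (U2 p - U2 (p.1, p.2 - h)) -
  (U2 p - U2 (p.1 - h, p.2)) * (U1 p - U1 (p.1, p.2 - h)).

Let shift2 h L' U : lip2 L' U -> continuous (fun p : R * R => U (p.1, p.2 + h)).
Proof. by move=> /lip2_swap/(lip2_shift1 h)/lip2_swap/lip2_continuous. Qed.
Let shift1 h L' U : lip2 L' U -> continuous (fun p : R * R => U (p.1 + h, p.2)).
Proof. by move=> /(lip2_shift1 h)/lip2_continuous. Qed.
Let c1 := lip2_continuous L1.
Let c2 := lip2_continuous L2.

Let cJp h : continuous (Jp h).
Proof.
move=> p; apply: cvgB; apply: cvgM; apply: cvgB;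
  by [exact: c1|exact: c2|exact: (shift1 L1)|exact: (shift1 L2)|
      exact: (shift2 L1)|exact: (shift2 L2)].
Qed.

Let cJm h : continuous (Jm h).
Proof.
move=> p; apply: cvgB; apply: cvgM; apply: cvgB;
  by [exact: c1|exact: c2|exact: (shift1 L1)|exact: (shift1 L2)|
      exact: (shift2 L1)|exact: (shift2 L2)].
Qed.

Let intB_sub f g : continuous f -> continuous g ->
  (\int[mu2]_(p in B3) (f p - g p)%:E =
   \int[mu2]_(p in B3) (f p)%:E - \int[mu2]_(p in B3) (g p)%:E)%E.
Proof.
move=> cf cg; have mB : measurable B3 by apply: measurableX; exact: measurable_itv.
by rewrite integralB_EFin//; exact: continuous_integrable_box.
Qed.

Let comp1 (f : R * R -> R) h : continuous f -> continuous (fun p => f (p.1 + h, p.2)).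
Proof.
move=> cf p.
apply: (@cvg_comp2 _ _ _ _ (nbhs p) (nbhs (p.1 + h)) (nbhs p.2) (nbhs (f (p.1 + h, p.2)))
    _ _ _ (fun q : R * R => q.1 + h) snd (fun a b => f (a, b))) => /=.
- by apply: cvgD; [exact: cvg_fst|exact: cvg_cst].
- exact: cvg_snd.
- have := cf (p.1 + h, p.2); rewrite (_ : (fun q : R * R => f (q.1, q.2)) = f)//.
  by apply/funext => -[].
Qed.

Let comp2 (f : R * R -> R) h : continuous f -> continuous (fun p => f (p.1, p.2 + h)).
Proof.
move=> cf p.
apply: (@cvg_comp2 _ _ _ _ (nbhs p) (nbhs p.1) (nbhs (p.2 + h)) (nbhs (f (p.1, p.2 + h)))
    _ _ _ fst (fun q : R * R => q.2 + h) (fun a b => f (a, b))) => /=.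
- exact: cvg_fst.
- by apply: cvgD; [exact: cvg_snd|exact: cvg_cst].
- have := cf (p.1, p.2 + h); rewrite (_ : (fun q : R * R => f (q.1, q.2)) = f)//.
  by apply/funext => -[].
Qed.

(* The forward triangle at a corner of a small square and the backward one at
   the opposite corner make up a quadrilateral whose area telescopes. *)
Lemma integral_triangles h : 0 < h -> h < 1 ->
  (\int[mu2]_(p in B3) (Jp h p + Jm h p)%:E =
   (2 * h ^+ 2 * ((a1 - a0) * (b1 - b0)))%:E)%E.
Proof.
move=> h0 h1.
have C1 : continuous U1 by exact: lip2_continuous L1.
have C2 : continuous U2 by exact: lip2_continuous L2.
(* Shoelace terms of the images of the vertical edge ([e2]) and of the horizontal edge ([e1]) that
   start at [p]. *)
pose e2 p := U1 p * U2 (p.1, p.2 + h) - U2 p * U1 (p.1, p.2 + h).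
pose e1 p := U1 p * U2 (p.1 + h, p.2) - U2 p * U1 (p.1 + h, p.2).
pose W p := Jm h (p.1, p.2 + h).
have ce2 : continuous e2.
  by move=> p; apply: cvgB; apply: cvgM; by [exact: c1|exact: c2|exact: (shift2 L1)|exact: (shift2 L2)].
have ce1 : continuous e1.
  by move=> p; apply: cvgB; apply: cvgM; by [exact: c1|exact: c2|exact: (shift1 L1)|exact: (shift1 L2)].
have cW : continuous W by exact: comp2.
have I1 : (\int[mu2]_(p in B3) (e2 ((p.1 + h)%R, p.2) - e2 p)%:E =
    (h ^+ 2 * ((a1 - a0) * (b1 - b0)))%:E)%E.
  rewrite (@integral_box_difference1 R e2 h)//; first last.
  - move=> x y xl; rewrite /e2/= !U1l ?(U2l _ (_ : x <= -1)) ?(U2l _ (_ : -3 <= -1))//; lra.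
  - move=> x y xl; rewrite /e2/= !U1r ?(U2r _ (_ : 1 <= x)) ?(U2r _ (_ : 1 <= 3))//; lra.
  pose f (y : R) : R := h * (a1 * U2 (3, y) - a0 * U2 (-3, y)).
  transitivity (\int[mu]_(y in I3) (f (y + h) - f y)%:E)%E; last first.
    rewrite (@integral_difference _ f (h * (a1 - a0) * b0) (h * (a1 - a0) * b1))//.
    - by congr (_%:E); ring.
    - have cy x : continuous (fun y => U2 (x, y)).
        move=> y; apply: (cvg_comp2 (cvg_cst x) cvg_id (h := fun a b => U2 (a, b))) => /=.
        by have := C2 (x, y); rewrite (_ : (fun q : R * R => U2 (q.1, q.2)) = U2)//;
          apply/funext => -[].
      by move=> y; apply: cvgM; [exact: cvg_cst|apply: cvgB; apply: cvgM;
        by [exact: cvg_cst|exact: cy]].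
    - by move=> y yl; rewrite /f !U2b; [ring|lra..].
    - by move=> y yl; rewrite /f !U2t; [ring|lra..].
  by apply: eq_integral => y _; congr (_%:E); rewrite /f /e2 /= !(U1r _ (_ : 1 <= 3)) ?(U1l _ (_ : -3 <= -1)); [ring|lra..].
have I2 : (\int[mu2]_(p in B3) (e1 (p.1, (p.2 + h)%R) - e1 p)%:E =
    (- h ^+ 2 * ((a1 - a0) * (b1 - b0)))%:E)%E.
  rewrite (@integral_box_difference2 R e1 h)//; first last.
  - move=> x y xl; rewrite /e1/= !U2b ?(U1b _ (_ : y <= -1)) ?(U1b _ (_ : -3 <= -1))//; lra.
  - move=> x y xl; rewrite /e1/= !U2t ?(U1t _ (_ : 1 <= y)) ?(U1t _ (_ : 1 <= 3))//; lra.
  pose f (x : R) : R := h * (b0 * U1 (x, -3) - b1 * U1 (x, 3)).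
  transitivity (\int[mu]_(y in I3) (f (y + h) - f y)%:E)%E; last first.
    rewrite (@integral_difference _ f (h * (b0 - b1) * a0) (h * (b0 - b1) * a1))//.
    - by congr (_%:E); ring.
    - have cx y : continuous (fun x => U1 (x, y)).
        move=> x; apply: (cvg_comp2 cvg_id (cvg_cst y) (h := fun a b => U1 (a, b))) => /=.
        by have := C1 (x, y); rewrite (_ : (fun q : R * R => U1 (q.1, q.2)) = U1)//;
          apply/funext => -[].
      by move=> y; apply: cvgM; [exact: cvg_cst|apply: cvgB; apply: cvgM;
        by [exact: cvg_cst|exact: cx]].
    - by move=> y yl; rewrite /f !U1l; [ring|lra..].
    - by move=> y yl; rewrite /f !U1r; [ring|lra..].
  by apply: eq_integral => y _; congr (_%:E); rewrite /f /e1 /= !(U2t _ (_ : 1 <= 3)) ?(U2b _ (_ : -3 <= -1)); [ring|lra..].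
have W0 x y : x <= -2 \/ 2 <= x -> W (x, y) = 0.
  rewrite /W /Jm/= => -[xl|xl].
    by rewrite !U1l; [ring|lra..].
  by rewrite !U1r; [ring|lra..].
have J0 x y : y <= -2 \/ 2 <= y -> Jm h (x, y) = 0.
  rewrite /Jm/= => -[xl|xl].
    by rewrite !U2b; [ring|lra..].
  by rewrite !U2t; [ring|lra..].
have I3' : (\int[mu2]_(p in B3) (W ((p.1 + h)%R, p.2) - W p)%:E = 0)%E.
  rewrite (@integral_box_difference1 R W h)//; first last.
  - by move=> x y xl; rewrite !W0//; left; lra.
  - by move=> x y xl; rewrite !W0//; right; lra.
  by apply: integral0_eq => y _; rewrite !W0 ?subrr ?mulr0//; [left|right]; lra.
have I4 : (\int[mu2]_(p in B3) (Jm h (p.1, (p.2 + h)%R) - Jm h p)%:E = 0)%E.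
  rewrite (@integral_box_difference2 R (Jm h) h)//; first last.
  - by move=> x y xl; rewrite !J0//; left; lra.
  - by move=> x y xl; rewrite !J0//; right; lra.
  by apply: integral0_eq => y _; rewrite !J0 ?subrr ?mulr0//; [left|right]; lra.
pose D1 (f : R * R -> R) p := f (p.1 + h, p.2) - f p.
pose D2 (f : R * R -> R) p := f (p.1, p.2 + h) - f p.
have cD1 f : continuous f -> continuous (D1 f).
  by move=> cf p; apply: cvgB; [exact: comp1|exact: cf].
have cD2 f : continuous f -> continuous (D2 f).
  by move=> cf p; apply: cvgB; [exact: comp2|exact: cf].
(* [Jp] at [p] plus [Jm] at the opposite corner is the shoelace sum of the quadrilateral. The terms
   [D1 W] and [D2 (Jm h)] move [Jm] from that corner back to [p]; both integrate to 0. *)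
transitivity (\int[mu2]_(p in B3) (((D1 e2 p - D2 e1 p) - D1 W p) - D2 (Jm h) p)%:E)%E.
  apply: eq_integral => -[x y] _; congr (_%:E).
  rewrite /D1 /D2 /e1 /e2 /W /Jp /Jm/= !addrK.
  by ring.
have cB (f g : R * R -> R) : continuous f -> continuous g -> continuous (fun p => f p - g p).
  by move=> cf cg p; apply: cvgB; [exact: cf|exact: cg].
have K1 := cB _ _ (cD1 _ ce2) (cD2 _ ce1).
have K2 := cB _ _ K1 (cD1 _ cW).
rewrite (intB_sub K2 (cD2 _ (@cJm h))) (intB_sub K1 (cD1 _ cW)).
rewrite (intB_sub (cD1 _ ce2) (cD2 _ ce1)) I1 I2 I3' I4 !sube0 -EFinB.
by congr (_%:E); ring.
Qed.

Let dx (U : R * R -> R) (p : R * R) := derive1 (fun t => U (t, p.2)) p.1.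
Let dy (U : R * R -> R) (p : R * R) := derive1 (fun t => U (p.1, t)) p.2.
Let good (U : R * R -> R) (p : R * R) :=
  derivable (fun t => U (t, p.2)) p.1 1 /\ derivable (fun t => U (p.1, t)) p.2 1.
Let det p := dx U1 p * dy U2 p - dy U1 p * dx U2 p.
(** The shift to [n.+2] keeps the step below 1, as [integral_triangles] requires. *)
Let hh n : R := n.+2%:R^-1.
Let J n p := (hh n) ^- 2 * (Jp (hh n) p + Jm (hh n) p).

Let hh0 n : 0 < hh n. Proof. by rewrite invr_gt0. Qed.
Let hh1 n : hh n < 1. Proof. by rewrite invf_lt1 ?ltr1n. Qed.

Let hh_cvg : hh n @[n --> \oo] --> 0.
Proof.
have := @cvg_harmonic R; rewrite -(cvg_shiftn 1)/=.
by under eq_fun do rewrite addn1.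
Qed.

(** Only differences along the axes occur, so the limit follows from the existence of the four
    partial derivatives, which one-variable differentiability provides almost everywhere. *)
Let J_cvg p : good U1 p -> good U2 p -> J n p @[n --> \oo] --> 2 * det p.
Proof.
move=> [gx1 gy1] [gx2 gy2].
have hN n : - hh n != 0 by rewrite oppr_eq0 gt_eqF.
have hP n : hh n != 0 by rewrite gt_eqF.
have hNc : - hh n @[n --> \oo] --> 0 by rewrite -oppr0; exact: cvgN.
pose q (U : R * R -> R) (f : R -> R * R) (h : R) := h^-1 * (U (f h) - U (p.1, p.2)).
pose fx h := (p.1 + h, p.2); pose fy h := (p.1, p.2 + h).
have X1 : q U1 fx (hh n) @[n --> \oo] --> dx U1 p := cvg_difference_quotient gx1 hP hh_cvg.
have X2 : q U2 fx (hh n) @[n --> \oo] --> dx U2 p := cvg_difference_quotient gx2 hP hh_cvg.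
have Y1 : q U1 fy (hh n) @[n --> \oo] --> dy U1 p := cvg_difference_quotient gy1 hP hh_cvg.
have Y2 : q U2 fy (hh n) @[n --> \oo] --> dy U2 p := cvg_difference_quotient gy2 hP hh_cvg.
have X1' : q U1 fx (- hh n) @[n --> \oo] --> dx U1 p := cvg_difference_quotient gx1 hN hNc.
have X2' : q U2 fx (- hh n) @[n --> \oo] --> dx U2 p := cvg_difference_quotient gx2 hN hNc.
have Y1' : q U1 fy (- hh n) @[n --> \oo] --> dy U1 p := cvg_difference_quotient gy1 hN hNc.
have Y2' : q U2 fy (- hh n) @[n --> \oo] --> dy U2 p := cvg_difference_quotient gy2 hN hNc.
rewrite mulr_natl mulr2n.
have S := cvgD (cvgB (cvgM X1 Y2) (cvgM Y1 X2)) (cvgB (cvgM X1' Y2') (cvgM Y1' X2')).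
apply: cvg_trans (S _ _ _ _ _ _ _); apply: near_eq_cvg; near=> n; rewrite /= /q /fx /fy.
rewrite /J /Jp /Jm -!surjective_pairing /=.
by rewrite !fctE /=; field; exact: hP.
Unshelve. all: by end_near. Qed.

Let J_bound n p : `|J n p| <= 4 * L ^+ 2.
Proof.
have L0 := lip2_ge0 L1.
have D1 U h : lip2 L U -> `|U (p.1 + h, p.2) - U p| <= L * `|h|.
  by move=> /(_ (p.1 + h, p.2) p)/= /le_trans; apply; rewrite addrAC !subrr add0r normr0 addr0.
have D2 U h : lip2 L U -> `|U (p.1, p.2 + h) - U p| <= L * `|h|.
  by move=> /(_ (p.1, p.2 + h) p)/= /le_trans; apply; rewrite addrAC !subrr add0r normr0 add0r.
have D1' U h : lip2 L U -> `|U p - U (p.1 - h, p.2)| <= L * `|h|.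
  by move=> /(D1 _ (- h)); rewrite normrN distrC.
have D2' U h : lip2 L U -> `|U p - U (p.1, p.2 - h)| <= L * `|h|.
  by move=> /(D2 _ (- h)); rewrite normrN distrC.
have M (a b h : R) : `|a| <= L * `|h| -> `|b| <= L * `|h| -> `|a * b| <= L ^+ 2 * h ^+ 2.
  move=> ha hb; rewrite normrM -[h ^+ 2]real_normK ?num_real// -exprMn expr2.
  by apply: ler_pM.
have h0 := hh0 n.
rewrite /J normrM ger0_norm ?exprn_ge0 ?invr_ge0 ?(ltW h0)// ?invr_ge0 ?sqr_ge0//.
rewrite ler_pdivrMl ?exprn_gt0//.
have T (a b c d : R) : `|a - b + (c - d)| <= `|a| + `|b| + (`|c| + `|d|).
  by rewrite (le_trans (ler_normD _ _))// lerD// ler_normB.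
rewrite /Jp /Jm (le_trans (T _ _ _ _))//.
have -> : hh n ^+ 2 * (4 * L ^+ 2) = L ^+ 2 * hh n ^+ 2 + L ^+ 2 * hh n ^+ 2 +
  (L ^+ 2 * hh n ^+ 2 + L ^+ 2 * hh n ^+ 2) by ring.
apply: lerD; apply: lerD.
- exact: M (D1 _ _ L1) (D2 _ _ L2).
- exact: M (D1 _ _ L2) (D2 _ _ L1).
- exact: M (D1' _ _ L1) (D2' _ _ L2).
- exact: M (D1' _ _ L2) (D2' _ _ L1).
Qed.

(** The integral of [J n] over the box does not depend on [n]; by dominated convergence it equals
    that of twice the determinant of the partial derivatives. *)
Lemma square_area_le (D Z : set (R * R)) (j : R * R -> R) :
  measurable D -> D `<=` B3 -> measurable Z -> mu2 Z = 0%E -> (forall p, D p -> 0 <= j p) ->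
  (forall p, good U1 p -> good U2 p -> ~ Z p -> D p -> `|det p| <= j p) ->
  (forall p, good U1 p -> good U2 p -> ~ Z p -> ~ D p -> det p = 0) ->
  (((a1 - a0) * (b1 - b0))%:E <= \int[mu2]_(p in D) (j p)%:E)%E.
Proof.
move=> mD DB mZ Z0 j0 jD jN.
pose N : set (R * R) := Z `|` (~` [set p | derivable (fun t => U1 (t, p.2)) p.1 1] `|`
  ~` [set p | derivable (fun t => U1 (p.1, t)) p.2 1] `|`
  (~` [set p | derivable (fun t => U2 (t, p.2)) p.1 1] `|`
  ~` [set p | derivable (fun t => U2 (p.1, t)) p.2 1])).
have m1 := measurableC (measurable_derivable1 L1).
have m2 := measurableC (measurable_derivable2 L1).
have m3 := measurableC (measurable_derivable1 L2).
have m4 := measurableC (measurable_derivable2 L2).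
have mN : measurable N := measurableU _ _ mZ (measurableU _ _ (measurableU _ _ m1 m2) (measurableU _ _ m3 m4)).
have N0 : mu2 N = 0%E.
  have n1 := (@negligibleP _ _ _ mu2 _ m1).2 (lip2_derivable1_null L1).
  have n2 := (@negligibleP _ _ _ mu2 _ m2).2 (lip2_derivable2_null L1).
  have n3 := (@negligibleP _ _ _ mu2 _ m3).2 (lip2_derivable1_null L2).
  have n4 := (@negligibleP _ _ _ mu2 _ m4).2 (lip2_derivable2_null L2).
  have nZ := (@negligibleP _ _ _ mu2 _ mZ).2 Z0.
  exact: (@negligibleP _ _ _ mu2 _ mN).1 (negligibleU nZ (negligibleU (negligibleU n1 n2) (negligibleU n3 n4))).
have goodN p : ~ N p -> [/\ good U1 p, good U2 p & ~ Z p].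
  move=> /not_orP[nZ /not_orP[/not_orP[/contrapT d1 /contrapT d2] /not_orP[/contrapT d3 /contrapT d4]]].
  exact: And3 (conj d1 d2) (conj d3 d4) nZ.
pose d p : R := det p * \1_(~` N) p.
have mB : measurable B3 by apply: measurableX; exact: measurable_itv.
have cJ n : continuous (J n).
  move=> p; apply: cvgM; first exact: cvg_cst.
  by apply: cvgD; [exact: cJp|exact: cJm].
(* Cutting off the null set [N] makes the convergence hold everywhere, which gives the measurability
   of the limit; the factor 1/2 undoes the factor 2 of [J_cvg]. *)
pose J' n p : R := 2^-1 * J n p * \1_(~` N) p.
have mJ' n : measurable_fun setT (J' n).
  apply: measurable_funM.
    by apply: continuous_measurable2 => p; apply: cvgM; [exact: cvg_cst|exact: cJ].
  by apply: measurable_indic; exact: measurableC.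
have J'd p : J' n p @[n --> \oo] --> d p.
  rewrite /J' /d indicE; case: (boolP (p \in ~` N)) => [|_].
    rewrite inE => /goodN[g1 g2 gz]; apply: cvgM; last exact: cvg_cst.
    have : 2^-1 * J n p @[n --> \oo] --> 2^-1 * (2 * det p).
      by apply: cvgM; [exact: cvg_cst|exact: J_cvg].
    by rewrite mulrA mulVf// mul1r.
  by under eq_fun do rewrite mulr0; rewrite mulr0; exact: cvg_cst.
have md : measurable_fun setT d.
  by apply: (measurable_fun_cvg (h := J')) => // p _; exact: J'd.
have J'b n p : `|J' n p| <= 4 * L ^+ 2.
  rewrite /J' normrM indicE; case: (_ \in _).
    rewrite normr1 mulr1.
    by rewrite normrM ger0_norm// (le_trans _ (J_bound n p))// ler_piMl// invf_le1// ler1n.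
  by rewrite normr0 mulr0 mulr_ge0// sqr_ge0.
have [|||||id _ lim] := @dominated_convergence _ _ R mu2 B3 mB (fun n p => (J' n p)%:E)
   (EFin \o d) (cst (4 * L ^+ 2)%:E).
- by move=> n; apply/measurable_EFinP; exact: (measurable_funTS (mJ' n)).
- by apply/measurable_EFinP; exact: (measurable_funTS md).
- by apply: aeW => p _; apply: cvg_EFin; [exact: nearW|exact: J'd].
- by apply: (continuous_integrable_box (f := cst _)) => p; exact: cvg_cst.
- by apply: aeW => p n _; rewrite /= lee_fin.
have negN p : p \in N = false -> \1_(~` N) p = 1 :> R.
  by move=> pN; rewrite indicE in_setC pN.
have JJ' n : (\int[mu2]_(p in B3) (J' n p)%:E = ((a1 - a0) * (b1 - b0))%:E)%E.
  pose k : R := 2^-1 * hh n ^- 2.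
  transitivity (\int[mu2]_(p in B3) (k%:E * (Jp (hh n) p + Jm (hh n) p)%:E))%E.
    apply: ae_eq_integral => //.
    - by apply/measurable_EFinP; exact: (measurable_funTS (mJ' n)).
    - apply/measurable_EFinP; apply: measurable_funTS; apply: continuous_measurable2.
      move=> p; apply: cvgM; first exact: cvg_cst.
      by apply: cvgD; [exact: cJp|exact: cJm].
    - exists N; split=> // p /= h; apply: contrapT => pN; apply: h => _.
      rewrite /J' negN ?mulr1 ?mulrA//; apply/negbTE.
      by rewrite notin_setE.
  rewrite integralZl//; last first.
    by apply: continuous_integrable_box => p; apply: cvgD; [exact: cJp|exact: cJm].
  rewrite (integral_triangles (hh0 n) (hh1 n)) -EFinM /k; congr (_%:E).
  by field; rewrite gt_eqF.
have dE : (\int[mu2]_(p in B3) (d p)%:E = ((a1 - a0) * (b1 - b0))%:E)%E.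
  apply: (cvg_unique (@ereal_hausdorff R) lim).
  rewrite (_ : (fun n => _) = cst ((a1 - a0) * (b1 - b0))%:E); first exact: cvg_cst.
  by apply/funext => n; exact: JJ'.
have dD : (\int[mu2]_(p in B3) (d p)%:E <= \int[mu2]_(p in D) (`|d p|)%:E)%E.
  apply: (@le_trans _ _ (\int[mu2]_(p in B3) (`|d p|)%:E)%E).
    apply: le_integral => //.
    + exact: (integrable_abse id).
    + by move=> p _; rewrite lee_fin ler_norm.
  have -> : (\int[mu2]_(p in D) (`|d p|)%:E =
      \int[mu2]_(p in B3) ((fun p => (`|d p|)%:E) \_ D) p)%E.
    by rewrite -integral_mkcondr (setIidr DB).
  rewrite le_eqVlt; apply/orP; left; apply/eqP; apply: eq_integral => p _.
  rewrite patchE; case: ifPn => //; rewrite notin_setE => pD.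
  rewrite /d indicE in_setC.
  case: (boolP (p \in N)) => [_|]; first by rewrite mulr0 normr0.
  by rewrite notin_setE => /goodN[g1 g2 gz]; rewrite jN// mul0r normr0.
rewrite -dE; apply: le_trans dD _; apply: ge0_le_lower_integral => p Dp; rewrite lee_fin//.
rewrite /d normrM indicE in_setC.
case: (boolP (p \in N)) => [_|].
  by rewrite normr0 mulr0 j0.
rewrite notin_setE => /goodN[g1 g2 gz].
by rewrite normr1 mulr1 jD.
Qed.

End SquareArea.

Ltac grp := rewrite ?(commgEl, conjgE, invgM, invgK, invg1, mulgA, mulgK, mulgVK,
  mulgV, mulVg, mul1g, mulg1)//.

(** * Commutator calculus and the area of words *)

Section IntegerPower.
Local Open Scope group_scope.
Variable F : groupType.
Implicit Types (g h : F) (m k : int).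

Definition expz g m := match m with Posz n => g ^+ n | Negz n => g ^- n.+1 end.

Lemma expzS g m : expz g (m + 1)%R = expz g m * g.
Proof.
case: m => [n|n]; first by rewrite -PoszD addn1 /= expgSr.
rewrite NegzE (_ : (- n.+1%:Z + 1)%R = - n%:Z)%R; last by lia.
rewrite -NegzE /= expgS invgM mulgVK.
by case: n => [|n]; rewrite ?oppr0 ?invg1// -NegzE.
Qed.

Lemma expzP g m : expz g (m - 1)%R = expz g m * g^-1.
Proof. by rewrite -[in RHS](subrK 1%R m) expzS mulgK. Qed.

Lemma expzD g m k : expz g (m + k)%R = expz g m * expz g k.
Proof.
elim/int_rect: k => [|n IH|n IH]; first by rewrite addr0 mulg1.
  by rewrite -addn1 PoszD addrA !expzS IH mulgA.
by rewrite -addn1 PoszD opprD addrA !expzP IH mulgA.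
Qed.

Lemma expVz g m : expz g^-1 m = (expz g m)^-1.
Proof. by case: m => n /=; rewrite ?expVgn// invgK. Qed.

End IntegerPower.

(** * Equality of group elements at a given cost *)

Section AreaCalculus.
Local Open Scope group_scope.
Variables (F : groupType) (N : nat -> F -> Prop).
Hypothesis N1 : N 0 1.
Hypothesis NM : forall k l g h, N k g -> N l h -> N (k + l) (g * h).
Hypothesis NV : forall k g, N k g -> N k g^-1.
Hypothesis NJ : forall k g x, N k g -> N k (g ^ x).
Hypothesis Nle : forall k l g, (k <= l)%N -> N k g -> N l g.
Implicit Types (g h x y : F) (k l : nat).

(** Read [N k g] as: [g] is a product of at most [k] conjugates of relators and their inverses.
    Costs add under transitivity and under products. *)
Definition area_eq k g h := N k (g^-1 * h).

Lemma aeq_refl g : area_eq 0 g g.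
Proof. by rewrite /area_eq mulVg. Qed.

Lemma aeq_sym k g h : area_eq k g h -> area_eq k h g.
Proof. by move=> /NV; rewrite /area_eq invgM invgK. Qed.

Lemma aeq_trans k l h g x : area_eq k g h -> area_eq l h x -> area_eq (k + l) g x.
Proof. by rewrite /area_eq => /NM H /H; rewrite mulgA mulgK. Qed.

Lemma aeq_mul k l g g' h h' : area_eq k g g' -> area_eq l h h' ->
  area_eq (k + l) (g * h) (g' * h').
Proof.
rewrite /area_eq => /(NJ h) a b; have := NM a b.
by congr (N _ _); grp.
Qed.

Lemma aeq_inv k g h : area_eq k g h -> area_eq k g^-1 h^-1.
Proof.
rewrite /area_eq => /NV/(NJ g^-1); congr (N _ _); grp.
Qed.

Lemma aeq_le k l g h : (k <= l)%N -> area_eq k g h -> area_eq l g h.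
Proof. exact: Nle. Qed.

Lemma com_aeq k g h : N k [~ g, h] -> area_eq k (h * g) (g * h).
Proof. by rewrite /area_eq; congr (N _ _); grp. Qed.

Lemma com_sym k g h : N k [~ g, h] -> N k [~ h, g].
Proof. by move=> /NV; rewrite invgR. Qed.

Lemma com_mull k l g g' h : N k [~ g, h] -> N l [~ g', h] -> N (k + l) [~ g * g', h].
Proof. by move=> /(NJ g') a b; have := NM a b; congr (N _ _); grp. Qed.

Lemma com_mulr k l g h h' : N k [~ g, h] -> N l [~ g, h'] -> N (k + l) [~ g, h * h'].
Proof. by move=> /com_sym a /com_sym b; apply: com_sym; exact: com_mull. Qed.

Lemma com_invl k g h : N k [~ g, h] -> N k [~ g^-1, h].
Proof. by move=> /NV/(NJ g^-1); congr (N _ _); grp. Qed.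

Lemma com_invr k g h : N k [~ g, h] -> N k [~ g, h^-1].
Proof. by move=> /com_sym/com_invl/com_sym. Qed.

Lemma com_expl k g h n : N k [~ g, h] -> N (n * k) [~ g ^+ n, h].
Proof.
move=> H; elim: n => [|n IH]; first by rewrite comm1g.
by rewrite expgS mulSn; exact: com_mull.
Qed.

Lemma com_expzl k g h m : N k [~ g, h] -> N (`|m| * k) [~ expz g m, h].
Proof.
by move=> H; case: m => n; rewrite ?NegzE ?abszN/=; [|apply: com_invl]; exact: com_expl.
Qed.

Lemma com_expz k g h (m l : int) : N k [~ g, h] -> N (`|m| * (`|l| * k)) [~ expz g m, expz h l].
Proof.
by move=> H; apply/com_expzl/com_sym/com_expzl/com_sym.
Qed.

Lemma com_aeql k l g g' h : area_eq k g g' -> N l [~ g, h] -> N (k + k + l) [~ g', h].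
Proof.
move=> a b; have H : N (k + k) [~ g^-1 * g', h].
  by rewrite commgEl; apply: NM; [exact: NV|exact: NJ].
by have := com_mull b H; rewrite mulVKg addnC.
Qed.

Lemma com_aeqr k l g h h' : area_eq k h h' -> N l [~ g, h] -> N (k + k + l) [~ g, h'].
Proof. by move=> a /com_sym b; apply: com_sym; exact: com_aeql b. Qed.

Lemma aeq_com_conj k g h : N k [~ g, h] -> area_eq k g (g ^ h).
Proof. by rewrite /area_eq -commgEl. Qed.

(** Each new [g] is moved past [h ^+ n] at cost [n * k], so the costs sum up to a quadratic one. *)
Lemma aeq_expM k g h n : N k [~ g, h] ->
  area_eq (n * n * k) (g ^+ n * h ^+ n) ((g * h) ^+ n).
Proof.
move=> H; elim: n => [|n IH]; first by rewrite !expg0 mulg1; exact: aeq_refl.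
have -> : g ^+ n.+1 * h ^+ n.+1 = g ^+ n * (g * h ^+ n) * h.
  by rewrite [g ^+ _]expgSr [h ^+ _]expgSr !mulgA.
have c : area_eq (n * k) (g * h ^+ n) (h ^+ n * g).
  by apply: com_aeq; apply: com_expl; exact: com_sym.
have := aeq_mul (aeq_mul (aeq_refl (g ^+ n)) c) (aeq_refl h).
rewrite add0n addn0 => /aeq_trans T.
have := aeq_mul IH (aeq_refl (g * h)); rewrite addn0 -expgSr.
rewrite !mulgA in T * => /T; rewrite -mulgA; apply: aeq_le.
by lia.
Qed.

Lemma aeq_expzM k g h m : N k [~ g, h] ->
  area_eq (2 * `|m| * `|m| * k) (expz g m * expz h m) (expz (g * h) m).
Proof.
move=> H; case: m => n; rewrite ?NegzE ?abszN /=.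
  by apply: aeq_le (aeq_expM n H); lia.
rewrite -invgM.
have := com_expz n.+1 n.+1 (com_sym H); rewrite /= => /com_aeq c.
apply: aeq_inv; apply: aeq_le (aeq_trans (aeq_sym c) (aeq_expM n.+1 H)).
by lia.
Qed.

Lemma aeq_N k l g h : area_eq k g h -> N l h -> N (k + l) g.
Proof. by move=> /aeq_sym a b; have := NM b a; rewrite mulVKg addnC. Qed.

(** Each of [g] and [h] occurs twice in their commutator. *)
Lemma com_comml k l g h x : N k [~ g, x] -> N l [~ h, x] ->
  N (2 * (k + l)) [~ [~ g, h], x].
Proof.
move=> a b; rewrite [X in N _ [~ X, _]]commgEl conjgE.
apply: Nle (com_mull (com_invl a) (com_mull (com_invl b) (com_mull a b))).
by lia.
Qed.

(* Diagonal words [g1 * h1] and [g2 * h2] commute up to bounded area, so their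
   powers commute up to quadratic area. *)
Lemma comm_expz_opposite b c g1 g2 h1 h2 (L : nat) (m k : int) :
  N b [~ g1, h1] -> N b [~ g1, h2] -> N b [~ g2, h1] -> N b [~ g2, h2] ->
  N c [~ g1 * h1, g2 * h2] -> (`|m| <= L)%N -> (`|k| <= L)%N ->
  area_eq ((c + 20 * b) * (L * L)) [~ expz g1 m, expz g2 k]
    [~ expz h1 m, expz h2 k]^-1.
Proof.
move=> b11 b12 b21 b22 cc mL kL.
set A := expz g1 m; set B := expz g2 k; set C := expz h1 m; set D := expz h2 k.
have sq (u v w : nat) : (u <= L)%N -> (v <= L)%N -> (u * (v * w) <= L * L * w)%N.
  by move=> uL vL; rewrite mulnA leq_mul// leq_mul.
have sq2 (u w : nat) : (u <= L)%N -> (2 * u * u * w <= 2 * (L * L * w))%N.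
  by move=> uL; have := sq u u w uL uL; lia.
have E1 : area_eq (2 * (L * L * b)) (A * C) (expz (g1 * h1) m).
  by apply: aeq_le (aeq_expzM m b11); exact: sq2.
have E2 : area_eq (2 * (L * L * b)) (B * D) (expz (g2 * h2) k).
  by apply: aeq_le (aeq_expzM k b22); exact: sq2.
have cAD : N (L * L * b) [~ A, D] by have := com_expz m k b12; apply: Nle; exact: sq.
have cAC : N (L * L * b) [~ A, C] by have := com_expz m m b11; apply: Nle; exact: sq.
have cBC : N (L * L * b) [~ B, C] by have := com_expz k m b21; apply: Nle; exact: sq.
have cBD : N (L * L * b) [~ B, D] by have := com_expz k k b22; apply: Nle; exact: sq.
have cPQ : N (8 * (L * L * b) + L * L * c) [~ A * C, B * D].
  have := com_aeql (aeq_sym E1) (com_aeqr (aeq_sym E2) (com_expz m k cc)).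
  apply: Nle; have := sq _ _ c mL kL; lia.
have c1 : area_eq (8 * (L * L * b)) [~ A, B] ([~ A, B] ^ (D * C)).
  apply: aeq_com_conj.
  apply: Nle (com_mulr (com_comml cAD cBD) (com_comml cAC cBC)); lia.
have c2 : N (2 * (L * L * b) + (8 * (L * L * b) + L * L * c))
    ([~ A, B] ^ (D * C) * [~ C, D]).
  have := NM (NV (NJ C cAD)) (NM cPQ (NV (NJ D (com_sym cBC)))).
  have -> : ([~ A, D] ^ C)^-1 * ([~ A * C, B * D] * ([~ C, B] ^ D)^-1) =
      [~ A, B] ^ (D * C) * [~ C, D] by grp.
  by apply: Nle; lia.
rewrite /area_eq -invgM; apply: NV.
have := aeq_N (aeq_mul c1 (aeq_refl [~ C, D])) c2.
move=> /(NJ [~ C, D]^-1); rewrite conjgE invgK mulgK.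
by apply: Nle; rewrite mulnDl; lia.
Qed.

End AreaCalculus.

(** * Normal forms of words at quadratic cost *)

Section CommutatorArea.
Local Open Scope group_scope.
Variables (F : groupType) (N : nat -> F -> Prop).
Hypothesis N1 : N 0 1.
Hypothesis NM : forall k l g h, N k g -> N l h -> N (k + l) (g * h).
Hypothesis NV : forall k g, N k g -> N k g^-1.
Hypothesis NJ : forall k g x, N k g -> N k (g ^ x).
Hypothesis Nle : forall k l g, (k <= l)%N -> N k g -> N l g.
Variables (r n : nat) (a : 'I_r -> 'I_n -> F).
Hypothesis R1 : forall (i j : 'I_r) (p q : 'I_n), p != q -> N 1 [~ a i p, a j q].
Hypothesis R2 : forall i j p q, N 1 ([~ a i p, a j p] * [~ a i q, a j q]^-1).
Variables p0 p1 : 'I_n.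
Hypothesis p01 : p0 != p1.
Implicit Types (g h x y z w : F) (m k e c : int) (L D C : nat) (i j l : 'I_r) (p q : 'I_n).

(** With the cost in units of [L * L], a chain of equalities at a fixed scale only adds up the
    constants [C]. *)
Definition sq_area L C g := N (C * (L * L)) g.
Definition sq_eq L C g h := area_eq N (C * (L * L)) g h.
Definition lpow i p m := expz (a i p) m.
Definition lcomm p i j m k := [~ lpow i p m, lpow j p k].

Lemma sqe_refl L g : sq_eq L 0 g g.
Proof. exact: aeq_refl. Qed.
Lemma sqe_sym L C g h : sq_eq L C g h -> sq_eq L C h g.
Proof. exact: aeq_sym. Qed.
Lemma sqe_trans L C C' h g x : sq_eq L C g h -> sq_eq L C' h x -> sq_eq L (C + C') g x.
Proof. by rewrite /sq_eq mulnDl; exact: aeq_trans. Qed.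
Lemma sqe_mul L C C' g g' h h' : sq_eq L C g g' -> sq_eq L C' h h' ->
  sq_eq L (C + C') (g * h) (g' * h').
Proof. by rewrite /sq_eq mulnDl; exact: aeq_mul. Qed.
Lemma sqe_mull L C g h x : sq_eq L C g h -> sq_eq L C (x * g) (x * h).
Proof. by move=> H; have := sqe_mul (sqe_refl L x) H; rewrite add0n. Qed.
Lemma sqe_mulr L C g h x : sq_eq L C g h -> sq_eq L C (g * x) (h * x).
Proof. by move=> H; have := sqe_mul H (sqe_refl L x); rewrite addn0. Qed.
Lemma sqe_le L C C' g h : (C <= C')%N -> sq_eq L C g h -> sq_eq L C' g h.
Proof. by move=> le; apply: Nle; rewrite leq_mul2r le orbT. Qed.
Lemma sqe_double L C g h : sq_eq L C g h -> sq_eq (2 * L) C g h.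
Proof. by apply: Nle; nia. Qed.
Lemma sqe_com L C g h : sq_area L C [~ g, h] -> sq_eq L C (h * g) (g * h).
Proof. exact: com_aeq. Qed.

Lemma sqe_mid L C x y z w : sq_eq L C (y * z) (z * y) ->
  sq_eq L C (x * y * (z * w)) (x * z * (y * w)).
Proof.
move=> H; have -> : x * y * (z * w) = x * (y * z) * w by rewrite !mulgA.
have -> : x * z * (y * w) = x * (z * y) * w by rewrite !mulgA.
exact/sqe_mulr/sqe_mull.
Qed.

(** The commutator of the two diagonal products is the product of the commutators up to conjugation
    by elements that commute with the other factor. *)
Lemma com_opposite (b w : nat) (A B C D : F) : N b [~ A, D] -> N b [~ A, C] -> N b [~ B, C] ->
  N b [~ B, D] -> N w ([~ A, B] * [~ C, D]) -> N (10 * b + w) [~ A * C, B * D].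
Proof.
move=> cAD cAC cBC cBD W.
have c1 : area_eq N (8 * b) ([~ A, B] ^ (D * C)) [~ A, B].
  apply: aeq_sym => //; apply: aeq_com_conj => //.
  by apply: Nle (com_mulr NM NV NJ (com_comml NM NV NJ Nle cAD cBD) (com_comml NM NV NJ Nle cAC cBC)); lia.
have c2 := aeq_N NM NV (aeq_mul NM NJ c1 (aeq_refl N1 [~ C, D])) W.
have -> : [~ A * C, B * D] =
   [~ A, D] ^ C * ([~ A, B] ^ (D * C) * [~ C, D]) * [~ C, B] ^ D by grp.
by apply: Nle (NM (NM (NJ C cAD) c2) (NJ D (com_sym NV cBC))); lia.
Qed.

Lemma lpow_com D L i j p q m k : p != q -> (`|m| <= D * L)%N -> (`|k| <= D * L)%N ->
  sq_area L (D * D) [~ lpow i p m, lpow j q k].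
Proof.
move=> pq mD kD; apply: Nle (com_expz N1 NM NV NJ m k (R1 i j pq)).
by rewrite muln1; have := leq_mul mD kD; nia.
Qed.

(** Pairing letter [i] of one factor with letter [j] of the other makes the two diagonals commute,
    and this exchanges the exponents. In the constant, 31 is 11 + 20: the commutation of the
    diagonals and the overhead of [comm_expz_opposite]. *)
Lemma lcomm_flip D L i j p q m k : p != q -> (`|m| <= D * L)%N -> (`|k| <= D * L)%N ->
  sq_eq L (31 * (D * D)) (lcomm p i j m k) (lcomm q i j k m).
Proof.
move=> pq mD kD; have qp : q != p by rewrite eq_sym.
have W : N 11 [~ a i p * a j q, a j p * a i q].
  apply: (@com_opposite 1 1); try exact: R1.
  by rewrite -[ [~ a j q, _]]invgR.
have := comm_expz_opposite N1 NM NV NJ Nle (R1 i j pq) (R1 i i pq) (R1 j j pq) (R1 j i pq) W mD kD.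
by rewrite invgR; apply: Nle; nia.
Qed.

Lemma other_factor p : exists q, p != q.
Proof. by have [->|] := eqVneq p p0; [exists p1|exists p0]. Qed.

Lemma lcomm_central D L i j l p q m k e :
  (`|m| <= D * L)%N -> (`|k| <= D * L)%N -> (`|e| <= D * L)%N ->
  sq_area L (66 * (D * D)) [~ lcomm p i j m k, lpow l q e].
Proof.
move=> mD kD eD.
have C q' q'' i' j' m' k' : (`|m'| <= D * L)%N -> (`|k'| <= D * L)%N -> q' != q'' ->
    sq_area L (4 * (D * D)) [~ lcomm q' i' j' m' k', lpow l q'' e].
  move=> mD' kD' pq.
  apply: Nle (com_comml NM NV NJ Nle (lpow_com i' l pq mD' eD) (lpow_com j' l pq kD' eD)).
  by lia.
have [pq|pq] := eqVneq p q; last by apply: Nle (C _ _ _ _ _ _ mD kD pq); lia.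
have [q' pq'] := other_factor p.
have qp : q' != q by rewrite eq_sym -pq.
apply: Nle (com_aeql NM NV NJ (aeq_sym NV (lcomm_flip i j pq' mD kD)) (C q' q i j _ _ kD mD qp)).
by lia.
Qed.

(** Here the second diagonal uses an inverse letter, which keeps the exponents in order. Removing
    the inverse is a conjugation, paid for by centrality. *)
Lemma lcomm_transfer D L i j p q m k : p != q -> (`|m| <= D * L)%N -> (`|k| <= D * L)%N ->
  sq_eq L (200 * (D * D)) (lcomm p i j m k) (lcomm q i j m k).
Proof.
move=> pq mD kD; have qp : q != p by rewrite eq_sym.
have W : N 15 [~ a i p * a i q, a j p * (a j q)^-1].
  apply: (@com_opposite 1 5); [exact/(com_invr NV NJ)/R1|exact: R1|exact: R1|exact/(com_invr NV NJ)/R1|].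
  have -> : [~ a i q, (a j q)^-1] = [~ a i q, a j q]^-1 ^ (a j q)^-1 by grp.
  have H : N 1 (([~ a i p, a j p] * [~ a i q, a j q]^-1) ^ (a j q)^-1) by exact: NJ.
  have c : area_eq N 4 [~ a i p, a j p] ([~ a i p, a j p] ^ (a j q)^-1).
    apply: aeq_com_conj.
    exact: (com_comml NM NV NJ Nle (com_invr NV NJ (R1 i j pq)) (com_invr NV NJ (R1 j j pq))).
  have := aeq_mul NM NJ c (aeq_refl N1 ([~ a i q, a j q]^-1 ^ (a j q)^-1)).
  by rewrite -conjMg => /(aeq_N NM NV)/(_ H).
have := comm_expz_opposite N1 NM NV NJ Nle (R1 i i pq) (com_invr NV NJ (R1 i j pq))
  (R1 j i pq) (com_invr NV NJ (R1 j j pq)) W mD kD.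
rewrite expVz -/(lpow i p m) -/(lpow j p k) -/(lpow i q m) -/(lpow j q k) => E1.
have -> : lcomm q i j m k = [~ lpow i q m, (lpow j q k)^-1]^-1 ^ lpow j q k by rewrite /lcomm; grp.
have E2 : N (66 * (D * D) * (L * L)) [~ [~ lpow i q m, (lpow j q k)^-1]^-1, lpow j q k].
  have := NJ (lpow j q k)^-1 (lcomm_central i j j q q mD kD kD).
  by congr (N _ _); rewrite /lcomm; grp.
apply: Nle (aeq_trans NM E1 (aeq_com_conj E2)); nia.
Qed.

(** Flip into another factor, which exchanges the exponents, and transfer back, which does not. *)
Lemma lcomm_swap D L i j p m k : (`|m| <= D * L)%N -> (`|k| <= D * L)%N ->
  sq_eq L (231 * (D * D)) (lcomm p i j m k) (lcomm p i j k m).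
Proof.
move=> mD kD; have [q pq] := other_factor p.
have qp : q != p by rewrite eq_sym.
apply: sqe_le (sqe_trans (lcomm_flip i j pq mD kD) (lcomm_transfer i j qp kD mD)).
by lia.
Qed.

Lemma lcomm_addl D L i j p m m' k : (`|m| <= D * L)%N -> (`|m'| <= D * L)%N ->
  (`|k| <= D * L)%N ->
  sq_eq L (66 * (D * D)) (lcomm p i j (m + m')%R k) (lcomm p i j m k * lcomm p i j m' k).
Proof.
move=> mD m'D kD; apply: sqe_sym.
have -> : lcomm p i j (m + m')%R k = lcomm p i j m k ^ lpow i p m' * lcomm p i j m' k.
  by rewrite /lcomm /lpow expzD; grp.
apply: sqe_mulr; apply: aeq_com_conj; exact: lcomm_central.
Qed.

Lemma lcomm_addr D L i j p m k k' : (`|m| <= D * L)%N -> (`|k| <= D * L)%N ->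
  (`|k'| <= D * L)%N ->
  sq_eq L (66 * (D * D)) (lcomm p i j m (k + k')%R) (lcomm p i j m k * lcomm p i j m k').
Proof.
move=> mD kD k'D; apply: sqe_sym.
have -> : lcomm p i j m (k + k')%R = lcomm p i j m k * lcomm p i j m k' ^ lpow j p k.
  by rewrite addrC /lcomm /lpow expzD; grp.
apply: sqe_mull; apply: aeq_com_conj; exact: lcomm_central.
Qed.

Lemma lcomm_com D L i j i' j' p q m k m' k' : (`|m| <= D * L)%N -> (`|k| <= D * L)%N ->
  (`|m'| <= D * L)%N -> (`|k'| <= D * L)%N ->
  sq_area L (264 * (D * D)) [~ lcomm p i j m k, lcomm q i' j' m' k'].
Proof.
move=> mD kD m'D k'D.
have H1 := com_sym NV (lcomm_central i j i' p q mD kD m'D).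
have H2 := com_sym NV (lcomm_central i j j' p q mD kD k'D).
by apply: Nle (com_sym NV (com_comml NM NV NJ Nle H1 H2)); lia.
Qed.

Lemma lcomm0l p i j k : lcomm p i j 0%R k = 1.
Proof. exact: comm1g. Qed.
Lemma lcomm0r p i j m : lcomm p i j m 0%R = 1.
Proof. exact: commg1. Qed.

Lemma lcommNl D L i j p m k : (`|m| <= D * L)%N -> (`|k| <= D * L)%N ->
  sq_eq L (66 * (D * D)) (lcomm p i j (- m)%R k) (lcomm p i j m k)^-1.
Proof.
move=> mD kD; have mD' : (`|(- m)%R| <= D * L)%N by rewrite abszN.
have := sqe_mull (lcomm p i j m k)^-1 (sqe_sym (lcomm_addl i j p mD mD' kD)).
by rewrite mulKg subrr lcomm0l mulg1.
Qed.

Lemma lcommNr D L i j p m k : (`|m| <= D * L)%N -> (`|k| <= D * L)%N ->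
  sq_eq L (66 * (D * D)) (lcomm p i j m (- k)%R) (lcomm p i j m k)^-1.
Proof.
move=> mD kD; have kD' : (`|(- k)%R| <= D * L)%N by rewrite abszN.
have := sqe_mull (lcomm p i j m k)^-1 (sqe_sym (lcomm_addr i j p mD kD kD')).
by rewrite mulKg subrr lcomm0r mulg1.
Qed.

(** A word of length [O(L)] for the [c]-th power of a commutator of two letters when [c] is
    [O(L ^ 2)]: the exponent is written in base [L], as [q * L + e], and placed in the factor
    [p0]. *)
Definition znf L i j c :=
  lcomm p0 i j L%:Z (c %/ L%:Z)%Z * lcomm p0 i j (c %% L%:Z)%Z 1%R.

Lemma znfE L i j c (q e : int) : (0 < L)%N -> c = (q * L%:Z + e)%R -> (0 <= e < L%:Z)%R ->
  znf L i j c = lcomm p0 i j L%:Z q * lcomm p0 i j e 1%R.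
Proof.
move=> L0 -> /andP[e0 eL]; rewrite /znf.
have L1 : (L%:Z != 0)%R by lia.
rewrite divzMDl// divz_small ?gtr0_norm ?ltz_nat//; last by apply/andP.
by rewrite addr0 modzMDl modz_small// e0.
Qed.

Lemma znf_spec L c D : (0 < L)%N -> (`|c| <= D * (L * L))%N -> exists q e : int,
  [/\ c = (q * L%:Z + e)%R, (0 <= e < L%:Z)%R & (`|q| <= D.+1 * L)%N].
Proof.
move=> L0 cD; exists (c %/ L%:Z)%Z, (c %% L%:Z)%Z.
have L1 : (L%:Z != 0)%R by lia.
have := divz_eq c L%:Z; have := modz_ge0 c L1; have := ltz_mod c L1.
set q := (c %/ _)%Z; set e := (c %% _)%Z.
rewrite gtr0_norm ?ltz_nat// => eL e0 ce; split; [exact: ce|by rewrite e0|].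
have : (q * L%:Z <= (D * L)%N%:Z * L%:Z)%R by nia.
have : (- ((D * L)%N%:Z + 1) * L%:Z <= q%R * L%:Z)%R by nia.
rewrite !ler_pM2r ?ltz_nat//; nia.
Qed.

Lemma znf0 L i j : (0 < L)%N -> znf L i j 0%R = 1.
Proof.
move=> L0; rewrite (@znfE L i j 0%R 0%R 0%R); [|by []|by rewrite mul0r|by lia].
by rewrite lcomm0l lcomm0r mulg1.
Qed.

(** Addition digit by digit: bilinearity adds the quotients and the remainders, and a possible carry
    remains. *)
Lemma znf_add D L i j c c' : (0 < L)%N ->
  (`|c| <= D * (L * L))%N -> (`|c'| <= D * (L * L))%N ->
  sq_eq L (528 * ((2 * D + 4) * (2 * D + 4))) (znf L i j c * znf L i j c')
    (znf L i j (c + c')%R).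
Proof.
move=> L0 /(znf_spec L0)[q [e [cE e01 qD]]] /(znf_spec L0)[q' [e' [cE' e01' qD']]].
rewrite (znfE i j L0 cE e01) (znfE i j L0 cE' e01').
set D1 := (2 * D + 4)%N.
have bL : (`|L%:Z| <= D1 * L)%N by rewrite /D1; nia.
have b1 : (`|1%R : int| <= D1 * L)%N by rewrite /D1; nia.
have bq : (`|q| <= D1 * L)%N by rewrite /D1; nia.
have bq' : (`|q'| <= D1 * L)%N by rewrite /D1; nia.
have be : (`|e| <= D1 * L)%N by rewrite /D1; nia.
have be' : (`|e'| <= D1 * L)%N by rewrite /D1; nia.
have bqq : (`|(q + q')%R| <= D1 * L)%N by rewrite /D1; nia.
set Z := lcomm p0 i j.
have s1 : sq_eq L (264 * (D1 * D1)) (Z L%:Z q * Z e 1%R * (Z L%:Z q' * Z e' 1%R))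
    (Z L%:Z q * Z L%:Z q' * (Z e 1%R * Z e' 1%R)).
  have -> : Z L%:Z q * Z e 1%R * (Z L%:Z q' * Z e' 1%R) =
    Z L%:Z q * (Z e 1%R * Z L%:Z q') * Z e' 1%R by grp.
  have -> : Z L%:Z q * Z L%:Z q' * (Z e 1%R * Z e' 1%R) =
    Z L%:Z q * (Z L%:Z q' * Z e 1%R) * Z e' 1%R by grp.
  by apply: sqe_mulr; apply: sqe_mull; apply: sqe_com; exact: lcomm_com.
have s2 := sqe_sym (lcomm_addr i j p0 bL bq bq').
have s3 := sqe_sym (lcomm_addl i j p0 be be' b1).
have s := sqe_trans s1 (sqe_mul s2 s3).
have [ee|ee] := ltP (e + e')%R (L%:Z)%R.
  rewrite (@znfE L i j (c + c')%R (q + q')%R (e + e')%R)//; last by lia.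
    by apply: sqe_le s; lia.
  by rewrite cE cE'; ring.
(* The carry: the remainder gives up [L], and the resulting commutator with exponents [L] and 1
   joins the quotient. *)
rewrite (@znfE L i j (c + c')%R (q + q' + 1)%R (e + e' - L%:Z)%R)//; last by lia.
  have be'' : (`|(e + e' - L%:Z)%R| <= D1 * L)%N by rewrite /D1; nia.
  have s4 := lcomm_addl i j p0 bL be'' b1.
  rewrite (_ : (L%:Z + (e + e' - L%:Z))%R = (e + e')%R) in s4; last by ring.
  have s5 := sqe_sym (lcomm_addr i j p0 bL bqq b1).
  have s6 := sqe_mulr (lcomm p0 i j (e + e' - L%:Z)%R 1%R) s5.
  rewrite -mulgA in s6.
  apply: sqe_le (sqe_trans s (sqe_trans (sqe_mull _ s4) s6)).
  by lia.
by rewrite cE cE'; ring.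
Qed.

Lemma sqe_quarter L C g h : sq_eq L (4 * C) g h -> sq_eq (2 * L) C g h.
Proof. by apply: Nle; nia. Qed.

(** Change of base from [L] to [2 * L]. *)
Lemma znf_scale D L i j c : (0 < L)%N -> (`|c| <= D * (L * L))%N ->
  sq_eq (2 * L) (264 * ((D + 2) * (D + 2))) (znf L i j c) (znf (2 * L) i j c).
Proof.
move=> L0 /(znf_spec L0)[q [e [cE e01 qD]]].
rewrite (znfE i j L0 cE e01).
set D1 := (D + 2)%N; set Z := lcomm p0 i j.
(* Halving the quotient leaves a bit [d]; the two copies of [q'] merge into one with first exponent
   [2 * L], and [d * L] joins the remainder. *)
have [q' [d [qE d01]]] : exists q' d : int, q = (q' + (q' + d))%R /\ (d = 0 \/ d = 1)%R.
  exists (q %/ 2)%Z, (q %% 2)%Z; have := divz_eq q 2; have := @modz_ge0 q 2 isT.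
  by have := @ltz_mod q 2 isT; lia.
have bL : (`|L%:Z| <= D1 * L)%N by rewrite /D1; nia.
have b1 : (`|1%R : int| <= D1 * L)%N by rewrite /D1; nia.
have bq' : (`|q'| <= D1 * L)%N by rewrite /D1; nia.
have bqd : (`|(q' + d)%R| <= D1 * L)%N by rewrite /D1; nia.
have bd : (`|d| <= D1 * L)%N by rewrite /D1; nia.
have be : (`|e| <= D1 * L)%N by rewrite /D1; nia.
have s1 := sqe_trans (lcomm_addr i j p0 bL bq' bqd) (sqe_mull _ (lcomm_addr i j p0 bL bq' bd)).
rewrite -qE mulgA in s1.
have s2 := sqe_sym (lcomm_addl i j p0 bL bL bq').
have s3 := sqe_trans s1 (sqe_mulr (Z L%:Z d) s2).
have s4 : sq_eq L (66 * (D1 * D1)) (Z L%:Z d * Z e 1%R) (Z (d * L%:Z + e)%R 1%R).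
  case: d01 => dE.
    by rewrite dE /Z lcomm0r mul1g mul0r add0r; apply: sqe_le (sqe_refl _ _); lia.
  by rewrite dE mul1r; apply: sqe_sym; exact: lcomm_addl.
have s5 := sqe_trans (sqe_mulr (Z e 1%R) s3) (_ : sq_eq L _ _ (Z (L%:Z + L%:Z)%R q' * Z (d * L%:Z + e)%R 1%R)).
rewrite (@znfE (2 * L) i j c q' (d * L%:Z + e)%R); [|lia|by rewrite cE qE; lia|by case: d01 => ->; lia].
have -> : (2 * L)%N%:Z = (L%:Z + L%:Z)%R by lia.
apply: sqe_double; apply: sqe_le (s5 _ (_ : sq_eq L (66 * (D1 * D1)) _ _)); first by lia.
by rewrite -mulgA; apply: sqe_mull.
Qed.

(** A signed digit can be carried from one slot of the commutator to the other; this puts the strips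
    of a bisection into the form that [znf] expects. *)
Lemma lcomm_ext L (d : int) i j k : (d = 0 \/ d = 1 \/ d = -1)%R -> (`|k| <= 2 * L)%N ->
  sq_eq L 528 (lcomm p0 i j (d * L%:Z)%R k) (lcomm p0 i j L%:Z (d * k)%R).
Proof.
move=> dE k2; have bL : (`|L%:Z| <= 2 * L)%N by lia.
case: dE => [->|[->|->]].
- rewrite !mul0r lcomm0l lcomm0r; apply: sqe_le (sqe_refl _ _); lia.
- rewrite !mul1r; apply: sqe_le (sqe_refl _ _); lia.
- rewrite !mulN1r.
  by apply: sqe_le (sqe_trans (lcommNl i j p0 bL k2) (sqe_sym (lcommNr i j p0 bL k2))); lia.
Qed.

(* Only the smallest of the four sub-rectangles needs a recursive treatment, so
   the costs form a geometric series. *)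
Lemma lcomm_znf i j : exists A, forall t m k, (`|m| <= 2 ^ t)%N -> (`|k| <= 2 ^ t)%N ->
  sq_eq (2 ^ t) (4 * A) (lcomm p0 i j m k) (znf (2 ^ t) i j (m * k)%R).
Proof.
have [Al addl] : exists A, forall L m m' k, (`|m| <= 2 * L)%N -> (`|m'| <= 2 * L)%N ->
    (`|k| <= 2 * L)%N ->
    sq_eq L A (lcomm p0 i j (m + m')%R k) (lcomm p0 i j m k * lcomm p0 i j m' k).
  by eexists => L; exact: lcomm_addl.
have [Ar addr] : exists A, forall L m k k', (`|m| <= 2 * L)%N -> (`|k| <= 2 * L)%N ->
    (`|k'| <= 2 * L)%N ->
    sq_eq L A (lcomm p0 i j m (k + k')%R) (lcomm p0 i j m k * lcomm p0 i j m k').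
  by eexists => L; exact: lcomm_addr.
have [As swap] : exists A, forall L m k, (`|m| <= 2 * L)%N -> (`|k| <= 2 * L)%N ->
    sq_eq L A (lcomm p0 i j m k) (lcomm p0 i j k m).
  by eexists => L; exact: lcomm_swap.
have [Ae ext] : exists A, forall L (d : int) k, (d = 0 \/ d = 1 \/ d = -1)%R -> (`|k| <= 2 * L)%N ->
    sq_eq L A (lcomm p0 i j (d * L%:Z)%R k) (lcomm p0 i j L%:Z (d * k)%R).
  by eexists => L d k; exact: lcomm_ext.
have [Az zadd] : exists A, forall L c c', (0 < L)%N -> (`|c| <= 4 * (L * L))%N ->
    (`|c'| <= 4 * (L * L))%N ->
    sq_eq L A (znf L i j c * znf L i j c') (znf L i j (c + c')%R).
  by eexists => L; exact: znf_add.
have scale D : exists A, forall L c, (0 < L)%N -> (`|c| <= D * (L * L))%N ->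
    sq_eq (2 * L) A (znf L i j c) (znf (2 * L) i j c).
  by eexists => L; exact: znf_scale.
have [[A1 scale1] [A2 scale2]] := (scale 1%N, scale 2%N).
(* A cost [4 * A] at scale [L] is a cost [A] at scale [2 * L], which leaves [3 * A] for the pieces
   treated without recursion. *)
exists (Al + Ar + As + 2 * Ae + 2 * Az + A1 + 2 * A2)%N.
elim=> [|t IH] m k mt kt.
  rewrite (@znfE _ i j _ (m * k)%R 0%R) ?expn0//; last by lia.
  rewrite lcomm0l mulg1.
  have mE : (m = m * 1%N%:Z)%R by lia.
  rewrite {1}mE; apply: sqe_le (ext 1%N m k _ _) => //; lia.
set L := (2 ^ t)%N in IH; have L0 : (0 < L)%N by rewrite expn_gt0.
have LE : (2 ^ t.+1 = 2 * L)%N by rewrite expnS.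
rewrite LE in mt kt *.
have split m' : (`|m'| <= 2 * L)%N -> exists d m'' : int,
    [/\ m' = (d * L%:Z + m'')%R, (d = 0 \/ d = 1 \/ d = -1)%R & (`|m''| <= L)%N].
  move=> m2; have [h|h] := ltP L%:Z m'.
    by exists 1%R, (m' - L%:Z)%R; split; [ring|auto|lia].
  have [h'|h'] := ltP m' (- L%:Z)%R.
    by exists (-1)%R, (m' + L%:Z)%R; split; [ring|auto|lia].
  by exists 0%R, m'; split; [ring|auto|lia].
have [d [m' [mE dE m'L]]] := split m mt.
have [f [k' [kE fE k'L]]] := split k kt.
have bdL : (`|(d * L%:Z)%R| <= 2 * L)%N by case: dE => [->|[->|->]]; lia.
have bfL : (`|(f * L%:Z)%R| <= 2 * L)%N by case: fE => [->|[->|->]]; lia.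
have bm' : (`|m'| <= 2 * L)%N by lia.
have bk' : (`|k'| <= 2 * L)%N by lia.
have Zb c : (`|c| <= 2 * L)%N ->
    sq_eq (2 * L) A2 (lcomm p0 i j L%:Z c) (znf (2 * L) i j (c * L%:Z)%R).
  move=> cL; have <- : znf L i j (c * L%:Z)%R = lcomm p0 i j L%:Z c.
    rewrite (@znfE L i j (c * L%:Z)%R c 0%R L0 _ _); [by rewrite lcomm0l mulg1|by rewrite addr0|].
    by rewrite lexx ltz_nat.
  by apply: scale2 => //; nia.
(* The rectangle [m * k] is cut into the strips [d * L] by [k] and [m'] by [f * L], which have a
   side in the set 0, [L], [- L], and the small rectangle [m'] by [k'], to which [IH] applies. *)
have s1l := addl _ _ _ _ bdL bm' kt; rewrite -mE in s1l.
have s1r := addr _ _ _ _ bm' bfL bk'; rewrite -kE in s1r.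
have s1 := sqe_double (sqe_trans s1l (sqe_mull _ s1r)).
have t1 := sqe_trans (sqe_double (ext _ _ _ dE kt)) (Zb (d * k)%R ltac:(by case: dE => [->|[->|->]]; lia)).
have t2 := sqe_trans (sqe_double (sqe_trans (swap _ _ _ bm' bfL) (ext _ _ _ fE bm')))
  (Zb (f * m')%R ltac:(by case: fE => [->|[->|->]]; lia)).
have bmk' : (`|(m' * k')%R| <= 1 * (L * L))%N by rewrite mul1n abszM leq_mul.
have t3 := sqe_trans (sqe_quarter (IH m' k' m'L k'L)) (scale1 L (m' * k')%R L0 bmk').
have L20 : (0 < 2 * L)%N by lia.
have XL : (4 * ((2 * L) * (2 * L)) = 16 * (L * L))%N by lia.
have bdk : (`|(d * k * L%:Z)%R| <= 2 * (L * L))%N.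
  by rewrite !abszM absz_nat mulnA leq_mul2r; case: dE => [->|[->|->]]; lia.
have bfm : (`|(f * m' * L%:Z)%R| <= L * L)%N.
  by rewrite !abszM absz_nat leq_mul2r; case: fE => [->|[->|->]]; lia.
have bmk : (`|(m' * k')%R| <= L * L)%N by rewrite abszM leq_mul.
have W (c X : nat) : X = 2%N \/ X = 1%N -> (c <= X * (L * L))%N -> (c <= 4 * ((2 * L) * (2 * L)))%N.
  by rewrite XL => X2 /leq_trans; apply; rewrite leq_mul2r; case: X2 => ->; rewrite orbT.
have absD (x y : int) : (`|(x + y)%R| <= `|x| + `|y|)%N by clear; lia.
have b1 := W _ 2%N (or_introl erefl) bdk.
have b2 : (`|(f * m' * L%:Z)%R| <= 4 * ((2 * L) * (2 * L)))%N.
  by apply: (W _ 1%N (or_intror erefl)); rewrite mul1n.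
have b3 : (`|(m' * k')%R| <= 4 * ((2 * L) * (2 * L)))%N by exact: W _ 1%N (or_intror erefl) bmk'.
have b23 : (`|(f * m' * L%:Z + m' * k')%R| <= 4 * ((2 * L) * (2 * L)))%N.
  apply: (W _ 2%N (or_introl erefl)); apply: leq_trans (absD _ _) _.
  by rewrite mul2n -addnn leq_add.
have u := sqe_trans (sqe_mull _ (zadd _ _ _ L20 b2 b3)) (zadd _ _ _ L20 b1 b23).
have := sqe_trans s1 (sqe_trans (sqe_mul t1 (sqe_mul t2 t3)) u).
have -> : (d * k * L%:Z + (f * m' * L%:Z + m' * k'))%R = (m * k)%R.
  by rewrite mE kE; ring.
by apply: sqe_le; clear; lia.
Qed.

Definition zprod L (l : seq ('I_r * 'I_r)) (c : 'I_r * 'I_r -> int) : F :=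
  foldr (fun u g => znf L u.1 u.2 (c u) * g) 1 l.
Definition lprod (l : seq ('I_r * 'I_n)) (e : 'I_r * 'I_n -> int) : F :=
  foldr (fun s g => lpow s.1 s.2 (e s) * g) 1 l.
Definition zle B L (c : 'I_r * 'I_r -> int) := forall u, (`|c u| <= B * (L * L))%N.

Lemma zle_le B B' L (c : 'I_r * 'I_r -> int) : (B <= B')%N -> zle B L c -> zle B' L c.
Proof. by move=> BB H u; rewrite (leq_trans (H u))// leq_mul2r BB orbT. Qed.

Lemma zleD B B' L (c c' : 'I_r * 'I_r -> int) : zle B L c -> zle B' L c' -> zle (B + B') L (fun u => c u + c' u)%R.
Proof. by move=> H H' u; have := H u; have := H' u; rewrite mulnDl; lia. Qed.

Lemma znf_central B L i j l q c e : (0 < L)%N -> (`|c| <= B * (L * L))%N -> (`|e| <= L)%N ->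
  sq_area L (132 * ((B + 2) * (B + 2))) [~ znf L i j c, lpow l q e].
Proof.
move=> L0 /(znf_spec L0)[d [f [cE f01 dB]]] eL; rewrite (znfE i j L0 cE f01).
have b1 : (`|L%:Z| <= (B + 2) * L)%N by nia.
have b2 : (`|d| <= (B + 2) * L)%N by nia.
have b3 : (`|f| <= (B + 2) * L)%N by nia.
have b4 : (`|1%R : int| <= (B + 2) * L)%N by nia.
have b5 : (`|e| <= (B + 2) * L)%N by nia.
apply: Nle (com_mull NM NJ (lcomm_central i j l p0 q b1 b2 b5) (lcomm_central i j l p0 q b3 b4 b5)).
by lia.
Qed.

Lemma znf_com B L i j i' j' c c' : (0 < L)%N ->
  (`|c| <= B * (L * L))%N -> (`|c'| <= B * (L * L))%N ->
  sq_area L (1056 * ((B + 2) * (B + 2))) [~ znf L i j c, znf L i' j' c'].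
Proof.
move=> L0 /(znf_spec L0)[d [f [cE f01 dB]]] /(znf_spec L0)[d' [f' [cE' f01' dB']]].
rewrite (znfE i j L0 cE f01) (znfE i' j' L0 cE' f01').
have b1 : (`|L%:Z| <= (B + 2) * L)%N by nia.
have b2 : (`|d| <= (B + 2) * L)%N by nia.
have b3 : (`|f| <= (B + 2) * L)%N by nia.
have b4 : (`|1%R : int| <= (B + 2) * L)%N by nia.
have b5 : (`|d'| <= (B + 2) * L)%N by nia.
have b6 : (`|f'| <= (B + 2) * L)%N by nia.
have H := fun e1 e2 e3 e4 : int => @lcomm_com (B + 2) L i j i' j' p0 p0 e1 e2 e3 e4.
apply: Nle (com_mull NM NJ (com_mulr NM NV NJ (H _ _ _ _ b1 b2 b1 b5) (H _ _ _ _ b1 b2 b6 b4))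
  (com_mulr NM NV NJ (H _ _ _ _ b3 b4 b1 b5) (H _ _ _ _ b3 b4 b6 b4))).
by lia.
Qed.

Lemma zprod_central B L (l : seq ('I_r * 'I_r)) (c : 'I_r * 'I_r -> int) (s : 'I_r * 'I_n) e : (0 < L)%N -> zle B L c -> (`|e| <= L)%N ->
  sq_area L (size l * (132 * ((B + 2) * (B + 2)))) [~ zprod L l c, lpow s.1 s.2 e].
Proof.
move=> L0 cB eL; elim: l => [|u l IH] /=; first by rewrite /sq_area comm1g.
have := com_mull NM NJ (znf_central u.1 u.2 s.1 s.2 L0 (cB u) eL) IH.
by apply: Nle; lia.
Qed.

Lemma zprod_com B L (l : seq ('I_r * 'I_r)) (c : 'I_r * 'I_r -> int) (u : 'I_r * 'I_r) (c' : 'I_r * 'I_r -> int) : (0 < L)%N -> zle B L c -> zle B L c' ->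
  sq_area L (size l * (1056 * ((B + 2) * (B + 2)))) [~ zprod L l c, znf L u.1 u.2 (c' u)].
Proof.
move=> L0 cB cB'; elim: l => [|v l IH] /=; first by rewrite /sq_area comm1g.
have := com_mull NM NJ (znf_com v.1 v.2 u.1 u.2 L0 (cB v) (cB' u)) IH.
by apply: Nle; lia.
Qed.

Lemma zprod_add B (l : seq ('I_r * 'I_r)) : exists C, forall L (c c' : 'I_r * 'I_r -> int), (0 < L)%N -> zle B L c -> zle B L c' ->
  sq_eq L C (zprod L l c * zprod L l c') (zprod L l (fun u => c u + c' u)%R).
Proof.
elim: l => [|u l [C IH]] /=.
  by exists 0%N => L c c' _ _ _; rewrite mulg1; exact: sqe_refl.
eexists => L c c' L0 cB cB'.
have s1 := sqe_com (zprod_com l u L0 cB cB').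
have s2 := sqe_mid (znf L u.1 u.2 (c u)) (zprod L l c') (sqe_sym s1).
have s3 := sqe_mul (znf_add u.1 u.2 L0 (cB u) (cB' u)) (IH L c c' L0 cB cB').
exact: sqe_trans s2 s3.
Qed.

Lemma zprod_scale B (l : seq ('I_r * 'I_r)) : exists C, forall L (c : 'I_r * 'I_r -> int), (0 < L)%N -> zle B L c ->
  sq_eq (2 * L) C (zprod L l c) (zprod (2 * L) l c).
Proof.
elim: l => [|u l [C IH]] /=; first by exists 0%N => L c _ _; exact: sqe_refl.
eexists => L c L0 cB.
exact: sqe_mul (znf_scale u.1 u.2 L0 (cB u)) (IH L c L0 cB).
Qed.

Lemma zprod0 L (l : seq ('I_r * 'I_r)) (c : 'I_r * 'I_r -> int) : (0 < L)%N -> (forall u, u \in l -> c u = 0%R) -> zprod L l c = 1.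
Proof.
move=> L0; elim: l => [//|u l IH] /= H.
rewrite H ?mem_head// znf0// mul1g IH// => v vl; apply: H.
by rewrite in_cons vl orbT.
Qed.

Lemma zprod_single L (l : seq ('I_r * 'I_r)) u c : (0 < L)%N -> uniq l -> u \in l ->
  zprod L l (fun v => if v == u then c else 0%R) = znf L u.1 u.2 c.
Proof.
move=> L0; elim: l => [//|v l IH] /= /andP[vl ul]; rewrite in_cons.
have [uv _|uv /= ul'] := eqVneq u v; first subst v.
  rewrite ?eqxx zprod0 ?mulg1// => w wl; case: eqP => // wv.
  by rewrite wv (negbTE vl) in wl.
by rewrite ?(eq_sym v) ?(negbTE uv) znf0// mul1g IH.
Qed.

Implicit Types (u v : 'I_r * 'I_r).

Let prs := enum [set: 'I_r * 'I_r]%SET.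
Let ltr := enum [set: 'I_r * 'I_n]%SET.
Let in_prs u : u \in prs. Proof. by rewrite mem_enum inE. Qed.
Let uniq_prs : uniq prs. Proof. exact: enum_uniq. Qed.

(** The commutators of letters [i < j] form a basis of the center of the free two-step nilpotent
    group; with this restriction the coefficients are determined by the value of the word. *)
Definition triangular (c : 'I_r * 'I_r -> int) := forall i j : 'I_r, (j <= i)%N -> c (i, j) = 0%R.

(** Letters of different factors commute; in one factor the commutator is transferred to [p0], and
    inverted when the letters come in the wrong order. *)
Lemma letters_com (s s' : 'I_r * 'I_n) : exists A, forall t m k, (`|m| <= 2 ^ t)%N -> (`|k| <= 2 ^ t)%N ->
  exists c : 'I_r * 'I_r -> int, [/\ zle 1 (2 ^ t) c, triangular c &
  sq_eq (2 ^ t) A [~ lpow s.1 s.2 m, lpow s'.1 s'.2 k]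
    (zprod (2 ^ t) prs c)].
Proof.
case: s s' => i p [j q] /=.
have [A zA] : exists A, forall t m k, (`|m| <= 2 ^ t)%N -> (`|k| <= 2 ^ t)%N ->
    sq_eq (2 ^ t) A (lcomm p0 i j m k) (znf (2 ^ t) i j (m * k)%R) /\
    sq_eq (2 ^ t) A (lcomm p0 j i m k) (znf (2 ^ t) j i (m * k)%R).
  have [A HA] := lcomm_znf i j; have [A' HA'] := lcomm_znf j i.
  exists (4 * A + 4 * A')%N => t m k mL kL.
  by split; [apply: sqe_le (HA t m k mL kL); lia|apply: sqe_le (HA' t m k mL kL); lia].
exists (A + 400)%N => t m k; set L := (2 ^ t)%N => mL kL.
have L0 : (0 < L)%N by rewrite expn_gt0.
have m1 : (`|m| <= 1 * L)%N by rewrite mul1n.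
have k1 : (`|k| <= 1 * L)%N by rewrite mul1n.
have [pq|pq] := eqVneq p q; last first.
  exists (fun=> 0%R); split=> //; rewrite zprod0//.
  have := lpow_com i j pq m1 k1; rewrite /sq_eq /area_eq mulg1 => /NV.
  by apply: Nle; rewrite leq_mul2r; apply/orP; right; lia.
rewrite -{q}pq.
have tr i' j' m' k' : sq_eq L A (lcomm p0 i' j' m' k') (znf L i' j' (m' * k')%R) ->
    (`|m'| <= 1 * L)%N -> (`|k'| <= 1 * L)%N ->
    sq_eq L (A + 200) (lcomm p i' j' m' k') (znf L i' j' (m' * k')%R).
  rewrite !mul1n => b mL' kL'.
  have [<-|pp] := eqVneq p0 p; first by apply: sqe_le b; lia.
  have pp' : p != p0 by rewrite eq_sym.
  have a' : sq_eq L (200 * (1 * 1)) (lcomm p i' j' m' k') (lcomm p0 i' j' m' k').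
    by apply: lcomm_transfer pp' _ _; rewrite mul1n.
  by apply: sqe_le (sqe_trans a' b); lia.
have mk : (`|(m * k)%R| <= 1 * (L * L))%N by rewrite mul1n abszM leq_mul.
have [ij|ij|ij] := ltngtP i j.
- exists (fun u => if u == (i, j) then (m * k)%R else 0%R); split.
  + by move=> u; case: ifP.
  + move=> i' j' ji; case: eqP => // -[? ?]; subst i' j'; lia.
  + by rewrite zprod_single//; apply: sqe_le (tr i j m k (zA t m k mL kL).1 m1 k1); lia.
- exists (fun u => if u == (j, i) then (- (k * m))%R else 0%R); split.
  + by move=> u; case: ifP => // _; rewrite abszN mulrC.
  + move=> i' j' ji; case: eqP => // -[? ?]; subst i' j'; lia.
  + rewrite zprod_single//=; apply: sqe_sym.
    have k1' : (`|(- m)%R| <= 1 * L)%N by rewrite abszN.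
    have mL' : (`|(- m)%R| <= L)%N by rewrite abszN.
    have h1 := tr j i k (- m)%R (zA t k (- m)%R kL mL').2 k1 k1'.
    have h2 := sqe_sym (lcommNr j i p k1 m1).
    rewrite -mulrN -[X in sq_eq _ _ _ X]invgR; apply: sqe_sym.
    by apply: sqe_le (sqe_trans h2 h1); lia.
- move/val_inj: ij => ij; subst j; exists (fun=> 0%R); split=> //; rewrite zprod0//.
  have -> : [~ lpow i p m, lpow i p k] = 1.
    have E : lpow i p m * lpow i p k = lpow i p k * lpow i p m.
      by rewrite /lpow -!expzD addrC.
    by rewrite commgEl conjgE E mulKg mulVg.
  by apply: sqe_le (sqe_refl _ _).
Qed.

Lemma lprod_central B (l : seq ('I_r * 'I_n)) t (c : 'I_r * 'I_r -> int) (e : 'I_r * 'I_n -> int) :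
  zle B (2 ^ t) c -> (forall s, (`|e s| <= 2 ^ t)%N) ->
  sq_area (2 ^ t) (size l * (size prs * (132 * ((B + 2) * (B + 2)))))
    [~ zprod (2 ^ t) prs c, lprod l e].
Proof.
move=> cB eL; have L0 : (0 < 2 ^ t)%N by rewrite expn_gt0.
elim: l => [|s l IH] /=; first by rewrite /sq_area commg1.
have := com_mulr NM NV NJ (zprod_central prs s L0 cB (eL s)) IH.
by apply: Nle; rewrite -mulnDl.
Qed.

Lemma triangularD (c c' : 'I_r * 'I_r -> int) : triangular c -> triangular c' ->
  triangular (fun u => c u + c' u)%R.
Proof. by move=> H H' i j ij; rewrite H// H'. Qed.

(** The commutator with a product splits letter by letter, and the conjugations that appear
    disappear by centrality. *)
Lemma lprod_com (l : seq ('I_r * 'I_n)) : exists B C, forall t (s : 'I_r * 'I_n)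
    (e : 'I_r * 'I_n -> int) k,
  (forall s, (`|e s| <= 2 ^ t)%N) -> (`|k| <= 2 ^ t)%N ->
  exists c : 'I_r * 'I_r -> int, [/\ zle B (2 ^ t) c, triangular c &
    sq_eq (2 ^ t) C [~ lprod l e, lpow s.1 s.2 k] (zprod (2 ^ t) prs c)].
Proof.
elim: l => [|s' l [B [C IH]]].
  exists 0%N, 0%N => t s e k _ _; exists (fun=> 0%R); split=> //.
  by rewrite comm1g zprod0 ?expn_gt0//; exact: sqe_refl.
have [C' addC] := zprod_add (B + 1) prs.
have [A lett] : exists A, forall s, forall t m k, (`|m| <= 2 ^ t)%N -> (`|k| <= 2 ^ t)%N ->
    exists c : 'I_r * 'I_r -> int, [/\ zle 1 (2 ^ t) c, triangular c &
    sq_eq (2 ^ t) A [~ lpow s'.1 s'.2 m, lpow s.1 s.2 k] (zprod (2 ^ t) prs c)].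
  have [f fP] := choice (letters_com s').
  exists (\sum_s f s)%N => s t m k mL kL; have [c [c1 tc E]] := fP s t m k mL kL.
  by exists c; split=> //; apply: sqe_le E; rewrite (bigD1 s)//= leq_addr.
eexists; eexists => t s e k eL kL; set L := (2 ^ t)%N.
have L0 : (0 < L)%N by rewrite expn_gt0.
have [c1 [c1B tc1 E1]] := lett s t _ _ (eL s') kL.
have [c2 [c2B tc2 E2]] := IH t s e k eL kL.
exists (fun u => c1 u + c2 u)%R; split; [exact: zleD c1B c2B|exact: triangularD|].
rewrite [lprod _ _]/=.
have -> : forall g h x : F, [~ g * h, x] = [~ g, x] ^ h * [~ h, x] by move=> *; grp.
have cen := aeq_sym NV (aeq_com_conj (lprod_central l c1B eL)).
have E1' : sq_eq L A ([~ lpow s'.1 s'.2 (e s'), lpow s.1 s.2 k] ^ lprod l e)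
    (zprod L prs c1 ^ lprod l e).
  by rewrite /sq_eq /area_eq -conjVg -conjMg; exact: (NJ (lprod l e) E1).
have c1B' := zle_le (leq_addl B 1) c1B; have c2B' := zle_le (leq_addr 1 B) c2B.
exact: (sqe_trans (sqe_mul (sqe_trans E1' cen) E2) (addC L c1 c2 L0 c1B' c2B')).
Qed.

Lemma lprod_mul (l : seq ('I_r * 'I_n)) : exists B C, forall t (e e' : 'I_r * 'I_n -> int),
  (forall s, (`|e s| <= 2 ^ t)%N) -> (forall s, (`|e' s| <= 2 ^ t)%N) ->
  exists c : 'I_r * 'I_r -> int, [/\ zle B (2 ^ t) c, triangular c &
    sq_eq (2 ^ t) C (lprod l e * lprod l e')
      (lprod l (fun s => e s + e' s)%R * zprod (2 ^ t) prs c)].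
Proof.
elim: l => [|s l [B [C IH]]].
  exists 0%N, 0%N => t e e' _ _; exists (fun=> 0%R); split=> //.
  by rewrite zprod0 ?expn_gt0//; exact: sqe_refl.
have [B1 [C1 com]] := lprod_com l.
have [C' addC] := zprod_add (B + B1) prs.
eexists; eexists => t e e' eL eL'; set L := (2 ^ t)%N.
have L0 : (0 < L)%N by rewrite expn_gt0.
have [c1 [c1B tc1 E1]] := com t s e (e' s) eL (eL' s).
have [c2 [c2B tc2 E2]] := IH t e e' eL eL'.
exists (fun u => c2 u + c1 u)%R; split; [exact: zleD c2B c1B|exact: triangularD|].
rewrite [lprod (s :: l) e]/= [lprod (s :: l) e']/= [lprod (s :: l) _]/=.
have -> : lpow s.1 s.2 (e s + e' s)%R = lpow s.1 s.2 (e s) * lpow s.1 s.2 (e' s).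
  exact: expzD.
set x := lpow _ _ (e s); set x' := lpow _ _ (e' s).
set g := lprod l e in E1 E2 *; set g' := lprod l e' in E2 *.
set h := lprod l _ in E2 *.
have -> : x * g * (x' * g') = x * x' * (g * ([~ g, x'] * g')) by grp.
have cen := sqe_com (lprod_central l c1B eL').
have s1 := sqe_trans (sqe_mulr g' E1) (sqe_sym cen).
have s2 := sqe_mull g s1; rewrite [g * (g' * _)]mulgA in s2.
have s3 := sqe_mulr (zprod L prs c1) E2; rewrite -[h * _ * _]mulgA in s3.
have c1B' := zle_le (leq_addl B B1) c1B; have c2B' := zle_le (leq_addr B1 B) c2B.
have s4 := sqe_mull h (addC L c2 c1 L0 c2B' c1B').
rewrite -[x * x' * h * _]mulgA.
exact: (sqe_mull (x * x') (sqe_trans (sqe_trans s2 s3) s4)).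
Qed.

Definition wval (w : seq (('I_r * 'I_n) * bool)) : F :=
  foldr (fun (b : ('I_r * 'I_n) * bool) g => (if b.2 then (a b.1.1 b.1.2)^-1 else a b.1.1 b.1.2) * g) 1 w.

Lemma wval_cat (w1 w2 : seq (('I_r * 'I_n) * bool)) : wval (w1 ++ w2) = wval w1 * wval w2.
Proof. by elim: w1 => [|b w1 IH]; rewrite ?mul1g//= IH mulgA. Qed.

Lemma lprod0 (l : seq ('I_r * 'I_n)) (e : 'I_r * 'I_n -> int) : (forall s, s \in l -> e s = 0%R) -> lprod l e = 1.
Proof.
elim: l => [//|s l IH] H /=; rewrite H ?mem_head// mul1g IH// => u ul.
by apply: H; rewrite in_cons ul orbT.
Qed.

Lemma lprod_single (l : seq ('I_r * 'I_n)) (s : 'I_r * 'I_n) e : uniq l -> s \in l ->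
  lprod l (fun v : 'I_r * 'I_n => if v == s then e else 0%R) = lpow s.1 s.2 e.
Proof.
elim: l => [//|v l IH] /= /andP[vl ul]; rewrite in_cons.
have [uv _|uv /= ul'] := eqVneq s v; first subst v.
  rewrite ?eqxx lprod0 ?mulg1// => w wl; case: eqP => // wv.
  by rewrite wv (negbTE vl) in wl.
by rewrite ?(eq_sym v) ?(negbTE uv) mul1g IH.
Qed.

(** Words are halved. The normal forms of the halves are brought to the scale of the whole word,
    multiplied, and sorted with [lprod_mul]. *)
Lemma word_normal_form : exists B C, forall t (w : seq (('I_r * 'I_n) * bool)), (size w <= 2 ^ t)%N ->
  exists (e : 'I_r * 'I_n -> int) (c : 'I_r * 'I_r -> int), [/\ forall s, (`|e s| <= 2 ^ t)%N,
    zle B (2 ^ t) c, triangular c &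
    sq_eq (2 ^ t) C (wval w) (lprod ltr e * zprod (2 ^ t) prs c)].
Proof.
have [B1 [C1 mulC]] := lprod_mul ltr.
have [C2 addC] := zprod_add (4 * B1) prs.
have [C3 scaleC] := zprod_scale (2 * B1) prs.
(* Each half costs [4 * K] at its own scale, that is [K] at the new one, and joining the halves
   costs another [K]; the sum [3 * K] stays below [4 * K]. *)
pose K := (size ltr * (size prs * (132 * ((2 * B1 + 2) * (2 * B1 + 2)))) + C1 + 2 * C2 + 2 * C3)%N.
exists (2 * B1)%N, (4 * K)%N; elim=> [|t IH] w wt.
  case: w wt => [|x [|//]] _.
    exists (fun=> 0%R), (fun=> 0%R); split=> //.
    by rewrite lprod0// zprod0// mulg1; apply: sqe_le (sqe_refl _ _).
  exists (fun v : 'I_r * 'I_n => if v == x.1 then (if x.2 then -1 else 1)%R else 0%R), (fun=> 0%R).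
  split=> //; first by move=> s; case: ifP => // _; case: ifP.
  rewrite lprod_single ?mem_enum ?inE ?enum_uniq// zprod0//.
  apply: sqe_le (_ : sq_eq _ 0 _ _) => //.
  by case: x => -[i p] [] /=; rewrite !mulg1; exact: sqe_refl.
set L := (2 ^ t)%N in IH; have L0 : (0 < L)%N by rewrite expn_gt0.
have LE : (2 ^ t.+1 = 2 * L)%N by rewrite expnS.
have sz1 : (size (take L w) <= L)%N by rewrite size_take_min geq_minl.
have sz2 : (size (drop L w) <= L)%N by rewrite size_drop; lia.
have [e1 [c1 [e1L c1B tc1 E1]]] := IH _ sz1.
have [e2 [c2 [e2L c2B tc2 E2]]] := IH _ sz2.
have W (e : 'I_r * 'I_n -> int) : (forall s, (`|e s| <= L)%N) -> forall s : 'I_r * 'I_n, (`|e s| <= 2 ^ t.+1)%N.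
  by move=> H s; rewrite LE (leq_trans (H s))// leq_pmull.
have [c3 [c3B tc3 E3]] := mulC t.+1 e1 e2 (W _ e1L) (W _ e2L).
(* The same quarter rule for the central exponents: those of the two halves together use up [B1] at
   the new scale, and [c3] the other [B1]. *)
have half B (c : 'I_r * 'I_r -> int) : zle (4 * B) L c -> zle B (2 ^ t.+1) c.
  by move=> H u; rewrite LE; apply: leq_trans (H u) _; lia.
have c1B' : zle B1 (2 ^ t.+1) c1 by apply: half; apply: zle_le c1B; lia.
have c2B' : zle B1 (2 ^ t.+1) c2 by apply: half; apply: zle_le c2B; lia.
have c12B : zle B1 (2 ^ t.+1) (fun u => c1 u + c2 u)%R.
  by apply: half; have := zleD c1B c2B; apply: zle_le; lia.
exists (fun s => e1 s + e2 s)%R, (fun u => c3 u + (c1 u + c2 u))%R; split.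
- by move=> s; rewrite LE; have := e1L s; have := e2L s; lia.
- by apply: zle_le (zleD c3B c12B); lia.
- exact/triangularD/triangularD.
have L20 : (0 < 2 ^ t.+1)%N by rewrite expn_gt0.
rewrite -{1}(cat_take_drop L w) wval_cat.
have s1 := sqe_mul (sqe_quarter E1) (sqe_quarter E2).
have s2 := sqe_mul (sqe_mull (lprod ltr e1) (scaleC L c1 L0 c1B))
  (sqe_mull (lprod ltr e2) (scaleC L c2 L0 c2B)).
have c1B2 : zle (2 * B1) (2 ^ t.+1) c1 by apply: zle_le c1B'; lia.
have cen := sqe_sym (sqe_com (lprod_central ltr c1B2 (W _ e2L))).
have s3 := sqe_mid (lprod ltr e1) (zprod (2 ^ t.+1) prs c2) cen.
have c1B4 : zle (4 * B1) (2 ^ t.+1) c1 by apply: zle_le c1B'; lia.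
have c2B4 : zle (4 * B1) (2 ^ t.+1) c2 by apply: zle_le c2B'; lia.
have c3B4 : zle (4 * B1) (2 ^ t.+1) c3 by apply: zle_le c3B; lia.
have c12B4 : zle (4 * B1) (2 ^ t.+1) (fun u => c1 u + c2 u)%R by apply: zle_le c12B; lia.
have s4 := sqe_mul E3 (addC _ _ _ L20 c1B4 c2B4).
have s5 := sqe_mull (lprod ltr (fun s => e1 s + e2 s)%R) (addC _ _ _ L20 c3B4 c12B4).
rewrite mulgA in s5; rewrite -LE in s1 s2.
apply: sqe_le (sqe_trans s1 (sqe_trans s2 (sqe_trans s3 (sqe_trans s4 s5)))).
rewrite /K; set X := (size ltr * _)%N; clearbody X.
by move: C1 C2 C3 X {mulC addC scaleC K IH E1 E2 E3 s1 s2 s3 s4 s5 cen} => *; lia.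
Qed.

End CommutatorArea.

(** * Exponents and signed areas as invariants of words *)

Section WordInvariants.
Variable r : nat.
Implicit Types (i j k : 'I_r) (u v : words 'I_r).

Definition wsgn (b : bool) : int := if b then -1 else 1.
Definition wexp i u : int := \sum_(x <- u) (if x.1 == i then wsgn x.2 else 0).
(** For [i != j] this is the coefficient of [X_i X_j] in the Magnus expansion: the signed number of
    letters [i] followed later by a letter [j]. *)
Fixpoint warea i j u : int :=
  if u is x :: u' then warea i j u' + (if x.1 == i then wsgn x.2 else 0) * wexp j u' else 0.

Lemma wexpM i u v : wexp i (u * v)%g = wexp i u + wexp i v.
Proof. exact: big_cat. Qed.

Lemma wexp0 i : wexp i [::] = 0.
Proof. exact: big_nil. Qed.

Lemma wexp_cons i x u : wexp i (x :: u) = (if x.1 == i then wsgn x.2 else 0) + wexp i u.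
Proof. exact: big_cons. Qed.

Lemma wareaM i j u v : warea i j (u * v)%g = warea i j u + warea i j v + wexp i u * wexp j v.
Proof.
rewrite /mul/=; elim: u => [|x u IH] /=.
  by rewrite wexp0 mul0r add0r addr0.
have wexpM' : wexp j (u ++ v) = wexp j u + wexp j v := wexpM j u v.
by rewrite IH wexpM' (wexp_cons i x u); ring.
Qed.

Lemma wexpV i u : wexp i u^-1%g = - wexp i u.
Proof.
rewrite /wexp /inv/= /wordV (perm_big _ (permEl (perm_rev _))) big_map -sumrN.
apply: eq_bigr => -[k b] _ /=; by case: ifP; case: b.
Qed.

Lemma wareaV i j u : i != j -> warea i j u^-1%g = - warea i j u + wexp i u * wexp j u.
Proof.
move=> ij; elim: u => [|x u IH]; first by rewrite !wexp0 mul0r addr0.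
have -> : ((x :: u : words 'I_r)^-1 = (u : words 'I_r)^-1 * ([:: (x.1, ~~ x.2)] : words 'I_r))%g.
  by rewrite -[RHS]/(wordV u ++ _) -[LHS]/(wordV (x :: u)) /wordV/= rev_cons -cats1.
rewrite wareaM IH !wexpV [warea _ _ (_ :: _)]/= [warea _ _ (x :: u)]/= /= ?wexp0 !(wexp_cons _ x u) (wexp_cons _ (x.1, ~~ x.2)) !wexp0.
case: x => k b /=; have [ki|ki] := eqVneq k i; have [kj|kj] := eqVneq k j.
- by rewrite -ki -kj eqxx in ij.
- by case: b; rewrite /wsgn /=; ring.
- by case: b; rewrite /wsgn /=; ring.
- by ring.
Qed.

Lemma wexp_gcongr i u v : gcongr (@nilpotent2_rel r) u v -> wexp i u = wexp i v.
Proof.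
elim=> [_ _ [a b c]|x|//|x y _ ->//|x y z _ -> _ ->//|x x' y y' _ IH _ IH'].
- by rewrite !(wexpM, wexpV) wexp0; ring.
- by rewrite wexpM wexpV addNr /wexp big_nil.
- by rewrite !wexpM IH IH'.
Qed.

Lemma warea_gcongr i j u v : i != j -> gcongr (@nilpotent2_rel r) u v ->
  warea i j u = warea i j v.
Proof.
move=> ij; elim=> [_ _ [a b c]|x|//|x y _ ->//|x y z _ -> _ ->//|x x' y y' H1 IH H2 IH'].
- by rewrite !(wareaM, wareaV, wexpM, wexpV)//=; ring.
- by rewrite wareaM wareaV// wexpV; ring.
- by rewrite !wareaM IH IH' (wexp_gcongr i H1) (wexp_gcongr j H2).
Qed.

Local Notation G := (free_nilpotent2 r).
Definition nexp i (g : G) : int := wexp i (repr g).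
Definition narea i j (g : G) : int := warea i j (repr g).

Lemma nexp_pi i u : nexp i (\pi_G u)%qT = wexp i u.
Proof. exact/wexp_gcongr/gcongr_repr. Qed.

Lemma narea_pi i j u : i != j -> narea i j (\pi_G u)%qT = warea i j u.
Proof. by move=> ij; exact/(warea_gcongr ij)/gcongr_repr. Qed.

Lemma nexpM i (g h : G) : nexp i (g * h)%g = nexp i g + nexp i h.
Proof. by rewrite [LHS]nexp_pi wexpM. Qed.

Lemma nareaM i j (g h : G) : i != j ->
  narea i j (g * h)%g = narea i j g + narea i j h + nexp i g * nexp j h.
Proof. by move=> ij; rewrite [LHS]narea_pi// wareaM. Qed.

(** Commuting with a generator of index [j != i] changes [narea] by exactly the exponent of [z];
    such a [j] exists as the rank is at least two. *)
Lemma nexp_central i (z : G) : (1 < r)%N -> (forall g, commute z g) -> nexp i z = 0.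
Proof.
move=> r1 zC; have [j ij] : exists j, i != j.
  case: r r1 i => [|[|r']]// _ [[|i] hi]; first by exists ord_max.
  by exists ord0.
have := congr1 (narea i j) (zC (\pi_G (letter j))%qT).
rewrite !nareaM// !nexp_pi !narea_pi// /wexp !big_cons !big_nil /=.
by rewrite eqxx eq_sym (negbTE ij) /wsgn; lia.
Qed.

End WordInvariants.

(** * The invariants on the central product *)

Section CentralPowerInvariants.
Variables (r n : nat).
Hypothesis r1 : (1 < r)%N.
Local Notation H := ({ffun 'I_n -> free_nilpotent2 r}).
Local Notation G := (Lambda r n).
Implicit Types (i j : 'I_r) (p q : 'I_n).

Definition pexp i p (f : H) : int := nexp i (f p).
(** Identifying the centers moves area from one factor to another, so only the sum is well
    defined. *)
Definition parea i j (f : H) : int := \sum_p narea i j (f p).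

Lemma pexpM i p (f g : H) : pexp i p (f * g)%g = pexp i p f + pexp i p g.
Proof. by rewrite /pexp ffunE nexpM. Qed.

Lemma pareaM i j (f g : H) : i != j ->
  parea i j (f * g)%g = parea i j f + parea i j g + \sum_p pexp i p f * pexp j p g.
Proof.
by move=> ij; rewrite /parea -!big_split /=; apply: eq_bigr => p _; rewrite ffunE nareaM.
Qed.

Lemma nexp1 i : nexp i (1%g : free_nilpotent2 r) = 0.
Proof. by have := nexpM i 1%g 1%g; rewrite mul1g; lia. Qed.

Lemma narea1 i j : i != j -> narea i j (1%g : free_nilpotent2 r) = 0.
Proof. by move=> ij; have := nareaM 1%g 1%g ij; rewrite mul1g nexp1; lia. Qed.

Lemma parea_at i j p z : i != j -> parea i j (at_factor p z) = narea i j z.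
Proof.
move=> ij; rewrite /parea (bigD1 p)//= ffunE eqxx big1 ?addr0// => q qp.
by rewrite ffunE (negbTE qp) narea1.
Qed.

(** The exponents survive factor by factor, because a central element has exponents 0. *)
Lemma pexp_gcongr i p (f g : H) : gcongr (@central_rel _ _) f g -> pexp i p f = pexp i p g.
Proof.
elim=> [_ _ [k l z zC]|x|//|x y _ ->//|x y z _ -> _ ->//|x x' y y' _ IH _ IH'].
- by rewrite /pexp !ffunE; do 2 case: ifP => _; rewrite ?nexp1 ?(nexp_central i r1 zC).
- by rewrite mulVg.
- by rewrite !pexpM IH IH'.
Qed.

Lemma parea_gcongr i j (f g : H) : i != j -> gcongr (@central_rel _ _) f g ->
  parea i j f = parea i j g.
Proof.
move=> ij; elim=> [_ _ [k l z zC]|x|//|x y _ ->//|x y z _ -> _ ->//|x x' y y' H1 IH H2 IH'].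
- by rewrite !parea_at.
- by rewrite mulVg.
- rewrite !pareaM// IH IH'; congr (_ + _); apply: eq_bigr => p _.
  by rewrite (pexp_gcongr i p H1) (pexp_gcongr j p H2).
Qed.

Definition cexp i p (g : G) : int := pexp i p (repr g).
Definition carea i j (g : G) : int := parea i j (repr g).

Lemma cexp_pi i p f : cexp i p (\pi_G f)%qT = pexp i p f.
Proof. exact/pexp_gcongr/gcongr_repr. Qed.

Lemma carea_pi i j f : i != j -> carea i j (\pi_G f)%qT = parea i j f.
Proof. by move=> ij; exact/(parea_gcongr ij)/gcongr_repr. Qed.

Lemma cexpM i p (g h : G) : cexp i p (g * h)%g = cexp i p g + cexp i p h.
Proof. by rewrite [LHS]cexp_pi pexpM. Qed.

Lemma careaM i j (g h : G) : i != j ->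
  carea i j (g * h)%g = carea i j g + carea i j h + \sum_p cexp i p g * cexp j p h.
Proof. by move=> ij; rewrite [LHS]carea_pi// pareaM. Qed.

Definition cgen i p : G := (\pi_G (at_factor p (\pi_(free_nilpotent2 r) (letter i))%qT))%qT.

Lemma cexp_gen i p j q : cexp i p (cgen j q) = ((i == j) && (p == q))%:R.
Proof.
rewrite cexp_pi /pexp ffunE; case: ifP => pq; last by rewrite nexp1 andbF.
by rewrite nexp_pi wexp_cons wexp0 addr0 /= eq_sym andbT; case: eqP.
Qed.

End CentralPowerInvariants.

Section CommutatorInvariants.
Local Open Scope ring_scope.
Variables (r n : nat).
Hypothesis r1 : (1 < r)%N.
Local Notation G := (Lambda r n).
Implicit Types (g h : G) (i j : 'I_r) (p q : 'I_n).

Lemma cexp1 i p : cexp i p (1%g : G) = 0.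
Proof. by have := cexpM r1 i p 1%g 1%g; rewrite mul1g; lia. Qed.

Lemma cexpV i p g : cexp i p g^-1%g = - cexp i p g.
Proof. by have := cexpM r1 i p g g^-1%g; rewrite mulgV cexp1; lia. Qed.

Lemma carea1 i j : i != j -> carea i j (1%g : G) = 0.
Proof.
move=> ij; have := careaM r1 (1%g : G) (1%g : G) ij; rewrite mul1g.
under eq_bigr do rewrite cexp1 mul0r.
by rewrite big1//; lia.
Qed.

Lemma cexp_comm i p g h : cexp i p [~ g, h]%g = 0.
Proof. by rewrite commgEl /conjg !(cexpM r1, cexpV); lia. Qed.

Lemma carea_comm i j g h : i != j ->
  carea i j [~ g, h]%g = \sum_p (cexp i p g * cexp j p h - cexp i p h * cexp j p g).
Proof.
move=> ij; have E : (g * h = h * g * [~ g, h])%g by rewrite -commgC.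
have := congr1 (carea i j) E; rewrite !(careaM r1 _ _ ij).
rewrite [X in _ = _ + X]big1; last by move=> p _; rewrite cexp_comm mulr0.
rewrite sumrB; move: (\sum_p cexp i p g * _) (\sum_p cexp i p h * _) => S1 S2; lia.
Qed.

Lemma cexp_expz i p g m : cexp i p (expz g m) = m * cexp i p g.
Proof.
elim: m => [|k IH|k IH]; first by rewrite cexp1 mul0r.
- by rewrite -addn1 PoszD expzS (cexpM r1) IH mulrDl mul1r.
- have -> : (- k.+1%:Z = - k%:Z - 1) by lia.
  by rewrite expzP (cexpM r1) IH cexpV mulrDl mulN1r.
Qed.

End CommutatorInvariants.

Section GeneratorRelations.
Local Open Scope group_scope.
Variables (r n : nat).
Local Notation T := (free_nilpotent2 r).
Local Notation H := ({ffun 'I_n -> T}).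
Local Notation G := (Lambda r n).

Definition ngen (i : 'I_r) : T := (\pi_T (letter i))%qT.

Lemma pi_mulg (M : starMonoidType) (S : M -> M -> Prop) (x y : M) :
  (\pi_(gquot S) (x * y))%qT = (\pi_(gquot S) x)%qT * (\pi_(gquot S) y)%qT.
Proof. by rewrite -[RHS]/(gquot_mul _ _) gquot_piM. Qed.

Lemma pi_invg (M : starMonoidType) (S : M -> M -> Prop) (x : M) :
  (\pi_(gquot S) x^-1)%qT = (\pi_(gquot S) x)%qT^-1.
Proof. by rewrite -[RHS]/(gquot_inv _) gquot_piV. Qed.

Lemma words_ind (A : choiceType) (P : words A -> Prop) : P 1 ->
  (forall x u, P u -> P (letter x * u)) -> (forall x u, P u -> P ((letter x)^-1 * u)) ->
  forall u, P u.
Proof. by move=> P1 Pl Pv; elim=> [//|[x [|]] u]; [exact: (Pv x u)|exact: (Pl x u)]. Qed.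

Lemma ngen_comm_central i j (g : T) : commute [~ ngen i, ngen j] g.
Proof.
have gen k : commute [~ ngen i, ngen j] (ngen k).
  apply: commute_sym; apply/commgP/eqP.
  have -> : [~ ngen k, [~ ngen i, ngen j]] =
      (\pi_T [~ letter k, [~ letter i, letter j]])%qT.
    by rewrite /commg /conjg !(pi_mulg, pi_invg).
  exact/gquotP/gcongr_rel/Nilpotent2Rel.
elim/quotW: g; elim/words_ind => [|k u IH|k u IH]; first by rewrite /commute mulg1 mul1g.
  by rewrite pi_mulg; apply: commuteM => //; exact: gen.
by rewrite pi_mulg pi_invg; apply: commuteM => //; apply: commuteV; exact: gen.
Qed.

Lemma at_factorM p (y z : T) : at_factor p (y * z) = at_factor p y * at_factor p z :> H.
Proof. by apply/ffunP => q; rewrite !ffunE; case: ifP; rewrite ?mulg1. Qed.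

Lemma at_factorV p (z : T) : at_factor p z^-1 = (at_factor p z)^-1 :> H.
Proof. by apply/ffunP => q; rewrite !ffunE; case: ifP; rewrite ?invg1. Qed.

Lemma cgen_commute (i j : 'I_r) (p q : 'I_n) : p != q -> commute (cgen i p) (cgen j q).
Proof.
move=> pq; rewrite /commute /cgen -!pi_mulg; congr (\pi_G _)%qT.
apply/ffunP => s; rewrite !ffunE; have [->|] := eqVneq s p; last by rewrite mul1g mulg1.
by rewrite (negbTE pq) mulg1 mul1g.
Qed.

Lemma cgen_comm_factor (i j : 'I_r) (p q : 'I_n) :
  [~ cgen i p, cgen j p] = [~ cgen i q, cgen j q].
Proof.
have E s : [~ cgen i s, cgen j s] = (\pi_G (at_factor s [~ ngen i, ngen j]))%qT.
  by rewrite /commg /conjg !(at_factorM, at_factorV) !(pi_mulg, pi_invg).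
by rewrite !E; apply/gquotP/gcongr_rel/CentralRel/ngen_comm_central.
Qed.

End GeneratorRelations.

(** * Quadratic area of the words of value 1 *)

Section WordArea.
Local Open Scope ring_scope.
Variables (r n : nat) (F : groupType) (a : 'I_r -> 'I_n -> F).
Hypothesis r1 : (1 < r)%N.
Variables (p0 p1 : 'I_n).
Hypothesis p01 : p0 != p1.
Local Notation G := (Lambda r n).
Variable phi : F -> G.
Hypothesis phiM : forall g h, phi (g * h)%g = (phi g * phi h)%g.
Hypothesis phia : forall i p, phi (a i p) = cgen i p.

Let phi1 : phi 1%g = 1%g.
Proof. by apply: (mulgI (phi 1%g)); rewrite -phiM !mulg1. Qed.
Let phiV g : phi g^-1%g = (phi g)^-1%g.
Proof. by apply: (mulgI (phi g)); rewrite -phiM !mulgV. Qed.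
Let phiR g h : phi [~ g, h]%g = [~ phi g, phi h]%g.
Proof. by rewrite /commg /conjg !(phiM, phiV). Qed.
Let phi_expz g m : phi (expz g m) = expz (phi g) m.
Proof.
elim: m => [//|k IH|k IH]; first by rewrite -addn1 PoszD !expzS phiM IH.
have -> : (- k.+1%:Z = - k%:Z - 1) by lia.
by rewrite !expzP phiM phiV IH.
Qed.

Local Notation lpow := (lpow a). Local Notation lcomm := (lcomm a).

Let cexp_lpow i p j q m : cexp i p (phi (lpow j q m)) = m * ((i == j) && (p == q))%:R.
Proof. by rewrite phi_expz cexp_expz// phia cexp_gen. Qed.

Let cexp_lprod l e i p : uniq l -> (i, p) \in l -> cexp i p (phi (lprod a l e)) = e (i, p).
Proof.
have E s : uniq s -> cexp i p (phi (lprod a s e)) = ((i, p) \in s)%:R * e (i, p).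
  elim: s => [_|[j q] s IH] /=; first by rewrite phi1 cexp1// mul0r.
  move=> /andP[js us]; rewrite phiM (cexpM r1) cexp_lpow IH// in_cons xpair_eqE /=.
  case: andP => [[/eqP ij /eqP pq]|_] /=; last by rewrite mulr0 add0r.
  by subst; rewrite (negbTE js) mulr1 mul0r mul1r addr0.
by move=> us ls; rewrite E// ls mul1r.
Qed.

Let cexp_lcomm i p q j k m m' : cexp i p (phi (lcomm q j k m m')) = 0.
Proof. by rewrite phiR cexp_comm. Qed.

Let cexp_zprod L l c i p : cexp i p (phi (zprod a p0 L l c)) = 0.
Proof.
elim: l => [|u l IH] /=; first by rewrite phi1 cexp1.
by rewrite phiM /znf [in X in (X * _)%g]phiM !(cexpM r1) IH !cexp_lcomm.
Qed.

Let carea_lcomm i j k l m m' : i != j ->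
  carea i j (phi (lcomm p0 k l m m')) =
  m * m' * (((i == k) && (j == l))%:R - ((i == l) && (j == k))%:R).
Proof.
move=> ij; rewrite phiR carea_comm// (bigD1 p0)//= big1 ?addr0; last first.
  by move=> q qp; rewrite !cexp_lpow (negbTE qp) !andbF !mulr0 subr0.
rewrite !cexp_lpow eqxx !andbT.
by case: (i == k); case: (j == l); case: (i == l); case: (j == k) => /=; ring.
Qed.

Let carea_zprod L (l : seq ('I_r * 'I_r)) (c : 'I_r * 'I_r -> int) (i j : 'I_r) : (0 < L)%N -> (i < j)%N -> triangular c -> uniq l ->
  carea i j (phi (zprod a p0 L l c)) = ((i, j) \in l)%:R * c (i, j).
Proof.
move=> L0 lij tc; have ij : i != j by apply: contraTneq lij => ->; rewrite ltnn.
elim: l => [_|[k l] s IH] /=; first by rewrite phi1 carea1// mul0r.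
move=> /andP[js us]; rewrite phiM /znf [in X in (X * _)%g]phiM !(careaM r1 _ _ ij) !carea_lcomm// IH//.
rewrite big1 ?addr0; last by move=> q _; rewrite cexp_lcomm mul0r.
rewrite big1 ?addr0; last by move=> q _; rewrite cexp_zprod mulr0.
rewrite mulr1 [L%:Z * _]mulrC -mulrDl -divz_eq in_cons xpair_eqE.
case: (boolP ((i == k) && (j == l))) => [/andP[/eqP ? /eqP ?]|nkl] /=.
  subst k l; rewrite (negbTE js) (negbTE ij) /=; ring.
rewrite sub0r; case: (boolP ((i == l) && (j == k))) => [/andP[/eqP ? /eqP ?]|_] /=.
  by subst k l; rewrite (tc j i (ltnW lij)); ring.
by rewrite oppr0 mulr0 add0r.
Qed.

(** For a word of value 1, the invariants [cexp] and [carea] show that all exponents of its normal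
    form vanish. The normal form is then trivial, and the cost of reaching it bounds the area. *)
Lemma word_area (N : nat -> F -> Prop) :
  N 0 1%g -> (forall k l g h, N k g -> N l h -> N (k + l)%N (g * h)%g) ->
  (forall k g, N k g -> N k g^-1%g) -> (forall k g x, N k g -> N k (g ^ x)%g) ->
  (forall k l g, (k <= l)%N -> N k g -> N l g) ->
  (forall i j p q, p != q -> N 1 [~ a i p, a j q]%g) ->
  (forall i j p q, N 1 ([~ a i p, a j p] * [~ a i q, a j q]^-1)%g) ->
  exists C, forall w, phi (wval a w) = 1%g ->
    N (C * ((size w).+1 * (size w).+1))%N (wval a w).
Proof.
move=> N1 NM NV NJ Nle R1 R2.
(* Recording the value along with the area makes every equality of the normal form valid in [G],
   where the invariants live. *)
pose N' k g := N k g /\ phi g = 1%g.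
have N'1 : N' 0 1%g by split.
have N'M k l g h : N' k g -> N' l h -> N' (k + l)%N (g * h)%g.
  by move=> [? g1] [? h1]; split; [exact: NM|rewrite phiM g1 h1 mulg1].
have N'V k g : N' k g -> N' k g^-1%g.
  by move=> [? g1]; split; [exact: NV|rewrite phiV g1 invg1].
have N'J k g x : N' k g -> N' k (g ^ x)%g.
  by move=> [? g1]; split; [exact: NJ|rewrite !phiM g1 mul1g phiV mulVg].
have N'le k l g : (k <= l)%N -> N' k g -> N' l g.
  by move=> kl [? g1]; split=> //; exact: Nle kl _.
have R1' i j p q : p != q -> N' 1 [~ a i p, a j q]%g.
  move=> pq; split; first exact: R1.
  by rewrite phiR !phia; apply/eqP/commgP; exact: cgen_commute.
have R2' i j p q : N' 1 ([~ a i p, a j p] * [~ a i q, a j q]^-1)%g.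
  split; first exact: R2.
  by rewrite phiM phiV !phiR !phia (cgen_comm_factor i j p q) mulgV.
have [B [C NF]] := word_normal_form N'1 N'M N'V N'J N'le R1' R2' p01.
exists (4 * C)%N => w w1.
(* The normal form needs a length that is a power of two; rounding up at most doubles it, whence the
   factor 4. *)
pose t := up_log 2 (size w).+1.
have wt : (size w < 2 ^ t)%N by exact: up_logP.
have tw : (2 ^ t <= 2 * (size w).+1)%N.
  have [s0|s0] := posnP (size w); first by rewrite /t s0 up_log1.
  have := @up_log_bounds 2 (size w).+1 isT s0; rewrite -/t.
  have t0 : (0 < t)%N by rewrite up_log_gt0.
  by case/andP=> + _; rewrite -{2}(prednK t0) expnS; lia.
have [e [c [_ _ tc [NE E]]]] := NF t w (ltnW wt).
have L0 : (0 < 2 ^ t)%N by rewrite expn_gt0.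
rewrite phiM phiV w1 invg1 mul1g in E.
have e0 s : e s = 0.
  case: s => i p; have := congr1 (cexp i p) E.
  rewrite phiM (cexpM r1) cexp_zprod addr0 cexp1//.
  by rewrite cexp_lprod ?enum_uniq// mem_enum inE.
have l1 : lprod a (enum [set: 'I_r * 'I_n]%SET) e = 1%g by apply: lprod0.
rewrite l1 mul1g in E NE.
have c0 u : c u = 0.
  case: u => i j; case: (ltnP i j) => ij; last exact: tc.
  have := congr1 (carea i j) E.
  rewrite carea_zprod ?enum_uniq// mem_enum inE mul1r carea1//.
  by apply: contraTneq ij => ->; rewrite ltnn.
rewrite (zprod0 a p01)// in NE.
have NE' : N (C * (2 ^ t * 2 ^ t))%N (wval a w).
  by rewrite -[wval a w]invgK; apply: NV; move: NE; rewrite /area_eq mulg1.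
apply: Nle NE'; rewrite -mulnA (mulnC 4%N) -!mulnA leq_mul2l.
by apply/orP; right; have := leq_mul tw tw; lia.
Qed.

End WordArea.

(** * Realizations as path metric spaces *)

Section Segments.
Variables (R : realType) (V : choiceType) (K : complex V).
Local Notation X := (realization R K).
Implicit Types (x y z : X) (s t L : R) (c : R -> X).

Lemma mdistE (U : {fset V}) x y : (finsupp x `<=` U)%fset -> (finsupp y `<=` U)%fset ->
  mdist x y = Num.sqrt (\sum_(v <- U) (x v - y v) ^+ 2).
Proof. exact: bary_distE. Qed.

Lemma mdist_triangle y x z : mdist x z <= mdist x y + mdist y z.
Proof. exact: bary_dist_triangle. Qed.

Lemma mdistC x y : mdist x y = mdist y x.
Proof. exact: bary_dist_sym. Qed.

Lemma bary_face x : face K (finsupp x).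
Proof. by have /and3P[] := baryP x. Qed.

Lemma bary_ge0 x v : 0 <= x v.
Proof.
have /and3P[_ /allP H _] := baryP x.
by have [/H|/fsfun_dflt->] := boolP (v \in finsupp x).
Qed.

Lemma bary_sum (U : {fset V}) x : (finsupp x `<=` U)%fset -> \sum_(v <- U) x v = 1.
Proof.
move=> xU; have /and3P[_ _ /eqP <-] := baryP x.
by rewrite -(big_fset_incl _ xU)// => v _ /fsfun_dflt.
Qed.

Lemma bary_le1 x v : x v <= 1.
Proof.
have [vx|/fsfun_dflt->//] := boolP (v \in finsupp x).
rewrite -(bary_sum (fsubset_refl (finsupp x))) (big_fsetD1 v vx)/= lerDl.
by apply: sumr_ge0 => *; exact: bary_ge0.
Qed.

Lemma bary_gt0 x v : (0 < x v) = (v \in finsupp x).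
Proof. by rewrite lt_def bary_ge0 andbT mem_finsupp. Qed.

Lemma bary_neq0 x : exists v, v \in finsupp x.
Proof. by have /fset0Pn := face_neq0 (bary_face x). Qed.

Lemma bary_ext x y : (forall v, x v = y v) -> x = y.
Proof. by move=> xy; apply/val_inj/fsfunP. Qed.

Lemma bary_exists (s : {fset V}) (f : V -> R) : face K s -> (forall v, v \in s -> 0 <= f v) ->
  (forall v, v \notin s -> f v = 0) -> \sum_(v <- s) f v = 1 ->
  exists x : X, forall v, x v = f v.
Proof.
move=> Ks f0 fn f1; pose g : {fsfun V -> R with 0} := [fsfun v in s => f v].
have gE v : g v = f v by rewrite fsfunE; case: ifPn => // /fn.
have gs : (finsupp g `<=` s)%fset.
  by apply/fsubsetP => v; apply: contraTT => vs; rewrite memNfinsupp gE fn.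
have g1 : \sum_(v <- finsupp g) g v = 1.
  rewrite -f1 (big_fset_incl _ gs); first by apply: eq_bigr => v _; rewrite gE.
  by move=> v _ /fsfun_dflt.
have gP : barycentric K g.
  apply/and3P; split; last exact/eqP.
    apply: face_sub Ks gs _; apply: contra_eq_neq g1 => ->.
    by rewrite big_seq_fset0 eq_sym oner_eq0.
  by apply/allP => v /(fsubsetP gs) vs; rewrite gE f0.
by exists (Realization gP).
Qed.

(** The union of the supports is a face exactly when the two points lie in a common simplex. *)
Definition compat x y := face K (finsupp x `|` finsupp y)%fset.

Lemma compat_face (s : {fset V}) x y : face K s -> (finsupp x `<=` s)%fset ->
  (finsupp y `<=` s)%fset -> compat x y.
Proof.
move=> Ks xs ys; apply: face_sub Ks _ _; first by rewrite fsubUset xs.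
have [v vx] := bary_neq0 x; apply/fset0Pn; exists v.
by rewrite in_fsetU vx.
Qed.

Lemma compat_sub x y : (finsupp x `<=` finsupp y)%fset -> compat x y.
Proof. by move=> xy; apply: compat_face (bary_face y) xy _. Qed.

Lemma compatC x y : compat x y = compat y x.
Proof. by rewrite /compat fsetUC. Qed.

(* Junk value [x] unless [x] and [y] lie in a common simplex. *)
Definition seg x y t : X := xget x [set z : X | forall v, z v = (1 - t) * x v + t * y v].

Lemma segE x y t v : compat x y -> 0 <= t <= 1 -> seg x y t v = (1 - t) * x v + t * y v.
Proof.
move=> xy /andP[t0 t1]; rewrite /seg; case: xgetP => [z _ ->//|no].
set U := (finsupp x `|` finsupp y)%fset.
have [w wU|w||z zE] := @bary_exists U (fun v => (1 - t) * x v + t * y v) xy.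
- by rewrite addr_ge0// mulr_ge0 ?bary_ge0// subr_ge0.
- by rewrite in_fsetU negb_or => /andP[wx wy]; rewrite !fsfun_dflt// !mulr0 addr0.
- by rewrite big_split/= -!mulr_sumr !bary_sum ?fsubsetUl ?fsubsetUr// !mulr1 subrK.
- by case: (no z).
Qed.

Lemma seg_supp x y t : compat x y -> 0 <= t <= 1 ->
  (finsupp (seg x y t) `<=` finsupp x `|` finsupp y)%fset.
Proof.
move=> xy t01; apply/fsubsetP => v; apply: contraTT.
rewrite in_fsetU negb_or => /andP[vx vy].
by rewrite memNfinsupp segE// !fsfun_dflt// !mulr0 addr0.
Qed.

Lemma seg0 x y : compat x y -> seg x y 0 = x.
Proof. by move=> xy; apply: bary_ext => v; rewrite segE ?lexx ?ler01// subr0 mul1r mul0r addr0. Qed.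

Lemma seg1 x y : compat x y -> seg x y 1 = y.
Proof. by move=> xy; apply: bary_ext => v; rewrite segE ?lexx ?ler01// subrr mul1r mul0r add0r. Qed.

Lemma segxx x t : 0 <= t <= 1 -> seg x x t = x.
Proof.
move=> t01; apply: bary_ext => v.
by rewrite segE// ?compat_sub// -mulrDl subrK mul1r.
Qed.

Lemma coord_mdist x y v : `|x v - y v| <= mdist x y.
Proof.
set U := (finsupp x `|` finsupp y)%fset.
rewrite (@mdistE U) ?fsubsetUl ?fsubsetUr//.
have [vU|] := boolP (v \in U); last first.
  by rewrite in_fsetU negb_or => /andP[vx vy]; rewrite !fsfun_dflt// subrr normr0 sqrtr_ge0.
rewrite -sqrtr_sqr ler_wsqrtr// (big_fsetD1 v vU)/= lerDl.
by apply: sumr_ge0 => *; exact: sqr_ge0.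
Qed.

Lemma mdist_le2 x y : mdist x y <= 2.
Proof.
set U := (finsupp x `|` finsupp y)%fset.
rewrite (@mdistE U) ?fsubsetUl ?fsubsetUr//.
rewrite -[leRHS]ger0_norm// -sqrtr_sqr ler_wsqrtr//.
apply: (@le_trans _ _ (\sum_(v <- U) (x v + y v))).
  apply: ler_sum => v _; have := bary_ge0 x v; have := bary_ge0 y v.
  by have := bary_le1 x v; have := bary_le1 y v; nra.
rewrite big_split/= !bary_sum ?fsubsetUl ?fsubsetUr//; nra.
Qed.

Lemma seg_mdist x y s t : compat x y -> 0 <= s <= 1 -> 0 <= t <= 1 ->
  mdist (seg x y s) (seg x y t) = `|s - t| * mdist x y.
Proof.
move=> xy s01 t01; set U := (finsupp x `|` finsupp y)%fset.
rewrite (@mdistE U) ?seg_supp// (@mdistE U x y) ?fsubsetUl ?fsubsetUr//.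
rewrite -sqrtr_sqr -sqrtrM ?sqr_ge0// mulr_sumr; congr Num.sqrt.
by apply: eq_bigr => v _; rewrite !segE//; ring.
Qed.

Lemma seg_convex x y x' y' t : compat x y -> compat x' y' -> 0 <= t <= 1 ->
  mdist (seg x y t) (seg x' y' t) <= (1 - t) * mdist x x' + t * mdist y y'.
Proof.
move=> xy xy' t01; have /andP[t0 t1] := t01.
set U := (finsupp x `|` finsupp y `|` (finsupp x' `|` finsupp y'))%fset.
have sU : (finsupp x `|` finsupp y `<=` U)%fset by exact: fsubsetUl.
have sU' : (finsupp x' `|` finsupp y' `<=` U)%fset by exact: fsubsetUr.
have xU : (finsupp x `<=` U)%fset by apply: fsubset_trans sU; exact: fsubsetUl.
have yU : (finsupp y `<=` U)%fset by apply: fsubset_trans sU; exact: fsubsetUr.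
have xU' : (finsupp x' `<=` U)%fset by apply: fsubset_trans sU'; exact: fsubsetUl.
have yU' : (finsupp y' `<=` U)%fset by apply: fsubset_trans sU'; exact: fsubsetUr.
rewrite (@mdistE U); [|exact: fsubset_trans (seg_supp xy t01) sU|exact: fsubset_trans (seg_supp xy' t01) sU'].
rewrite (@mdistE U x x')// (@mdistE U y y')//.
have -> : (1 - t) * Num.sqrt (\sum_(v <- U) (x v - x' v) ^+ 2) =
    Num.sqrt (\sum_(v <- U) ((1 - t) * (x v - x' v)) ^+ 2).
  under [in RHS]eq_bigr do rewrite exprMn.
  by rewrite -mulr_sumr sqrtrM ?sqr_ge0// sqrtr_sqr ger0_norm// subr_ge0.
have -> : t * Num.sqrt (\sum_(v <- U) (y v - y' v) ^+ 2) =
    Num.sqrt (\sum_(v <- U) (t * (y v - y' v)) ^+ 2).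
  under [in RHS]eq_bigr do rewrite exprMn.
  by rewrite -mulr_sumr sqrtrM ?sqr_ge0// sqrtr_sqr ger0_norm.
have M := Defs.minkowski U (fun v => (1 - t) * (x v - x' v)) (fun v => t * (y v - y' v)).
apply: (le_trans _ M).
rewrite le_eqVlt; apply/orP; left; apply/eqP; congr Num.sqrt; apply: eq_bigr => v _; rewrite !segE//; ring.
Qed.

Lemma mdist_lt_supp x y : (forall v, v \in finsupp x -> mdist x y < x v) ->
  (finsupp x `<=` finsupp y)%fset.
Proof.
move=> H; apply/fsubsetP => v vx; rewrite -bary_gt0.
have := le_lt_trans (coord_mdist x y v) (H v vx).
by rewrite ltr_norml => /andP[_]; rewrite ltrBlDl ltrDr.
Qed.

(** Lipschitz for the ambient Euclidean distance, which is computable in coordinates;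
    [lipc_path_dist] passes to the path metric with the same constant. *)
Definition lipc (a b L : R) c := forall s t, a <= s -> s <= t -> t <= b ->
  mdist (c s) (c t) <= L * (t - s).

Lemma lipc_le a b L L' c : L <= L' -> lipc a b L c -> lipc a b L' c.
Proof.
move=> LL H s t sa st tb; apply: le_trans (H _ _ sa st tb) _.
by rewrite ler_wpM2r// subr_ge0.
Qed.

Lemma lipc_sub a b a' b' L c : a <= a' -> b' <= b -> lipc a b L c -> lipc a' b' L c.
Proof. by move=> aa bb H s t *; apply: H; lra. Qed.

Lemma lipc_eq a b L c c' : (forall t, a <= t <= b -> c t = c' t) -> lipc a b L c -> lipc a b L c'.
Proof.
move=> E H s t as_ st tb; rewrite -!E; last 2 first.
- by rewrite (le_trans as_ st).
- by rewrite as_ (le_trans st tb).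
exact: H.
Qed.

Lemma lipc_cst a b L x : 0 <= L -> lipc a b L (fun=> x).
Proof. by move=> L0 s t *; rewrite mdistxx mulr_ge0// subr_ge0. Qed.

Lemma lipc_glue a b e L c : lipc a b L c -> lipc b e L c -> lipc a e L c.
Proof.
move=> H1 H2 s t as_ st te; have [tb|/ltW bt] := leP t b; first exact: H1.
have [bs|/ltW sb] := leP b s; first exact: H2.
apply: le_trans (mdist_triangle (c b) _ _) _.
have := H1 s b as_ sb (lexx _); have := H2 b t (lexx _) bt te; nra.
Qed.

Lemma lipcP a b L c s t : 0 <= L -> lipc a b L c -> a <= s <= b -> a <= t <= b ->
  mdist (c s) (c t) <= L * `|s - t|.
Proof.
move=> L0 H /andP[as_ sb] /andP[at_ tb]; have [st|/ltW ts] := leP s t.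
  by rewrite distrC ger0_norm ?subr_ge0//; exact: H.
by rewrite mdistC ger0_norm ?subr_ge0//; exact: H.
Qed.

(* Reparametrization by a Lipschitz function; it may reverse the direction. *)
Lemma lipc_comp a b a' b' L M c (u : R -> R) : 0 <= L -> lipc a b L c ->
  (forall s t, a' <= s -> s <= t -> t <= b' -> `|u t - u s| <= M * (t - s)) ->
  (forall t, a' <= t <= b' -> a <= u t <= b) -> lipc a' b' (L * M) (c \o u).
Proof.
move=> L0 H Hu uab s t as_ st tb /=.
have := lipcP L0 H (uab s _) (uab t _); rewrite as_ (le_trans st tb) (le_trans as_ st) tb.
move=> /(_ isT isT)/le_trans; apply; rewrite -mulrA ler_wpM2l// distrC.
exact: Hu.
Qed.

Lemma lipc_seg x y : compat x y -> lipc 0 1 (mdist x y) (seg x y).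
Proof.
move=> xy s t s0 st t1; rewrite seg_mdist//; last 2 first.
- by rewrite s0 (le_trans st t1).
- by rewrite t1 (le_trans s0 st).
by rewrite distrC ger0_norm ?subr_ge0// mulrC.
Qed.

Lemma lipc_continuous a b L c : lipc a b L c -> {within `[a, b], continuous c}.
Proof.
wlog L0 : L / 0 <= L.
  move=> H cL; apply: (H (Num.max L 0)); first by rewrite le_max lexx orbT.
  by apply: lipc_le cL; rewrite le_max lexx.
move=> H; apply/subspace_continuousP => t tab; apply/cvg_ballP => e e0.
have L1 : 0 < L + 1 by rewrite ltr_wpDl.
have d0 : 0 < e / (L + 1) by exact: divr_gt0.
rewrite near_withinE; near=> s => sab; rewrite ballEmdist/=.
have tab' : a <= t <= b by move: tab; rewrite /= in_itv.
have sab' : a <= s <= b by move: sab; rewrite /= in_itv.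
apply: le_lt_trans (lipcP L0 H tab' sab') _.
have : `|t - s| < e / (L + 1) by near: s; exact: (nbhsx_ballx t _ d0).
rewrite ltr_pdivlMr// => H1; apply: le_lt_trans H1.
by rewrite mulrC ler_wpM2l// lerDl.
Unshelve. all: by end_near.
Qed.

End Segments.

(** * The path metric and the Euclidean metric *)

Section PathMetric.
Variables (R : realType) (V : choiceType) (K : complex V).
Local Notation X := (realization R K).
Implicit Types (x y z : X) (s t L : R) (c : R -> X).

Lemma lipc_length a b L c : a <= b -> lipc a b L c ->
  (curve_length a b c <= (L * (b - a))%:E)%E.
Proof.
move=> ab H; apply: ge_ereal_sup => _ [s sP <-]; rewrite lee_fin.
have [ps /eqP ls] := sP.
have E : L * (b - a) = \sum_(0 <= i < size s) (L * nth b (a :: s) i.+1 - L * nth b (a :: s) i).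
  by rewrite telescope_sumr// (itv_partition_nth_size b sP) /= mulrBr.
rewrite E; apply: ler_sum_nat => i /andP[_ is_]; rewrite -mulrBr.
apply: H; first by apply: itv_partition_nth_ge sP; exact: ltnW.
  by have /(pathP b)/(_ i is_)/ltW := ps.
exact: itv_partition_nth_le sP.
Qed.

Lemma mdist_le_path_dist x y : ((mdist x y)%:E <= path_dist x y)%E.
Proof.
apply: le_ereal_inf_tmp => _ [c [_ <- <-] <-].
apply: ereal_sup_ubound; exists [:: 1]; first exact: itv_partition1 ltr01.
by rewrite /= big_nat1.
Qed.

(** The piece of the curve between the two times, rescaled to [0, 1], is itself an admissible
    path. *)
Lemma lipc_path_dist a b L c s t : 0 <= L -> lipc a b L c -> a <= s -> s <= t -> t <= b ->
  (path_dist (c s) (c t) <= (L * (t - s))%:E)%E.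
Proof.
move=> L0 H as_ st tb; pose u r := s + r * (t - s).
have uH r r' : 0 <= r -> r <= r' -> r' <= 1 -> `|u r' - u r| <= (t - s) * (r' - r).
  move=> r0 rr r1; rewrite /u; have -> : s + r' * (t - s) - (s + r * (t - s)) = (t - s) * (r' - r) by ring.
  by rewrite ger0_norm// mulr_ge0// subr_ge0.
have L1 : lipc 0 1 (L * (t - s)) (c \o u).
  by apply: lipc_comp L0 H uH _ => r /andP[r0 r1]; rewrite /u; apply/andP; split; nra.
apply: (@le_trans _ _ (curve_length 0 1 (c \o u))).
  apply: ereal_inf_lbound; exists (c \o u) => //; split; first exact: lipc_continuous L1.
    by rewrite /= /u mul0r addr0.
  by rewrite /= /u mul1r addrC subrK.
by apply: le_trans (lipc_length ler01 L1) _; rewrite subr0 mulr1.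
Qed.

Lemma path_dist_compat x y : compat x y -> (path_dist x y <= (mdist x y)%:E)%E.
Proof.
move=> xy; have := lipc_path_dist (mdist_ge0 x y) (lipc_seg xy) (lexx 0) ler01 (lexx 1).
by rewrite seg0// seg1// subr0 mulr1.
Qed.

Lemma positive_lower_bound (l : seq V) (f : V -> R) : (forall v, v \in l -> 0 < f v) ->
  exists2 d, 0 < d & forall v, v \in l -> d <= f v.
Proof.
elim: l => [_|v l IH H]; first by exists 1.
have [|d d0 dl] := IH; first by move=> w wl; apply: H; rewrite in_cons wl orbT.
exists (Num.min d (f v)); first by rewrite lt_min d0 H// mem_head.
move=> w; rewrite in_cons => /predU1P[->|/dl H1]; first by rewrite ge_min lexx orbT.
by rewrite ge_min H1.
Qed.

(** The finitely many positive coordinates of [x] stay positive nearby, so [x] and every nearby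
    point lie in a common simplex, where both metrics agree. *)
Lemma star_nbhs x : exists2 d, 0 < d & forall y, mdist x y < d -> (finsupp x `<=` finsupp y)%fset.
Proof.
have [v|d d0 H] := @positive_lower_bound (finsupp x) x; first by rewrite bary_gt0.
by exists d => // y yd; apply: mdist_lt_supp => v /H; exact: lt_le_trans.
Qed.

Section Isometry.
Variable f : X -> X.
Hypothesis iso : forall x y, path_dist (f x) (f y) = path_dist x y.

(** A chord is bounded by a path distance, which [f] preserves and which the curve itself bounds. *)
Lemma isometry_lipc a b L c : 0 <= L -> lipc a b L c -> lipc a b L (f \o c).
Proof.
move=> L0 H s t as_ st tb; rewrite -lee_fin.
apply: le_trans (mdist_le_path_dist _ _) _; rewrite /= iso.
exact: lipc_path_dist H as_ st tb.
Qed.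

Lemma isometry_continuous : continuous f.
Proof.
move=> x; suff B e : 0 < e -> \forall y \near nbhs x, ball (f x) e (f y).
  have FF : Filter (f @ nbhs x) by apply: fmap_filter; exact: nbhs_filter.
  by apply/(@fcvg_ballP R X (f @ nbhs x) FF (f x)) => e e0; exact: B.
move=> e0; have [d d0 H] := star_nbhs x.
have de0 : 0 < Num.min d e by rewrite lt_min d0.
near=> y; have yd : mdist x y < Num.min d e.
  by near: y; have := nbhsx_ballx x _ de0; rewrite ballEmdist.
rewrite ballEmdist /=.
move: yd; rewrite lt_min => /andP[yd ye].
rewrite -lte_fin; apply: le_lt_trans (mdist_le_path_dist _ _) _; rewrite iso.
by apply: le_lt_trans (path_dist_compat (compat_sub (H _ yd))) _; rewrite lte_fin.
Unshelve. all: by end_near.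
Qed.

End Isometry.
End PathMetric.

Section Vertices.
Variables (R : realType) (V : choiceType) (K : complex V) (x0 : realization R K).
Local Notation X := (realization R K).
Implicit Types (x y z : X) (v w : V).

(* Junk value [x0] unless [v] is a vertex. *)
Definition vert v : X := xget x0 [set z : X | forall u, z u = (u == v)%:R].

Lemma vertE v u : face K [fset v]%fset -> vert v u = (u == v)%:R.
Proof.
move=> Kv; rewrite /vert; case: xgetP => [z _ ->//|no].
have [w _|w||z zE] := @bary_exists R V K [fset v]%fset (fun u => (u == v)%:R) Kv.
- by rewrite ler0n.
- by rewrite inE => /negbTE ->.
- by rewrite big_seq_fset1 eqxx.
by case: (no z).
Qed.

Lemma vert_supp v : face K [fset v]%fset -> finsupp (vert v) = [fset v]%fset.
Proof.
by move=> Kv; apply/fsetP => u; rewrite -bary_gt0 vertE// inE; case: eqP; rewrite ?ltr01 ?ltxx.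
Qed.

Lemma face1 v (s : {fset V}) : face K s -> v \in s -> face K [fset v]%fset.
Proof.
move=> Ks vs; apply: face_sub Ks _ _; first by rewrite fsub1set.
by apply/fset0Pn; exists v; rewrite inE.
Qed.

Lemma supp_vert x v : v \in finsupp x -> (finsupp (vert v) `<=` finsupp x)%fset.
Proof. by move=> vx; rewrite vert_supp ?fsub1set//; exact: face1 (bary_face x) vx. Qed.

Lemma max_coord (U : {fset V}) x : (finsupp x `<=` U)%fset ->
  exists2 v, v \in finsupp x & (#|` U|)%:R^-1 <= x v.
Proof.
move=> xU; have [//|no] := pselect (exists2 v, v \in finsupp x & (#|` U|)%:R^-1 <= x v).
have U0 : (0 < #|` U|)%N.
  have [v /(fsubsetP xU) vU] := bary_neq0 x; rewrite cardfs_gt0.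
  by apply/fset0Pn; exists v.
have : \sum_(v <- U) x v < \sum_(v <- U) (#|` U|)%:R^-1.
  have lt v : x v < (#|` U|)%:R^-1.
    rewrite ltNge; apply/negP => H; apply: no; exists v => //.
    by rewrite -bary_gt0 (lt_le_trans _ H)// invr_gt0 ltr0n.
  move: U0; have [w wU] : exists w, w \in U.
    by have [v /(fsubsetP xU) vU] := bary_neq0 x; exists v.
  rewrite (big_fsetD1 w wU) [ltRHS](big_fsetD1 w wU)/= => _.
  by apply: ltr_leD => //; apply: ler_sum => v _; exact/ltW.
rewrite bary_sum// big_const_seq count_predT iter_addr addr0 -[X in _ *+ X]/(#|` U|).
by rewrite -[_ *+ _]mulr_natr mulVf ?ltxx// pnatr_eq0 -lt0n.
Qed.

End Vertices.

(** * Compact sets, finite subcomplexes and local finiteness *)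

Section MetricCompactness.
Variables (R : realType) (X : metricType R).

Lemma compact_net (A : set X) (r : X -> R) : compact A -> (forall a, 0 < r a) ->
  exists s : seq X, (forall z, z \in s -> A z) /\ forall a, A a -> exists2 z, z \in s & mdist z a < r z.
Proof.
move=> /compact_near_coveringP cA r0.
pose P (l : seq X) (a : X) := exists2 z, z \in l & mdist z a < r z.
(* The filter of finite subsets of [A] ordered by inclusion; the near-covering form of compactness
   then yields one finite set that serves all points. *)
pose F := [set S : set (seq X) | exists l0 : seq X, (forall z, z \in l0 -> A z) /\
  forall l : seq X, {subset l0 <= l} -> (forall z, z \in l -> A z) -> S l].
have FF : Filter F.
  split; first by exists [::].
    move=> S S' [l [lA H]] [l' [lA' H']]; exists (l ++ l'); split=> [z|m ml mA].
      by rewrite mem_cat => /orP[/lA|/lA'].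
    by split; [apply: H|apply: H'] => // z zl; apply: ml; rewrite mem_cat zl ?orbT.
  by move=> S S' SS [l [lA H]]; exists l; split=> // m ml mA; apply/SS/H.
have [|l [lA H]] := cA _ F P FF.
  move=> x Ax; exists (ball x (r x), [set l : seq X | x \in l]); first split=> /=.
  - exact: nbhsx_ballx.
  - by exists [:: x]; split=> [z|l ml _]; [rewrite inE => /eqP->|apply: ml; rewrite inE].
  by move=> [y l] [/=]; rewrite ballEmdist => xy xl; exists x.
by exists l; split=> // a Aa; apply: H.
Qed.

Lemma compact_packing (A : set X) r : compact A -> 0 < r -> exists N : nat,
  forall (I : eqType) (l : seq I) (p : I -> X), uniq l -> (forall i, i \in l -> A (p i)) ->
  (forall i j, i \in l -> j \in l -> i != j -> r <= mdist (p i) (p j)) -> (size l <= N)%N.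
Proof.
move=> cA r0; have [a|s [_ sA]] := @compact_net A (fun=> r / 2) cA; first by rewrite divr_gt0.
exists (size s) => I l p ul lA sep.
pose z i := xget (p i) [set z | z \in s /\ mdist z (p i) < r / 2].
have zP i : i \in l -> z i \in s /\ mdist (z i) (p i) < r / 2.
  move=> il; have [y ys yd] := sA _ (lA _ il).
  by rewrite /z; case: xgetP => [w -> //|/(_ y)]; case.
rewrite -(size_map z); apply: uniq_leq_size; last first.
  by move=> _ /mapP[i /zP[zs _] ->].
rewrite map_inj_in_uniq// => i j il jl zij; apply/eqP/negPn/negP => /(sep _ _ il jl).
apply/negP; rewrite -ltNge; have [_ zi] := zP _ il; have [_ zj] := zP _ jl.
have tri : mdist (p i) (p j) <= mdist (p i) (z i) + mdist (z i) (p j) := metric_triangle _ _ _.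
have sy : mdist (p i) (z i) = mdist (z i) (p i) := metric_sym _ _.
by rewrite -zij in zj; lra.
Qed.

Lemma compact_seq_limit (x : X) (q : nat -> X) :
  (forall e, 0 < e -> exists N, forall n, (N <= n)%N -> mdist x (q n) < e) ->
  compact [set y | y = x \/ exists n, y = q n].
Proof.
move=> qx F FF FA; have [xF|nF] := pselect (cluster F x); first by exists x; split=> //; left.
have [B [C [FB xC BC]]] : exists B C, [/\ F B, nbhs x C & B `&` C = set0].
  apply: contrapT => no; apply: nF => B C FB xC; apply/set0P.
  by apply: contra_notN no => /eqP E; exists B, C.
have /nbhs_ballP[e /= e0 eC] := xC; have [N qN] := qx _ e0.
have out y : B y -> ball x e y -> False.
  by move=> By /eC Cy; have : (B `&` C) y by []; rewrite BC.
have FD : F (q @` `I_N).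
  apply: filterS (filterI FB FA) => y [By [yx|[n yq]]].
    by case: (out y By); rewrite yx; exact: ballxx.
  exists n => //=; rewrite ltnNge; apply/negP => /qN xq.
  by apply: (out y By); rewrite ballEmdist yq.
have [z [[n _ <-] cz]] := finite_compact (finite_image q (finite_II N)) FF FD.
by exists (q n); split=> //; right; exists n.
Qed.

End MetricCompactness.

Lemma distinct_choice (T : choiceType) (S : nat -> set T) : (forall n, infinite_set (S n)) ->
  exists2 g : nat -> T, injective g & forall n, S n (g n).
Proof.
move=> Sinf; have ex n (l : seq T) : exists a, S n a /\ a \notin l.
  apply: contrapT => no; apply: (Sinf n); apply: (@sub_finite_set _ _ [set` l]); last exact: finite_seq.
  by move=> a Sa /=; apply: contrapT => /negP al; apply: no; exists a.
pose f n l := projT1 (cid (ex n l)).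
have fP n l : S n (f n l) /\ f n l \notin l by rewrite /f; case: cid.
pose fix pre n : seq T := if n is m.+1 then f m (pre m) :: pre m else [::].
have preS m n : (m < n)%N -> f m (pre m) \in pre n.
  elim: n => // n IH; rewrite ltnS leq_eqVlt => /predU1P[->|/IH H] /=.
    by rewrite mem_head.
  by rewrite in_cons H orbT.
exists (fun n => f n (pre n)) => [m n E|n]; last by have [] := fP n (pre n).
have [mn|nm|//] := ltngtP m n.
- by have [_] := fP n (pre n); rewrite -E preS.
- by have [_] := fP m (pre m); rewrite E preS.
Qed.

Lemma divr_nat_lt (R : realFieldType) (e : R) m : 0 < e -> e / m.+1%:R *+ m < e.
Proof.
move=> e0; rewrite -mulr_natr mulrAC ltr_pdivrMr ?ltr0n//.
by rewrite ltr_pM2l// ltr_nat.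
Qed.

Section FiniteSupport.
Variables (R : realType) (V : choiceType) (K : complex V).
Local Notation X := (realization R K).

(** An ultrafilter has a limit in each of the finitely many coordinates. The limits form a point of
    the realization, and coordinatewise convergence on [U] is Euclidean convergence. *)
Lemma compact_finite_supp (U : {fset V}) : compact [set x : X | (finsupp x `<=` U)%fset].
Proof.
rewrite compact_ultra => F FF FU.
have lim v : exists l : R, (fun x : X => x v) @ F --> l.
  have : compact (`[0, 1]%classic : set R) by exact: segment_compact.
  move=> /(_ ((fun x : X => x v) @ F) _)[].
    suff : F [set x : X | (`[0, 1]%classic : set R) (x v)] by [].
    apply: filterS FU => x _; rewrite /= in_itv /=; apply/andP.
    by split; [exact: bary_ge0|exact: bary_le1].
  move=> l [_ cl]; exists l => N Nl.
  have [//|nN] := in_ultra_setVsetC ((fun x : X => x v) @^-1` N) FF.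
  by have [z [zN /zN]] := cl (~` N) N nN Nl.
have [f fE] := choice lim.
have close e (s : seq V) : 0 < e -> \forall x \near F, forall v, v \in s -> `|f v - (x : X) v| < e.
  move=> e0; elim: s => [|v s IH]; first by apply: filterE.
  have Hv : \forall x \near F, `|f v - (x : X) v| < e.
    by have /cvgrPdist_lt/(_ e e0) := fE v.
  by apply: filterS2 IH Hv => x H1 H2 w; rewrite in_cons => /predU1P[->|/H1].
have approx e : 0 < e -> exists x : X, (finsupp x `<=` U)%fset /\ forall v, v \in U -> `|f v - x v| < e.
  by move=> e0; have [x [? ?]] := filter_ex (filterI FU (close e U e0)); exists x.
have f0 v : v \in U -> 0 <= f v.
  move=> vU; rewrite leNgt; apply/negP => fv.
  have [|x [_ /(_ v vU)]] := approx (- f v); first by rewrite oppr_gt0.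
  by have := bary_ge0 x v; rewrite ltr_norml => ? /andP[]; lra.
pose g v := if v \in U then f v else 0.
have g1 : \sum_(v <- U) g v = 1.
  apply/eqP; rewrite -subr_eq0 -normr_le0; apply/ler_addgt0Pl => e e0; rewrite addr0.
  have [|x [xU xe]] := approx (e / (#|` U|.+1)%:R); first by rewrite divr_gt0.
  rewrite -(bary_sum xU) -sumrB; apply: le_trans (ler_norm_sum _ _ _) _.
  apply: (@le_trans _ _ (\sum_(v <- U) e / (#|` U|.+1)%:R)).
    rewrite big_seq [leRHS]big_seq; apply: ler_sum => v vU.
    by rewrite /g vU; exact/ltW/xe.
  rewrite big_const_seq count_predT iter_addr addr0 -[X in _ *+ X]/(#|` U|).
  exact/ltW/divr_nat_lt.
pose s := [fset v in U | f v != 0]%fset.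
have [d d0 dP] : exists2 d, 0 < d & forall v, v \in (s : seq V) -> d <= f v.
  apply: positive_lower_bound => v; rewrite !inE => /andP[vU fv].
  by rewrite lt_def fv f0.
(* The positive limits stay positive at a nearby point, so [s] is contained in a support. *)
have sface : face K s.
  have [x [xU xe]] := approx d d0.
  have sx : (s `<=` finsupp x)%fset.
    apply/fsubsetP => v vs; rewrite -bary_gt0; have := dP v vs.
    have vU : v \in U by move: vs; rewrite !inE => /andP[].
    by have := xe v vU; rewrite ltr_norml => /andP[]; lra.
  apply: face_sub (bary_face x) sx _; apply: contra_eq_neq g1 => s0.
  rewrite big_seq big1 ?(eq_sym 0) ?oner_eq0// => v vU; rewrite /g vU.
  apply/eqP; apply: contraT => fv; have : v \in s by rewrite !inE vU fv.
  by rewrite s0 in_fset0.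
have [v vs|v vs||x xE] := @bary_exists R V K s g sface.
- by rewrite /g; case: ifP => // /f0.
- rewrite /g; case: ifP => // vU; apply/eqP; apply: contraT => fv.
  by move: vs; rewrite !inE vU fv.
- rewrite -g1; apply: big_fset_incl => [|v vU vs]; first by apply/fsubsetP => v; rewrite !inE => /andP[].
  by rewrite /g vU; apply/eqP; apply: contraT => fv; move: vs; rewrite !inE vU fv.
have xU : (finsupp x `<=` U)%fset.
  apply/fsubsetP => v; apply: contraTT => vU.
  by rewrite memNfinsupp xE /g (negbTE vU).
exists x; split=> //; apply/cvg_ballP => e e0.
have e'0 : 0 < e / (#|` U|.+1)%:R by rewrite divr_gt0.
apply: filterS2 FU (close _ U e'0) => y yU ye.
rewrite ballEmdist /= (@mdistE R V K U)//.
apply: (@le_lt_trans _ _ (\sum_(v <- U) `|x v - y v|)).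
  rewrite -[leRHS]ger0_norm ?sumr_ge0// -sqrtr_sqr ler_wsqrtr//.
  elim: (U : seq V) => [|v l IH]; first by rewrite !big_nil expr0n.
  rewrite !big_cons [leRHS]sqrrD real_normK ?num_real// -addrA lerD2l.
  by apply: le_trans IH _; rewrite lerDr mulrn_wge0// mulr_ge0// sumr_ge0.
apply: (@le_lt_trans _ _ (\sum_(v <- U) e / (#|` U|.+1)%:R)).
  rewrite big_seq [leRHS]big_seq; apply: ler_sum => v vU.
  by have := ye v vU; rewrite xE /g vU => /ltW.
rewrite big_const_seq count_predT iter_addr addr0 -[X in _ *+ X]/(#|` U|).
exact: divr_nat_lt.
Qed.

End FiniteSupport.

Section LocallyFinite.
Variables (R : realType) (V : choiceType) (K : complex V).
Local Notation X := (realization R K).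
Hypothesis locally_finite : forall v, finite_set [set w | face K [fset v; w]%fset].

Lemma star_supp v : exists U : {fset V}, forall x : X, v \in finsupp x -> (finsupp x `<=` U)%fset.
Proof.
have /finite_fsetP[U UE] := locally_finite v; exists U => x vx; apply/fsubsetP => w wx.
suff : [set w | face K [fset v; w]%fset] w by rewrite UE.
rewrite /=; apply: face_sub (bary_face x) _ _; first by rewrite fsubUset !fsub1set vx.
by apply/fset0Pn; exists v; rewrite !inE eqxx.
Qed.

(** Finitely many open stars cover [A], and each star has finitely many vertices. *)
Lemma compact_supp (A : set X) : compact A ->
  exists U : {fset V}, forall x, A x -> (finsupp x `<=` U)%fset.
Proof.
move=> cA; pose r (x : X) := sval (cid2 (star_nbhs x)).
have rP x : 0 < r x /\ forall y, mdist x y < r x -> (finsupp x `<=` finsupp y)%fset.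
  by rewrite /r; case: cid2.
have [a|s [_ H]] := compact_net (r := r) cA; first by have [] := rP a.
have [U UP] : exists U : {fset V}, forall z, z \in s -> forall y, mdist z y < r z ->
    (finsupp y `<=` U)%fset.
  elim: s {H} => [|z s [U IH]]; first by exists fset0.
  have [v vz] := bary_neq0 z; have [U' U'P] := star_supp v.
  exists (U `|` U')%fset => w; rewrite in_cons => /predU1P[->|ws] y yw.
    apply: fsubset_trans (fsubsetUr _ _); apply: U'P.
    by have [_ /(_ y yw)/fsubsetP/(_ v vz)] := rP z.
  exact: fsubset_trans (IH _ ws y yw) (fsubsetUl _ _).
by exists U => x /H[z zs zx]; apply: UP zs _ zx.
Qed.

(** A point supported in [U] has a coordinate at least 1 over the size of [U]. A closer point keeps
    this vertex, so it lies in one of finitely many finite stars, and the radius depends on [U]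
    only. *)
Lemma finite_supp_ball (U : {fset V}) : exists2 d, 0 < d & exists U1 : {fset V}, forall x y : X,
  (finsupp x `<=` U)%fset -> mdist x y < d -> (finsupp y `<=` U1)%fset.
Proof.
have [U1 U1P] : exists U1 : {fset V}, forall v, v \in (U : seq V) -> forall x : X,
    v \in finsupp x -> (finsupp x `<=` U1)%fset.
  elim: (U : seq V) => [|v s [U1 IH]]; first by exists fset0.
  have [U' U'P] := star_supp v; exists (U1 `|` U')%fset => w.
  rewrite in_cons => /predU1P[->|ws] x wx.
    exact: fsubset_trans (U'P _ wx) (fsubsetUr _ _).
  exact: fsubset_trans (IH _ ws x wx) (fsubsetUl _ _).
exists (#|` U|.+1)%:R^-1; first by rewrite invr_gt0 ltr0n.
exists U1 => x y xU xy; have [v vx vU] := max_coord xU.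
have vU' := fsubsetP xU _ vx; apply: (U1P v vU'); rewrite -bary_gt0.
have U0 : (0 < #|` U|)%N by rewrite cardfs_gt0; apply/fset0Pn; exists v.
have := le_lt_trans (coord_mdist x y v) xy; rewrite ltr_norml => /andP[_].
have : (#|` U|.+1)%:R^-1 < (#|` U|)%:R^-1 :> R by rewrite ltf_pV2 ?posrE ?ltr0n// ltr_nat.
move: (#|` U|.+1%:R^-1) (#|` U|%:R^-1) vU => a b; lra.
Qed.

End LocallyFinite.

(** * Finiteness drawn from a proper cocompact action *)

Section GeometricAction.
Variables (R : realType) (V : choiceType) (K : complex V) (G : groupType).
Local Notation X := (realization R K).
Variable act : G -> X -> X.
Hypothesis act1 : forall x, act 1%g x = x.
Hypothesis actM : forall g h x, act (g * h)%g x = act g (act h x).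
Hypothesis act_iso : forall g x y, path_dist (act g x) (act g y) = path_dist x y.
Hypothesis act_proper : forall A : set X, compact A -> finite_set [set g | (act g @` A) `&` A !=set0].
Variable C : set X.
Hypothesis Ccompact : compact C.
Hypothesis Ccover : \bigcup_g (act g @` C) = setT.

Lemma actK g x : act g^-1%g (act g x) = x.
Proof. by rewrite -actM mulVg act1. Qed.

Lemma actVK g x : act g (act g^-1%g x) = x.
Proof. by rewrite -actM mulgV act1. Qed.

Lemma act_cover x : exists g, C (act g^-1%g x).
Proof.
have : (\bigcup_g (act g @` C)) x by rewrite Ccover.
by case=> g _ [y Cy <-]; exists g; rewrite actK.
Qed.

Lemma act_compact g (A : set X) : compact A -> compact (act g @` A).
Proof.
by move=> cA; apply: continuous_compact => //; apply: continuous_subspaceT; exact/isometry_continuous/act_iso.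
Qed.

Lemma finite_translates (A : set X) : compact A -> finite_set [set g | exists2 x, A x & C (act g^-1%g x)].
Proof.
move=> cA; apply: sub_finite_set (act_proper (compactU Ccompact cA)) => g [x Ax Cx].
exists x; split; last by right.
by exists (act g^-1%g x); [left|rewrite actVK].
Qed.

(** Otherwise infinitely many translates of [C] would meet a sequence converging to [x]; the
    sequence with its limit is compact, against properness. *)
Lemma locally_finite_translates x : exists2 d, 0 < d &
  finite_set [set g | exists2 y, mdist x y < d & C (act g^-1%g y)].
Proof.
apply: contrapT => no.
have Sinf n : infinite_set [set g | exists2 y, mdist x y < n.+1%:R^-1 & C (act g^-1%g y)].
  by move=> fin; apply: no; exists n.+1%:R^-1 => //; rewrite invr_gt0.
have [g ginj gP] := distinct_choice Sinf.
have /choice[q qP] : forall n, exists y, mdist x y < n.+1%:R^-1 /\ C (act (g n)^-1%g y).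
  by move=> n; have [y ? ?] := gP n; exists y.
have cA : compact [set y | y = x \/ exists n, y = q n].
  apply: compact_seq_limit => e e0; exists (Num.truncn e^-1) => n nN.
  have [H _] := qP n; apply: lt_trans H _.
  rewrite -[ltRHS]invrK ltf_pV2 ?posrE ?invr_gt0 ?ltr0n//.
  apply: lt_le_trans (truncnS_gt e^-1) _.
  by rewrite ler_nat ltnS.
have fin := finite_translates cA.
apply: infinite_nat; apply: sub_finite_set (finite_preimage (in2W ginj) fin) => n _.
by have [_ H] := qP n; exists (q n) => //; right; exists n.
Qed.

(** Points on the edges at [v], at a fixed small parameter [t], lie in finitely many translates of
    [C], a compact set, but are pairwise at distance at least [t]. *)
Lemma geometric_locally_finite v : finite_set [set w | face K [fset v; w]%fset].
Proof.
have [Kv|nK] := boolP (face K [fset v]%fset); last first.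
  apply: (@sub_finite_set _ _ set0) => // w /= vw; apply: (negP nK).
  by apply: face1 vw _; rewrite !inE eqxx.
have [x0 _] : exists x : X, forall u, x u = (u == v)%:R.
  apply: (bary_exists Kv) => [u _|u|]; first exact: ler0n.
    by rewrite inE => /negbTE ->.
  by rewrite big_seq_fset1 eqxx.
have [d d0 fin] := locally_finite_translates (vert x0 v).
pose t := Num.min 1 (d / 4).
have t01 : 0 <= t <= 1 by rewrite ge_min lexx le_min ler01 divr_ge0// ltW.
have t0 : 0 < t by rewrite lt_min ltr01 divr_gt0.
pose p w := seg (vert x0 v) (vert x0 w) t.
have face_v w : face K [fset v; w]%fset -> face K [fset w]%fset.
  by move=> vw; apply: face1 vw _; rewrite !inE eqxx orbT.
have cvw w : face K [fset v; w]%fset -> compat (vert x0 v) (vert x0 w).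
  by move=> vw; apply: (compat_face vw); rewrite vert_supp ?fsub1set ?inE ?eqxx ?orbT//; exact: face_v.
have pv w : face K [fset v; w]%fset -> mdist (vert x0 v) (p w) < d.
  move=> vw; rewrite -{1}(seg0 (cvw w vw)) seg_mdist ?lexx ?ler01//; last exact: cvw.
  rewrite sub0r normrN ger0_norm ?ltW//.
  have := mdist_le2 (vert x0 v) (vert x0 w); have : t <= d / 4 by rewrite ge_min lexx orbT.
  by have := mdist_ge0 (vert x0 v) (vert x0 w); nra.
have cB : compact (\bigcup_(g in [set g | exists2 y, mdist (vert x0 v) y < d & C (act g^-1%g y)]) (act g @` C)).
  have /finite_fsetP[D ->] := fin.
  rewrite bigcup_fset; apply: bigsetU_compact => g _; exact: act_compact.
have pB w : face K [fset v; w]%fset ->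
    (\bigcup_(g in [set g | exists2 y, mdist (vert x0 v) y < d & C (act g^-1%g y)]) (act g @` C)) (p w).
  move=> vw; have [g Cg] := act_cover (p w).
  exists g; first by exists (p w) => //; exact: pv.
  by exists (act g^-1%g (p w)) => //; rewrite actVK.
have [N NP] := compact_packing cB t0.
(* The set may contain [v] itself, which is not separated in this way; after its removal more than
   [N] vertices remain. *)
apply: contrapT => inf; have [D DS ND] := infinite_set_fset N.+2 inf.
have := NP _ (D `\ v)%fset p (fset_uniq _); apply/not_implyP; split.
  by move=> w; rewrite !inE => /andP[_ /DS]; exact: pB.
move=> /(_ _)/wrap[]; last first.
  apply/negP; rewrite -ltnNge; apply: (@leq_trans (#|` D|.-1)).
    by rewrite -ltnS; apply: leq_trans ND _; exact: leqSpred.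
  by rewrite (cardfsD1 v D); case: (v \in D); rewrite ?add1n ?add0n /= ?leq_pred.
move=> w w'; rewrite !inE => /andP[wv /DS vw] /andP[wv' /DS vw'] ww.
apply: le_trans (coord_mdist _ _ w).
rewrite !segE ?cvw// !vertE// ?face_v// (negbTE wv) eqxx (negbTE ww) !mulr0 !mulr1 add0r addr0 subr0.
by rewrite ger0_norm// ltW.
Qed.

Let lf := geometric_locally_finite.

(** By cocompactness a step of length [d / 2] from anywhere has a controlled support: move the start
    into [C], take the step there, and move back with one of finitely many group elements. Then
    induct on the number of steps. *)
Lemma reach_supp (U0 : {fset V}) (B : R) : 0 <= B -> exists U : {fset V}, forall c : R -> X,
  lipc 0 1 B c -> (finsupp (c 0) `<=` U0)%fset -> forall t, 0 <= t <= 1 -> (finsupp (c t) `<=` U)%fset.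
Proof.
move=> B0; have [UC UCP] := compact_supp lf Ccompact.
have [d d0 [U1 U1P]] := finite_supp_ball R lf UC.
suff H k : exists U : {fset V}, forall c : R -> X, lipc 0 1 B c -> (finsupp (c 0) `<=` U0)%fset ->
    forall t, 0 <= t <= 1 -> B * t <= k%:R * (d / 2) -> (finsupp (c t) `<=` U)%fset.
  have [U UP] := H (Num.truncn (B / (d / 2))).+1.
  exists U => c cL c0 t t01; apply: UP => //.
  have := ltW (truncnS_gt (B / (d / 2))); rewrite ler_pdivrMr ?divr_gt0//.
  by apply: le_trans; have /andP[] := t01; nra.
elim: k => [|k [U IH]].
  exists U0 => c cL c0 t /andP[t0 t1]; rewrite mul0r => Bt.
  suff <- : c 0 = c t by [].
  apply: mdist_positivity; apply/le_anti; rewrite mdist_ge0 andbT.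
  by apply: le_trans (cL 0 t (lexx _) t0 t1) _; rewrite subr0.
have cU := @compact_finite_supp R V K U.
have cU1 := @compact_finite_supp R V K U1.
have /finite_fsetP[D DE] := finite_translates cU.
have [W WP] : exists W : {fset V}, forall g, g \in (D : seq G) -> forall y : X,
    (finsupp y `<=` U1)%fset -> (finsupp (act g y) `<=` W)%fset.
  elim: (D : seq G) => [|g s [W IH']]; first by exists fset0.
  have [W' W'P] := compact_supp lf (act_compact (g := g) cU1).
  exists (W `|` W')%fset => h; rewrite in_cons => /predU1P[->|hs] y yU.
    by apply: fsubset_trans (fsubsetUr _ _); apply: W'P; exists y.
  exact: fsubset_trans (IH' _ hs y yU) (fsubsetUl _ _).
exists (U `|` W)%fset => c cL c0 t t01; have /andP[t0 t1] := t01 => Bt.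
have [tk|tk] := leP (B * t) (k%:R * (d / 2)).
  exact: fsubset_trans (IH c cL c0 t t01 tk) (fsubsetUl _ _).
apply: fsubset_trans (fsubsetUr _ _).
have Bp : 0 < B.
  rewrite lt_neqAle B0 andbT; apply: contraTneq tk => <-.
  by rewrite mul0r -leNgt mulr_ge0// divr_ge0// ltW.
pose t' := k%:R * (d / 2) / B.
have Bt' : B * t' = k%:R * (d / 2) by rewrite /t' mulrC divfK ?gt_eqF.
have t'0 : 0 <= t' by rewrite /t' !mulr_ge0// ?invr_ge0 ltW.
have t't : t' <= t by rewrite -(ler_pM2l Bp) Bt' ltW.
have t'1 : 0 <= t' <= 1 by rewrite t'0 (le_trans t't).
have U't' := IH c cL c0 t' t'1; rewrite Bt' lexx in U't'.
have [g Cg] := act_cover (c t').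
have gD : g \in D.
  suff : [set` D] g by [].
  by rewrite -DE; exists (c t') => //; exact: U't'.
rewrite -(actVK g (c t)); apply: WP => //.
apply: U1P (UCP _ Cg) _.
have gL := isometry_lipc (act_iso g^-1%g) B0 cL.
apply: le_lt_trans (gL _ _ t'0 t't t1) _.
by rewrite mulrBr Bt'; move: Bt; rewrite -natr1; lra.
Qed.

End GeometricAction.

(** * Lipschitz homotopies of paths *)

Section Squares.
Variables (R : realType) (V : choiceType) (K : complex V).
Local Notation X := (realization R K).
Implicit Types (g : R -> R -> X) (x y e : R).

Definition xlip g x0 x1 y0 y1 a := forall y, y0 <= y <= y1 -> lipc x0 x1 a (fun x => g x y).
Definition ylip g x0 x1 y0 y1 a := forall x, x0 <= x <= x1 -> lipc y0 y1 a (g x).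

Definition xconst g x y := exists2 e, 0 < e &
  (forall t, x <= t <= x + e -> g t y = g x y) \/ (forall t, x - e <= t <= x -> g t y = g x y).

(* Near such a point the partial derivatives of g are parallel: one of them
   vanishes, or both are multiples of the derivative of the same curve P. *)
Definition flat_at g x y := xconst g x y \/ xconst (fun x y => g y x) y x \/
  exists (P : R -> X) (a b e : R), 0 < e /\ forall t, `|t| <= e ->
    g (x + t) y = P (a * t) /\ g x (y + t) = P (b * t).

(** A certificate of area at most [A]. Gluing, swapping and affine changes of variable act on
    certificates syntactically, and measure theory enters once, in [cert_majorant]. *)
Inductive cert g : R -> R -> R -> R -> R -> Prop :=
| cert_box x0 x1 y0 y1 a b A of 0 <= a & 0 <= b & xlip g x0 x1 y0 y1 a & ylip g x0 x1 y0 y1 b &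
    a * b * ((x1 - x0) * (y1 - y0)) <= A : cert g x0 x1 y0 y1 A
| cert_flat x0 x1 y0 y1 A of (forall x y, x0 < x < x1 -> y0 < y < y1 -> flat_at g x y) & 0 <= A :
    cert g x0 x1 y0 y1 A
| cert_hsplit x0 x1 x2 y0 y1 A B of x0 <= x1 & x1 <= x2 & cert g x0 x1 y0 y1 A &
    cert g x1 x2 y0 y1 B : cert g x0 x2 y0 y1 (A + B)
| cert_vsplit x0 x1 y0 y1 y2 A B of y0 <= y1 & y1 <= y2 & cert g x0 x1 y0 y1 A &
    cert g x0 x1 y1 y2 B : cert g x0 x1 y0 y2 (A + B).

Lemma flat_swap g x y : flat_at g x y -> flat_at (fun x y => g y x) y x.
Proof.
move=> [H|[H|[P [a [b [e [e0 H]]]]]]]; [by right; left|by left|right; right].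
by exists P, b, a, e; split=> // t /H[].
Qed.

Lemma cert_swap g x0 x1 y0 y1 A : cert g x0 x1 y0 y1 A -> cert (fun x y => g y x) y0 y1 x0 x1 A.
Proof.
elim=> {x0 x1 y0 y1 A} [x0 x1 y0 y1 a b A a0 b0 xl yl le|x0 x1 y0 y1 A H A0|x0 x1 x2 y0 y1 A B h1 h2 _ IA _ IB|x0 x1 y0 y1 y2 A B h1 h2 _ IA _ IB].
- by apply: (@cert_box _ _ _ _ _ b a) => //; rewrite (mulrC b) (mulrC (y1 - y0)).
- by apply: cert_flat => // x y xx yy; apply: flat_swap; exact: H.
- exact: cert_vsplit h1 h2 IA IB.
- exact: cert_hsplit h1 h2 IA IB.
Qed.

Lemma cert_le g x0 x1 y0 y1 A B : A <= B -> cert g x0 x1 y0 y1 A -> cert g x0 x1 y0 y1 B.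
Proof.
move=> AB H; elim: H B AB => {x0 x1 y0 y1 A} [x0 x1 y0 y1 a b A a0 b0 xl yl le|x0 x1 y0 y1 A H A0|x0 x1 x2 y0 y1 A B h1 h2 cA IA cB IB|x0 x1 y0 y1 y2 A B h1 h2 cA IA cB IB] D AD.
- by apply: (@cert_box _ _ _ _ _ a b) => //; exact: le_trans AD.
- by apply: cert_flat => //; exact: le_trans AD.
- rewrite -(subrK B D) ; apply: (cert_hsplit h1 h2) => //; apply: IA; lra.
- rewrite -(subrK B D) ; apply: (cert_vsplit h1 h2) => //; apply: IA; lra.
Qed.

Lemma xconst_eq g g' x0 x1 x y : x0 < x < x1 -> (forall t, x0 <= t <= x1 -> g t y = g' t y) ->
  xconst g x y -> xconst g' x y.
Proof.
move=> /andP[x0x xx1] E [e e0 H].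
exists (Num.min e (Num.min (x - x0) (x1 - x))); first by rewrite !lt_min e0 !subr_gt0 x0x.
have eE : let m := Num.min e (Num.min (x - x0) (x1 - x)) in m <= e /\ m <= x - x0 /\ m <= x1 - x.
  by rewrite /=; split; rewrite !ge_min ?lexx ?orbT.
move: eE => /=; set m := Num.min _ _ => -[me [m0 m1]].
by case: H => H; [left|right] => t /andP[t1 t2]; rewrite -!E ?H//; apply/andP; split; lra.
Qed.

Lemma flat_eq g g' x0 x1 y0 y1 x y : x0 < x < x1 -> y0 < y < y1 ->
  (forall x y, x0 <= x <= x1 -> y0 <= y <= y1 -> g x y = g' x y) -> flat_at g x y -> flat_at g' x y.
Proof.
move=> xx yy E [H|[H|[P [a [b [e [e0 H]]]]]]].
- left; apply: xconst_eq xx _ H => t tt; apply: E => //.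
  by have /andP[/ltW-> /ltW->] := yy.
- right; left; apply: xconst_eq yy _ H => t tt; apply: E => //.
  by have /andP[/ltW-> /ltW->] := xx.
- right; right; move: (xx) (yy) => /andP[x0x xx1] /andP[y0y yy1].
  exists P, a, b, (Num.min e (Num.min (Num.min (x - x0) (x1 - x)) (Num.min (y - y0) (y1 - y)))).
  split; first by rewrite !lt_min e0 !subr_gt0 x0x xx1 y0y yy1.
  move=> t; rewrite !le_min ler_norml => /andP[te /andP[/andP[] + + /andP[]]].
  rewrite !ler_norml => /andP[? ?] /andP[? ?] /andP[? ?] /andP[? ?].
  have [|E1 E2] := H t; first by rewrite ler_norml.
  by rewrite -!E ?E1 ?E2//; apply/andP; split; lra.
Qed.

Lemma cert_eq g g' x0 x1 y0 y1 A : (forall x y, x0 <= x <= x1 -> y0 <= y <= y1 -> g x y = g' x y) ->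
  cert g x0 x1 y0 y1 A -> cert g' x0 x1 y0 y1 A.
Proof.
move=> + H; elim: H => {x0 x1 y0 y1 A} [x0 x1 y0 y1 a b A a0 b0 xl yl le|x0 x1 y0 y1 A H A0|x0 x1 x2 y0 y1 A B h1 h2 cA IA cB IB|x0 x1 y0 y1 y2 A B h1 h2 cA IA cB IB] E.
- apply: (@cert_box _ _ _ _ _ a b) => // [y yy|x xx].
    by apply: lipc_eq (xl y yy) => x xx; exact: E.
  by apply: lipc_eq (yl x xx) => y yy; exact: E.
- apply: cert_flat => // x y xx yy; exact: flat_eq xx yy E (H x y xx yy).
- apply: (cert_hsplit h1 h2); [apply: IA|apply: IB] => x y /andP[? ?] ?; apply: E => //; lra.
- apply: (cert_vsplit h1 h2); [apply: IA|apply: IB] => x y ? /andP[? ?]; apply: E => //; lra.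
Qed.

(** The one property of the action on which homotopies depend. *)
Definition preserves_lip (f : X -> X) := forall a b L (c : R -> X),
  0 <= L -> lipc a b L c -> lipc a b L (f \o c).

Lemma cert_comp g (f : X -> X) x0 x1 y0 y1 A :
  preserves_lip f ->
  cert g x0 x1 y0 y1 A -> cert (fun x y => f (g x y)) x0 x1 y0 y1 A.
Proof.
move=> fL; elim=> {x0 x1 y0 y1 A} [x0 x1 y0 y1 a b A a0 b0 xl yl le|x0 x1 y0 y1 A H A0|x0 x1 x2 y0 y1 A B h1 h2 cA IA cB IB|x0 x1 y0 y1 y2 A B h1 h2 cA IA cB IB].
- apply: (@cert_box _ _ _ _ _ a b) => // [y yy|x xx].
    by apply: (fL _ _ _ (fun x => g x y)) => //; exact: xl.
  by apply: (fL _ _ _ (g x)) => //; exact: yl.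
- apply: cert_flat => // x y xx yy; case: (H x y xx yy) => [[e e0 H']|[[e e0 H']|[P [a [b [e [e0 H']]]]]]].
  + by left; exists e => //; case: H' => H'; [left|right] => t /H' ->.
  + by right; left; exists e => //; case: H' => H'; [left|right] => t /H' ->.
  + by right; right; exists (f \o P), a, b, e; split=> // t /H'[-> ->].
- exact: cert_hsplit h1 h2 IA IB.
- exact: cert_vsplit h1 h2 IA IB.
Qed.

Lemma lipc_aff a b L m q (c : R -> X) : 0 < m -> lipc (m * a + q) (m * b + q) L c ->
  lipc a b (L * m) (fun t => c (m * t + q)).
Proof.
move=> m0 H s t as_ st tb; have -> : L * m * (t - s) = L * (m * t + q - (m * s + q)) by ring.
by apply: H; rewrite lerD2r ler_pM2l.
Qed.

Lemma cert_xaff g m q x0 x1 y0 y1 A : 0 < m -> cert g (m * x0 + q) (m * x1 + q) y0 y1 A ->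
  cert (fun x => g (m * x + q)) x0 x1 y0 y1 A.
Proof.
move=> m0; move EX0: (m * x0 + q) => X0; move EX1: (m * x1 + q) => X1 H.
elim: H x0 x1 EX0 EX1 => {X0 X1 y0 y1 A} [X0 X1 y0 y1 a b A a0 b0 xl yl le|X0 X1 y0 y1 A H A0|X0 X1 X2 y0 y1 A B h1 h2 cA IA cB IB|X0 X1 y0 y1 y2 A B h1 h2 cA IA cB IB] x0 x1 E0 E1.
- subst X0 X1; apply: (@cert_box _ _ _ _ _ (a * m) b) => //; first by rewrite mulr_ge0// ltW.
  + by move=> y yy; apply: (@lipc_aff _ _ _ _ _ (fun x => g x y)) => //; exact: xl.
  + move=> x /andP[xx0 xx1]; apply: yl; rewrite !lerD2r !ler_pM2l//; exact/andP.
  + by apply: le_trans le; rewrite le_eqVlt; apply/orP; left; apply/eqP; ring.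
- subst X0 X1; apply: cert_flat => // x y xx yy.
  have XX : m * x0 + q < m * x + q < m * x1 + q by rewrite !ltrD2r !ltr_pM2l.
  case: (H _ _ XX yy) => [[e e0 H']|[[e e0 H']|[P [a [b [e [e0 H']]]]]]].
  + left; exists (e / m); first by rewrite divr_gt0.
    have em : m * (e / m) = e by rewrite mulrC divfK ?gt_eqF.
    by case: H' => H'; [left|right] => t /andP[t1 t2]; apply: H'; apply/andP; split; nra.
  + by right; left; exists e.
  + right; right; exists P, (a * m), b, (Num.min e (e / m)); split; first by rewrite lt_min e0 divr_gt0.
    move=> t; rewrite le_min => /andP[te tem].
    have [_ ->] := H' t te; split=> //.
    have -> : m * (x + t) + q = m * x + q + m * t by ring.
    have -> : a * m * t = a * (m * t) by ring.
    by have [|-> _] := H' (m * t); first by rewrite normrM (gtr0_norm m0) mulrC -ler_pdivlMr.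
- have E : m * ((X1 - q) / m) + q = X1 by rewrite mulrC divfK ?gt_eqF// subrK.
  apply: (@cert_hsplit _ _ ((X1 - q) / m)); [| |exact: IA|exact: IB].
  + by rewrite -(ler_pM2l m0) -(lerD2r q) E E0.
  + by rewrite -(ler_pM2l m0) -(lerD2r q) E E1.
- by apply: (cert_vsplit h1 h2); [exact: IA|exact: IB].
Qed.

Lemma lipc_opp a b L (c : R -> X) : lipc (- b) (- a) L c -> lipc a b L (fun t => c (- t)).
Proof.
move=> H s t as_ st tb; rewrite mdistC; have -> : t - s = - s - - t by ring.
by apply: H; rewrite lerN2.
Qed.

Lemma cert_xopp g x0 x1 y0 y1 A : cert g (- x1) (- x0) y0 y1 A ->
  cert (fun x => g (- x)) x0 x1 y0 y1 A.
Proof.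
move EX0: (- x0) => X0; move EX1: (- x1) => X1 H.
elim: H x0 x1 EX0 EX1 => {X0 X1 y0 y1 A} [X1 X0 y0 y1 a b A a0 b0 xl yl le|X1 X0 y0 y1 A H A0|X2 X1 X0 y0 y1 A B h1 h2 cA IA cB IB|X1 X0 y0 y1 y2 A B h1 h2 cA IA cB IB] x0 x1 E0 E1.
- subst X0 X1; apply: (@cert_box _ _ _ _ _ a b) => //.
  + by move=> y yy; apply: (@lipc_opp _ _ _ (fun x => g x y)); exact: xl.
  + by move=> x /andP[xx0 xx1]; apply: yl; rewrite !lerN2 xx0 xx1.
  + by have -> : x1 - x0 = - x0 - - x1 by ring.
- subst X0 X1; apply: cert_flat => // x y /andP[xx0 xx1] yy.
  have XX : - x1 < - x < - x0 by rewrite !ltrN2 xx0 xx1.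
  case: (H _ _ XX yy) => [[e e0 H']|[[e e0 H']|[P [a [b [e [e0 H']]]]]]].
  + by left; exists e => //; case: H' => H'; [right|left] => t /andP[t1 t2]; apply: H'; apply/andP; split; lra.
  + by right; left; exists e.
  + right; right; exists P, (- a), b, e; split=> // t te; have [_ ->] := H' t te; split=> //.
    have -> : - (x + t) = - x + - t by ring.
    have -> : - a * t = a * - t by ring.
    by have [|-> _] := H' (- t); first by rewrite normrN.
- rewrite addrC; apply: (@cert_hsplit _ _ (- X1)).
  + by move: h2; rewrite -E0; lra.
  + by move: h1; rewrite -E1; lra.
  + by apply: IB; rewrite ?opprK.
  + by apply: IA; rewrite ?opprK.
- by apply: (cert_vsplit h1 h2); [exact: IA|exact: IB].
Qed.

(** A Lipschitz square with bottom, top, left and right sides [b], [t], [l], [r]. Its Lipschitz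
    constant is forgotten: a filling needs some constant, and only [A] is tracked. *)
Definition sq A x0 x1 y0 y1 (b t l r : R -> X) := exists (g : R -> R -> X) (L : R),
  [/\ 0 <= L /\ xlip g x0 x1 y0 y1 L /\ ylip g x0 x1 y0 y1 L, cert g x0 x1 y0 y1 A,
   forall x, x0 <= x <= x1 -> g x y0 = b x /\ g x y1 = t x &
   forall y, y0 <= y <= y1 -> g x0 y = l y /\ g x1 y = r y].

Lemma sq_ext A x0 x1 y0 y1 b t l r b' t' l' r' :
  (forall x, x0 <= x <= x1 -> b x = b' x /\ t x = t' x) ->
  (forall y, y0 <= y <= y1 -> l y = l' y /\ r y = r' y) ->
  sq A x0 x1 y0 y1 b t l r -> sq A x0 x1 y0 y1 b' t' l' r'.
Proof.
move=> E1 E2 [g [L [Lg cg H1 H2]]]; exists g, L; split=> // [x xx|y yy].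
  by have [<- <-] := E1 x xx; exact: H1.
by have [<- <-] := E2 y yy; exact: H2.
Qed.

Lemma sq_le A B x0 x1 y0 y1 b t l r : A <= B -> sq A x0 x1 y0 y1 b t l r -> sq B x0 x1 y0 y1 b t l r.
Proof. by move=> AB [g [L [? cg ? ?]]]; exists g, L; split=> //; exact: cert_le cg. Qed.

Lemma sq_swap A x0 x1 y0 y1 b t l r : sq A x0 x1 y0 y1 b t l r -> sq A y0 y1 x0 x1 l r b t.
Proof.
by move=> [g [L [[? [? ?]] cg ? ?]]]; exists (fun x y => g y x), L; split=> //; exact: cert_swap.
Qed.

Lemma sq_comp A (f : X -> X) x0 x1 y0 y1 b t l r :
  preserves_lip f ->
  sq A x0 x1 y0 y1 b t l r -> sq A x0 x1 y0 y1 (f \o b) (f \o t) (f \o l) (f \o r).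
Proof.
move=> fL [g [L [[L0 [xl yl]] cg H1 H2]]]; exists (fun x y => f (g x y)), L; split.
- split=> //; split=> [y yy|x xx]; first by apply: (fL _ _ _ (fun x => g x y)) => //; exact: xl.
  by apply: (fL _ _ _ (g x)) => //; exact: yl.
- exact: cert_comp.
- by move=> x /H1[-> ->].
- by move=> y /H2[-> ->].
Qed.

Lemma sq_hglue A B x0 x1 x2 y0 y1 b t l m r : x0 <= x1 -> x1 <= x2 ->
  sq A x0 x1 y0 y1 b t l m -> sq B x1 x2 y0 y1 b t m r -> sq (A + B) x0 x2 y0 y1 b t l r.
Proof.
move=> x01 x12 [g [L [[L0 [xl yl]] cg H1 H2]]] [g' [L' [[L0' [xl' yl']] cg' H1' H2']]].
pose h x y := if x <= x1 then g x y else g' x y.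
pose M := Num.max L L'.
have hg x y : x0 <= x <= x1 -> h x y = g x y by rewrite /h => /andP[_ ->].
have hg' x y : y0 <= y <= y1 -> x1 <= x <= x2 -> h x y = g' x y.
  move=> yy /andP[xx xx2]; rewrite /h; case: ifPn => // xx1.
  have -> : x = x1 by apply/eqP; rewrite eq_le xx xx1.
  by have [_ ->] := H2 y yy; have [-> _] := H2' y yy.
have M0 : 0 <= M by rewrite le_max L0.
have LM : L <= M by rewrite le_max lexx.
have LM' : L' <= M by rewrite le_max lexx orbT.
exists h, M; split.
- split=> //; split=> [y yy|x /andP[xx0 xx2]].
    apply: (@lipc_glue _ _ _ _ x1).
      by apply: lipc_eq (lipc_le LM (xl y yy)) => x xx; rewrite hg.
    by apply: lipc_eq (lipc_le LM' (xl' y yy)) => x xx; rewrite hg'.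
  have [xx|/ltW xx] := leP x x1.
    have xx' : x0 <= x <= x1 by rewrite xx0.
    by apply: lipc_eq (lipc_le LM (yl x xx')) => y yy; rewrite hg.
  have xx' : x1 <= x <= x2 by rewrite xx.
  by apply: lipc_eq (lipc_le LM' (yl' x xx')) => y yy; rewrite hg'.
- apply: (cert_hsplit x01 x12).
    by apply: cert_eq cg => x y xx yy; rewrite hg.
  by apply: cert_eq cg' => x y xx yy; rewrite hg'.
- move=> x /andP[xx0 xx2]; rewrite /h; case: ifPn => xx.
    by apply: H1; rewrite xx0.
  by apply: H1'; rewrite xx2 ltW// ltNge.
- move=> y yy; split; first by rewrite hg ?lexx//; have [] := H2 y yy.
  by rewrite hg' ?x12 ?lexx//; have [] := H2' y yy.
Qed.

Lemma sq_vglue A B x0 x1 y0 y1 y2 b m t l r : y0 <= y1 -> y1 <= y2 ->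
  sq A x0 x1 y0 y1 b m l r -> sq B x0 x1 y1 y2 m t l r -> sq (A + B) x0 x1 y0 y2 b t l r.
Proof. by move=> h1 h2 /sq_swap H1 /sq_swap H2; apply/sq_swap; exact: sq_hglue h1 h2 H1 H2. Qed.

Lemma sq_xaff A m q x0 x1 y0 y1 b t l r : 0 < m -> sq A (m * x0 + q) (m * x1 + q) y0 y1 b t l r ->
  sq A x0 x1 y0 y1 (fun x => b (m * x + q)) (fun x => t (m * x + q)) l r.
Proof.
move=> m0 [g [L [[L0 [xl yl]] cg H1 H2]]].
have rg x : x0 <= x <= x1 -> m * x0 + q <= m * x + q <= m * x1 + q by rewrite !lerD2r !ler_pM2l.
exists (fun x => g (m * x + q)), (Num.max L (L * m)); split.
- split; first by rewrite le_max L0.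
  split=> [y yy|x /rg xx].
    apply: lipc_le (@lipc_aff _ _ _ _ _ (fun x => g x y) m0 (xl y yy)).
    by rewrite le_max lexx orbT.
  by apply: lipc_le (yl _ xx); rewrite le_max lexx.
- exact: cert_xaff.
- by move=> x /rg/H1.
- by move=> y /H2.
Qed.

Lemma sq_xopp A x0 x1 y0 y1 b t l r : sq A (- x1) (- x0) y0 y1 b t l r ->
  sq A x0 x1 y0 y1 (fun x => b (- x)) (fun x => t (- x)) r l.
Proof.
move=> [g [L [[L0 [xl yl]] cg H1 H2]]].
have rg x : x0 <= x <= x1 -> - x1 <= - x <= - x0 by rewrite !lerN2 andbC.
exists (fun x => g (- x)), L; split.
- split=> //; split=> [y yy|x /rg xx]; last exact: yl.
  by apply: (@lipc_opp _ _ _ (fun x => g x y)); exact: xl.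
- exact: cert_xopp.
- by move=> x /rg/H1.
- by move=> y /H2[].
Qed.

Lemma sq_yaff A m q x0 x1 y0 y1 b t l r : 0 < m -> sq A x0 x1 (m * y0 + q) (m * y1 + q) b t l r ->
  sq A x0 x1 y0 y1 b t (fun x => l (m * x + q)) (fun x => r (m * x + q)).
Proof. by move=> m0 /sq_swap H; apply/sq_swap; exact: sq_xaff. Qed.

Lemma sq_yopp A x0 x1 y0 y1 b t l r : sq A x0 x1 (- y1) (- y0) b t l r ->
  sq A x0 x1 y0 y1 t b (fun x => l (- x)) (fun x => r (- x)).
Proof. by move=> /sq_swap H; apply/sq_swap; exact: sq_xopp. Qed.

End Squares.

(** * Homotopies relative to the endpoints *)

Section Homotopies.
Variables (R : realType) (V : choiceType) (K : complex V).
Local Notation X := (realization R K).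
Implicit Types (p q r : R -> X) (P : R -> X) (x A B : R).

Definition lhom x0 x1 A p q := sq A x0 x1 0 1 p q (fun=> p x0) (fun=> p x1).

Lemma lhom_ends x0 x1 A p q : x0 <= x1 -> lhom x0 x1 A p q -> p x0 = q x0 /\ p x1 = q x1.
Proof.
move=> x01 [g [L [_ _ H1 H2]]].
have [_ <-] := H1 x0 (introT andP (conj (lexx _) x01)).
have [_ <-] := H1 x1 (introT andP (conj x01 (lexx _))).
by have [-> ->] := H2 1 (introT andP (conj ler01 (lexx _))).
Qed.

Lemma lhom_ext x0 x1 A p q p' q' : x0 <= x1 -> (forall x, x0 <= x <= x1 -> p x = p' x) ->
  (forall x, x0 <= x <= x1 -> q x = q' x) -> lhom x0 x1 A p q -> lhom x0 x1 A p' q'.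
Proof.
move=> x01 E E'; apply: sq_ext => [x xx|y _]; first by rewrite E ?E'.
by rewrite !E ?lexx ?x01.
Qed.

Lemma lhom_le x0 x1 A B p q : A <= B -> lhom x0 x1 A p q -> lhom x0 x1 B p q.
Proof. exact: sq_le. Qed.

Lemma lhom_comp (f : X -> X) x0 x1 A p q :
  preserves_lip f ->
  lhom x0 x1 A p q -> lhom x0 x1 A (f \o p) (f \o q).
Proof. exact: sq_comp. Qed.

Lemma lhom_sym x0 x1 A p q : x0 <= x1 -> lhom x0 x1 A p q -> lhom x0 x1 A q p.
Proof.
move=> x01 H; have [E0 E1] := lhom_ends x01 H.
have H' : sq A x0 x1 (1 * (-1) + 1) (1 * 0 + 1) p q (fun=> p x0) (fun=> p x1).
  by rewrite !mul1r addNr add0r.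
have H3 : sq A x0 x1 (- 1) (- 0) p q (fun=> p x0) (fun=> p x1).
  by rewrite oppr0; exact: sq_yaff ltr01 H'.
by apply: sq_ext (sq_yopp H3) => // y _; rewrite E0 E1.
Qed.

Lemma lhom_trans x0 x1 A B p q r : x0 <= x1 -> lhom x0 x1 A p q -> lhom x0 x1 B q r ->
  lhom x0 x1 (A + B) p r.
Proof.
move=> x01 H H'; have [E0 E1] := lhom_ends x01 H.
have H1 : sq B x0 x1 (1 * 1 + -1) (1 * 2 + -1) q r (fun=> q x0) (fun=> q x1).
  have -> : 1 * 1 + -1 = 0 :> R by ring.
  by have -> : 1 * 2 + -1 = 1 :> R by ring.
have {}H1 := sq_yaff ltr01 H1; rewrite -E0 -E1 in H1.
have G := sq_vglue ler01 (ler1n _ 2) H H1.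
have {}G : sq (A + B) x0 x1 (2 * 0 + 0) (2 * 1 + 0) p r (fun=> p x0) (fun=> p x1).
  by rewrite mulr0 mulr1 !addr0.
exact: (sq_yaff (ltr0n R 2) G).
Qed.

Lemma lhom_cat x0 x1 x2 A B p q : x0 <= x1 -> x1 <= x2 -> lhom x0 x1 A p q -> lhom x1 x2 B p q ->
  lhom x0 x2 (A + B) p q.
Proof. exact: sq_hglue. Qed.

Lemma lhom_aff m s x0 x1 A p q : 0 < m -> lhom (m * x0 + s) (m * x1 + s) A p q ->
  lhom x0 x1 A (fun x => p (m * x + s)) (fun x => q (m * x + s)).
Proof. exact: sq_xaff. Qed.

Lemma lhom_refl x0 x1 L p : 0 <= L -> lipc x0 x1 L p -> lhom x0 x1 0 p p.
Proof.
move=> L0 pL; exists (fun x _ => p x), L; split=> //.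
  by split=> //; split=> // x _; exact: lipc_cst.
by apply: cert_flat => // x y _ _; right; left; exists 1 => //; left.
Qed.

(** The parameter [psi] clamps a level [w y], sinking from [b] to [a], between [v x] and [u x].
    Where it is clamped it does not depend on [y], and elsewhere not on [x], so the square is flat
    even if [u], [v] and [P] are not differentiable. *)
Let reparam_ge a b L M x0 x1 P (u v : R -> R) : 0 <= L -> 0 <= M -> lipc a b L P -> a < b ->
  (forall s t, x0 <= s -> s <= t -> t <= x1 -> `|u t - u s| <= M * (t - s)) ->
  (forall s t, x0 <= s -> s <= t -> t <= x1 -> `|v t - v s| <= M * (t - s)) ->
  (forall t, x0 <= t <= x1 -> u t <= b /\ a <= v t /\ v t <= u t) -> u x0 = v x0 -> u x1 = v x1 ->
  x0 <= x1 -> lhom x0 x1 0 (P \o u) (P \o v).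
Proof.
move=> L0 M0 PL ab uM vM uv E0 E1 x01.
pose w y := b - (b - a) * y.
pose psi x y := Num.max (v x) (Num.min (u x) (w y)).
have wl s t : 0 <= s -> s <= t -> t <= 1 -> w t <= w s /\ w s - w t <= (b - a) * (t - s).
  by move=> s0 st t1; rewrite /w; split; nra.
have maxl (p q r s e : R) : `|p - q| <= e -> `|r - s| <= e -> `|Num.max p r - Num.max q s| <= e.
  by rewrite !ler_norml => /andP[? ?] /andP[? ?]; apply/andP; split; case: (leP p r); case: (leP q s); lra.
have minl (p q r s e : R) : `|p - q| <= e -> `|r - s| <= e -> `|Num.min p r - Num.min q s| <= e.
  by rewrite !ler_norml => /andP[? ?] /andP[? ?]; apply/andP; split; case: (leP p r); case: (leP q s); lra.
have rg x y : x0 <= x <= x1 -> a <= psi x y <= b.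
  move=> xx; have [h1 [h2 h3]] := uv x xx; rewrite /psi le_max h2 ge_max ge_min h1 /=.
  by rewrite (le_trans h3 h1).
exists (fun x y => P (psi x y)), (L * (M + (b - a))); split.
- split; first by rewrite mulr_ge0// addr_ge0// subr_ge0 ltW.
  split=> [y yy|x xx].
    apply: (lipc_comp L0 PL _ (fun x xx => rg x y xx)) => s t h1 h2 h3.
    have ts : 0 <= t - s by rewrite subr_ge0.
    apply: (@le_trans _ _ (M * (t - s))); last by nra.
    apply: maxl; first exact: vM.
    by apply: minl; [exact: uM|rewrite subrr normr0 mulr_ge0].
  apply: (lipc_comp L0 PL _ (fun y _ => rg x y xx)) => s t h1 h2 h3.
  have ts : 0 <= t - s by rewrite subr_ge0.
  apply: (@le_trans _ _ ((b - a) * (t - s))); last by nra.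
  have ba : 0 <= (b - a) * (t - s) by rewrite mulr_ge0// subr_ge0 ltW.
  apply: maxl; first by rewrite subrr normr0.
  apply: minl; first by rewrite subrr normr0.
  by have [w1 w2] := wl s t h1 h2 h3; rewrite ler_norml; apply/andP; split; lra.
- apply: cert_flat => // x y /andP[xx0 xx1] /andP[y0 y1].
  have xx : x0 <= x <= x1 by rewrite !ltW.
  have [h1 [h2 h3]] := uv x xx.
  have [wv|wv] := leP (w y) (v x).
    right; left; exists 1 => //; left => t /andP[t0 _]; congr P.
    have wt : w t <= w y by rewrite /w; nra.
    by rewrite /psi !max_l// ge_min ?(le_trans wt wv) ?wv orbT.
  have [uw|uw] := leP (u x) (w y).
    right; left; exists 1 => //; right => t /andP[_ t0]; congr P.
    have wt : w y <= w t by rewrite /w; nra.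
    by rewrite /psi !min_l// (le_trans uw wt).
  left; pose e := Num.min (u x - w y) (w y - v x) / (M + 1).
  have M1 : 0 < M + 1 by rewrite ltr_wpDl.
  have e0 : 0 < e by rewrite divr_gt0// lt_min !subr_gt0 uw.
  exists (Num.min e (x1 - x)); first by rewrite lt_min e0 subr_gt0.
  left => t /andP[t0 t1]; have te : t - x <= e by move: t1; rewrite -lerBlDl le_min => /andP[].
  have tx1 : t <= x1 by move: t1; rewrite -lerBlDl le_min => /andP[_]; lra.
  have B : M * (t - x) <= Num.min (u x - w y) (w y - v x).
    have : (t - x) * (M + 1) <= Num.min (u x - w y) (w y - v x) by rewrite -ler_pdivlMr.
    by apply: le_trans; nra.
  move: B; rewrite le_min => /andP[B1 B2].
  have := uM x t (ltW xx0) t0 tx1; have := vM x t (ltW xx0) t0 tx1.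
  rewrite !ler_norml => /andP[? ?] /andP[? ?]; congr P.
  by rewrite /psi !min_r ?max_r//; lra.
- move=> x xx; have [h1 [h2 h3]] := uv x xx; rewrite /psi /w mulr0 mulr1 subr0 subKr /=.
  by split; congr P; [rewrite min_l// max_r|rewrite max_l// ge_min h2 orbT].
- move=> y yy.
  have H x : u x = v x -> psi x y = u x.
    by move=> E; rewrite /psi E max_l// ge_min lexx.
  by rewrite !H.
Qed.

Lemma lhom_reparam a b L M x0 x1 P (u v : R -> R) : 0 <= L -> 0 <= M -> lipc a b L P -> a < b ->
  (forall s t, x0 <= s -> s <= t -> t <= x1 -> `|u t - u s| <= M * (t - s)) ->
  (forall s t, x0 <= s -> s <= t -> t <= x1 -> `|v t - v s| <= M * (t - s)) ->
  (forall t, x0 <= t <= x1 -> a <= u t <= b /\ a <= v t <= b) -> u x0 = v x0 -> u x1 = v x1 ->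
  x0 <= x1 -> lhom x0 x1 0 (P \o u) (P \o v).
Proof.
move=> L0 M0 PL ab uM vM uv E0 E1 x01.
pose w t := Num.max (u t) (v t).
have wM s t : x0 <= s -> s <= t -> t <= x1 -> `|w t - w s| <= M * (t - s).
  move=> h1 h2 h3; have := uM s t h1 h2 h3; have := vM s t h1 h2 h3; rewrite /w !ler_norml.
  move=> /andP[? ?] /andP[? ?]; apply/andP; split; case: (leP (u t) (v t)); case: (leP (u s) (v s)); lra.
have w0 : w x0 = u x0 by rewrite /w -E0 maxxx.
have w1 : w x1 = u x1 by rewrite /w -E1 maxxx.
rewrite -[0]addr0; apply: (@lhom_trans _ _ _ _ _ (P \o w)) => //.
  apply: lhom_sym => //; apply: (@reparam_ge a b L M) => //.
  by move=> t /uv[/andP[? ?] /andP[? ?]]; rewrite /w ge_max le_max lexx; split=> //; exact/andP.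
apply: (@reparam_ge a b L M) => //; rewrite ?w0 ?w1//.
by move=> t /uv[/andP[? ?] /andP[? ?]]; rewrite /w ge_max le_max lexx orbT; split=> //; exact/andP.
Qed.

(** The factor 2 bounds the Lipschitz constant in the direction of the homotopy, since the Euclidean
    diameter of the realization is at most 2. *)
Lemma lhom_straight x0 x1 L p q : 0 <= L -> x0 <= x1 -> lipc x0 x1 L p -> lipc x0 x1 L q ->
  (forall x, x0 <= x <= x1 -> compat (p x) (q x)) -> p x0 = q x0 -> p x1 = q x1 ->
  lhom x0 x1 (L * 2 * (x1 - x0)) p q.
Proof.
move=> L0 x01 pL qL pq E0 E1; exists (fun x y => seg (p x) (q x) y), (Num.max L 2).
have xl : xlip (fun x y => seg (p x) (q x) y) x0 x1 0 1 L.
  move=> y yy s t h1 h2 h3.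
  have ss : x0 <= s <= x1 by rewrite h1 (le_trans h2 h3).
  have tt : x0 <= t <= x1 by rewrite h3 (le_trans h1 h2).
  apply: le_trans (seg_convex (pq s ss) (pq t tt) yy) _.
  by have := pL s t h1 h2 h3; have := qL s t h1 h2 h3; have /andP[] := yy; nra.
have yl : ylip (fun x y => seg (p x) (q x) y) x0 x1 0 1 2.
  by move=> x xx; apply: lipc_le (lipc_seg (pq x xx)); exact: mdist_le2.
split.
- split; first by rewrite le_max L0.
  split=> [y yy|x xx]; first by apply: lipc_le (xl y yy); rewrite le_max lexx.
  by apply: lipc_le (yl x xx); rewrite le_max lexx orbT.
- by apply: (@cert_box _ _ _ _ _ _ _ _ L 2) => //; rewrite subr0 mulr1.
- by move=> x xx; rewrite seg0 ?seg1//; exact: pq.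
- by move=> y yy; rewrite -E0 -E1 !segxx.
Qed.

End Homotopies.

Ltac absurd_lra := exfalso; lra.

(** * Moore paths: concatenation, inversion and homotopy *)

Section MoorePaths.
Variables (R : realType) (V : choiceType) (K : complex V).
Local Notation X := (realization R K).
Implicit Types (p q r : R -> X) (x y z : X) (a b c A B T L : R).

Definition glip L p := forall s t, s <= t -> mdist (p s) (p t) <= L * (t - s).

Lemma glip_lipc L p a b : glip L p -> lipc a b L p.
Proof. by move=> H s t _ st _; exact: H. Qed.

(** Paths of duration [a] are extended by constants to the whole line. Durations make concatenation
    strictly associative, and the extension allows paths of different durations to be compared. *)
Definition mpath a x y p := 0 <= a /\ (exists2 L, 0 <= L & glip L p) /\
  (forall t, t <= 0 -> p t = x) /\ (forall t, a <= t -> p t = y).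

Definition pcat a p q : R -> X := fun t => if t <= a then p t else q (t - a).
Definition rpath a p : R -> X := fun t => p (a - t).

Lemma mpath_cst a x : 0 <= a -> mpath a x x (fun=> x).
Proof. by move=> a0; split=> //; split=> //; exists 0 => // s t _; rewrite mdistxx mul0r. Qed.

Lemma mpath_cat a b x y z p q : mpath a x y p -> mpath b y z q -> mpath (a + b) x z (pcat a p q).
Proof.
move=> [a0 [[L L0 pL] [p0 p1]]] [b0 [[M M0 qM] [q0 q1]]]; split; first exact: addr_ge0.
split; last first.
  split=> t H; rewrite /pcat; case: leP => H'.
  - by rewrite p0.
  - by absurd_lra.
  - rewrite p1; last lra.
    by rewrite -(q0 0)// q1//; lra.
  - by rewrite q1//; lra.
have pa t : a <= t -> pcat a p q t = q (t - a).
  rewrite /pcat => at_; case: leP => // ta.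
  by have -> : t = a by [lra]; rewrite subrr p1// q0.
exists (Num.max L M); first by rewrite le_max L0.
move=> s t st.
suff H : lipc s t (Num.max L M) (pcat a p q) by exact: H.
have H1 u : lipc u a (Num.max L M) (pcat a p q).
  apply: (lipc_eq (c := p)) => [v /andP[_ va]|]; first by rewrite /pcat va.
  by apply: (lipc_le _ (glip_lipc pL)); rewrite le_max lexx.
have H2 u : lipc a u (Num.max L M) (pcat a p q).
  apply: (lipc_eq (c := fun t => q (t - a))) => [v /andP[av _]|]; first by rewrite pa.
  move=> v w _ vw _; have -> : w - v = (w - a) - (v - a) by ring.
  apply: le_trans (qM _ _ _) _; first by rewrite lerD2r.
  by rewrite ler_wpM2r ?le_max ?lexx ?orbT// subr_ge0 lerD2r.
by apply: (lipc_sub _ _ (lipc_glue (H1 (Num.min s a)) (H2 (Num.max t a)))); rewrite ?ge_min ?le_max lexx.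
Qed.

Lemma mpath_inv a x y p : mpath a x y p -> mpath a y x (rpath a p).
Proof.
move=> [a0 [[L L0 pL] [p0 p1]]]; split=> //; split.
  exists L => // s t st; rewrite /rpath mdistC; have -> : t - s = (a - s) - (a - t) by ring.
  by apply: pL; lra.
by split=> t tt; [apply: p1|apply: p0]; lra.
Qed.

Lemma pcat_cst0 b y z q x : mpath b y z q -> x = y -> pcat 0 (fun=> x) q = q.
Proof.
move=> [_ [_ [q0 _]]] ->; apply/funext => t; rewrite /pcat subr0.
by case: leP => // /q0.
Qed.

Lemma pcat_cst a x y p : mpath a x y p -> pcat a p (fun=> y) = p.
Proof.
by move=> [_ [_ [_ p1]]]; apply/funext => t; rewrite /pcat; case: leP => // /ltW/p1.
Qed.

Lemma pcatA a b p q r : 0 <= b -> pcat (a + b) (pcat a p q) r = pcat a p (pcat b q r).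
Proof.
move=> b0; apply/funext => t; rewrite /pcat lerBlDl.
by case: (leP t a) => h1; case: (leP t (a + b)) => h2 //; [absurd_lra|rewrite opprD addrA].
Qed.

(** Both paths have come to rest at time [T], so they can be compared on one interval. *)
Definition mhom a b A p q := exists T, [/\ 0 <= T, a <= T, b <= T & lhom 0 T A p q].

Lemma mhom_extend a b x y p q A T T' : mpath a x y p -> mpath b x y q -> 0 <= T -> T <= T' ->
  a <= T -> b <= T -> lhom 0 T A p q -> lhom 0 T' A p q.
Proof.
move=> [_ [_ [_ p1]]] [_ [_ [_ q1]]] T0 TT aT bT H.
rewrite -[A]addr0; apply: (lhom_cat T0 TT H).
apply: (@lhom_ext _ _ _ _ _ _ (fun=> y) (fun=> y)) => //.
- by move=> t /andP[t0 _]; rewrite p1// (le_trans aT).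
- by move=> t /andP[t0 _]; rewrite q1// (le_trans bT).
- by apply: (@lhom_refl _ _ _ _ _ 0) => //; exact: lipc_cst.
Qed.

Lemma mhom_refl a x y p : mpath a x y p -> mhom a a 0 p p.
Proof.
move=> [a0 [[L L0 pL] _]]; exists a; split=> //.
by apply: (lhom_refl L0); exact: glip_lipc.
Qed.

Lemma mhom_sym a b A p q : mhom a b A p q -> mhom b a A q p.
Proof. by move=> [T [T0 aT bT H]]; exists T; split=> //; exact: lhom_sym. Qed.

Lemma mhom_le a b A B p q : A <= B -> mhom a b A p q -> mhom a b B p q.
Proof. by move=> AB [T [T0 aT bT H]]; exists T; split=> //; exact: lhom_le H. Qed.

Lemma mhom_trans a b c A B x y p q r : mpath a x y p -> mpath b x y q -> mpath c x y r ->
  mhom a b A p q -> mhom b c B q r -> mhom a c (A + B) p r.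
Proof.
move=> pp pq pr [T [T0 aT bT H]] [T' [T0' aT' bT' H']].
exists (Num.max T T'); rewrite !le_max T0 aT bT' orbT; split=> //.
apply: (@lhom_trans _ _ _ _ _ _ _ _ q); first by rewrite le_max T0.
  by apply: (mhom_extend pp pq) H => //; rewrite le_max lexx.
by apply: (mhom_extend pq pr) H' => //; rewrite le_max lexx orbT.
Qed.

Lemma mhom_comp (f : X -> X) a b A p q :
  preserves_lip f ->
  mhom a b A p q -> mhom a b A (f \o p) (f \o q).
Proof. by move=> fL [T [T0 aT bT H]]; exists T; split=> //; exact: lhom_comp. Qed.

Lemma mpath_comp (f : X -> X) a x y p :
  preserves_lip f ->
  mpath a x y p -> mpath a (f x) (f y) (f \o p).
Proof.
move=> fL [a0 [[L L0 pL] [p0 p1]]]; split=> //; split.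
  by exists L => // s t st; exact: (fL s t L p L0 (@glip_lipc L p s t pL) s t (lexx s) st (lexx t)).
by split=> t tt /=; [rewrite p0|rewrite p1].
Qed.

Lemma lhom_shift a T A p q : lhom 0 T A p q ->
  lhom a (a + T) A (fun t => p (t - a)) (fun t => q (t - a)).
Proof.
move=> H; have H' : lhom (1 * a + - a) (1 * (a + T) + - a) A p q.
  by rewrite !mul1r subrr addrAC subrr add0r.
have E u : (fun x : R => u (1 * x - a)) = (fun t => u (t - a)) :> (R -> X).
  by apply/funext => t; rewrite mul1r.
by have := lhom_aff ltr01 H'; rewrite !E.
Qed.

Lemma mhom_catl a b b' x y z p q q' A : mpath a x y p -> mpath b y z q -> mpath b' y z q' ->
  mhom b b' A q q' -> mhom (a + b) (a + b') A (pcat a p q) (pcat a p q').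
Proof.
move=> [a0 [[L L0 pL] [p0 p1]]] [b0 [_ [q0 q1]]] [b0' [_ [q0' q1']]] [T [T0 bT bT' H]].
exists (a + T); rewrite !lerD2l addr_ge0//; split=> //.
rewrite -[A]add0r; apply: (@lhom_cat _ _ _ _ a) => //; first by rewrite lerDl.
  apply: (@lhom_ext _ _ _ _ _ _ p p) => // [t /andP[_ ta]|t /andP[_ ta]|]; rewrite /pcat ?ta//.
  by apply: (lhom_refl L0); exact: glip_lipc.
have E u w t : (forall s, s <= 0 -> u s = y) -> a <= t -> u (t - a) = pcat a p u t :> X.
  move=> u0 at_; rewrite /pcat; case: leP => // ta.
  by rewrite u0 ?p1//; lra.
apply: lhom_ext (lhom_shift a H); first by rewrite lerDl.
  by move=> t /andP[ta _]; apply: E.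
by move=> t /andP[ta _]; apply: E.
Qed.

(** Waiting between the two paths is a reparametrization and costs no area. *)
Lemma pcat_pad a b T x y z p q : a <= T -> mpath a x y p -> mpath b y z q ->
  mhom (a + b) (T + b) 0 (pcat a p q) (pcat T p q).
Proof.
move=> aT pp pq; have [_ [[L L0 PL] _]] := mpath_cat pp pq.
have [a0 [_ [p0 p1]]] := pp; have [b0 [_ [q0 q1]]] := pq.
have Ta : 0 <= T := le_trans a0 aT.
exists (T + b); split; rewrite ?addr_ge0 ?lerD2r//.
(* The parameter [v] waits at [a] until time [T], and [u] stops at [a + b]. *)
pose v t := Num.min t a + Num.max (t - T) 0.
pose u t := Num.min t (a + b).
apply: (@lhom_ext _ _ _ _ _ _ (pcat a p q \o u) (pcat a p q \o v)); first exact: addr_ge0.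
- move=> t _ /=; rewrite /u; case: (leP t (a + b)) => // h; rewrite /pcat.
  case: leP => h1.
    rewrite p1; last lra.
    case: leP => h2; first absurd_lra.
    by rewrite -(q0 0)// !q1//; lra.
  case: leP => h2; first absurd_lra.
  by rewrite !q1//; lra.
- move=> t _ /=; rewrite /v; case: (leP (t - T) 0) => h1; case: (leP t a) => h2; rewrite /pcat ?addr0 ?h2.
  + by rewrite (le_trans h2 aT).
  + rewrite lexx; case: leP => h3; last absurd_lra.
    by rewrite !p1//; lra.
  + absurd_lra.
  + case: leP => h3; first absurd_lra.
    case: leP => h4; first absurd_lra.
    by congr q; ring.
- have minL c s t : s <= t -> `|Num.min t c - Num.min s c| <= t - s.
    by move=> st; rewrite ler_norml; case: (leP t c); case: (leP s c) => *; apply/andP; split; lra.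
  have maxL s t : s <= t -> `|Num.max (t - T) 0 - Num.max (s - T) 0| <= t - s.
    by move=> st; rewrite ler_norml; case: (leP (t - T) 0); case: (leP (s - T) 0) => *; apply/andP; split; lra.
  have Tb : 0 <= T + b by rewrite addr_ge0.
  (* Starting the parameter interval at -1 keeps it nondegenerate when [a + b] is 0. *)
  apply: (@lhom_reparam _ _ _ (-1) (a + b) L 2) => //; rewrite ?mul1r//.
  + exact: glip_lipc.
  + by apply: (@lt_le_trans _ _ 0); rewrite ?ltrN10// addr_ge0.
  + by move=> s t s0 st tT; apply: le_trans (minL _ _ _ st) _; rewrite mulr2n mulrDl mul1r lerDl subr_ge0.
  + move=> s t s0 st tT; rewrite /v opprD addrACA; apply: le_trans (ler_normD _ _) _.
    by rewrite mulr2n mulrDl mul1r lerD// ?minL// maxL.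
  + move=> t /andP[t0 tT]; have ab : 0 <= a + b by rewrite addr_ge0.
    have h1 : 0 <= u t by rewrite /u le_min t0.
    have h2 : 0 <= v t by rewrite /v addr_ge0// ?le_min ?t0// le_max lexx orbT.
    split; apply/andP; split.
    * by apply: le_trans h1; rewrite oppr_le0.
    * by rewrite /u ge_min lexx orbT.
    * by apply: le_trans h2; rewrite oppr_le0.
    * by rewrite /v lerD// ?ge_min ?lexx ?orbT// ge_max b0 lerBlDl tT.
  + by rewrite /u /v min_l ?addr_ge0// min_l// max_r ?addr0// sub0r oppr_le0.
  + rewrite /u /v min_r ?lerD2r// min_r; last by rewrite (le_trans aT)// lerDl.
    by rewrite addrAC subrr add0r max_l.
Qed.

(** The paths [p] and [p'] may have different durations, so [q] would start at different times; both
    are first padded to the time [T] of the homotopy. *)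
Lemma mhom_catr a a' b x y z p p' q A : mpath a x y p -> mpath a' x y p' -> mpath b y z q ->
  mhom a a' A p p' -> mhom (a + b) (a' + b) A (pcat a p q) (pcat a' p' q).
Proof.
move=> pp pp' pq [T [T0 aT aT' H]].
have mT p0 a0 : a0 <= T -> mpath a0 x y p0 -> mpath T x y p0.
  by move=> aT0 [_ [? [? h]]]; split=> //; split=> //; split=> // t Tt; apply: h; exact: le_trans Tt.
have M0 := mpath_cat pp pq; have M0' := mpath_cat pp' pq.
have M1 := mpath_cat (mT _ _ aT pp) pq; have M1' := mpath_cat (mT _ _ aT' pp') pq.
rewrite -[A]add0r; apply: (mhom_trans M0 M1 M0'); first exact: pcat_pad pp pq.
rewrite -[A]addr0; apply: (mhom_trans M1 M1' M0'); last exact/mhom_sym/(pcat_pad aT' pp' pq).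
have [b0 [[L L0 qL] [q0 q1]]] := pq; have [a0 [_ [p0 p1]]] := pp; have [a0' [_ [p0' p1']]] := pp'.
exists (T + b); rewrite addr_ge0// lexx; split=> //.
rewrite -[A]addr0; apply: (@lhom_cat _ _ _ _ T) => //; first by rewrite lerDl.
  by apply: lhom_ext H => // t /andP[_ tT]; rewrite /pcat tT.
have qq : lhom 0 b 0 q q by apply: (lhom_refl L0); exact: glip_lipc.
apply: lhom_ext (lhom_shift T qq); first by rewrite lerDl.
  by move=> t /andP[Tt _]; rewrite /pcat; case: leP => // tT; rewrite q0 ?p1//; lra.
by move=> t /andP[Tt _]; rewrite /pcat; case: leP => // tT; rewrite q0 ?p1'//; lra.
Qed.

(** The backtracking path is [p] composed with a tent function, and the constant path is [p]
    composed with 0: a reparametrization of area 0. *)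
Lemma mhom_Vr a x y p : mpath a x y p -> mhom (a + a) 0 0 (pcat a p (rpath a p)) (fun=> x).
Proof.
move=> pp; have [a0 [[L L0 pL] [p0 p1]]] := pp.
exists (a + a); rewrite addr_ge0//; split=> //.
pose u t := Num.min t (a + a - t).
apply: (@lhom_ext _ _ _ _ _ _ (p \o u) (p \o cst 0)); first exact: addr_ge0.
- move=> t /andP[t0 ta] /=; rewrite /u /pcat /rpath; case: (leP t a) => h; case: leP => h' //; try absurd_lra.
  by congr p; ring.
- by move=> t _ /=; rewrite p0.
- apply: (@lhom_reparam _ _ _ (-1) (a + 1) L 1) => //; try lra.
  + exact: glip_lipc.
  + move=> s t s0 st tT; rewrite /u ler_norml.
    by case: (leP t (a + a - t)); case: (leP s (a + a - s)) => *; apply/andP; split; lra.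
  + by move=> s t s0 st tT; rewrite /cst subrr normr0; lra.
  + by move=> t /andP[t0 ta]; rewrite /u /cst; case: (leP t (a + a - t)) => *; split; apply/andP; split; lra.
  + by rewrite /u /cst; case: (leP 0 (a + a - 0)) => *; lra.
  + by rewrite /u /cst; case: (leP (a + a) _) => *; lra.
Qed.

Lemma rpathK a p : rpath a (rpath a p) = p.
Proof. by apply/funext => t; rewrite /rpath subKr. Qed.

Lemma mhom_Vl a x y p : mpath a x y p -> mhom (a + a) 0 0 (pcat a (rpath a p) p) (fun=> y).
Proof. by move=> /mpath_inv/mhom_Vr; rewrite rpathK. Qed.

End MoorePaths.

(** * Derivatives with a default value *)

Section DerivativeFacts.
Variable R : realType.

(** The default value at points without derivative; it lets the Jacobian estimates below hold at
    every point. *)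
Lemma derive1_dvg (f : R -> R) (x : R) : ~ derivable f x 1 -> derive1 f x = 0.
Proof. by move=> nd; rewrite derive1E /derive; apply: (dvgP nd). Qed.

Lemma cvg_scaled_harmonic (e : R) : (fun n => e * n.+1%:R^-1) @ \oo --> (0 : R).
Proof.
by rewrite -[X in _ --> X](mulr0 e); apply: cvgM; [exact: cvg_cst|exact: cvg_harmonic].
Qed.

Lemma scaled_harmonic_le (e : R) n : 0 <= e -> 0 <= e * n.+1%:R^-1 <= e.
Proof.
move=> e0; rewrite mulr_ge0 ?invr_ge0//= ler_piMr// invf_le1 ?ltr0n//.
by rewrite ler1n.
Qed.

(** Either there is no derivative, with default value 0, or it equals the one-sided limit of
    vanishing quotients. *)
Lemma derive1_cst_one_side (f : R -> R) (x e : R) : 0 < e ->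
  (forall t, x <= t <= x + e -> f t = f x) \/ (forall t, x - e <= t <= x -> f t = f x) ->
  derive1 f x = 0.
Proof.
move=> e0 H; have [d|] := pselect (derivable f x 1); last exact: derive1_dvg.
have [u [u0 [uc fu]]] : exists u : nat -> R, (forall n, u n != 0) /\ (u n @[n --> \oo] --> (0 : R)) /\
    forall n, f (x + u n) = f x.
  case: H => H.
  - exists (fun n => e * n.+1%:R^-1); split; first by move=> n; rewrite mulf_neq0 ?gt_eqF.
    split=> [|n]; first exact: cvg_scaled_harmonic.
    by apply: H; have /andP[? ?] := scaled_harmonic_le n (ltW e0); rewrite lerDl lerD2l; apply/andP.
  - exists (fun n => - e * n.+1%:R^-1); split; first by move=> n; rewrite mulf_neq0 ?oppr_eq0 ?gt_eqF.
    split=> [|n]; first exact: cvg_scaled_harmonic.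
    by apply: H; have /andP[? ?] := scaled_harmonic_le n (ltW e0); rewrite mulNr lerD2l lerN2 gerDl oppr_le0; apply/andP.
have C := cvg_difference_quotient d u0 uc.
have C0 : (fun n => (u n)^-1 * (f (x + u n) - f x)) @ \oo --> (0 : R).
  by under eq_fun do rewrite fu subrr mulr0; exact: cvg_cst.
exact: (cvg_unique _ C C0).
Qed.

(** For [a != 0] differentiability of [f] and of [h] are equivalent, so the formula also holds with
    default values on both sides; for [a = 0] the function [f] is locally constant. *)
Lemma derive1_scale (f h : R -> R) (x a e : R) : 0 < e ->
  (forall t, `|t| <= e -> f (x + t) = h (a * t)) -> derive1 f x = a * derive1 h 0.
Proof.
move=> e0 E; have [a0|a0] := eqVneq a 0.
  rewrite a0 mul0r; apply: (derive1_cst_one_side e0); left => t /andP[t0 t1].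
  have -> : t = x + (t - x) by rewrite addrC subrK.
  rewrite E ?a0 ?mul0r; last by rewrite ger0_norm ?subr_ge0// lerBlDl.
  by rewrite -[in RHS](addr0 x) E ?normr0 ?ltW// a0 mul0r.
pose g (s : R) := - (a * x) + s * a.
have gE t : g (x + t) = a * t by rewrite /g; ring.
have nearE : \forall s \near x, (h \o g) s = f s.
  exists e => //= s; rewrite /ball_ /= => xs.
  have sE : s = x + (s - x) by rewrite addrC subrK.
  by rewrite sE gE E// distrC ltW.
have nearE' : \forall s \near (0 : R), (f \o (fun s => x + s * a^-1)) s = h s.
  exists (e * `|a|); first by rewrite /= mulr_gt0// normr_gt0.
  move=> s; rewrite /ball_ /= sub0r normrN => sa.
  rewrite E; first by rewrite mulrC divfK.
  by rewrite normrM normfV ler_pdivrMr ?normr_gt0// ltW.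
have aff (c d s : R) : is_derive s (1 : R) (fun s : R => c + s * d) d.
  rewrite (_ : (fun s : R => c + s * d) = cst c + d \*: (id : R -> R)); last first.
    by apply/funext => t; rewrite mulrC.
  by apply: is_derive_eq; rewrite add0r [LHS]mulr1.
have [d|nd] := pselect (derivable h 0 1); last first.
  rewrite (derive1_dvg nd) mulr0; apply: derive1_dvg => fd; apply: nd.
  apply: near_eq_derivable nearE' _.
  have fd' : is_derive (x + 0 * a^-1) (1 : R) f (derive1 f x).
    by rewrite mul0r addr0 derive1E; exact: derivableP.
  have := @is_derive1_comp R f (fun s => x + s * a^-1) 0 (derive1 f x) a^-1 fd' (aff x a^-1 0).
  by case.
have hd : is_derive (g x) (1 : R) h (derive1 h 0).
  by have := gE 0; rewrite addr0 mulr0 => ->; rewrite derive1E; exact: derivableP.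
have [_ fd] := near_eq_is_derive nearE (is_derive1_comp hd (aff _ _ x)).
by rewrite derive1E fd mulrC.
Qed.

End DerivativeFacts.

(** * Certificates bound the area *)

Section Soundness.
Variables (R : realType) (V : choiceType) (K : complex V).
Local Notation X := (realization R K).
Implicit Types (g : R -> R -> X) (x y : R).

Lemma sum_sq_mdist (s : seq V) (x y : X) : uniq s -> \sum_(v <- s) (x v - y v) ^+ 2 <= mdist x y ^+ 2.
Proof.
move=> us; pose U := (finsupp x `|` finsupp y `|` [fset v | v in s])%fset.
rewrite (@mdistE R V K U); last 2 first.
- by rewrite /U -fsetUA fsubsetUl.
- by rewrite /U fsetUAC fsubsetUr.
rewrite sqr_sqrtr; last by apply: sumr_ge0 => *; exact: sqr_ge0.
rewrite [leRHS](bigID (mem s)) /= -[X in _ <= X + _]big_filter.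
rewrite [X in _ <= X + _](perm_big s); first by rewrite lerDl sumr_ge0// => *; exact: sqr_ge0.
apply: uniq_perm => //; first by rewrite filter_uniq// fset_uniq.
move=> v; rewrite mem_filter; case vs : (v \in s) => //=.
by rewrite !inE vs !orbT.
Qed.

(** The difference quotients of finitely many coordinates have square sum at most [L ^+ 2], because
    the curve is Lipschitz for the Euclidean distance; the bound passes to the limit. *)
Lemma deriv_sq_sum (c : R -> X) L x e (s : seq V) : 0 <= L -> 0 < e -> lipc x (x + e) L c -> uniq s ->
  \sum_(v <- s) derive1 (fun t => c t v) x ^+ 2 <= L ^+ 2.
Proof.
move=> L0 e0 cL us; pose u n : R := e * n.+1%:R^-1.
have u_gt0 n : 0 < u n by rewrite mulr_gt0 ?invr_gt0.
have uc := cvg_scaled_harmonic e.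
(* Coordinates without derivative contribute 0, in agreement with the default value of [derive1]. *)
pose q v n := if pselect (derivable (fun t => c t v) x 1) then (u n)^-1 * (c (x + u n) v - c x v) else 0.
have qc v : q v n @[n --> \oo] --> derive1 (fun t => c t v) x.
  rewrite /q; case: pselect => [d|nd] /=.
    by apply: (cvg_difference_quotient d) => // n; rewrite gt_eqF.
  by rewrite derive1_dvg//; exact: cvg_cst.
have sc : (fun n => \sum_(v <- s) q v n * q v n) @ \oo --> \sum_(v <- s) derive1 (fun t => c t v) x ^+ 2.
  elim: s {us} => [|v s IH]; first by under eq_fun do rewrite big_nil; rewrite big_nil; exact: cvg_cst.
  under eq_fun do rewrite big_cons; rewrite big_cons expr2.
  by apply: cvgD => //; apply: cvgM.
have bound n : \sum_(v <- s) q v n * q v n <= L ^+ 2.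
  apply: (@le_trans _ _ (\sum_(v <- s) (u n)^-1 ^+ 2 * (c (x + u n) v - c x v) ^+ 2)).
    apply: ler_sum => v _; rewrite /q; case: pselect => [d|nd] /=; first by rewrite -expr2 exprMn.
    by rewrite mul0r mulr_ge0 ?sqr_ge0.
  rewrite -mulr_sumr; apply: (@le_trans _ _ ((u n)^-1 ^+ 2 * mdist (c (x + u n)) (c x) ^+ 2)).
    by rewrite ler_wpM2l ?sqr_ge0// sum_sq_mdist.
  have ui : 0 <= (u n)^-1 by rewrite invr_ge0 ltW.
  rewrite -exprMn ler_sqr ?nnegrE ?mulr_ge0 ?mdist_ge0//.
  rewrite mulrC ler_pdivrMr// mdistC.
  have /andP[h0 h1] := scaled_harmonic_le n (ltW e0).
  have := cL x (x + u n) (lexx _); rewrite lerDl lerD2l [x + _ - x]addrAC subrr add0r.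
  by apply => //; exact: ltW.
have := @ler_cvg_to _ _ _ _ _ _ _ _ sc (@cvg_cst _ (L ^+ 2) _ _ _); apply.
by apply: nearW.
Qed.

(** By convention the sum is 0 when infinitely many terms are nonzero; the lemmas on [fsum] cover
    this case as well. *)
Definition fsum (F : V -> R) := \sum_(v \in [set: V]) F v.

Lemma fsum_le (F : V -> R) M : 0 <= M -> (forall s : seq V, uniq s -> \sum_(v <- s) F v <= M) ->
  fsum F <= M.
Proof.
rewrite /fsum => M0 H; have [fin|inf] := pselect (finite_set ([set: V] `&` F @^-1` [set~ 0])).
  by rewrite fsbig_supp fsbig_finite//; apply: H; exact: fset_uniq.
by rewrite fsbig_dflt.
Qed.

Lemma fsum_ge0 (F : V -> R) : (forall v, 0 <= F v) -> 0 <= fsum F.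
Proof. by move=> F0; apply: fsumr_ge0. Qed.

Lemma fsum_scale (c : R) (F : V -> R) : fsum (fun v => c * F v) = c * fsum F.
Proof.
rewrite /fsum.
have [->|c0] := eqVneq c 0.
  by rewrite mul0r; apply: fsbig1 => v _; rewrite mul0r.
have [fin|inf] := pselect (finite_set ([set: V] `&` F @^-1` [set~ 0])).
  by rewrite full_fsbig_distrr.
rewrite (fsbig_dflt _ inf) mulr0 fsbig_dflt//.
apply: contra_not inf; congr finite_set; apply/funext => v; apply/propext; split=> -[_ H]; split=> //; move: H => /=.
  by move=> /eqP; rewrite mulf_eq0 negb_or => /andP[_ /eqP].
by move=> /eqP Fv; apply/eqP; rewrite mulf_neq0.
Qed.

Let G g : R * R -> X := fun p => g p.1 p.2.

Lemma jacobianE (f : R * R -> X) p : Defs.jacobian f p =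
  Num.sqrt (fsum (fun v => partial1 f p v ^+ 2) * fsum (fun v => partial2 f p v ^+ 2) -
            fsum (fun v => partial1 f p v * partial2 f p v) ^+ 2).
Proof. by []. Qed.

(** A Gram determinant is at most the product of the squared lengths of its two vectors. *)
Lemma jacobian_le g x y e a b : 0 <= a -> 0 <= b -> 0 < e ->
  lipc x (x + e) a (fun t => g t y) -> lipc y (y + e) b (g x) -> Defs.jacobian (G g) (x, y) <= a * b.
Proof.
move=> a0 b0 e0 ga gb; rewrite jacobianE.
have Ea := fsum_le (sqr_ge0 a) (fun s us => deriv_sq_sum a0 e0 ga us).
have Hb := fsum_le (sqr_ge0 b) (fun s us => deriv_sq_sum b0 e0 gb us).
have E0 := fsum_ge0 (fun v => sqr_ge0 (partial1 (G g) (x, y) v)).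
have H0 := fsum_ge0 (fun v => sqr_ge0 (partial2 (G g) (x, y) v)).
rewrite -[leRHS]ger0_norm ?mulr_ge0// -sqrtr_sqr ler_wsqrtr// exprMn.
apply: le_trans (ler_pM E0 H0 Ea Hb).
by rewrite lerBlDr lerDl sqr_ge0.
Qed.

Lemma jacobian_parallel g x y (d : V -> R) a b :
  (forall v, partial1 (G g) (x, y) v = a * d v) -> (forall v, partial2 (G g) (x, y) v = b * d v) ->
  Defs.jacobian (G g) (x, y) = 0.
Proof.
move=> E1 E2; rewrite jacobianE.
have -> : (fun v => partial1 (G g) (x, y) v ^+ 2) = (fun v => a ^+ 2 * d v ^+ 2).
  by apply/funext => v; rewrite E1 exprMn.
have -> : (fun v => partial1 (G g) (x, y) v * partial2 (G g) (x, y) v) = (fun v => a * b * d v ^+ 2).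
  by apply/funext => v; rewrite E1 E2; ring.
have -> : (fun v => partial2 (G g) (x, y) v ^+ 2) = (fun v => b ^+ 2 * d v ^+ 2).
  by apply/funext => v; rewrite E2 exprMn.
rewrite !fsum_scale (_ : _ - _ = 0) ?sqrtr0//; ring.
Qed.

Lemma jacobian_xconst g x y : xconst g x y -> Defs.jacobian (G g) (x, y) = 0.
Proof.
move=> [e e0 H]; apply: (@jacobian_parallel _ _ _ (partial2 (G g) (x, y)) 0 1) => v; last by rewrite mul1r.
rewrite mul0r /partial1 /=; apply: (derive1_cst_one_side e0).
by case: H => H; [left|right] => t /H E; rewrite /G /= E.
Qed.

Lemma jacobian_yconst g x y : xconst (fun x y => g y x) y x -> Defs.jacobian (G g) (x, y) = 0.
Proof.
move=> [e e0 H]; apply: (@jacobian_parallel _ _ _ (partial1 (G g) (x, y)) 1 0) => v; first by rewrite mul1r.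
rewrite mul0r /partial2 /=; apply: (derive1_cst_one_side e0).
by case: H => H; [left|right] => t /H E; rewrite /G /= E.
Qed.

Lemma jacobian_flat g x y : flat_at g x y -> Defs.jacobian (G g) (x, y) = 0.
Proof.
move=> [/jacobian_xconst//|[/jacobian_yconst//|[P [a [b [e [e0 H]]]]]]].
apply: (@jacobian_parallel _ _ _ (fun v => derive1 (fun t => P t v) 0) a b) => v.
  by apply: (derive1_scale e0) => t /H[E _]; rewrite /G /= E.
by apply: (derive1_scale e0) => t /H[_ E]; rewrite /G /= E.
Qed.

Local Open Scope ereal_scope.
Local Notation mu := (@lebesgue_measure R).

(** Integrals can be added and split for a measurable majorant, whereas the Jacobian is only known
    pointwise. *)
Lemma cert_majorant g x0 x1 y0 y1 A : (x0 <= x1)%R -> (y0 <= y1)%R -> cert g x0 x1 y0 y1 A ->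
  exists m : R * R -> \bar R, [/\ measurable_fun setT m, forall p, 0 <= m p,
    forall p, (x0 < p.1 < x1)%R -> (y0 < p.2 < y1)%R -> (Defs.jacobian (G g) p)%:E <= m p &
    \int[mu \x mu]_p m p <= A%:E].
Proof.
move=> + + H; elim: H => {x0 x1 y0 y1 A} [x0 x1 y0 y1 a b A a0 b0 xl yl le|x0 x1 y0 y1 A H A0|x0 x1 x2 y0 y1 A B h1 h2 cA IA cB IB|x0 x1 y0 y1 y2 A B h1 h2 cA IA cB IB] xx yy.
- pose D : set (R * R) := `]x0, x1[ `*` `]y0, y1[.
  have mD : measurable D by apply: measurableX; exact: measurable_itv.
  exists ((cst (a * b)%:E) \_ D); split.
  + by apply/(measurable_restrictT _ mD); exact: measurable_cst.
  + by move=> p; rewrite patchE; case: ifP => // _; rewrite lee_fin mulr_ge0.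
  + move=> [x y] /= /andP[? ?] /andP[? ?]; rewrite patchE ifT; last first.
      by rewrite inE /D /=; split; rewrite /= in_itv /=; exact/andP.
    rewrite lee_fin; apply: (@jacobian_le _ _ _ (Num.min (x1 - x)%R (y1 - y)%R)) => //.
    * by rewrite lt_min !subr_gt0; apply/andP.
    * have yI : (y0 <= y <= y1)%R by rewrite !ltW.
      by apply: (lipc_sub _ _ (xl y yI)); [exact: ltW|rewrite -lerBrDl ge_min lexx].
    * have xI : (x0 <= x <= x1)%R by rewrite !ltW.
      by apply: (lipc_sub _ _ (yl x xI)); [exact: ltW|rewrite -lerBrDl ge_min lexx orbT].
  + have muD : product_measure1 mu mu D = mu (`]x0, x1[%classic : set R) * mu (`]y0, y1[%classic : set R).
      by apply: product_measure1E; exact: measurable_itv.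
    rewrite -integral_mkcond integral_cst// [X in _ * X]muD.
    rewrite !lebesgue_measure_itv /= !lte_fin.
    apply: (@le_trans _ _ (a * b * ((x1 - x0) * (y1 - y0)))%:E); last by rewrite lee_fin.
    rewrite !EFinM lee_wpmul2l ?lee_fin ?mulr_ge0//.
    case: ifP => _; case: ifP => _; rewrite ?mul0e ?mule0 -?EFinM ?lee_fin ?mulr_ge0 ?subr_ge0//.
- exists (cst 0); split=> //; last by rewrite integral0 lee_fin.
  by move=> [x y] ? ?; rewrite jacobian_flat//; exact: H.
- have [m1 [mm1 m10 m1P m1A]] := IA h1 yy; have [m2 [mm2 m20 m2P m2A]] := IB h2 yy.
  (* On the common side neither half gives a bound; the value [+oo] covers these points at no cost,
     as the line is a null set. *)
  pose D : set (R * R) := [set x1] `*` [set: R].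
  have mD : measurable D by apply: measurableX.
  have mDp : measurable_fun setT ((cst +oo : R * R -> \bar R) \_ D).
    by apply/(measurable_restrictT _ mD); exact: measurable_cst.
  have D0 p : 0 <= ((cst +oo : R * R -> \bar R) \_ D) p by rewrite patchE; case: ifP => _; rewrite /= ?le0y.
  exists (fun p => m1 p + m2 p + ((cst +oo : R * R -> \bar R) \_ D) p); split.
  + by apply: emeasurable_funD => //; exact: emeasurable_funD.
  + by move=> p; rewrite !adde_ge0.
  + move=> p /andP[p0 p2] py; have [px|px|px] := ltgtP p.1 x1.
    * apply: (@le_trans _ _ (m1 p)); first by apply: m1P; rewrite ?p0.
      by rewrite -addeA leeDl// adde_ge0.
    * apply: (@le_trans _ _ (m2 p)); first by apply: m2P; rewrite ?px.
      by rewrite addeAC leeDr// adde_ge0.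
    * by rewrite patchE ifT ?inE//= addey ?leey// gt_eqF// (lt_le_trans _ (adde_ge0 _ _))// ltNy0.
  + rewrite ge0_integralD//; [|by move=> *; rewrite adde_ge0|exact: emeasurable_funD].
    rewrite ge0_integralD// -integral_mkcond integral_cst//.
    have muD : product_measure1 mu mu D = 0.
      by rewrite /D product_measure1E//= lebesgue_measure_set1 mul0e.
    rewrite [X in _ * X]muD mule0 adde0.
    by rewrite EFinD leeD.
- have [m1 [mm1 m10 m1P m1A]] := IA xx h1; have [m2 [mm2 m20 m2P m2A]] := IB xx h2.
  pose D : set (R * R) := [set: R] `*` [set y1].
  have mD : measurable D by apply: measurableX.
  have mDp : measurable_fun setT ((cst +oo : R * R -> \bar R) \_ D).
    by apply/(measurable_restrictT _ mD); exact: measurable_cst.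
  have D0 p : 0 <= ((cst +oo : R * R -> \bar R) \_ D) p by rewrite patchE; case: ifP => _; rewrite /= ?le0y.
  exists (fun p => m1 p + m2 p + ((cst +oo : R * R -> \bar R) \_ D) p); split.
  + by apply: emeasurable_funD => //; exact: emeasurable_funD.
  + by move=> p; rewrite !adde_ge0.
  + move=> p px /andP[p0 p2]; have [py|py|py] := ltgtP p.2 y1.
    * apply: (@le_trans _ _ (m1 p)); first by apply: m1P; rewrite ?p0.
      by rewrite -addeA leeDl// adde_ge0.
    * apply: (@le_trans _ _ (m2 p)); first by apply: m2P; rewrite ?py.
      by rewrite addeAC leeDr// adde_ge0.
    * by rewrite patchE ifT ?inE//= addey ?leey// gt_eqF// (lt_le_trans _ (adde_ge0 _ _))// ltNy0.
  + rewrite ge0_integralD//; [|by move=> *; rewrite adde_ge0|exact: emeasurable_funD].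
    rewrite ge0_integralD// -integral_mkcond integral_cst//.
    have muD : product_measure1 mu mu D = 0.
      by rewrite /D product_measure1E//= lebesgue_measure_set1 mule0.
    rewrite [X in _ * X]muD mule0 adde0.
    by rewrite EFinD leeD.
Qed.

End Soundness.

(** * From a homotopy of two paths to a square with four given sides *)

Section Bigon.
Variables (R : realType) (V : choiceType) (K : complex V).
Local Notation X := (realization R K).
Implicit Types (S : R -> X) (A B T L : R).

(** The square factors through the curve [S], by a parameter that is affine along every coordinate
    line. So it is flat by the third case of [flat_at], whatever the curve. *)
Lemma sq_bilinear S L c0 c1 c2 c3 x0 x1 y0 y1 : 0 <= L -> glip L S -> 0 <= x0 -> x1 <= 3 -> 0 <= y0 -> y1 <= 3 ->
  let psi x y := c0 + c1 * x + c2 * y + c3 * x * y in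
  sq 0 x0 x1 y0 y1 (fun x => S (psi x y0)) (fun x => S (psi x y1)) (fun y => S (psi x0 y)) (fun y => S (psi x1 y)).
Proof.
move=> L0 SL x00 x13 y00 y13 psi.
pose M := `|c1| + `|c2| + 3 * `|c3|.
have M0 : 0 <= M by rewrite !addr_ge0// mulr_ge0.
have lin (u : R -> R) (m : R) a b : `|m| <= M -> (forall s t, u t - u s = m * (t - s)) -> lipc a b (L * M) (S \o u).
  move=> mM uE; apply: (@lipc_comp _ _ _ (Num.min (u a) (u b)) (Num.max (u a) (u b)) _ _ _ _ S u L0).
  - exact: glip_lipc.
  - move=> s t _ st _; rewrite uE normrM (ger0_norm (x := t - s)) ?subr_ge0//.
    by rewrite ler_wpM2r// subr_ge0.
  - move=> t /andP[ta tb]; have E1 := uE a t; have E2 := uE t b.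
    rewrite ge_min le_max; have [m0|m0] := leP 0 m.
      have h1 : u a <= u t by rewrite -subr_ge0 E1 mulr_ge0// subr_ge0.
      by have h2 : u t <= u b by [rewrite -subr_ge0 E2 mulr_ge0// subr_ge0]; rewrite h1 h2 orbT.
    have h1 : u t <= u a by rewrite -subr_le0 E1 nmulr_rle0 ?subr_ge0.
    by have h2 : u b <= u t by [rewrite -subr_le0 E2 nmulr_rle0 ?subr_ge0]; rewrite h1 h2 orbT.
have c3M a : 0 <= a <= 3 -> `|c3 * a| <= 3 * `|c3|.
  by move=> /andP[a0 a3]; rewrite normrM (ger0_norm a0); have := normr_ge0 c3; nra.
have xl : xlip (fun x y => S (psi x y)) x0 x1 y0 y1 (L * M).
  move=> y /andP[yy0 yy1]; apply: (lin (fun x => psi x y) (c1 + c3 * y)); last by move=> s t; rewrite /psi; ring.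
  apply: le_trans (ler_normD _ _) _; have := c3M y; rewrite (le_trans y00 yy0) (le_trans yy1 y13) => /(_ isT).
  by have := normr_ge0 c2; rewrite /M; lra.
have yl : ylip (fun x y => S (psi x y)) x0 x1 y0 y1 (L * M).
  move=> x /andP[xx0 xx1]; apply: (lin (psi x) (c2 + c3 * x)); last by move=> s t; rewrite /psi; ring.
  apply: le_trans (ler_normD _ _) _; have := c3M x; rewrite (le_trans x00 xx0) (le_trans xx1 x13) => /(_ isT).
  by have := normr_ge0 c1; rewrite /M; lra.
exists (fun x y => S (psi x y)), (L * M); split=> //; first by rewrite mulr_ge0.
apply: cert_flat => // x y _ _; right; right.
exists (fun t => S (psi x y + t)), (c1 + c3 * y), (c2 + c3 * x), 1; split=> // t _.
by split; congr S; rewrite /psi; ring.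
Qed.

(** The square is cut into a 3 by 3 grid. The middle cell carries the homotopy, with two sides
    collapsed to the points [x] and [z]; the eight others factor through the boundary curve and cost
    nothing. *)
Lemma bigon_square A (x y y' z : X) (b t l r : R -> X) : mpath 1 x y b -> mpath 1 y z r ->
  mpath 1 x y' l -> mpath 1 y' z t -> mhom (1 + 1) (1 + 1) A (pcat 1 b r) (pcat 1 l t) ->
  sq A 0 1 0 1 b t l r.
Proof.
move=> pb pr pl pt [T [T0 T2 _ H]].
have [_ [[L L0 SL] [S0 S1]]] := mpath_cat pb pr.
have [_ [[L' L0' SL'] [S0' S1']]] := mpath_cat pl pt.
have {}H : lhom (2 * 0 + 0) (2 * 1 + 0) A (pcat 1 b r) (pcat 1 l t).
  have T20 : 0 < T / 2 by rewrite divr_gt0//; lra.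
  have E : (T / 2) * 2 = T by rewrite divfK.
  have H1 : lhom (T / 2 * 0 + 0) (T / 2 * 2 + 0) A (pcat 1 b r) (pcat 1 l t).
    by rewrite mulr0 !addr0 E.
  have {}H1 := lhom_aff T20 H1.
  rewrite mulr0 mulr1 !addr0.
  have rep P M : 0 <= M -> glip M P -> (forall t, 1 + 1 <= t -> P t = z) ->
      lhom 0 2 0 P (fun s : R => P (T / 2 * s + 0)).
    move=> M0 PM P2; pose u s : R := T / 2 * s.
    apply: (@lhom_ext _ _ _ _ _ _ (P \o id) (P \o (fun s => Num.min (u s) 2))) => //.
      move=> s _ /=; rewrite addr0 -/(u s); case: (leP (u s) 2) => // h.
      by rewrite !P2//; lra.
    apply: (@lhom_reparam _ _ _ (-1) 3 M (T / 2)) => //; try lra.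
    - exact: glip_lipc.
    - by move=> s t0 _ st _; rewrite ger0_norm ?subr_ge0//; nra.
    - move=> s t0 _ st _; rewrite /u.
      have h : T / 2 * t0 - T / 2 * s = T / 2 * (t0 - s) by ring.
      have h0 : 0 <= T / 2 * (t0 - s) by rewrite mulr_ge0// ?subr_ge0// ltW.
      by rewrite ler_norml; case: (leP (T / 2 * s) 2); case: (leP (T / 2 * t0) 2) => *; apply/andP; split; lra.
    - move=> s /andP[s0 s2]; have : 0 <= u s by rewrite mulr_ge0// ltW.
      by case: (leP (u s) 2) => *; split; apply/andP; split; lra.
    - by rewrite /u mulr0; case: leP; lra.
    - by rewrite /u E; case: leP; lra.
  rewrite -[A]add0r; apply: lhom_trans (rep _ _ L0 SL S1) _ => //.
  rewrite -[A]addr0; apply: lhom_trans H1 (lhom_sym _ (rep _ _ L0' SL' S1')) => //.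
(* The boundary curve with [x] at 0: it follows [b] and [r] in positive direction, [l] and [t] in
   negative direction, and rests at [z] from 2 and from -2 on. *)
pose S s := if 0 <= s then pcat 1 b r s else pcat 1 l t (- s).
(* The same curve cut at [x] and joined at [z]; the top right cell is centered there. *)
pose S' s := if 0 <= s then S (-2 + s) else S (2 + s).
have SP s : 0 <= s -> S s = pcat 1 b r s by rewrite /S => ->.
have SN s : s <= 0 -> S s = pcat 1 l t (- s).
  rewrite /S; case: ifPn => // s0 s0'; have -> : s = 0 by lra.
  by rewrite oppr0 S0 ?S0'.
have Sge s : 2 <= s -> S s = z by move=> s2; rewrite SP ?S1//; lra.
have Sle s : s <= -2 -> S s = z by move=> s2; rewrite SN ?S1'//; lra.
have L2 : 0 <= Num.max L L' by rewrite le_max L0.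
have Sglip : glip (Num.max L L') S.
  move=> s u su.
  have H1 v : lipc v 0 (Num.max L L') S.
    apply: (lipc_eq (c := fun s => pcat 1 l t (- s))) => [w /andP[_ w0]|]; first by rewrite SN.
    by apply: lipc_opp; apply: (lipc_le _ (glip_lipc SL')); rewrite le_max lexx orbT.
  have H2 v : lipc 0 v (Num.max L L') S.
    apply: (lipc_eq (c := pcat 1 b r)) => [w /andP[w0 _]|]; first by rewrite SP.
    by apply: (lipc_le _ (glip_lipc SL)); rewrite le_max lexx.
  by apply: (lipc_glue (H1 (Num.min s 0)) (H2 (Num.max u 0))); rewrite ?ge_min ?le_max ?lexx.
have SP' s : 0 <= s -> S' s = S (-2 + s) by rewrite /S' => ->.
have SN' s : s <= 0 -> S' s = S (2 + s).
  rewrite /S'; case: ifPn => // s0 s0'; have -> : s = 0 by lra.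
  by rewrite !addr0 (Sge 2)// Sle.
have S'glip : glip (Num.max L L') S'.
  move=> s u su.
  have sh c v w : lipc v w (Num.max L L') (fun s => S (c + s)).
    move=> s1 u1 _ su1 _; have -> : u1 - s1 = (c + u1) - (c + s1) by ring.
    by apply: Sglip; rewrite lerD2l.
  have H1 v : lipc v 0 (Num.max L L') S'.
    by apply: (lipc_eq _ (sh 2 _ _)) => w /andP[_ w0]; rewrite SN'.
  have H2 v : lipc 0 v (Num.max L L') S'.
    by apply: (lipc_eq _ (sh (-2) _ _)) => w /andP[w0 _]; rewrite SP'.
  by apply: (lipc_glue (H1 (Num.min s 0)) (H2 (Num.max u 0))); rewrite ?ge_min ?le_max ?lexx.
(* The horizontal and vertical lines of the grid, as curves on [0, 3]. The middle thirds of [h1] and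
   [h2] run through the two sides of the bigon, and [v1] and [v2] rest at [x] and at [z]. *)
pose h0 s := S (s / 3). pose h3 s := S (-1 - s / 3).
pose v0 s := S (- (s / 3)). pose v3 s := S (1 + s / 3).
pose h1 s := if s <= 1 then S ((s - 1) / 3) else if s <= 2 then S (2 * (s - 1)) else S (2 - 2 / 3 * (s - 2)).
pose h2 s := if s <= 1 then S (2 / 3 * (s - 1)) else if s <= 2 then S (-2 * (s - 1)) else S (2 - (s - 2) / 3).
pose v1 s := if s <= 1 then S ((1 - s) / 3) else if s <= 2 then S 0 else S (- (4 / 3 * (s - 2))).
pose v2 s := if s <= 1 then S (2 / 3 + 4 / 3 * s) else if s <= 2 then S 2 else S (-2 + (s - 2) / 3).
clearbody S S'.
have z2 : S (-2) = S 2 by rewrite Sle ?Sge.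
have a01 s : s <= 1 -> (h1 s = S ((s - 1) / 3)) * (h2 s = S (2 / 3 * (s - 1))) *
    (v1 s = S ((1 - s) / 3)) * (v2 s = S (2 / 3 + 4 / 3 * s)).
  by move=> s1; rewrite /h1 /h2 /v1 /v2 s1.
have a12 s : 1 <= s -> s <= 2 -> (h1 s = S (2 * (s - 1))) * (h2 s = S (-2 * (s - 1))) *
    (v1 s = S 0) * (v2 s = S 2).
  move=> s1 s2; rewrite /h1 /h2 /v1 /v2 s2; case: leP => // s1'.
  have -> : s = 1 by lra.
  by do !split; congr S; clear -R V K; lra.
have a23 s : 2 <= s -> (h1 s = S (2 - 2 / 3 * (s - 2))) * (h2 s = S (2 - (s - 2) / 3)) *
    (v1 s = S (- (4 / 3 * (s - 2)))) * (v2 s = S (-2 + (s - 2) / 3)).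
  move=> s2; rewrite /h1 /h2 /v1 /v2; case: leP => s1; first absurd_lra.
  case: leP => // s2'; have -> : s = 2 by lra.
  have -> : -2 * (2 - 1) = -2 :> R by clear -R V K; lra.
  have -> : -2 + (2 - 2) / 3 = -2 :> R by clear -R V K; lra.
  rewrite z2; do !split; congr S; clear -R V K; lra.
clearbody h1 h2 v1 v2.
have BL : sq 0 0 1 0 1 h0 h1 v0 v1.
  have /= := @sq_bilinear S _ 0 (1/3) (-1/3) 0 0 1 0 1 L2 Sglip ltac:(lra) ltac:(lra) ltac:(lra) ltac:(lra).
  by apply: sq_ext => s /andP[s0 s1]; rewrite /h0 /v0 (a01 s)//; split; congr S; clear -R V K; lra.
have BM : sq 0 1 2 0 1 h0 h1 v1 v2.
  have /= := @sq_bilinear S _ 0 (1/3) (-2) (5/3) 1 2 0 1 L2 Sglip ltac:(lra) ltac:(lra) ltac:(lra) ltac:(lra).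
  apply: sq_ext => s /andP[s0 s1]; first by rewrite /h0 (a12 s)//; split; congr S; clear -R V K; lra.
  by rewrite !(a01 s)//; split; congr S; clear -R V K; lra.
have BR : sq 0 2 3 0 1 h0 h1 v2 v3.
  have /= := @sq_bilinear S _ 0 (1/3) (10/3) (-1) 2 3 0 1 L2 Sglip ltac:(lra) ltac:(lra) ltac:(lra) ltac:(lra).
  apply: sq_ext => s /andP[s0 s1]; first by rewrite /h0 (a23 s)//; split; congr S; clear -R V K; lra.
  by rewrite /v3 (a01 s)//; split; congr S; clear -R V K; lra.
have LM : sq 0 0 1 1 2 h1 h2 v0 v1.
  have /= := @sq_bilinear S _ 0 0 (-1/3) (1/3) 0 1 1 2 L2 Sglip ltac:(lra) ltac:(lra) ltac:(lra) ltac:(lra).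
  apply: sq_ext => s /andP[s0 s1]; first by rewrite !(a01 s)//; split; congr S; clear -R V K; lra.
  by rewrite /v0 (a12 s)//; split; congr S; clear -R V K; lra.
have RM : sq 0 2 3 1 2 h1 h2 v2 v3.
  have /= := @sq_bilinear S _ 4 (-1) (-2/3) (1/3) 2 3 1 2 L2 Sglip ltac:(lra) ltac:(lra) ltac:(lra) ltac:(lra).
  apply: sq_ext => s /andP[s0 s1]; first by rewrite !(a23 s)//; split; congr S; clear -R V K; lra.
  by rewrite /v3 (a12 s)//; split; congr S; clear -R V K; lra.
have MM : sq A 1 2 1 2 h1 h2 v1 v2.
  have H1 : lhom (2 * 1 + -2) (2 * 2 + -2) A (pcat 1 b r) (pcat 1 l t).
    by move: H; rewrite !mulr0 !addr0; have -> : 2 * 1 - 2 = 0 :> R by [ring]; have -> : 2 * 2 - 2 = 2 * 1 :> R by ring.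
  have {}H1 := lhom_aff (ltr0n R 2) H1.
  have H2 : sq A 1 2 (1 * 1 + -1) (1 * 2 + -1) (fun s => pcat 1 b r (2 * s - 2)) (fun s => pcat 1 l t (2 * s - 2)) (fun=> x) (fun=> z).
    have -> : 1 * 1 + -1 = 0 :> R by ring. have -> : 1 * 2 + -1 = 1 :> R by ring.
    by move: H1; rewrite /lhom S0 ?S1//; lra.
  apply: sq_ext (sq_yaff ltr01 H2) => s /andP[s1 s2]; rewrite !(a12 s)//; last by rewrite (Sge 2)// SP// S0.
  rewrite SP ?SN; [|lra..].
  by split; congr pcat; clear -R V K; lra.
have TL : sq 0 0 1 2 3 h2 h3 v0 v1.
  have /= := @sq_bilinear S _ 0 (8/3) (-1/3) (-1) 0 1 2 3 L2 Sglip ltac:(lra) ltac:(lra) ltac:(lra) ltac:(lra).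
  apply: sq_ext => s /andP[s0 s1]; first by rewrite /h3 (a01 s)//; split; congr S; clear -R V K; lra.
  by rewrite /v0 (a23 s)//; split; congr S; clear -R V K; lra.
have TM : sq 0 1 2 2 3 h2 h3 v1 v2.
  have /= := @sq_bilinear S _ 8 (-16/3) (-3) (5/3) 1 2 2 3 L2 Sglip ltac:(lra) ltac:(lra) ltac:(lra) ltac:(lra).
  apply: sq_ext => s /andP[s0 s1]; first by rewrite /h3 (a12 s)//; split; congr S; clear -R V K; lra.
  by rewrite !(a23 s)//; split; congr S; clear -R V K; lra.
have TR : sq 0 2 3 2 3 h2 h3 v2 v3.
  have /= := @sq_bilinear S' _ 0 (-1/3) (1/3) 0 2 3 2 3 L2 S'glip ltac:(lra) ltac:(lra) ltac:(lra) ltac:(lra).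
  apply: sq_ext => s /andP[s2 s3].
    rewrite /h3 (a23 s)// SN'; last lra.
    rewrite SP'; last lra.
    by split; congr S; clear -R V K; lra.
  rewrite /v3 (a23 s)// SP'; last lra.
  rewrite SN'; last lra.
  by split; congr S; clear -R V K; lra.
have row (i j : R) (u w : R -> X) B : sq 0 0 1 i j u w v0 v1 -> sq B 1 2 i j u w v1 v2 -> sq 0 2 3 i j u w v2 v3 ->
    sq B 0 3 i j u w v0 v3.
  move=> q1 q2 q3; have := sq_hglue _ _ (sq_hglue ler01 _ q1 q2) q3.
  by rewrite add0r addr0; apply; rewrite ?ler0n ?ler_nat// ler1n.
have G := sq_vglue _ _ (sq_vglue ler01 _ (row _ _ _ _ _ BL BM BR) (row _ _ _ _ _ LM MM RM)) (row _ _ _ _ _ TL TM TR).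
rewrite add0r addr0 in G; have {}G := G (ler0n _ 2) _ (ler1n _ 2).
have {}G : sq A (3 * 0 + 0) (3 * 1 + 0) (3 * 0 + 0) (3 * 1 + 0) h0 h3 v0 v3.
  by rewrite !mulr0 !mulr1 !addr0; apply: G; rewrite ler_nat.
have := sq_yaff (ltr0n R 3) (sq_xaff (ltr0n R 3) G).
have th (s : R) : (3 * s + 0) / 3 = s by rewrite addr0 mulrC mulKf.
apply: sq_ext => s /andP[s0 s1]; rewrite /h0 /h3 /v0 /v3 th.
  rewrite SP// SN; last lra.
  rewrite /pcat s1; case: leP => h.
    have -> : s = 0 by lra.
    split=> //; have [_ [_ [t0 _]]] := pt; have [_ [_ [_ l1]]] := pl; rewrite t0// l1//; lra.
  by split=> //; congr t; lra.
rewrite SN ?SP; [|lra..].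
rewrite /pcat opprK s1; case: leP => h.
  have -> : s = 0 by lra.
  split=> //; have [_ [_ [r0 _]]] := pr; have [_ [_ [_ b1]]] := pb; rewrite r0// b1//; lra.
by split=> //; congr r; lra.
Qed.

End Bigon.

(** * Fillings of short curves and of loops of words *)

Section DiscFilling.
Variables (R : realType) (V : choiceType) (K : complex V).
Local Notation X := (realization R K).

Definition clamp (a b x : R) := Num.max a (Num.min b x).

Lemma clamp_in a b x : a <= b -> a <= clamp a b x <= b.
Proof. by move=> ab; rewrite /clamp le_max lexx ge_max ab ge_min lexx. Qed.

Lemma clamp_id a b x : a <= x <= b -> clamp a b x = x.
Proof. by move=> /andP[ax xb]; rewrite /clamp min_r// max_r. Qed.

Lemma clamp_hi a b x : a <= b -> b <= x -> clamp a b x = b.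
Proof. by move=> ab bx; rewrite /clamp min_l// max_r. Qed.

Lemma clamp_lo a b x : a <= b -> x <= a -> clamp a b x = a.
Proof. by move=> ab xa; rewrite /clamp max_l// ge_min xa orbT. Qed.

Lemma clamp_lip a b x y : `|clamp a b x - clamp a b y| <= `|x - y|.
Proof.
wlog xy : x y / x <= y.
  by move=> H; have [|/ltW] := leP x y; [exact: H|rewrite (distrC x) (distrC (clamp a b x)); exact: H].
have H : `|x - y| = y - x by rewrite distrC ger0_norm ?subr_ge0.
rewrite H ler_norml /clamp; clear H.
case: (leP b x) => h1; case: (leP b y) => h2; case: (leP a b) => h3;
  case: (leP a x) => h4; case: (leP a y) => h5; apply/andP; split; lra.
Qed.

(** A map of the inscribed square is extended to the disc by clamping both coordinates. Outside the
    square it does not depend on one of them, so no area is added. On the circle it is the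
    projection of each arc to a side, which dictates the boundary values. *)
Lemma square_filling (f : R * R -> X) s A : 0 < s -> s ^+ 2 *+ 2 = 1 ->
  sq A (- s) s (- s) s (fun x => f (x, - Num.sqrt (1 - x ^+ 2))) (fun x => f (x, Num.sqrt (1 - x ^+ 2)))
    (fun y => f (- Num.sqrt (1 - y ^+ 2), y)) (fun y => f (Num.sqrt (1 - y ^+ 2), y)) ->
  (filling_area f <= A%:E)%E.
Proof.
move=> s0 s2 [g [L [[L0 [xl yl]] cg H1 H2]]].
have ss : - s <= s by lra.
pose cl := clamp (- s) s.
pose h x y := g (cl x) (cl y).
have cin x : - s <= cl x <= s := clamp_in x ss.
have gE x y : - s <= x <= s -> - s <= y <= s -> h x y = g x y by move=> ? ?; rewrite /h /cl !clamp_id.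
apply: (@le_trans _ _ (area (fun p => h p.1 p.2))).
  apply: ereal_inf_lbound; exists (fun p => h p.1 p.2) => //; split.
    exists (L * 2) => -[x y] [x' y'] _ _ /=.
    set a := cl x; set b := cl y; set a' := cl x'; set b' := cl y'.
    (* The path distance is bounded by the image of a straight segment, which stays in the
       square. *)
    pose c t := g (a + t * (a' - a)) (b + t * (b' - b)).
    have rg u v t : - s <= u <= s -> - s <= v <= s -> 0 <= t <= 1 -> - s <= u + t * (v - u) <= s.
      by move=> /andP[? ?] /andP[? ?] /andP[? ?]; apply/andP; split; nra.
    have aI : - s <= a <= s := cin x; have bI : - s <= b <= s := cin y.
    have aI' : - s <= a' <= s := cin x'; have bI' : - s <= b' <= s := cin y'.
    have cL : lipc 0 1 (L * (`|a' - a| + `|b' - b|)) c.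
      move=> t t' t0 tt t1; have tI : 0 <= t <= 1 by rewrite t0 (le_trans tt).
      have tI' : 0 <= t' <= 1 by rewrite t1 (le_trans t0).
      apply: le_trans (mdist_triangle (g (a + t' * (a' - a)) (b + t * (b' - b))) _ _) _.
      have A1 := rg _ _ _ aI aI' tI; have A2 := rg _ _ _ aI aI' tI'.
      have B1 := rg _ _ _ bI bI' tI; have B2 := rg _ _ _ bI bI' tI'.
      have D1 := lipcP L0 (xl _ B1) A1 A2; have D2 := lipcP L0 (yl _ A2) B1 B2.
      apply: le_trans (lerD D1 D2) _.
      have n1 u v : `|u + t * (v - u) - (u + t' * (v - u))| = (t' - t) * `|v - u|.
        have -> : u + t * (v - u) - (u + t' * (v - u)) = - ((t' - t) * (v - u)) by ring.
        by rewrite normrN normrM ger0_norm// subr_ge0.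
      by rewrite !n1 le_eqVlt; apply/orP; left; apply/eqP; ring.
    have LL : 0 <= L * (`|a' - a| + `|b' - b|) by rewrite mulr_ge0// addr_ge0.
    have := lipc_path_dist LL cL (lexx 0) ler01 (lexx 1).
    rewrite /c !mul0r !addr0 !mul1r !(addrC _ (_ - _)) !subrK subr0 mulr1 => /le_trans; apply.
    rewrite lee_fin -mulrA ler_wpM2l// mulr2n mulrDl mul1r.
    have nx : `|x - x'| <= `|(x, y) - (x', y')| by rewrite prod_normE/= le_max lexx.
    have ny : `|y - y'| <= `|(x, y) - (x', y')| by rewrite prod_normE/= le_max lexx orbT.
    apply: lerD; first by rewrite distrC; apply: le_trans (clamp_lip _ _ _ _) nx.
    by rewrite distrC; apply: le_trans (clamp_lip _ _ _ _) ny.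
  move=> [x y] /= xy; rewrite /circle /= in xy.
  have root (u v : R) : u ^+ 2 + v ^+ 2 = 1 -> 0 <= v -> Num.sqrt (1 - u ^+ 2) = v.
    by move=> uv v0; rewrite (_ : 1 - u ^+ 2 = v ^+ 2) ?sqrtr_sqr ?ger0_norm//; lra.
  have sqs u : (u ^+ 2 <= s ^+ 2) = (- s <= u <= s).
    by rewrite -ler_norml -(real_normK (num_real u)) ler_sqr ?nnegrE ?normr_ge0// ltW.
  have [xs|xs] := boolP (- s <= x <= s).
    have x2 : x ^+ 2 <= s ^+ 2 by rewrite sqs.
    have [y0|y0] := leP 0 y.
      have ys : s <= y by rewrite -ler_sqr ?nnegrE ?(ltW s0)//; lra.
      by have [_] := H1 x xs; rewrite (root _ _ xy y0) => <-; rewrite /h /cl clamp_id// clamp_hi.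
    have ys : s <= - y by rewrite -ler_sqr ?nnegrE ?(ltW s0) ?sqrrN//; lra.
    have [+ _] := H1 x xs; rewrite (root x (- y)) ?sqrrN ?opprK//; last lra.
    by move=> <-; rewrite /h /cl clamp_id// clamp_lo//; lra.
  have x2 : s ^+ 2 < x ^+ 2 by rewrite ltNge sqs.
  have ys : - s <= y <= s by rewrite -sqs; lra.
  have yx : y ^+ 2 + x ^+ 2 = 1 by rewrite addrC.
  have [x0|x0] := leP 0 x.
    have xs' : s <= x by rewrite -ler_sqr ?nnegrE ?(ltW s0)//; lra.
    by have [_] := H2 y ys; rewrite (root _ _ yx x0) => <-; rewrite /h /cl [clamp _ _ y]clamp_id// clamp_hi.
  have xs' : s <= - x by rewrite -ler_sqr ?nnegrE ?(ltW s0) ?sqrrN//; lra.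
  have [+ _] := H2 y ys; rewrite (root y (- x)) ?sqrrN ?opprK//; last lra.
  by move=> <-; rewrite /h /cl [clamp _ _ y]clamp_id// clamp_lo//; lra.
have ch : cert h (- s) s (- s) s A by apply: cert_eq cg => x y xx yy; rewrite gE.
have [m [mm m0 mP mA]] := cert_majorant ss ss ch.
pose mu := @lebesgue_measure R.
pose E : set R := [set - s; s].
pose D1 : set (R * R) := E `*` [set: R].
pose D2 : set (R * R) := [set: R] `*` E.
have mE : measurable E by apply: measurableU.
have mD1 : measurable D1 by apply: measurableX.
have mD2 : measurable D2 by apply: measurableX.
have E0 : mu E = 0%E.
  by apply: countable_lebesgue_measure0; apply: finite_set_countable; exact: finite_set2.
pose n D : R * R -> \bar R := ((cst +oo%E : R * R -> \bar R) \_ D).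
have mn D : measurable D -> measurable_fun setT (n D).
  by move=> mD; apply/(measurable_restrictT _ mD); exact: measurable_cst.
have n0 D p : (0 <= n D p)%E by rewrite /n patchE; case: ifP => _; rewrite /= ?le0y.
(* The lines that carry the sides of the square are null sets; the value [+oo] settles their
   points. *)
pose N p := (m p + (n D1 p + n D2 p))%E.
have mN : measurable_fun setT N by apply: emeasurable_funD => //; apply: emeasurable_funD; exact: mn.
have N0 p : (0 <= N p)%E by rewrite /N !adde_ge0.
have NN p : (0 <= n D1 p + n D2 p)%E by rewrite adde_ge0.
have nN (x : \bar R) : (0 <= x)%E -> x != -oo%E by case: x.
have nE D p : D p -> n D p = +oo%E by move=> Dp; rewrite /n patchE ifT ?inE.
have NyE p : D1 p \/ D2 p -> N p = +oo%E.
  move=> [d|d]; rewrite /N (nE _ _ d).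
    by rewrite addye ?addey ?nN.
  by rewrite addey ?addey ?nN// adde_ge0.
have iN : (\int[(mu \x mu)%E]_p N p <= A%:E)%E.
  rewrite /N ge0_integralD//; last by apply: emeasurable_funD; exact: mn.
  rewrite ge0_integralD//; [|exact: mn..].
  rewrite /n -!integral_mkcond !integral_cst//.
  have e1 : product_measure1 mu mu D1 = (mu E * mu setT)%E by exact: product_measure1E.
  have e2 : product_measure1 mu mu D2 = (mu setT * mu E)%E by exact: product_measure1E.
  rewrite E0 mul0e in e1; rewrite E0 mule0 in e2; rewrite [X in (_ * X + _)%E]e1 [X in (_ + _ * X)%E]e2.
  rewrite !mule0 !adde0.
  exact: mA.
apply: le_trans iN; rewrite /area.
have mdisc : measurable (@disc R).
  apply: closed_measurable2.
  have -> : @disc R = (fun p : R * R => p.1 ^+ 2 + p.2 ^+ 2) @^-1` [set x | x <= 1] by [].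
  apply: closed_comp; last exact: closed_le.
  by move=> p _; apply: cvgD; apply: cvgM; [exact: cvg_fst|exact: cvg_fst|exact: cvg_snd|exact: cvg_snd].
have hi (x t : R) : s < x -> x <= t -> cl x = s /\ cl t = s.
  by move=> sx xt; rewrite /cl !clamp_hi//; lra.
have lo (x t : R) : s < - x -> t <= x -> cl x = - s /\ cl t = - s.
  by move=> sx xt; rewrite /cl !clamp_lo//; lra.
have hx1 (x y t : R) : s < x -> x <= t -> h t y = h x y by move=> a b; rewrite /h; have [-> ->] := hi _ _ a b.
have hx2 (x y t : R) : s < - x -> t <= x -> h t y = h x y by move=> a b; rewrite /h; have [-> ->] := lo _ _ a b.
have hy1 (x y t : R) : s < y -> y <= t -> h x t = h x y by move=> a b; rewrite /h; have [-> ->] := hi _ _ a b.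
have hy2 (x y t : R) : s < - y -> t <= y -> h x t = h x y by move=> a b; rewrite /h; have [-> ->] := lo _ _ a b.
apply: (@le_trans _ _ (\int[(mu \x mu)%E]_(p in @disc R) N p)%E).
  apply: ge0_le_lower_integral => p pd; first by rewrite lee_fin sqrtr_ge0.
  have [p1|p1] := eqVneq `|p.1| s.
    rewrite NyE ?leey//; left; split=> //=; move/eqP: p1; rewrite eqr_norml => /andP[/orP[/eqP|/eqP]]; by [right|left].
  have [p2|p2] := eqVneq `|p.2| s.
    rewrite NyE ?leey//; right; split=> //=; move/eqP: p2; rewrite eqr_norml => /andP[/orP[/eqP|/eqP]]; by [right|left].
  have [p1s|p1s] := ltP s `|p.1|.
    rewrite (_ : Defs.jacobian _ p = 0)//.
    case: p p1s {p1 p2 pd} => x y /=; rewrite lter_normr => /orP[] sx; apply: jacobian_xconst; exists 1 => //.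
      by left => t /andP[xt _]; exact: hx1.
    by right => t /andP[_ xt]; exact: hx2.
  have [p2s|p2s] := ltP s `|p.2|.
    rewrite (_ : Defs.jacobian _ p = 0)//.
    case: p p2s {p1 p2 pd p1s} => x y /=; rewrite lter_normr => /orP[] sx; apply: jacobian_yconst; exists 1 => //.
      by left => t /andP[xt _]; exact: hy1.
    by right => t /andP[_ xt]; exact: hy2.
  apply: (@le_trans _ _ (m p)); last by rewrite /N leeDl.
  apply: mP; first by rewrite -ltr_norml lt_neqAle p1.
  by rewrite -ltr_norml lt_neqAle p2.
by apply: ge0_subset_integral.
Qed.

End DiscFilling.

Lemma uniform_continuity (R : realType) (T : pseudoMetricType R) (Y : metricType R) (A : set T) (H : T -> Y) :
  compact A -> {within A, continuous H} -> forall e, 0 < e -> exists n : nat,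
  forall p q, A p -> A q -> ball p n.+1%:R^-1 q -> mdist (H p) (H q) < e.
Proof.
move=> /compact_near_coveringP cA /subspace_continuousP cH e e0.
pose P n p := A p -> forall q, A q -> ball p n.+1%:R^-1 q -> mdist (H p) (H q) < e.
have [|n _ nP] := cA _ \oo P _.
  move=> p Ap; have /cvg_ballP/(_ (e / 2)) := cH p Ap.
  rewrite near_withinE => /(_ (divr_gt0 e0 (ltr0n R 2)))/nbhs_ballP[d /= d0 dP].
  have [N _ NP] : \forall n \near \oo, (n.+1%:R^-1 : R) < d / 2.
    have d20 : 0 < d / 2 by rewrite divr_gt0.
    exists (Num.truncn (d / 2)^-1) => // n /= nN.
    rewrite -[ltRHS]invrK ltf_pV2 ?posrE ?invr_gt0 ?ltr0n//.
    by apply: lt_le_trans (truncnS_gt _) _; rewrite ler_nat ltnS.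
  exists (ball p (d / 2), [set n | (N <= n)%N]); first split=> /=.
  - by apply: nbhsx_ballx; rewrite divr_gt0.
  - by exists N.
  move=> [p' n] [/= pp' Nn] Ap' q Aq p'q.
  have h1 : mdist (H p) (H p') < e / 2.
    have := dP p' _ Ap'; rewrite ballEmdist; apply.
    by apply: le_ball pp'; rewrite ler_pdivrMr// ler_peMr ?ler1n// ltW.
  have h2 : mdist (H p) (H q) < e / 2.
    have := dP q _ Aq; rewrite ballEmdist; apply.
    rewrite [d]splitr; apply: ball_triangle pp' _.
    by apply: le_ball p'q; exact/ltW/(NP n).
  have tri : mdist (H p') (H q) <= mdist (H p') (H p) + mdist (H p) (H q) := metric_triangle _ _ _.
  have sy : mdist (H p') (H p) = mdist (H p) (H p') := metric_sym _ _.
  by rewrite [e]splitr; lra.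
by exists n => p q Ap; apply: nP => //=.
Qed.

(** Only finitely many lists of a given length have their entries in [U], so the separate bounds
    have a common one. *)
Lemma list_bound (R : realType) (T : eqType) (U : seq T) M (P : seq T -> R -> Prop) :
  (forall s A B, A <= B -> P s A -> P s B) -> (forall s, exists A, P s A) ->
  exists A, forall s, size s = M -> {subset s <= U} -> P s A.
Proof.
elim: M P => [|M IH] P Ple Pex.
  by have [A PA] := Pex [::]; exists A => -[].
have ex u : exists A, forall s, size s = M -> {subset s <= U} -> P (u :: s) A.
  by apply: IH => [s A B|s]; [exact: Ple|exact: Pex].
have [A AP] : exists A, forall u, u \in U -> forall s, size s = M -> {subset s <= U} -> P (u :: s) A.
  elim: {-2}U => [|u W [A AP]]; first by exists 0.
  have [B BP] := ex u; exists (Num.max A B) => w; rewrite in_cons => /predU1P[->|wW] s sM sU.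
    by apply: Ple (BP _ sM sU); rewrite le_max lexx orbT.
  by apply: Ple (AP _ wW _ sM sU); rewrite le_max lexx.
exists A => -[//|u s] /= [sM] sU; apply: AP => //; first by apply: sU; rewrite mem_head.
by move=> w ws; apply: sU; rewrite in_cons ws orbT.
Qed.

(** * Simplicial approximation of paths *)

Section EdgePaths.
Variables (R : realType) (V : choiceType) (K : complex V) (x0 : realization R K).
Local Notation X := (realization R K).
Implicit Types (v w : V).
Local Notation vt := (vert x0).

Definition adj v w := face K [fset v; w]%fset.

Lemma adj_face1 v w : adj v w -> face K [fset v]%fset /\ face K [fset w]%fset.
Proof. by move=> vw; split; apply: face1 vw _; rewrite !inE eqxx ?orbT. Qed.

Lemma adj_compat v w : adj v w -> compat (vt v) (vt w).
Proof.
move=> vw; have [Kv Kw] := adj_face1 vw.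
by apply: (compat_face vw); rewrite vert_supp// fsub1set !inE eqxx ?orbT.
Qed.

Definition edge v w : R -> X := fun t => seg (vt v) (vt w) (clamp 0 1 t).

Lemma mpath_edge v w : adj v w -> mpath 1 (vt v) (vt w) (edge v w).
Proof.
move=> vw; have C := adj_compat vw; split=> //; split.
  exists 2 => // t u tu; rewrite /edge seg_mdist ?clamp_in//.
  apply: (@le_trans _ _ (`|t - u| * 2)).
    by apply: ler_pM => //; [exact: mdist_ge0|exact: clamp_lip|exact: mdist_le2].
  by rewrite distrC ger0_norm ?subr_ge0// mulrC.
by split=> t tt; rewrite /edge; [rewrite clamp_lo// seg0|rewrite clamp_hi// seg1].
Qed.

Fixpoint epath v (s : seq V) : R -> X := if s is w :: s' then pcat 1 (edge v w) (epath w s') else fun=> vt v.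

Lemma mpath_epath (s : seq V) v : path adj v s -> mpath (size s)%:R (vt v) (vt (last v s)) (epath v s).
Proof.
elim: s v => [|w s IH] v /=; first by move=> _; exact: mpath_cst.
by move=> /andP[vw ws]; rewrite -nat1r; apply: mpath_cat (mpath_edge vw) (IH _ ws).
Qed.

Lemma epath_supp (s : seq V) v (z : X) (t : R) : path adj v s -> face K [fset v]%fset -> 0 <= t <= (size s)%:R ->
  (forall i, (i <= size s)%N -> `|t - i%:R| <= 1 -> nth v (v :: s) i \in finsupp z) ->
  (finsupp (epath v s t) `<=` finsupp z)%fset.
Proof.
elim: s v t => [|w s IH] v t /=.
  move=> _ Kv /andP[t0 t1] H; rewrite vert_supp// fsub1set; apply: (H 0%N) => //.
  by rewrite subr0 ger0_norm// (le_trans t1)// ler01.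
move=> /andP[vw ws] Kv /andP[t0 ts] H; rewrite /pcat; case: leP => t1.
  have vz : v \in finsupp z by apply: (H 0%N) => //; rewrite subr0 ger0_norm.
  have wz : w \in finsupp z by apply: (H 1%N) => //; rewrite ler_norml; apply/andP; split; lra.
  have [_ Kw] := adj_face1 vw.
  apply: fsubset_trans (seg_supp (adj_compat vw) (clamp_in _ ler01)) _.
  by rewrite !vert_supp// fsubUset !fsub1set vz.
apply: IH => //; first by have [] := adj_face1 vw.
  by move: ts; rewrite -nat1r => ts; apply/andP; split; lra.
move=> i si ti; have := H i.+1 si; rewrite /= (set_nth_default w)//=; apply.
by rewrite -nat1r opprD addrA.
Qed.

Variable U : {fset V}.

(** The picked vertex has a coordinate so large that it persists at all points closer than 1 over
    the size of [U]. The choice is total, so that [polygon] carries no side condition. *)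
Lemma pick_ex (x : X) : exists v, v \in finsupp x /\ ((finsupp x `<=` U)%fset -> (#|` U|)%:R^-1 <= x v).
Proof.
have [xU|nU] := boolP (finsupp x `<=` U)%fset; first by have [v vx vU] := max_coord xU; exists v.
by have [v vx] := bary_neq0 x; exists v.
Qed.
Definition pickv x := projT1 (cid (pick_ex x)).

Lemma pickv_in x : pickv x \in finsupp x.
Proof. by rewrite /pickv; case: cid => v []. Qed.

Lemma pickv_near (x y : X) : (finsupp x `<=` U)%fset -> mdist x y < (#|` U|)%:R^-1 -> pickv x \in finsupp y.
Proof.
rewrite /pickv; case: cid => v [_ H] /= /H Hv xy; rewrite -bary_gt0.
by have := le_lt_trans (coord_mdist x y v) xy; rewrite ltr_norml => /andP[_]; lra.
Qed.

Variable M : nat.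
Definition verts (f : R -> X) := [seq pickv (f i%:R) | i <- iota 1 M].
Definition polygon (f : R -> X) := epath (pickv (f 0)) (verts f).

Lemma verts_nth f i : (i <= M)%N -> nth (pickv (f 0)) (pickv (f 0) :: verts f) i = pickv (f i%:R).
Proof.
case: i => [//|i] iM /=; rewrite (nth_map 0%N) ?size_iota// nth_iota//.
Qed.

Lemma size_verts f : size (verts f) = M.
Proof. by rewrite size_map size_iota. Qed.

Definition nearby (f h : R -> X) := forall s t : R, 0 <= s <= M%:R -> 0 <= t <= M%:R -> `|s - t| <= 1 ->
  mdist (f s) (h t) < (#|` U|)%:R^-1.

Definition supported (f : R -> X) := forall t, 0 <= t <= M%:R -> (finsupp (f t) `<=` U)%fset.

Let Mi i : (i <= M)%N -> 0 <= (i%:R : R) <= M%:R.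
Proof. by move=> iM; rewrite ler0n ler_nat. Qed.

Lemma approx_path f : supported f -> nearby f f -> path adj (pickv (f 0)) (verts f).
Proof.
move=> fU ff; apply/(pathP (pickv (f 0))) => i; rewrite size_verts => iM.
rewrite (verts_nth f (ltnW iM)) -[nth _ (verts f) i]/(nth (pickv (f 0)) (pickv (f 0) :: verts f) i.+1) verts_nth//.
have h1 : pickv (f i.+1%:R) \in finsupp (f i%:R).
  apply: pickv_near; first by apply: fU; exact: Mi.
  apply: ff; [exact: Mi|by apply: Mi; exact: ltnW|].
  by rewrite -nat1r addrK normr1.
apply: face_sub (bary_face (f i%:R)) _ _; first by rewrite fsubUset !fsub1set pickv_in.
by apply/fset0Pn; exists (pickv (f i%:R)); rewrite !inE eqxx.
Qed.

(** At time [t] the polygon involves only vertices picked at integer times within 1 of [t], and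
    these persist at [h t]. *)
Lemma approx_supp f h t : supported f -> nearby f f -> nearby f h -> 0 <= t <= M%:R ->
  (finsupp (polygon f t) `<=` finsupp (h t))%fset.
Proof.
move=> fU ff fh tM; apply: epath_supp; first exact: approx_path.
- exact: face1 (bary_face (f 0)) (pickv_in _).
- by rewrite size_verts.
move=> i; rewrite size_verts => iM ti; rewrite verts_nth//.
apply: pickv_near; first by apply: fU; exact: Mi.
by apply: fh => //; [exact: Mi|rewrite distrC].
Qed.

Lemma approx_mpath f : supported f -> nearby f f ->
  mpath M%:R (vt (pickv (f 0))) (vt (pickv (f M%:R))) (polygon f).
Proof.
move=> fU ff; have := mpath_epath (approx_path fU ff); rewrite size_verts.
by rewrite (last_nth (pickv (f 0))) size_verts verts_nth.
Qed.

Lemma compat_mid (x y z : X) : (finsupp x `<=` finsupp z)%fset -> (finsupp y `<=` finsupp z)%fset -> compat x y.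
Proof. by move=> xz yz; apply: compat_face (bary_face z) xz yz. Qed.

Lemma approx_hom f L : 0 <= L -> lipc 0 M%:R L f -> supported f -> nearby f f ->
  f 0 = vt (pickv (f 0)) -> f M%:R = vt (pickv (f M%:R)) ->
  exists A, lhom 0 M%:R A f (polygon f).
Proof.
move=> L0 fL fU ff E0 E1; have [_ [[L' L0' aL] [a0 a1]]] := approx_mpath fU ff.
exists (Num.max L L' * 2 * (M%:R - 0)); apply: lhom_straight => //.
- by rewrite le_max L0.
- by apply: lipc_le fL; rewrite le_max lexx.
- by apply: (lipc_le _ (glip_lipc aL)); rewrite le_max lexx orbT.
- by move=> t tM; apply: (@compat_mid _ _ (f t)) => //; exact: approx_supp.
- by rewrite a0.
- by rewrite a1.
Qed.

Lemma approx_hom2 f h : supported f -> nearby f f -> supported h -> nearby h h -> nearby f h ->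
  pickv (f 0) = pickv (h 0) -> pickv (f M%:R) = pickv (h M%:R) ->
  exists A, lhom 0 M%:R A (polygon f) (polygon h).
Proof.
move=> fU ff hU hh fh E0 E1.
have [_ [[L L0 fL] [f0 f1]]] := approx_mpath fU ff.
have [_ [[L' L0' hL] [h0 h1]]] := approx_mpath hU hh.
exists (Num.max L L' * 2 * (M%:R - 0)); apply: lhom_straight => //.
- by rewrite le_max L0.
- by apply: (lipc_le _ (glip_lipc fL)); rewrite le_max lexx.
- by apply: (lipc_le _ (glip_lipc hL)); rewrite le_max lexx orbT.
- by move=> t tM; apply: (@compat_mid _ _ (h t)); exact: approx_supp.
- by rewrite f0// h0// E0.
- by rewrite f1// h1// E1.
Qed.

End EdgePaths.

(** * Lipschitz contractions from continuous ones *)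

Section LipschitzContraction.
Variables (R : realType) (V : choiceType) (K : complex V) (x0 : realization R K).
Local Notation X := (realization R K).
Local Notation vt := (vert x0).
Hypothesis locally_finite : forall v, finite_set [set w | face K [fset v; w]%fset].
Hypothesis sc : simply_connected R K.

Lemma pickv_vert U v : face K [fset v]%fset -> pickv U (vt v) = v.
Proof. by move=> Kv; have := pickv_in U (vt v); rewrite vert_supp// inE => /eqP. Qed.

(** A continuous contraction is sampled on a fine grid. The polygons of consecutive rows run through
    common simplices and are joined by straight homotopies; the area is finite but not
    controlled. *)
Lemma lipschitz_contraction v L (c : R -> X) : face K [fset v]%fset -> 0 <= L -> lipc 0 1 L c ->
  c 0 = vt v -> c 1 = vt v -> exists A, lhom 0 1 A c (fun=> vt v).
Proof.
move=> Kv L0 cL c0 c1; have [_ _ /(_ (vt v) c)[|H [cH H0 H1 H01]]] := sc.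
  by split=> //; exact: lipc_continuous cL.
pose Q : set (R * R) := [set p | p.1 \in `[0, 1] /\ p.2 \in `[0, 1]].
have QE : Q = `[0, 1]%classic `*` `[0, 1]%classic by apply/seteqP; split.
have cQ : compact Q by rewrite QE; apply: compact_setX; exact: segment_compact.
have cHQ : compact (H @` Q) by apply: continuous_compact.
have [U UP] := compact_supp locally_finite cHQ.
have U0 : 0 < (#|` U|)%:R^-1 :> R.
  have Q0 : Q (0, 0) by rewrite QE; split; rewrite /= in_itv /= lexx ler01.
  rewrite invr_gt0 ltr0n cardfs_gt0; apply/fset0Pn.
  have [w wH] := bary_neq0 (H (0, 0)); exists w.
  by apply: (fsubsetP (UP (H (0, 0)) _)) => //; exists (0, 0).
have [n nP] := uniform_continuity cQ cH U0.
(* With [n.+2] the mesh [1 / M] is strictly below the modulus [1 / n.+1]. *)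
pose M := n.+2; have M0 : 0 < M%:R :> R by rewrite ltr0n.
pose f j t := H (j%:R / M%:R, t / M%:R).
have inQ j t : (j <= M)%N -> 0 <= t <= M%:R -> Q (j%:R / M%:R, t / M%:R).
  move=> jM /andP[t0 tM]; rewrite QE; split; rewrite /= in_itv /= divr_ge0//= ler_pdivrMr// mul1r//.
  by rewrite ler_nat.
have near i j s t : (i <= M)%N -> (j <= M)%N -> `|i%:R - j%:R| <= 1 :> R -> 0 <= s <= M%:R ->
    0 <= t <= M%:R -> `|s - t| <= 1 -> mdist (f i s) (f j t) < (#|` U|)%:R^-1.
  move=> iM jM ij sM tM st; apply: nP; [exact: inQ|exact: inQ|].
  have small (a b : R) : `|a - b| <= 1 -> `|a / M%:R - b / M%:R| < n.+1%:R^-1.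
    move=> ab; rewrite -mulrBl normrM (ger0_norm (x := M%:R^-1)) ?invr_ge0//.
    apply: (@le_lt_trans _ _ (1 * M%:R^-1)); first by rewrite ler_wpM2r ?invr_ge0.
    by rewrite mul1r ltf_pV2 ?posrE ?ltr0n// ltr_nat.
  by split; exact: small.
have fU j : (j <= M)%N -> supported U M (f j).
  by move=> jM t tM; apply: UP; exists (j%:R / M%:R, t / M%:R) => //; exact: inQ.
have ff j : (j <= M)%N -> nearby U M (f j) (f j).
  by move=> jM s t sM tM st; apply: near => //; rewrite subrr normr0.
have f0 j : (j <= M)%N -> f j 0 = vt v.
  move=> jM; rewrite /f mul0r; have [] := H01 (j%:R / M%:R) => //.
  by have [] := inQ j 0 jM (introT andP (conj (lexx _) (ltW M0))).
have f1 j : (j <= M)%N -> f j M%:R = vt v.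
  move=> jM; rewrite /f divff ?gt_eqF//; have [] := H01 (j%:R / M%:R) => //.
  by have [] := inQ j 0 jM (introT andP (conj (lexx _) (ltW M0))).
have fE t : 0 <= t <= M%:R -> f 0%N t = c (t / M%:R).
  by move=> tM; rewrite /f mul0r H0//; have [] := inQ 0%N t (leq0n _) tM.
have fM t : 0 <= t <= M%:R -> f M t = vt v.
  by move=> tM; rewrite /f divff ?gt_eqF// H1//; have [] := inQ 0%N t (leq0n _) tM.
have fL : lipc 0 M%:R (L / M%:R) (f 0%N).
  apply: (lipc_eq (c := fun t => c (M%:R^-1 * t + 0))) => [t tM|]; first by rewrite fE// addr0 mulrC.
  apply: lipc_aff; first by rewrite invr_gt0.
  by rewrite mulr0 !addr0 mulVf ?gt_eqF.
have [A0 hA0] : exists A, lhom 0 M%:R A (f 0%N) (polygon x0 U M (f 0%N)).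
  apply: approx_hom fL _ _ _ _; first by rewrite divr_ge0// ltW.
  - exact: fU.
  - exact: ff.
  - by rewrite f0// pickv_vert.
  - by rewrite f1// pickv_vert.
have [A1 hA1] : exists A, lhom 0 M%:R A (polygon x0 U M (f 0%N)) (polygon x0 U M (f M)).
  suff S j : (j <= M)%N -> exists A, lhom 0 M%:R A (polygon x0 U M (f 0%N)) (polygon x0 U M (f j)) by exact: S.
  elim: j => [_|j IH jM].
    have [_ [[L' L0' aL] _]] := approx_mpath x0 (fU 0%N (leq0n _)) (ff 0%N (leq0n _)).
    by exists 0; apply: (lhom_refl L0'); exact: glip_lipc.
  have [A hA] := IH (ltnW jM).
  have [B hB] : exists A, lhom 0 M%:R A (polygon x0 U M (f j)) (polygon x0 U M (f j.+1)).
    have jM' := ltnW jM; apply: approx_hom2; [exact: fU|exact: ff|exact: fU|exact: ff| |by rewrite !f0|by rewrite !f1].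
    move=> s t sM tM st; apply: near => //.
    by rewrite -nat1r opprD addrCA subrr addr0 normrN normr1.
  by exists (A + B); apply: lhom_trans hA hB; exact: ltW.
have E t : 0 <= t <= M%:R -> polygon x0 U M (f M) t = vt v.
  move=> tM; have := approx_supp x0 (fU M (leqnn _)) (ff M (leqnn _)) (ff M (leqnn _)) tM.
  rewrite fM// vert_supp// => S.
  apply: bary_ext => w; rewrite vertE//; have S1 := bary_sum S; rewrite big_seq_fset1 in S1.
  have [->|wv] := eqVneq w v; first by rewrite S1.
  by rewrite fsfun_dflt//; apply: contraNN wv => /(fsubsetP S); rewrite inE.
exists (A0 + A1).
have h : lhom (M%:R * 0 + 0) (M%:R * 1 + 0) (A0 + A1) (fun t => c (t / M%:R)) (fun=> vt v).
  rewrite mulr0 mulr1 !addr0.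
  apply: lhom_ext (lhom_trans (ltW M0) hA0 hA1) => //; exact: ltW.
apply: lhom_ext (lhom_aff M0 h) => // t _.
by rewrite addr0 [M%:R * t]mulrC mulfK ?gt_eqF.
Qed.

End LipschitzContraction.

(** * Uniform fillings of loops of bounded length *)

Section BoundedLoops.
Variables (R : realType) (V : choiceType) (K : complex V) (G : groupType).
Local Notation X := (realization R K).
Variable act : G -> X -> X.
Hypothesis act1 : forall x, act 1%g x = x.
Hypothesis actM : forall g h x, act (g * h)%g x = act g (act h x).
Hypothesis act_iso : forall g x y, path_dist (act g x) (act g y) = path_dist x y.
Hypothesis act_proper : forall A : set X, compact A -> finite_set [set g | (act g @` A) `&` A !=set0].
Variable C : set X.
Hypothesis Ccompact : compact C.
Hypothesis Ccover : \bigcup_g (act g @` C) = setT.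
Hypothesis sc : simply_connected R K.
Variables (y0 : X) (v0 : V).
Hypothesis Kv0 : face K [fset v0]%fset.
Local Notation x0 := (vert y0 v0).
Hypothesis Cx0 : C x0.
Implicit Types (p q : R -> X) (x y z : X).

Let lf := geometric_locally_finite act1 actM act_iso act_proper Ccompact Ccover.

Lemma act_lip g : preserves_lip (act g).
Proof. by move=> a b L c L0 cL; apply: isometry_lipc L0 cL; exact: act_iso. Qed.

(** Such loops stay in one finite subcomplex, so they are close to polygons of fixed length with
    vertices in a finite set. There are finitely many of these, and their uncontrolled filling areas
    have a maximum. *)
Let unit_loop B : 0 <= B -> exists A, forall c, lipc 0 1 B c -> c 0 = x0 -> c 1 = x0 ->
  lhom 0 1 A c (fun=> x0).
Proof.
move=> B0; have [U UP] := reach_supp act1 actM act_iso act_proper Ccompact Ccover [fset v0]%fset B0.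
have UP' c : lipc 0 1 B c -> c 0 = x0 -> forall t, 0 <= t <= 1 -> (finsupp (c t) `<=` U)%fset.
  by move=> cL c0; apply: UP => //; rewrite c0 vert_supp.
have U0 : (0 < #|` U|)%N.
  rewrite cardfs_gt0; apply/fset0Pn; exists v0.
  have cL : lipc 0 1 B (fun=> x0) by exact: lipc_cst.
  have := UP' _ cL erefl 0; rewrite lexx ler01 => /(_ isT)/fsubsetP; apply.
  by rewrite vert_supp// inE.
pose M := (Num.truncn (B * (#|` U|)%:R)).+1; have M0 : 0 < M%:R :> R by rewrite ltr0n.
have BM : B / M%:R < (#|` U|)%:R^-1.
  rewrite ltr_pdivrMr// mulrC ltr_pdivlMr ?ltr0n//; exact: truncnS_gt.
pose P (s : seq V) A := size s = M -> path (adj K) v0 s -> last v0 s = v0 ->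
  lipc 0 M%:R A (epath y0 v0 s) /\ lhom 0 M%:R A (epath y0 v0 s) (fun=> x0).
have [A AP] : exists A, forall s, size s = M -> {subset s <= (U : seq V)} -> P s A.
  apply: list_bound => [s A B' AB PA sM sp sl|s].
    by have [h1 h2] := PA sM sp sl; split; [exact: lipc_le AB h1|exact: lhom_le AB h2].
  have [[sM [sp sl]]|no] := pselect (size s = M /\ path (adj K) v0 s /\ last v0 s = v0); last first.
    by exists 0 => sM sp sl; case: no.
  have [_ [[L L0 eL] [e0 e1]]] := mpath_epath y0 sp; rewrite sM sl in e1.
  have cL : lipc 0 1 (L * M%:R) (fun t => epath y0 v0 s (M%:R * t + 0)).
    by apply: lipc_aff => //; exact: glip_lipc.
  have LM0 : 0 <= L * M%:R by rewrite mulr_ge0// ltW.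
  have c0E : epath y0 v0 s (M%:R * 0 + 0) = x0 by rewrite mulr0 addr0 e0.
  have c1E : epath y0 v0 s (M%:R * 1 + 0) = x0 by rewrite mulr1 addr0 e1.
  have [A hA] := lipschitz_contraction lf sc Kv0 LM0 cL c0E c1E.
  exists (Num.max L A) => _ _ _; split.
    by apply: (lipc_le _ (glip_lipc eL)); rewrite le_max lexx.
  apply: (@lhom_le _ _ _ _ _ A); first by rewrite le_max lexx orbT.
  have i0 : 0 < M%:R^-1 :> R by rewrite invr_gt0.
  have hA' : lhom (M%:R^-1 * 0 + 0) (M%:R^-1 * M%:R + 0) A (fun t => epath y0 v0 s (M%:R * t + 0)) (fun=> x0).
    by rewrite mulr0 !addr0 mulVf ?gt_eqF.
  apply: lhom_ext (lhom_aff i0 hA') => //.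
  by move=> t _; rewrite !addr0 mulrA divff ?gt_eqF// mul1r.
pose L := Num.max (B / M%:R) A.
exists (L * 2 * (M%:R - 0) + A) => c cL c0 c1.
pose f t := c (t / M%:R).
have fin (t : R) : 0 <= t <= M%:R -> 0 <= t / M%:R <= 1.
  by move=> /andP[t0 tM]; rewrite divr_ge0 ?(ltW M0)//= ler_pdivrMr// mul1r.
have fU : supported U M f by move=> t /fin; exact: UP'.
have fL : lipc 0 M%:R (B / M%:R) f.
  apply: (lipc_eq (c := fun t => c (M%:R^-1 * t + 0))) => [t _|]; first by rewrite /f addr0 mulrC.
  by apply: lipc_aff; rewrite ?invr_gt0// mulr0 !addr0 mulVf ?gt_eqF.
have ff : nearby U M f f.
  move=> s t sM tM st; apply: le_lt_trans BM.
  have BM0 : 0 <= B / M%:R by rewrite divr_ge0// ltW.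
  apply: le_trans (lipcP BM0 fL sM tM) _.
  by rewrite ler_piMr// divr_ge0 ?ltW.
have f0 : f 0 = x0 by rewrite /f mul0r.
have fM : f M%:R = x0 by rewrite /f divff ?gt_eqF.
have p0 : pickv U (f 0) = v0 by rewrite f0 pickv_vert.
have pM : pickv U (f M%:R) = v0 by rewrite fM pickv_vert.
have sp := approx_path fU ff.
have sl : last v0 (verts U M f) = v0.
  by rewrite (last_nth v0) size_verts -{1 2}p0 verts_nth.
rewrite p0 in sp.
have sU : {subset verts U M f <= (U : seq V)}.
  move=> w /mapP[i]; rewrite mem_iota add1n ltnS => /andP[_ iM] ->.
  by apply: (fsubsetP (fU i%:R _)); rewrite ?ler0n ?ler_nat//; exact: pickv_in.
have [eL eH] := AP _ (size_verts _ _ _) sU (size_verts _ _ _) sp sl.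
have H1 : lhom 0 M%:R (L * 2 * (M%:R - 0)) f (epath y0 v0 (verts U M f)).
  have aE : polygon y0 U M f = epath y0 v0 (verts U M f) by rewrite /polygon p0.
  have [_ [_ [a0 a1]]] := approx_mpath y0 fU ff; rewrite p0 pM in a0 a1.
  rewrite -aE in eL *; apply: lhom_straight => //.
  - by rewrite /L le_max divr_ge0 ?(ltW M0).
  - by apply: lipc_le fL; rewrite le_max lexx.
  - by apply: lipc_le eL; rewrite le_max lexx orbT.
  - by move=> t tM; apply: (@compat_mid _ _ _ _ _ (f t)) => //; exact: approx_supp.
  - by rewrite a0// f0.
  - by rewrite a1// fM.
have H2 : lhom (M%:R * 0 + 0) (M%:R * 1 + 0) (L * 2 * (M%:R - 0) + A) f (fun=> x0).
  by rewrite mulr0 mulr1 !addr0; apply: lhom_trans H1 eH; exact: ltW.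
apply: lhom_ext (lhom_aff M0 H2) => // t _.
by rewrite /f addr0 [M%:R * t]mulrC mulfK ?gt_eqF.
Qed.

Lemma bounded_loop_filling B T : 0 <= B -> exists A, forall a p, a <= T -> mpath a x0 x0 p -> glip B p ->
  mhom a 0 A p (fun=> x0).
Proof.
move=> B0; pose T1 := Num.max 1 T; have T0 : 0 < T1 by rewrite lt_max ltr01.
have [|A AP] := @unit_loop (B * T1); first by rewrite mulr_ge0// ltW.
exists A => a p aT [a0 [_ [p0 p1]]] pB; have aT1 : a <= T1 by rewrite le_max aT orbT.
exists T1; split=> //; [exact: ltW|exact: ltW|].
have H : lhom (T1^-1 * 0 + 0) (T1^-1 * T1 + 0) A (fun t => p (T1 * t + 0)) (fun=> x0).
  rewrite mulr0 !addr0 mulVf ?gt_eqF//; apply: AP.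
  - by apply: lipc_aff => //; exact: glip_lipc.
  - by rewrite mulr0 addr0 p0.
  - by rewrite mulr1 addr0 p1.
apply: lhom_ext (lhom_aff _ H); rewrite ?invr_gt0//; first exact: ltW.
by move=> t _; rewrite !addr0 mulrA divff ?gt_eqF// mul1r.
Qed.

Definition ljoin D x y := exists2 p, mpath 1 x y p & glip D p.

Lemma mpath_scale a x y p : 0 < a -> mpath a x y p -> mpath 1 x y (fun t => p (a * t)).
Proof.
move=> a0 [_ [[L L0 pL] [p0 p1]]]; split=> //; split.
  exists (L * a) => [|s t st]; first by rewrite mulr_ge0// ltW.
  have -> : L * a * (t - s) = L * (a * t - a * s) by ring.
  by apply: pL; rewrite ler_pM2l.
by split=> t tt; [apply: p0; rewrite pmulr_rle0|apply: p1; rewrite ler_peMr// ltW].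
Qed.

Lemma mpath_ljoin a x y p : 0 < a -> mpath a x y p -> exists2 D, 0 <= D & ljoin D x y.
Proof.
move=> a0 /(mpath_scale a0) pp; have [_ [[L L0 pL] _]] := pp.
by exists L => //; exists (fun t => p (a * t)).
Qed.

Lemma mpath_seg x y : compat x y -> mpath 1 x y (fun t => seg x y (clamp 0 1 t)) /\
  glip 2 (fun t => seg x y (clamp 0 1 t)).
Proof.
move=> xy; have L : glip 2 (fun t => seg x y (clamp 0 1 t)).
  move=> s t st; rewrite seg_mdist ?clamp_in//.
  apply: (@le_trans _ _ (`|s - t| * 2)).
    by apply: ler_pM => //; [exact: mdist_ge0|exact: clamp_lip|exact: mdist_le2].
  by rewrite distrC ger0_norm ?subr_ge0// mulrC.
split=> //; split=> //; split; first by exists 2.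
by split=> t tt; [rewrite clamp_lo// seg0|rewrite clamp_hi// seg1].
Qed.

Lemma lipschitz_connected y : exists2 D, 0 <= D & ljoin D x0 y.
Proof.
have [_ /(_ x0 y)[c [cc c0 c1]] _] := sc.
have c01 : compact (`[0, 1]%classic : set R) by exact: segment_compact.
have [U UP] := compact_supp lf (continuous_compact cc c01).
have inI (t : R) : 0 <= t <= 1 -> (`[0, 1]%classic : set R) t by move=> h; rewrite /= in_itv.
have U0 : 0 < (#|` U|)%:R^-1 :> R.
  rewrite invr_gt0 ltr0n cardfs_gt0; apply/fset0Pn; exists v0.
  have := UP (c 0) (ex_intro2 _ _ 0 (inI 0 _) erefl); rewrite lexx ler01 => /(_ isT)/fsubsetP; apply.
  by rewrite c0 vert_supp// inE.
have [n nP] := uniform_continuity c01 cc U0.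
pose M := n.+2; have M0 : 0 < M%:R :> R by rewrite ltr0n.
pose f t := c (t / M%:R).
have fin (t : R) : 0 <= t <= M%:R -> (`[0, 1]%classic : set R) (t / M%:R).
  by move=> /andP[t0 tM]; apply: inI; rewrite divr_ge0 ?(ltW M0)//= ler_pdivrMr// mul1r.
have fU : supported U M f by move=> t /fin tM; apply: UP; exists (t / M%:R).
have ff : nearby U M f f.
  move=> s t sM tM st; apply: nP; [exact: fin|exact: fin|].
  rewrite /ball /= -mulrBl normrM (ger0_norm (x := M%:R^-1)) ?invr_ge0//.
  apply: (@le_lt_trans _ _ (1 * M%:R^-1)); first by rewrite ler_wpM2r ?invr_ge0.
  by rewrite mul1r ltf_pV2 ?posrE ?ltr0n// ltr_nat.
have ep := approx_mpath y0 fU ff.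
have p0 : pickv U (f 0) = v0 by rewrite /f mul0r c0 pickv_vert.
have fM : f M%:R = y by rewrite /f divff ?gt_eqF.
have [sg _] := mpath_seg (compat_sub (supp_vert y0 (pickv_in U y))).
rewrite p0 fM in ep.
by apply: mpath_ljoin (mpath_cat ep sg); rewrite addr_gt0.
Qed.

Lemma ljoin_le D D' x y : D <= D' -> ljoin D x y -> ljoin D' x y.
Proof.
by move=> DD [p pp pD]; exists p => // s t st; apply: le_trans (pD s t st) _; rewrite ler_wpM2r// subr_ge0.
Qed.

Lemma glip_pcat a D x y z b p q : 0 <= D -> mpath a x y p -> mpath b y z q -> glip D p -> glip D q ->
  glip D (pcat a p q).
Proof.
move=> D0 [a0 [_ [p0 p1]]] [b0 [_ [q0 q1]]] pD qD s t st; rewrite /pcat.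
case: (leP s a) => sa; case: (leP t a) => ta.
- exact: pD.
- apply: le_trans (mdist_triangle (p a) _ _) _.
  have := pD s a sa; have := qD 0 (t - a); rewrite q0// -(p1 a)// subr_ge0 => /(_ (ltW ta)); lra.
- absurd_lra.
- by have := qD (s - a) (t - a); rewrite lerD2r => /(_ st); congr (_ <= _ * _); ring.
Qed.

(** The duration 2 is one unit to a point of a finite net and one unit along a segment. *)
Lemma compact_track : exists2 D, 0 <= D & forall y, C y -> exists2 p, mpath 2 x0 y p & glip D p.
Proof.
pose r (x : X) := sval (cid2 (star_nbhs x)).
have rP x : 0 < r x /\ forall y, mdist x y < r x -> (finsupp x `<=` finsupp y)%fset.
  by rewrite /r; case: cid2.
have [a|s [_ H]] := compact_net (r := r) Ccompact; first by have [] := rP a.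
have [D D2 DP] : exists2 D, 2 <= D & forall z, z \in s -> ljoin D x0 z.
  elim: s {H} => [|z s [D D2 IH]]; first by exists 2.
  have [D' D0' H'] := lipschitz_connected z.
  exists (Num.max D D'); first by rewrite le_max D2.
  move=> w; rewrite in_cons => /predU1P[->|/IH]; first by apply: ljoin_le H'; rewrite le_max lexx orbT.
  by apply: ljoin_le; rewrite le_max lexx.
have D0 : 0 <= D by rewrite (le_trans _ D2).
exists D => // y /H[z zs zy]; have [p pp pD] := DP z zs.
have [q qq] := mpath_seg (compat_sub ((rP z).2 y zy)).
exists (pcat 1 p (fun t => seg z y (clamp 0 1 t))).
  by have := mpath_cat pp q; rewrite -[1 + 1]/(2%:R).
apply: glip_pcat pp q pD _ => // u t ut.
by apply: le_trans (qq u t ut) _; rewrite ler_wpM2r// subr_ge0.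
Qed.

(** The endpoint stays in a finite subcomplex, which only finitely many translates of [C] meet. *)
Lemma finite_bounded_moves B T : 0 <= B -> 0 < T ->
  finite_set [set g | exists a p, [/\ a <= T, mpath a x0 (act g x0) p & glip B p]].
Proof.
move=> B0 T0; have BT : 0 <= B * T by rewrite mulr_ge0// ltW.
have [U UP] := reach_supp act1 actM act_iso act_proper Ccompact Ccover [fset v0]%fset BT.
have cU := @compact_finite_supp R V K U.
apply: sub_finite_set (finite_translates act1 actM act_proper Ccompact cU) => g [a [p [aT [a0 [_ [p0 p1]]] pB]]].
exists (act g x0); last by rewrite actK.
have := UP (fun t => p (T * t + 0)); rewrite mulr0 addr0 p0// vert_supp//.
move=> /(_ _ (fsubset_refl _) 1); rewrite mulr1 addr0 p1// ler01 lexx /=; apply=> //.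
by apply: lipc_aff => //; exact: glip_lipc.
Qed.

End BoundedLoops.

(** * Words as paths, and their fillings *)

Section WordPaths.
Variables (R : realType) (V : choiceType) (K : complex V).
Local Notation X := (realization R K).
Variables (r n : nat).
Hypotheses (r1 : (1 < r)%N) (n1 : (1 < n)%N).
Local Notation G := (Lambda r n).
Local Notation L := ('I_r * 'I_n)%type.
Variable act : G -> X -> X.
Hypothesis act1 : forall x, act 1%g x = x.
Hypothesis actM : forall g h x, act (g * h)%g x = act g (act h x).
Hypothesis act_lip : forall g, preserves_lip (act g).
Variable x0 : X.
Variable P : L -> R -> X.
Hypothesis Pmpath : forall s : L, mpath 1 x0 (act (cgen s.1 s.2) x0) (P s).
Implicit Types (p q : R -> X) (x y z : X) (u v w : words L).

Definition lval (a : L * bool) : G := if a.2 then (cgen a.1.1 a.1.2)^-1%g else cgen a.1.1 a.1.2.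
(** With this choice for inverse letters, a letter followed by its inverse is a literal
    backtracking. *)
Definition lpath (a : L * bool) : R -> X :=
  if a.2 then act (cgen a.1.1 a.1.2)^-1%g \o rpath 1 (P a.1) else P a.1.

Fixpoint wordval w : G := if w is a :: w' then (lval a * wordval w')%g else 1%g.
Fixpoint wpath w : R -> X := if w is a :: w' then pcat 1 (lpath a) (act (lval a) \o wpath w') else fun=> x0.

Lemma lpath_mpath a : mpath 1 x0 (act (lval a) x0) (lpath a).
Proof.
case: a => s [|] /=; rewrite /lpath /lval /=; last exact: Pmpath.
have := mpath_comp (act_lip (cgen s.1 s.2)^-1%g) (mpath_inv (Pmpath s)).
by rewrite -actM mulVg act1.
Qed.

Lemma wordval_cat u v : wordval (u ++ v) = (wordval u * wordval v)%g.
Proof. by elim: u => [|a u IH] /=; rewrite ?mul1g// IH mulgA. Qed.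

Lemma wpath_mpath w : mpath (size w)%:R x0 (act (wordval w) x0) (wpath w).
Proof.
elim: w => [|a w IH] /=; first by rewrite act1; exact: mpath_cst.
rewrite -nat1r actM; apply: mpath_cat (lpath_mpath a) _.
exact: mpath_comp (act_lip _) IH.
Qed.

Lemma pcat_comp (f : X -> X) a p q : f \o pcat a p q = pcat a (f \o p) (f \o q).
Proof. by apply/funext => t; rewrite /pcat /=; case: ifP. Qed.

Lemma act_comp g h p : act g \o (act h \o p) = act (g * h)%g \o p.
Proof. by apply/funext => t /=; rewrite actM. Qed.

Lemma act1_comp p : act 1%g \o p = p.
Proof. by apply/funext => t /=; rewrite act1. Qed.

Lemma wpath_cat u v : wpath (u ++ v) = pcat (size u)%:R (wpath u) (act (wordval u) \o wpath v).
Proof.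
elim: u => [|a u IH] /=.
  by rewrite act1_comp (pcat_cst0 (wpath_mpath v)).
by rewrite IH -nat1r pcatA ?ler0n// pcat_comp act_comp.
Qed.

Lemma glip_act D g p : 0 <= D -> glip D p -> glip D (act g \o p).
Proof. by move=> D0 pD s t st; exact: (@act_lip g s t D p D0 (@glip_lipc _ _ _ D p s t pD) s t (lexx s) st (lexx t)). Qed.

Lemma wpath_glip : exists2 D, 0 <= D & forall w, glip D (wpath w).
Proof.
have [D D0 DP] : exists2 D, 0 <= D & forall s : L, s \in enum [set: L]%SET -> glip D (P s).
  elim: (enum _) => [|s l [D D0 IH]]; first by exists 0.
  have [_ [[B B0 sB] _]] := Pmpath s; exists (Num.max D B); first by rewrite le_max D0.
  have gle E E' q : E <= E' -> glip E q -> glip E' q.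
    by move=> EE H u v uv; apply: le_trans (H u v uv) _; rewrite ler_wpM2r// subr_ge0.
  move=> t; rewrite in_cons => /predU1P[->|/IH]; first by apply: gle sB; rewrite le_max lexx orbT.
  by apply: gle; rewrite le_max lexx.
have PD s : glip D (P s) by apply: DP; rewrite mem_enum inE.
have lD a : glip D (lpath a).
  case: a => s [|]; rewrite /lpath /=; last exact: PD.
  apply: glip_act => // u v uv; rewrite /rpath mdistC.
  have -> : v - u = (1 - u) - (1 - v) by ring.
  by apply: PD; rewrite lerD2l lerN2.
exists D => //; elim=> [|a w IH] /=; first by move=> s t st; rewrite mdistxx mulr_ge0// subr_ge0.
have W := mpath_comp (act_lip (lval a)) (wpath_mpath w).
exact: (glip_pcat D0 (lpath_mpath a) W (lD a) (@glip_act D (lval a) (wpath w) D0 IH)).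
Qed.

Definition whom A u v := wordval u = wordval v /\
  mhom (size u)%:R (size v)%:R A (wpath u) (wpath v).

Lemma whom_refl u : whom 0 u u.
Proof. by split=> //; exact: mhom_refl (wpath_mpath u). Qed.

Lemma whom_sym A u v : whom A u v -> whom A v u.
Proof. by move=> [E H]; split=> //; exact: mhom_sym. Qed.

Lemma whom_le A B u v : A <= B -> whom A u v -> whom B u v.
Proof. by move=> AB [E H]; split=> //; exact: mhom_le H. Qed.

Lemma whom_trans A B u v w : whom A u v -> whom B v w -> whom (A + B) u w.
Proof.
move=> [E H] [E' H']; split; first by rewrite E.
apply: mhom_trans H H'; [exact: wpath_mpath|rewrite E; exact: wpath_mpath|].
by rewrite E E'; exact: wpath_mpath.
Qed.

Lemma whom_cat A B u u' v v' : whom A u u' -> whom B v v' -> whom (A + B) (u ++ v) (u' ++ v').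
Proof.
move=> [E H] [E' H']; apply: (@whom_trans _ _ _ (u' ++ v)); split; rewrite ?wordval_cat ?E ?E'//.
  rewrite !wpath_cat !size_cat !natrD E.
  apply: (mhom_catr _ (wpath_mpath u') _ H); first by rewrite -E; exact: wpath_mpath.
  exact: mpath_comp (act_lip _) (wpath_mpath v).
rewrite !wpath_cat !size_cat !natrD.
apply: (mhom_catl (wpath_mpath u') (mpath_comp (act_lip _) (wpath_mpath v)) _ (mhom_comp (act_lip _) H')).
by rewrite E'; exact: mpath_comp (act_lip _) (wpath_mpath v').
Qed.

Lemma wordval_inv u : wordval (wordV u) = (wordval u)^-1%g.
Proof.
elim: u => [|[s b] u IH]; first by rewrite invg1.
rewrite /wordV /= rev_cons -cats1 wordval_cat -/(wordV u) IH /= mulg1 invgM.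
by congr (_ * _)%g; rewrite /lval /=; case: b => //=; rewrite invgK.
Qed.

Lemma whom_letterV a : whom 0 [:: (a.1, ~~ a.2); a] [::].
Proof.
case: a => s b; split.
  by rewrite /= /lval /=; case: b; rewrite /= mulg1 ?mulgV ?mulVg.
have -> : wpath [:: (s, ~~ b); (s, b)] = pcat 1 (lpath (s, ~~ b)) (act (lval (s, ~~ b)) \o lpath (s, b)).
  rewrite /= (pcat_cst (lpath_mpath (s, b))) //.
rewrite -[2%:R]/(1 + 1); case: b; rewrite /lpath /lval /=.
  rewrite act_comp mulgV act1_comp; exact: mhom_Vr (Pmpath s).
rewrite -pcat_comp.
have := mhom_comp (act_lip (cgen s.1 s.2)^-1%g) (mhom_Vl (Pmpath s)).
have -> // : act (cgen s.1 s.2)^-1%g \o (fun=> act (cgen s.1 s.2) x0) = (fun=> x0) :> (R -> X).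
by apply: boolp.funext => t /=; rewrite -actM mulVg act1.
Qed.

Lemma whom_Vcat u : whom 0 (wordV u ++ u) [::].
Proof.
elim: u => [|[s b] u IH]; first exact: whom_refl.
rewrite /wordV /= rev_cons -cats1 -/(wordV u) -catA /=.
have H := whom_cat (whom_refl (wordV u)) (whom_cat (whom_letterV (s, b)) (whom_refl u)).
by rewrite !addr0 /= in H; rewrite -[0]addr0; exact: whom_trans H IH.
Qed.

Lemma whom_cat2 A u v w : whom A u v -> whom A (w ++ u) (w ++ v).
Proof. by move=> H; have := whom_cat (whom_refl w) H; rewrite add0r. Qed.

Lemma whom_cat1 A u v w : whom A u v -> whom A (u ++ w) (v ++ w).
Proof. by move=> H; have := whom_cat H (whom_refl w); rewrite addr0. Qed.

Definition freegroup := gquot (fun _ _ : words L => False).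

Lemma gcongr_whom u v : gcongr (fun _ _ : words L => False) u v -> whom 0 u v.
Proof.
elim=> [//|x|x|x y _|x y z _ H _ H'|x x' y y' _ H _ H'].
- exact: whom_Vcat.
- exact: whom_refl.
- exact: whom_sym.
- by rewrite -[0]addr0; exact: whom_trans H H'.
- by rewrite -[0]addr0; exact: whom_cat H H'.
Qed.

Let phi (g : freegroup) : G := wordval (repr g).
Let a (i : 'I_r) (p : 'I_n) : freegroup := (\pi_freegroup (letter (i, p)))%qT.

Let phi_pi w : phi (\pi_freegroup w)%qT = wordval w.
Proof. by have [] := gcongr_whom (@gcongr_repr _ (fun _ _ : words L => False) w). Qed.

Let wval_pi (w : seq (L * bool)) : wval a w = (\pi_freegroup (w : words L))%qT.
Proof.
elim: w => [|[[i p] b] w IH] //=; rewrite IH.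
have -> : (((i, p), b) :: w : words L) = ((if b then (letter (i, p))^-1 else letter (i, p)) * (w : words L))%g by case: b.
by rewrite pi_mulg; case: b => //=; rewrite pi_invg.
Qed.

Let phiM g h : phi (g * h)%g = (phi g * phi h)%g.
Proof. by rewrite [LHS]phi_pi wordval_cat. Qed.

Variable A0 : R.
Hypothesis A00 : 0 <= A0.
Hypothesis relator : forall (i j : 'I_r) (p q : 'I_n), p != q ->
  whom A0 [~ letter (i, p), letter (j, q)]%g ([::] : words L).
Hypothesis relator2 : forall (i j : 'I_r) (p q : 'I_n),
  whom A0 ([~ letter (i, p), letter (j, p)] * [~ letter (i, q), letter (j, q)]^-1)%g ([::] : words L).

(** The abstract area is instantiated in the free group by the filling area of word paths. Free
    reduction costs area 0, so the bound passes to every word that represents the same element. *)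
Lemma word_filling : exists2 B, 0 <= B & forall w, wordval w = 1%g ->
  whom (B * ((size w)%:R + 1) ^+ 2) w [::].
Proof.
pose N k (g : freegroup) := exists2 w : words L, g = (\pi_freegroup w)%qT & whom (A0 * k%:R) w [::].
have [p0 [p1 p01]] : exists p0 p1 : 'I_n, p0 != p1.
  by exists (Ordinal (ltnW n1)), (Ordinal n1).
have Np k g w : N k g -> g = (\pi_freegroup w)%qT -> whom (A0 * k%:R) w [::].
  move=> [v -> H] E; have /gcongr_whom H' := (gquotP _ _ _).1 E.
  by have := whom_trans (whom_sym H') H; rewrite add0r.
have phia (i : 'I_r) (p : 'I_n) : phi (a i p) = cgen i p by rewrite /a phi_pi /= mulg1.
have N1 : N 0 1%g by exists [::] => //; rewrite mulr0; exact: whom_refl.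
have NM k l g h : N k g -> N l h -> N (k + l)%N (g * h)%g.
  move=> [u -> H] [v -> H']; exists (u * v)%g; first by rewrite pi_mulg.
  by rewrite natrD mulrDr; exact: whom_cat H H'.
have NV k g : N k g -> N k g^-1%g.
  move=> [u -> H]; exists u^-1%g; first by rewrite pi_invg.
  have := whom_trans (whom_sym (whom_cat2 (wordV u) H)) (whom_Vcat u).
  by rewrite cats0 addr0.
have NJ k g (x : freegroup) : N k g -> N k (g ^ x)%g.
  move=> [u -> H]; elim/quotW: x => x.
  exists (u ^ x)%g; first by rewrite /conjg !pi_mulg pi_invg.
  have := whom_trans (whom_cat2 (wordV x) (whom_cat1 x H)) (whom_Vcat x).
  by rewrite addr0.
have Nle k l g : (k <= l)%N -> N k g -> N l g.
  move=> kl [u -> H]; exists u => //; apply: whom_le H.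
  by rewrite ler_wpM2l// ler_nat.
have R1 (i j : 'I_r) (p q : 'I_n) : p != q -> N 1 [~ a i p, a j q]%g.
  move=> pq; exists [~ letter (i, p), letter (j, q)]%g; last by rewrite mulr1; exact: relator.
  by rewrite /a /commg /conjg !(pi_mulg, pi_invg).
have R2 (i j : 'I_r) (p q : 'I_n) : N 1 ([~ a i p, a j p] * [~ a i q, a j q]^-1)%g.
  exists ([~ letter (i, p), letter (j, p)] * [~ letter (i, q), letter (j, q)]^-1)%g; last by rewrite mulr1; exact: relator2.
  by rewrite /a /commg /conjg !(pi_mulg, pi_invg).
have [C CP] := word_area r1 p01 phiM phia N1 NM NV NJ Nle R1 R2.
exists (A0 * C%:R); first by rewrite mulr_ge0.
move=> w w1; have := CP (w : seq (L * bool)); rewrite wval_pi phi_pi => /(_ w1).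
move=> /Np/(_ erefl); apply: whom_le.
by rewrite natrM mulrA natrM -!natr1 expr2.
Qed.

End WordPaths.

Section PathCancellation.
Variables (R : realType) (V : choiceType) (K : complex V).
Local Notation X := (realization R K).
Implicit Types (p q : R -> X) (x y z : X) (a b A D : R).

Lemma glip_rpath D a p : glip D p -> glip D (rpath a p).
Proof.
move=> pD u v uv; rewrite /rpath mdistC.
have -> : v - u = (a - u) - (a - v) by ring.
by apply: pD; rewrite lerD2l lerN2.
Qed.

Lemma glip_le D E p : D <= E -> glip D p -> glip E p.
Proof. by move=> DE H u v uv; apply: le_trans (H u v uv) _; rewrite ler_wpM2r// subr_ge0. Qed.

Lemma mhom_loop a b A x y p q : mpath a x y p -> mpath b x y q ->
  mhom (a + b) 0 A (pcat a p (rpath b q)) (fun=> x) -> mhom a b A p q.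
Proof.
move=> pp pq H; have pq' := mpath_inv pq; have [b0 _] := pq.
have E1 := mhom_catl pp (mpath_cat pq' pq) (mpath_cst y (lexx 0)) (mhom_Vl pq).
rewrite addr0 (pcat_cst pp) -pcatA// addrA in E1.
have E2 := mhom_catr (mpath_cat pp pq') (mpath_cst x (lexx 0)) pq H.
rewrite add0r (pcat_cst0 pq)// in E2.
by have := mhom_trans pp (mpath_cat (mpath_cat pp pq') pq) pq (mhom_sym E1) E2; rewrite add0r.
Qed.

Lemma mhom_Vpcat a b x y z p q : mpath a x y p -> mpath b y z q ->
  mhom (a + (a + b)) b 0 (pcat a (rpath a p) (pcat a p q)) q.
Proof.
move=> pp pq; have [a0 _] := pp.
have := mhom_catr (mpath_cat (mpath_inv pp) pp) (mpath_cst y (lexx 0)) pq (mhom_Vl pp).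
by rewrite pcatA// add0r (pcat_cst0 pq)// addrA.
Qed.

Lemma mhom_pcatV a b x y z p q : mpath b x y q -> mpath a y z p ->
  mhom (b + a + a) b 0 (pcat (b + a) (pcat b q p) (rpath a p)) q.
Proof.
move=> pq pp; have [a0 _] := pp; have [b0 _] := pq.
have := mhom_catl pq (mpath_cat pp (mpath_inv pp)) (mpath_cst y (lexx 0)) (mhom_Vr pp).
by rewrite addr0 (pcat_cst pq) -pcatA// addrA.
Qed.

(** The inverses of the caps are attached to both paths and cancel there at area 0. *)
Lemma mhom_uncap a c b b' A u x y z p p' q q' :
  mpath a u x p -> mpath b x y q -> mpath b' x y q' -> mpath c y z p' ->
  mhom (a + b + c) (a + b' + c) A (pcat (a + b) (pcat a p q) p') (pcat (a + b') (pcat a p q') p') ->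
  mhom b b' A q q'.
Proof.
move=> pp pq pq' pp' H; have [a0 _] := pp.
have M1 := mpath_cat pp pq; have M2 := mpath_cat pp pq'; have pr := mpath_inv pp'.
have N1 := mpath_cat M1 pp'; have N2 := mpath_cat M2 pp'.
have H1 := mhom_catr N1 N2 pr H.
have H2 : mhom (a + b) (a + b') A (pcat a p q) (pcat a p q').
  rewrite -[A]add0r; apply: (mhom_trans M1 (mpath_cat N1 pr) M2 (mhom_sym (mhom_pcatV M1 pp'))).
  by rewrite -[A]addr0; exact: (mhom_trans (mpath_cat N1 pr) (mpath_cat N2 pr) M2 H1 (mhom_pcatV M2 pp')).
have pl := mpath_inv pp; have H3 := mhom_catl pl M1 M2 H2.
rewrite -[A]add0r; apply: (mhom_trans pq (mpath_cat pl M1) pq' (mhom_sym (mhom_Vpcat pp pq))).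
by rewrite -[A]addr0; exact: (mhom_trans (mpath_cat pl M1) (mpath_cat pl M2) pq' H3 (mhom_Vpcat pp pq')).
Qed.

End PathCancellation.

Section WordValues.
Variables r n : nat.
Local Notation G := (Lambda r n).
Local Notation W := (words ('I_r * 'I_n)%type).

Lemma wordvalM (u v : W) : wordval (u * v)%g = (wordval u * wordval v)%g.
Proof. exact: wordval_cat. Qed.

Lemma wordvalV (u : W) : wordval u^-1%g = (wordval u)^-1%g.
Proof. exact: wordval_inv. Qed.

Lemma wordval_letter s : wordval (letter s : W) = cgen s.1 s.2.
Proof. by rewrite /= mulg1. Qed.

(** An element is assembled one coordinate at a time, each coordinate being a word in the generators
    of its factor. *)
Lemma lambda_word (g : G) : exists w : W, wordval w = g.
Proof.
have factor p (z : free_nilpotent2 r) : exists w : W, wordval w = (\pi_G (at_factor p z))%qT.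
  elim/quotW: z => u; elim/words_ind: u => [|i u [w wE]|i u [w wE]].
  - exists 1%g; rewrite -[RHS]/((\pi_G (at_factor p (1%g : free_nilpotent2 r)))%qT).
    have -> // : at_factor p (1%g : free_nilpotent2 r) = 1%g.
    by apply/ffunP => j; rewrite !ffunE if_same.
  - exists (letter (i, p) * w)%g.
    by rewrite wordvalM wE pi_mulg at_factorM pi_mulg wordval_letter.
  - exists ((letter (i, p))^-1 * w)%g.
    by rewrite wordvalM wordvalV wE pi_mulg at_factorM pi_mulg wordval_letter pi_invg at_factorV pi_invg.
elim/quotW: g => f.
suff H j : (j <= n)%N -> exists w : W, wordval w = (\pi_G [ffun i : 'I_n => if (i < j)%N then f i else 1%g])%qT.
  have [w wE] := H n (leqnn n); exists w; rewrite wE; congr (\pi_G _)%qT.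
  by apply/ffunP => i; rewrite ffunE ltn_ord.
elim: j => [_|j IH jn].
  exists 1%g; have E : [ffun i : 'I_n => if (i < 0)%N then f i else 1%g] = (1%g : {ffun 'I_n -> free_nilpotent2 r}).
    by apply/ffunP => i; rewrite !ffunE.
  by rewrite E.
have [w wE] := IH (ltnW jn); have [w' wE'] := factor (Ordinal jn) (f (Ordinal jn)).
exists (w * w')%g; rewrite wordvalM wE wE' -pi_mulg; congr (\pi_G _)%qT.
apply/ffunP => i; rewrite !ffunE ltnS.
have [->|ij] := eqVneq i (Ordinal jn); first by rewrite ltnn leqnn mul1g.
have ij' : (val i == j) = false by apply/negbTE; apply: contra ij => /eqP e; apply/eqP/val_inj.
by rewrite [(i <= j)%N]leq_eqVlt ij' mulg1.
Qed.

End WordValues.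

(** * Quadratic filling of bigons *)

Section BigonFilling.
Variables (R : realType) (V : choiceType) (K : complex V) (r n : nat).
Hypotheses (r1 : (1 < r)%N) (n1 : (1 < n)%N).
Local Notation X := (realization R K).
Local Notation G := (Lambda r n).
Variable act : G -> X -> X.
Hypothesis act1 : forall x, act 1%g x = x.
Hypothesis actM : forall g h x, act (g * h)%g x = act g (act h x).
Hypothesis act_iso : forall g x y, path_dist (act g x) (act g y) = path_dist x y.
Hypothesis act_proper : forall A : set X, compact A -> finite_set [set g | (act g @` A) `&` A !=set0].
Variable C : set X.
Hypothesis Ccompact : compact C.
Hypothesis Ccover : \bigcup_g (act g @` C) = setT.
Hypothesis sc : simply_connected R K.
Variables (y0 : X) (v0 : V).
Hypothesis Kv0 : face K [fset v0]%fset.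
Local Notation x0 := (vert y0 v0).
Hypothesis Cx0 : C x0.
Implicit Types (p q : R -> X) (x y z : X) (g h : G).

Let alip : forall g, preserves_lip (act g).
Proof. by move=> g; exact: act_lip. Qed.

Let lift s := lipschitz_connected act1 actM act_iso act_proper Ccompact Ccover sc y0 Kv0 (act (cgen s.1 s.2) x0).

Let letters s : exists p, mpath 1 x0 (act (cgen s.1 s.2) x0) p.
Proof. by have [D _ [p pp _]] := lift s; exists p. Qed.

Let P (s : 'I_r * 'I_n) : R -> X := sval (cid (letters s)).

Let Pmpath s : mpath 1 x0 (act (cgen s.1 s.2) x0) (P s).
Proof. exact: (svalP (cid (letters s))). Qed.

Local Notation wp := (wpath act x0 P).

(** The longest relator is a product of two commutators of letters and has length 8. *)
Let short_word : exists2 A, 0 <= A & forall w, (size w <= 8)%N -> wordval w = 1%g -> whom act x0 P A w [::].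
Proof.
have [D D0 DP] := wpath_glip act1 actM alip Pmpath.
have [A AP] := bounded_loop_filling act1 actM act_iso act_proper Ccompact Ccover sc y0 Kv0 8 D0.
exists (Num.max 0 A); first by rewrite le_max lexx.
move=> w w8 w1; split=> //; apply: (@mhom_le _ _ _ _ _ A); first by rewrite le_max lexx orbT.
apply: AP => //; first by rewrite ler_nat.
by have := wpath_mpath act1 actM alip Pmpath w; rewrite w1 act1.
Qed.

Let filling : exists2 B, 0 <= B & forall w, wordval w = 1%g -> whom act x0 P (B * ((size w)%:R + 1) ^+ 2) w [::].
Proof.
have [A A0 AP] := short_word.
apply: (word_filling r1 n1 act1 actM alip Pmpath A0) => [i j p q pq|i j p q]; apply: AP.
- by [].
- rewrite /commg /conjg !(wordvalM, wordvalV, wordval_letter) /=.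
  by apply/eqP/commgP; exact: cgen_commute.
- by [].
- rewrite /commg /conjg !(wordvalM, wordvalV, wordval_letter) /=.
  by apply/eqP; rewrite divg_eq1; apply/eqP; exact: (cgen_comm_factor i j p q).
Qed.

(** The duration 5 is 2 + 1 + 2: a unit piece of curve with a track at either end. Finitely many
    group elements arise, so one length and one area serve all pieces. *)
Let piece_word B : 0 <= B -> exists k : nat, exists2 A, 0 <= A & forall g g' a q, a <= 5 ->
  mpath a (act g x0) (act g' x0) q -> glip B q ->
  exists w, [/\ (size w <= k)%N, (g * wordval w)%g = g' & mhom a (size w)%:R A q (act g \o wp w)].
Proof.
move=> B0; have T0 : 0 < 5 :> R by [].
have /finite_seqP[s sE] := finite_bounded_moves act1 actM act_iso act_proper Ccompact Ccover Kv0 Cx0 B0 T0.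
have [k kP] : exists k, forall h, h \in s -> exists w : words ('I_r * 'I_n)%type, (size w <= k)%N /\ wordval w = h.
  elim: (s) => [|h l [k IH]]; first by exists 0.
  have [w wE] := lambda_word h; exists (maxn (size w) k) => h'.
  rewrite in_cons => /predU1P[->|/IH[w' [kw wE']]]; first by exists w; rewrite leq_max leqnn.
  by exists w'; rewrite leq_max kw orbT.
have [D D0 DP] := wpath_glip act1 actM alip Pmpath.
have E0 : 0 <= Num.max B D by rewrite le_max B0.
have [A AP] := bounded_loop_filling act1 actM act_iso act_proper Ccompact Ccover sc y0 Kv0 (5 + k%:R) E0.
exists k, (Num.max 0 A); first by rewrite le_max lexx.
move=> g g' a q a5 qq qB.
have qq1 := mpath_comp (alip g^-1%g) qq; rewrite -!actM mulVg act1 in qq1.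
have qB1 := glip_act alip g^-1%g B0 qB.
have : [set` s] (g^-1 * g')%g by rewrite -sE; exists a, (act g^-1%g \o q).
move=> /kP[w [wk wE]]; exists w; split=> //; first by rewrite wE mulgA mulgV mul1g.
apply: (@mhom_le _ _ _ _ _ A); first by rewrite le_max lexx orbT.
have wm := wpath_mpath act1 actM alip Pmpath w; rewrite wE in wm.
have : mhom a (size w)%:R A (act g^-1%g \o q) (wp w).
  apply: (mhom_loop qq1 wm); apply: AP.
  - by apply: lerD => //; rewrite ler_nat.
  - exact: mpath_cat qq1 (mpath_inv wm).
  - apply: (glip_pcat E0 qq1 (mpath_inv wm)); first by apply: glip_le qB1; rewrite le_max lexx.
    by apply: glip_rpath; apply: glip_le (DP w); rewrite le_max lexx orbT.
move=> /(mhom_comp (alip g)).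
have -> // : act g \o (act g^-1%g \o q) = q.
by apply: boolp.funext => t /=; rewrite -actM mulgV act1.
Qed.

Let tracks : exists2 D, 0 <= D & forall x, exists g p, mpath 2 (act g x0) x p /\ glip D p.
Proof.
have [D D0 DP] := compact_track act1 actM act_iso act_proper Ccompact Ccover sc y0 Kv0.
exists D => // x; have [g Cg] := act_cover act1 actM Ccover x.
have [p pp pD] := DP _ Cg; exists g, (act g \o p); split; last exact: (glip_act alip).
by have := mpath_comp (alip g) pp; rewrite -actM mulgV act1.
Qed.

(** At each cut point a track to the orbit and back is inserted at area 0, so that the curve splits
    into pieces between orbit points. *)
Let long_word D : 0 <= D -> (forall x, exists g p, mpath 2 (act g x0) x p /\ glip D p) ->
  exists k : nat, exists2 A, 0 <= A & forall N Q x y g g' p p',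
  mpath N.+1%:R x y Q -> glip 1 Q -> mpath 2 (act g x0) x p -> glip D p ->
  mpath 2 (act g' x0) y p' -> glip D p' ->
  exists w, [/\ (size w <= N.+1 * k)%N, (g * wordval w)%g = g' &
    mhom (2 + N.+1%:R + 2) (size w)%:R (N.+1%:R * A) (pcat (2 + N.+1%:R) (pcat 2 p Q) (rpath 2 p')) (act g \o wp w)].
Proof.
move=> D0 tr; have B0 : 0 <= Num.max D 1 by rewrite le_max D0.
have [k [A A0 kA]] := piece_word B0; exists k, A => //.
have base Q x y g g' p p' : mpath 1 x y Q -> glip 1 Q -> mpath 2 (act g x0) x p -> glip D p ->
    mpath 2 (act g' x0) y p' -> glip D p' ->
    exists w, [/\ (size w <= k)%N, (g * wordval w)%g = g' &
      mhom (2 + 1 + 2) (size w)%:R A (pcat (2 + 1) (pcat 2 p Q) (rpath 2 p')) (act g \o wp w)].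
  move=> QQ Q1 pp pD pp' pD'; have M1 := mpath_cat pp QQ; have M' := mpath_inv pp'.
  apply: kA; [|exact: mpath_cat M1 M'|].
    by rewrite le_eqVlt; apply/orP; left; apply/eqP; ring.
  apply: (glip_pcat B0 M1 M').
    by apply: (glip_pcat B0 pp QQ); apply: glip_le; [|exact: pD| |exact: Q1]; rewrite le_max lexx ?orbT.
  by apply: glip_rpath; apply: glip_le pD'; rewrite le_max lexx.
elim=> [|N IH] Q x y g g' p p' QQ Q1 pp pD pp' pD'.
  by rewrite mul1r mul1n; exact: (base Q x y).
set a : R := N.+1%:R; have a0 : 0 <= a by [].
have NE : N.+2%:R = a + 1 :> R by rewrite /a -[in LHS]natr1.
rewrite NE in QQ *; have [_ [_ [Q0 Qe]]] := QQ.
pose Q' t := Q (Num.min t a); pose Q'' t := Q (a + Num.max t 0).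
have QE : Q = pcat a Q' Q''.
  apply: boolp.funext => t; rewrite /pcat /Q' /Q''; case: (leP t a) => // ta.
  by rewrite max_l ?subr_ge0 ?(ltW ta)// addrC subrK.
have l' : glip 1 Q'.
  move=> s t st; apply: le_trans (Q1 _ _ _) _.
    by rewrite le_min !ge_min st lexx orbT.
  by rewrite ler_wpM2l// /Num.min; case: ifP => h1; case: ifP => h2; lra.
have l'' : glip 1 Q''.
  move=> s t st; apply: le_trans (Q1 _ _ _) _.
    by rewrite lerD2l ge_max !le_max st lexx orbT.
  by rewrite ler_wpM2l// /Num.max; case: ifP => h1; case: ifP => h2; lra.
have m' : mpath a x (Q a) Q'.
  split=> //; split; first by exists 1.
  by split=> t ta; rewrite /Q' ?(min_r ta)// min_l ?Q0// (le_trans ta).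
have m'' : mpath 1 (Q a) y Q''.
  split=> //; split; first by exists 1.
  split=> t ta; rewrite /Q'' ?(max_r ta) ?addr0// max_l ?(le_trans _ ta)// Qe//.
  by rewrite lerD2l.
have [h [z [zz zD]]] := tr (Q a).
have [w [wk wE wH]] := IH Q' x (Q a) g h p z m' l' pp pD zz zD.
have [u [uk uE uH]] := base Q'' (Q a) y h g' z p' m'' l'' zz zD pp' pD'.
exists (w ++ u); split; first by rewrite size_cat mulSn addnC leq_add.
  by rewrite wordval_cat mulgA wE uE.
have Y := mpath_cat pp m'; have pr' := mpath_inv pp'; have zr := mpath_inv zz.
have Z := mpath_cat m'' pr'.
(* Insertion of the track [z] and its inverse at the last cut point. *)
have E0 : mhom (2 + (a + 1) + 2) (2 + a + (2 + (2 + (1 + 2)))) 0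
    (pcat (2 + (a + 1)) (pcat 2 p Q) (rpath 2 p'))
    (pcat (2 + a) (pcat 2 p Q') (pcat 2 (rpath 2 z) (pcat 2 z (pcat 1 Q'' (rpath 2 p'))))).
  have -> : pcat (2 + (a + 1)) (pcat 2 p Q) (rpath 2 p') =
      pcat (2 + a) (pcat 2 p Q') (pcat 1 Q'' (rpath 2 p')).
    by rewrite QE !pcatA ?addr_ge0.
  have -> : 2 + (a + 1) + 2 = 2 + a + (1 + 2) :> R by ring.
  apply: (mhom_catl Y Z (mpath_cat zr (mpath_cat zz Z))).
  exact/mhom_sym/(mhom_Vpcat zz Z).
have X1 := mpath_cat Y zr; have X2 := mpath_cat (mpath_cat zz m'') pr'.
have WM := mpath_comp (alip g) (wpath_mpath act1 actM alip Pmpath w); rewrite -actM wE in WM.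
have UM := mpath_comp (alip h) (wpath_mpath act1 actM alip Pmpath u); rewrite -actM uE in UM.
have E1 := mhom_catr X1 WM X2 wH; have E2 := mhom_catl WM X2 UM uH.
rewrite !pcatA ?addr_ge0// in E1 E2.
have lE : 2 + a + 2 + (2 + 1 + 2) = 2 + a + (2 + (2 + (1 + 2))) :> R by ring.
rewrite lE in E1.
have -> : act g \o wp (w ++ u) = pcat (size w)%:R (act g \o wp w) (act h \o wp u).
  rewrite (wpath_cat act1 actM alip Pmpath) pcat_comp; congr pcat.
  by rewrite act_comp// wE.
rewrite size_cat natrD.
have M0 := mpath_cat (mpath_cat pp QQ) pr'.
have M1 := mpath_cat Y (mpath_cat zr (mpath_cat zz Z)).
have MC : mpath ((size w)%:R + (2 + 1 + 2)) (act g x0) (act g' x0)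
    (pcat (size w)%:R (act g \o wp w) (pcat 2 z (pcat 1 Q'' (rpath 2 p')))).
  by have := mpath_cat WM X2; rewrite !pcatA ?addr_ge0.
have -> : (a + 1) * A = 0 + (a * A + A) by ring.
have {}E1 : mhom (2 + a + (2 + (2 + (1 + 2)))) ((size w)%:R + (2 + 1 + 2)) (a * A)
    (pcat (2 + a) (pcat 2 p Q') (pcat 2 (rpath 2 z) (pcat 2 z (pcat 1 Q'' (rpath 2 p')))))
    (pcat (size w)%:R (act g \o wp w) (pcat 2 z (pcat 1 Q'' (rpath 2 p')))).
  by rewrite pcatA.
exact: (mhom_trans M0 M1 (mpath_cat WM UM) E0 (mhom_trans M1 MC (mpath_cat WM UM) E1 E2)).
Qed.

(** With common tracks at both ends, the two sides become words with the same value. Their quotient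
    is a word of value 1 whose length is linear in the durations. *)
Lemma bigon_filling : exists2 A, 0 <= A & forall N M x y p q, mpath N.+1%:R x y p -> glip 1 p ->
  mpath M.+1%:R x y q -> glip 1 q -> mhom N.+1%:R M.+1%:R (A * (N.+1%:R + M.+1%:R) ^+ 2) p q.
Proof.
have [D D0 tr] := tracks; have [k [A A0 H]] := long_word D0 tr; have [B B0 BH] := filling.
exists (A * 2 + B * (k%:R + 1) ^+ 2); first by rewrite addr_ge0 ?mulr_ge0 ?sqr_ge0.
move=> N M x y p q pp p1 qq q1.
have [g [s [ss sD]]] := tr x; have [h [t [tt tD]]] := tr y.
have [w [wk wE wH]] := H N p x y g h s t pp p1 ss sD tt tD.
have [u [uk uE uH]] := H M q x y g h s t qq q1 ss sD tt tD.
have E : wordval w = wordval u by apply: (mulgI g); rewrite wE uE.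
have /BH F : wordval (w ++ wordV u) = 1%g by rewrite wordval_cat wordval_inv E mulgV.
have Vu := whom_Vcat act1 actM alip Pmpath u.
have F2 : whom act x0 P (B * ((size (w ++ wordV u))%:R + 1) ^+ 2) w u.
  have a1 := whom_cat2 act1 actM alip Pmpath w Vu; rewrite cats0 in a1.
  have a2 := whom_cat1 act1 actM alip Pmpath u F; rewrite -catA /= in a2.
  have := whom_trans act1 actM alip Pmpath (whom_sym a1) a2.
  by rewrite add0r.
have /(mhom_comp (alip g)) wu := F2.2.
have WM := mpath_comp (alip g) (wpath_mpath act1 actM alip Pmpath w); rewrite -actM wE in WM.
have UM := mpath_comp (alip g) (wpath_mpath act1 actM alip Pmpath u); rewrite -actM uE in UM.
have tr' := mpath_inv tt.
have M1 := mpath_cat (mpath_cat ss pp) tr'; have M2 := mpath_cat (mpath_cat ss qq) tr'.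
have := mhom_trans M1 UM M2 (mhom_trans M1 WM UM wH wu) (mhom_sym uH).
move=> /(mhom_uncap ss pp qq tr'); apply: mhom_le.
rewrite size_cat size_rev size_map; set S := (size w + size u)%N.
have SE : S%:R <= k%:R * (N.+1%:R + M.+1%:R) :> R.
  rewrite -natrD -natrM ler_nat /S mulnDr; apply: leq_add; first by rewrite mulnC.
  by rewrite mulnC.
set T : R := N.+1%:R + M.+1%:R in SE *; have T1 : 1 <= T by rewrite /T -!natr1; have := ler0n R N; have := ler0n R M; lra.
have k0 : 0 <= k%:R :> R by []; have S0 : 0 <= S%:R :> R by [].
have h1 : N.+1%:R * A + M.+1%:R * A <= A * 2 * T ^+ 2.
  rewrite -mulrDl -/T mulrC -mulrA ler_wpM2l//; nra.
have h2 : B * (S%:R + 1) ^+ 2 <= B * (k%:R + 1) ^+ 2 * T ^+ 2.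
  have ST : S%:R + 1 <= (k%:R + 1) * T by rewrite mulrDl mul1r lerD.
  have S1 : 0 <= S%:R + 1 :> R by rewrite addr_ge0.
  rewrite -mulrA -exprMn ler_wpM2l// ler_sqr ?nnegrE//.
  exact: le_trans S1 ST.
by rewrite mulrDl; lra.
Qed.

End BigonFilling.

(** * The quadratic upper bound *)

Section ArcLength.
Variables (R : realType) (V : choiceType) (K : complex V).
Local Notation X := (realization R K).
Implicit Types (x y z : X) (L M l : R).

Lemma continuous_lipschitz M (u : R -> R) : 0 <= M -> (forall s t, `|u t - u s| <= M * `|t - s|) ->
  continuous u.
Proof.
move=> M0 uM x; apply/cvgrPdist_lt => e e0; apply/nbhs_ballP.
have M1 : 0 < M + 1 by rewrite ltr_wpDl.
exists (e / (M + 1)) => /=; first by rewrite divr_gt0.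
move=> y; rewrite /ball /= ltr_pdivlMr// => h; apply: le_lt_trans (uM _ _) _.
apply: le_lt_trans h; rewrite mulrC ler_wpM2l//; lra.
Qed.

(** Parametrization by arc length, up to a bounded excess: one unit makes the new parameter strictly
    increasing and another rounds the duration up to an integer. *)
Lemma arc_length_param M l x y (P : R -> X) (W : R -> R) : 0 <= M -> mpath 1 x y P -> glip M P ->
  (forall u t, 0 <= u -> u <= t -> t <= 1 -> W u + mdist (P u) (P t) <= W t) ->
  (forall t, 0 <= t <= 1 -> 0 <= W t <= l) ->
  exists N Q, [/\ N.+1%:R <= l + 2, mpath N.+1%:R x y Q, glip 1 Q & mhom 1 N.+1%:R 0 P Q].
Proof.
move=> M0 [_ [_ [P0 P1]]] PM WP W0.
(* The potential [W] may jump. Its infimal convolution [lam] with slope [M] is [M]-Lipschitz and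
   still grows at least like the chords of [P]. *)
pose S t := [set z | exists u, [/\ 0 <= u, u <= t & z = W u + M * (t - u)]].
pose lam t := inf (S t).
have lam_le t u : 0 <= u -> u <= t -> t <= 1 -> lam t <= W u + M * (t - u).
  move=> u0 ut t1; apply: ge_inf; last by exists u.
  exists 0 => _ [v [v0 vt ->]]; rewrite addr_ge0// ?mulr_ge0 ?subr_ge0//.
  by have /andP[] := W0 v (introT andP (conj v0 (le_trans vt t1))).
have lam_ge t c : 0 <= t -> (forall u, 0 <= u -> u <= t -> c <= W u + M * (t - u)) -> c <= lam t.
  move=> t0 H; apply: lb_le_inf; first by exists (W t + M * (t - t)), t; split.
  by move=> _ [u [u0 ut ->]]; exact: H.
have up s t : 0 <= s -> s <= t -> t <= 1 -> lam s + mdist (P s) (P t) <= lam t.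
  move=> s0 st t1; have t0 := le_trans s0 st; apply: lam_ge => // u u0 ut.
  have [us|su] := leP u s.
    have h1 := lam_le s u u0 us (le_trans st t1); have h2 := PM s t st.
    have : M * (t - u) = M * (s - u) + M * (t - s) by ring.
    by move=> h3; clear -h1 h2 h3; lra.
  have h1 := lam_le s s s0 (lexx s) (le_trans st t1); rewrite subrr mulr0 addr0 in h1.
  have h2 := WP s u s0 (ltW su) (le_trans ut t1); have h3 := PM u t ut.
  have h4 := mdist_triangle (P u) (P s) (P t); clear -h1 h2 h3 h4; lra.
have dn s t : 0 <= s -> s <= t -> t <= 1 -> lam t <= lam s + M * (t - s).
  move=> s0 st t1; rewrite -lerBlDr; apply: lam_ge => // u u0 us.
  have h1 := lam_le t u u0 (le_trans us st) t1.
  have h3 : M * (t - u) = M * (s - u) + M * (t - s) by ring.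
  clear -h1 h3; lra.
(* The added term makes [La] injective on [0, 1] even where [P] rests. *)
pose La t := lam (clamp 0 1 t) + clamp 0 1 t.
have ci (t : R) : 0 <= clamp 0 1 t <= 1 := clamp_in t ler01.
have cid01 (t : R) : 0 <= t -> t <= 1 -> clamp 0 1 t = t by move=> a b; rewrite clamp_id// a.
have La_up s t : 0 <= s -> s <= t -> t <= 1 -> mdist (P s) (P t) + (t - s) <= La t - La s.
  move=> s0 st t1; have := up s t s0 st t1.
  by rewrite /La !cid01//; [lra|exact: le_trans st t1|exact: le_trans s0 st].
have La_lip s t : `|La t - La s| <= (M + 1) * `|t - s|.
  wlog st : s t / s <= t.
    by move=> H; have [|/ltW] := leP s t; [exact: H|rewrite (distrC (La t)) (distrC t); exact: H].
  have cst : clamp 0 1 s <= clamp 0 1 t.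
    rewrite /clamp ge_max le_max lexx /= le_max ; apply/orP; right.
    by rewrite le_min !ge_min lexx st orbT.
  have cl := clamp_lip 0 1 t s; rewrite ger0_norm ?subr_ge0// in cl.
  have /andP[s0 s1] := ci s; have /andP[t0 t1] := ci t.
  have h1 := dn _ _ s0 cst t1; have h2 := up _ _ s0 cst t1; have h3 := mdist_ge0 (P (clamp 0 1 s)) (P (clamp 0 1 t)).
  have h4 : La t - La s = lam (clamp 0 1 t) - lam (clamp 0 1 s) + (clamp 0 1 t - clamp 0 1 s) by rewrite /La; ring.
  rewrite h4 ger0_norm; last by clear -h2 h3 cst; lra.
  apply: (@le_trans _ _ ((M + 1) * (clamp 0 1 t - clamp 0 1 s))); first by rewrite mulrDl mul1r; clear -h1; lra.
  by rewrite ler_wpM2l ?addr_ge0.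
have La_cont : continuous La by apply: (@continuous_lipschitz (M + 1)) => //; rewrite addr_ge0.
set a := La 0; set b := La 1.
have a0 : 0 <= a.
  rewrite /a /La cid01// addr0; apply: lam_ge => // u u0 u0'.
  have u00 : 0 <= u <= 1 by rewrite u0 (le_trans u0').
  by have /andP[h _] := W0 u u00; rewrite addr_ge0// mulr_ge0// subr_ge0.
have bl : b <= l + 1.
  have h := lam_le 1 1 ler01 (lexx 1) (lexx 1); rewrite subrr mulr0 addr0 in h.
  have /andP[_ h'] := W0 1 (introT andP (conj ler01 (lexx 1))).
  by rewrite /b /La cid01//; lra.
have ab : a + 1 <= b by have := La_up 0 1 (lexx 0) ler01 (lexx 1); have := mdist_ge0 (P 0) (P 1); rewrite -/a -/b; lra.
have ab' : a <= b by lra.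
have inv c : {t | a <= c <= b -> [/\ 0 <= t, t <= 1 & La t = c]}.
  apply/cid; have [cab|] := boolP (a <= c <= b); last by exists 0.
  have [||t] := @IVT R La 0 1 c ler01; first exact: continuous_subspaceT.
    by rewrite -/a -/b (min_idPl ab') (max_idPr ab').
  by rewrite in_itv /= => /andP[t0 t1] tc; exists t.
pose iv c := sval (inv (clamp a b c)).
have ivP c : [/\ 0 <= iv c, iv c <= 1 & La (iv c) = clamp a b c].
  by apply: (svalP (inv (clamp a b c))); exact: clamp_in.
have La_inj s t : 0 <= s -> s <= 1 -> 0 <= t -> t <= 1 -> La s = La t -> s = t.
  move=> s0 s1 t0 t1 E; apply/eqP; rewrite eq_le; apply/andP; split; rewrite leNgt; apply/negP => h.
    by have := La_up t s t0 (ltW h) s1; have := mdist_ge0 (P t) (P s); rewrite E; lra.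
  by have := La_up s t s0 (ltW h) t1; have := mdist_ge0 (P s) (P t); rewrite E; lra.
(* As [La] grows at least like the chords, [P] composed with its inverse is 1-Lipschitz; [P] itself
   is [Q] reparametrized by [La]. *)
pose Q c := P (iv c).
have Q1 : glip 1 Q.
  move=> c d cd; have [c0 c1 cE] := ivP c; have [d0 d1 dE] := ivP d.
  have cl := clamp_lip a b d c; rewrite (ger0_norm (x := d - c)) ?subr_ge0// in cl.
  have cl' := le_trans (ler_norm _) cl; rewrite mul1r.
  have mono : clamp a b c <= clamp a b d.
    by rewrite /clamp ge_max le_max lexx /= le_max le_min !ge_min lexx cd !orbT.
  have [icd|icd] := leP (iv c) (iv d).
    by have := La_up _ _ c0 icd d1; rewrite cE dE /Q; lra.
  have := La_up _ _ d0 (ltW icd) c1; have := mdist_ge0 (P (iv d)) (P (iv c)); rewrite cE dE; lra.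
pose N := Num.truncn b; have b0 : 0 <= b by lra.
have bN : b <= N.+1%:R by apply: ltW; exact: truncnS_gt.
have Nb : N%:R <= b by rewrite /N truncn_le.
have QaE c : c <= a -> Q c = x.
  move=> ca; have [c0 c1 cE] := ivP c; rewrite clamp_lo// in cE.
  by rewrite /Q (La_inj _ 0 c0 c1 (lexx 0) ler01 cE) P0.
have QbE c : b <= c -> Q c = y.
  move=> ca; have [c0 c1 cE] := ivP c; rewrite clamp_hi// in cE.
  by rewrite /Q (La_inj _ 1 c0 c1 ler01 (lexx 1) cE) P1.
have N1 : 1 <= N.+1%:R :> R by rewrite ler1n.
exists N, Q; split => //.
- by rewrite -natr1; lra.
- split; first by [].
  split; first by exists 1.
  by split=> c h; [apply: QaE; exact: le_trans h a0|apply: QbE; exact: le_trans bN h].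
exists N.+1%:R; split=> //.
have H : lhom 0 N.+1%:R 0 (Q \o La) (Q \o clamp a b).
  have ab1 : a < b by lra.
  apply: (@lhom_reparam _ _ _ a b 1 (M + 1)) => //.
  - by rewrite addr_ge0.
  - exact: glip_lipc.
  - by move=> s t _ st _; rewrite -[X in _ <= _ * X]ger0_norm ?subr_ge0//; exact: La_lip.
  - move=> s t _ st _; apply: le_trans (clamp_lip _ _ _ _) _.
    by rewrite ger0_norm ?subr_ge0// ler_peMl ?subr_ge0// lerDr.
  - move=> t _; split; last exact: clamp_in.
    have /andP[t0 t1] := ci t.
    have E : La t = La (clamp 0 1 t) by rewrite /La (cid01 (clamp 0 1 t)).
    rewrite E; have h1 := La_up 0 _ (lexx 0) t0 t1; have h2 := La_up _ 1 t0 t1 (lexx 1).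
    rewrite -/a in h1; rewrite -/b in h2.
    have h3 := mdist_ge0 (P 0) (P (clamp 0 1 t)); have h4 := mdist_ge0 (P (clamp 0 1 t)) (P 1).
    by apply/andP; split; lra.
  - by rewrite -/a clamp_lo.
  - by rewrite (clamp_hi ab' bN) /b /La (clamp_hi ler01 N1) (clamp_hi ler01 (lexx 1)).
apply: lhom_ext H => // [t /andP[t0 _]|t _] /=; last first.
  by rewrite /Q /iv (clamp_id (clamp_in t ab')).
have /andP[u0 u1] := ci t.
have E : La t = La (clamp 0 1 t) by rewrite /La (cid01 (clamp 0 1 t)).
have LI : a <= La t <= b.
  rewrite E; have h1 := La_up 0 _ (lexx 0) u0 u1; have h2 := La_up _ 1 u0 u1 (lexx 1).
  rewrite -/a in h1; rewrite -/b in h2.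
  have h3 := mdist_ge0 (P 0) (P (clamp 0 1 t)); have h4 := mdist_ge0 (P (clamp 0 1 t)) (P 1).
  by apply/andP; split; lra.
have [c0 c1 cE] := ivP (La t); rewrite (clamp_id LI) [RHS]E in cE.
rewrite /Q (La_inj _ _ c0 c1 u0 u1 cE).
have [t1|t1] := leP t 1; first by rewrite cid01.
by rewrite (clamp_hi ler01 (ltW t1)) P1// P1// ltW.
Qed.

Fixpoint csum (c : R -> X) (x : R) (s : seq R) : R := if s is y :: s' then mdist (c x) (c y) + csum c y s' else 0.

Lemma csum_cat c (x : R) s t : csum c x (s ++ t) = csum c x s + csum c (last x s) t.
Proof. by elim: s x => [|y s IH] x /=; rewrite ?add0r// IH addrA. Qed.

Lemma csum_ge0 c (x : R) s : 0 <= csum c x s.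
Proof. by elim: s x => [|y s IH] x //=; rewrite addr_ge0// mdist_ge0. Qed.

Lemma csum_length (a b l : R) c s : (curve_length a b c <= l%:E)%E -> path <%R a s -> last a s = b -> csum c a s <= l.
Proof.
move=> H sp sl; rewrite -lee_fin; apply: le_trans H.
apply: ereal_sup_ubound; exists s; first by split=> //; apply/eqP.
congr (_%:E); elim: s a {sp sl} => [|y s IH] a /=; first by rewrite big_geq.
by rewrite big_nat_recl//= IH.
Qed.

(** The potential at [t] is the length of the curve up to [t], as a real number: a supremum of chord
    sums over partitions ending before [t]. *)
Lemma curve_potential (b l : R) (c : R -> X) : (curve_length 0 b c <= l%:E)%E -> exists W : R -> R,
  (forall u t, 0 <= u -> u <= t -> t <= b -> W u + mdist (c u) (c t) <= W t) /\
  (forall t, 0 <= t <= b -> 0 <= W t <= l).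
Proof.
move=> H.
pose S t := [set z | exists s, [/\ path <%R 0 s, last 0 s <= t & z = csum c 0 s]].
have S0 t : 0 <= t -> S t 0 by move=> t0; exists [::].
have Sl t : t <= b -> ubound (S t) l.
  move=> tb _ [s [sp sl ->]].
  have [E|lt] := eqVneq (last 0 s) b; first exact: (csum_length H sp E).
  have {}lt : last 0 s < b by rewrite lt_neqAle lt (le_trans sl tb).
  apply: le_trans (csum_length H (s := rcons s b) _ _).
  - by rewrite -cats1 csum_cat lerDl csum_ge0.
  - by rewrite rcons_path sp.
  - by rewrite last_rcons.
have Sub t : t <= b -> has_ubound (S t) by exists l; exact: Sl.
exists (fun t => sup (S t)); split=> [u t u0 ut tb|t /andP[t0 tb]].
  rewrite -lerBrDr; apply: ge_sup; first by exists 0; exact: S0.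
  move=> _ [s [sp sl ->]]; rewrite lerBrDr.
  have [->|ut'] := eqVneq u t.
    by rewrite mdistxx addr0; apply: ub_le_sup; [exact: Sub|exists s; rewrite (le_trans sl ut)].
  have {}ut' : u < t by rewrite lt_neqAle ut'.
  have := sl; rewrite le_eqVlt => /orP[/eqP E|lt].
    apply: ub_le_sup; first exact: Sub.
    exists (rcons s t); rewrite rcons_path sp last_rcons E ut' -cats1 csum_cat /= addr0 E.
    by split.
  apply: (@le_trans _ _ (csum c 0 (s ++ [:: u; t]))).
    by rewrite csum_cat /= addr0 lerD2l lerDr mdist_ge0.
  apply: ub_le_sup; first exact: Sub.
  by exists (s ++ [:: u; t]); rewrite cat_path sp last_cat /= lt ut'.
apply/andP; split; first by apply: ub_le_sup; [exact: Sub|exact: S0].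
by apply: ge_sup; [exists 0; exact: S0|exact: Sl].
Qed.

End ArcLength.

(** * The four arcs of a loop *)

Section CircleArcs.
Variables (R : realType) (V : choiceType) (K : complex V).
Local Notation X := (realization R K).
Variable s : R.
Hypotheses (s0 : 0 < s) (s2 : s ^+ 2 *+ 2 = 1).

Let sm (x : R) : - s <= x <= s -> x ^+ 2 <= s ^+ 2.
Proof. by move=> /andP[a b]; nra. Qed.

Let s1 : s < 1.
Proof. by have := s2; have := s0; move=> a b; rewrite ltNge; apply/negP => h; nra. Qed.

Lemma sqrt_ge_half (x : R) : - s <= x <= s -> s <= Num.sqrt (1 - x ^+ 2).
Proof.
move=> /sm h; rewrite -[s]ger0_norm ?(ltW s0)// -sqrtr_sqr ler_wsqrtr//.
by have := s2; lra.
Qed.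

Lemma sqr_sqrt_circle (x : R) : - s <= x <= s -> Num.sqrt (1 - x ^+ 2) ^+ 2 = 1 - x ^+ 2.
Proof. by move=> /sm h; rewrite sqr_sqrtr//; have := s2; have := sqr_ge0 s; lra. Qed.

(** The circle has slope at most 1 over [- s, s], because [s ^+ 2 *+ 2 = 1]. *)
Lemma sqrt_circle_lip (x y : R) : - s <= x <= s -> - s <= y <= s ->
  `|Num.sqrt (1 - x ^+ 2) - Num.sqrt (1 - y ^+ 2)| <= `|x - y|.
Proof.
move=> xs ys; have ha := sqrt_ge_half xs; have hb := sqrt_ge_half ys.
have := sqr_sqrt_circle xs; have := sqr_sqrt_circle ys.
move: ha hb; set a := Num.sqrt _; set b := Num.sqrt (1 - y ^+ 2) => ha hb Eb Ea.
have E : (a - b) * (a + b) = (y - x) * (y + x) by rewrite -!subr_sqr; lra.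
have nE : `|a - b| * (a + b) = `|x - y| * `|y + x|.
  rewrite -[X in _ * X](ger0_norm (x := a + b)); last by have := s0; lra.
  by rewrite -normrM E normrM distrC.
have h1 : `|y + x| <= 2 * s by case/andP: xs => ? ?; case/andP: ys => ? ?; rewrite ler_norml; apply/andP; split; lra.
have h2 : `|a - b| * (2 * s) <= `|x - y| * (2 * s).
  apply: (@le_trans _ _ (`|a - b| * (a + b))); first by rewrite ler_wpM2l//; lra.
  by rewrite nE ler_wpM2l.
by rewrite ler_pM2r ?mulr_gt0 in h2.
Qed.

Lemma acos_anti (x y : R) : -1 <= x -> x <= y -> y <= 1 -> acos y <= acos x.
Proof.
move=> x0 xy y1; have xi : -1 <= x <= 1 by rewrite x0 (le_trans xy).
have yi : -1 <= y <= 1 by rewrite y1 (le_trans x0).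
have [/andP[a0 a1] aE] := acos_def xi; have [/andP[b0 b1] bE] := acos_def yi.
rewrite leNgt; apply/negP => h.
have := @ltr_cos R (acos x) (acos y); rewrite !in_itv /= a0 a1 b0 b1 aE bE => /(_ isT isT).
by rewrite h ltNge xy.
Qed.

Lemma asin_mono (x y : R) : -1 <= x -> x <= y -> y <= 1 -> asin x <= asin y.
Proof.
move=> x0 xy y1; have xi : -1 <= x <= 1 by rewrite x0 (le_trans xy).
have yi : -1 <= y <= 1 by rewrite y1 (le_trans x0).
have [/andP[a0 a1] aE] := asin_def xi; have [/andP[b0 b1] bE] := asin_def yi.
rewrite leNgt; apply/negP => h.
have := @ltr_sin R (asin y) (asin x); rewrite !in_itv /= a0 a1 b0 b1 aE bE => /(_ isT isT).
by rewrite h ltNge xy.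
Qed.

Variables (f : R * R -> X) (L l : R).
Hypothesis L0 : 0 <= L.
Hypothesis fL : forall p q, circle p -> circle q -> mdist (f p) (f q) <= L * `|p - q|.
Hypothesis fl : (loop_length f <= l%:E)%E.

(** The common form of the four arcs: [W] is any potential that dominates the chords of this arc, to
    be derived from that of the whole loop. *)
Lemma side_arc (sg : R -> X) (W : R -> R) l' : lipc (- s) s L sg ->
  (forall u t, - s <= u -> u <= t -> t <= s -> W u + mdist (sg u) (sg t) <= W t) ->
  (forall t, - s <= t <= s -> 0 <= W t <= l') ->
  exists N Q, [/\ N.+1%:R <= l' + 2, mpath N.+1%:R (sg (- s)) (sg s) Q, glip 1 Q,
    mpath 1 (sg (- s)) (sg s) (fun t => sg (clamp (- s) s (2 * s * t - s))) &
    mhom 1 N.+1%:R 0 (fun t => sg (clamp (- s) s (2 * s * t - s))) Q].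
Proof.
move=> sgL WP W0; have s00 : - s <= s by have := s0; lra.
pose a t := clamp (- s) s (2 * s * t - s).
have aI t : - s <= a t <= s := clamp_in _ s00.
have am u t : u <= t -> a u <= a t.
  move=> ut; have : 2 * s * u - s <= 2 * s * t - s by rewrite lerD2r ler_wpM2l// mulr_ge0// ltW.
  by move=> h; rewrite /a /clamp ge_max le_max lexx /= le_max le_min !ge_min lexx h !orbT.
have pl : glip (L * (2 * s)) (sg \o a).
  move=> u t ut; have /andP[u0 _] := aI u; have /andP[_ t0] := aI t.
  apply: le_trans (sgL _ _ u0 (am _ _ ut) t0) _; rewrite -mulrA ler_wpM2l//.
  have := clamp_lip (- s) s (2 * s * t - s) (2 * s * u - s); rewrite -/(a t) -/(a u).
  move=> /(le_trans (ler_norm _))/le_trans; apply.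
  have -> : 2 * s * t - s - (2 * s * u - s) = 2 * s * (t - u) by ring.
  by rewrite ger0_norm// mulr_ge0 ?subr_ge0// mulr_ge0// ltW.
have sL : 0 <= L * (2 * s) by rewrite !mulr_ge0// ltW.
have pp : mpath 1 (sg (- s)) (sg s) (sg \o a).
  split=> //; split; first by exists (L * (2 * s)).
  split=> t tt /=; congr sg; rewrite /a; [rewrite clamp_lo//|rewrite clamp_hi//]; have := s0; nra.
have [||N [Q [? ? ? ?]]] := @arc_length_param _ _ _ (L * (2 * s)) l' _ _ _ (W \o a) sL pp pl.
- by move=> u t u0 ut t1 /=; have /andP[? _] := aI u; have /andP[_ ?] := aI t; apply: WP => //; exact: am.
- by move=> t _; exact: W0.
by exists N, Q.
Qed.

Let in1 (x : R) : - s <= x <= s -> -1 <= x <= 1.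
Proof. by move=> /andP[a b]; have h := s1; apply/andP; split; lra. Qed.

Let W := sval (cid (curve_potential fl)).

Let WP u t : 0 <= u -> u <= t -> t <= 2 * pi -> W u + mdist (f (cos u, sin u)) (f (cos t, sin t)) <= W t.
Proof. by have [H _] := svalP (cid (curve_potential fl)); exact: H. Qed.

Let W0 t : 0 <= t <= 2 * pi -> 0 <= W t <= l.
Proof. by have [_ H] := svalP (cid (curve_potential fl)); exact: H. Qed.

Let circ (x : R) : - s <= x <= s -> [/\ circle (x, Num.sqrt (1 - x ^+ 2)), circle (x, - Num.sqrt (1 - x ^+ 2)),
  circle (Num.sqrt (1 - x ^+ 2), x) & circle (- Num.sqrt (1 - x ^+ 2), x)].
Proof. by move=> /sqr_sqrt_circle E; split; rewrite /circle /= ?sqrrN E; ring. Qed.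

Let slip (h : R -> R * R) : (forall x, - s <= x <= s -> circle (h x)) ->
  (forall x y, - s <= x <= s -> - s <= y <= s -> `|h x - h y| <= `|x - y|) -> lipc (- s) s L (f \o h).
Proof.
move=> hc hl x y xs xy ys; have xi : - s <= x <= s by rewrite xs (le_trans xy).
have yi : - s <= y <= s by rewrite ys (le_trans xs).
apply: le_trans (fL (hc _ xi) (hc _ yi)) _; rewrite ler_wpM2l//.
by apply: le_trans (hl _ _ xi yi) _; rewrite distrC ger0_norm ?subr_ge0.
Qed.

Let arcs (sg : R -> X) (l' : R) : Prop := exists N Q, [/\ N.+1%:R <= l' + 2, mpath N.+1%:R (sg (- s)) (sg s) Q, glip 1 Q,
    mpath 1 (sg (- s)) (sg s) (fun t => sg (clamp (- s) s (2 * s * t - s))) &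
    mhom 1 N.+1%:R 0 (fun t => sg (clamp (- s) s (2 * s * t - s))) Q].

(** The loop runs through the top arc from right to left, so the potential along increasing abscissa
    is [l - W]. *)
Lemma top_side : arcs (fun x => f (x, Num.sqrt (1 - x ^+ 2))) l.
Proof.
have E x : - s <= x <= s -> (x, Num.sqrt (1 - x ^+ 2)) = (cos (acos x), sin (acos x)).
  by move=> /in1 xi; rewrite acosK ?in_itv// sin_acos.
have th x : - s <= x <= s -> 0 <= acos x <= 2 * pi.
  by move=> /in1 xi; have [/andP[a b] _] := acos_def xi; rewrite a (le_trans b)//; have := pi_gt0 R; lra.
apply: (@side_arc _ (fun x => l - W (acos x))).
- apply: slip => [x /circ[]//|x y xs ys]; rewrite prod_normE /= ge_max lexx /=.
  exact: sqrt_circle_lip.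
- move=> u t us ut ts; have ui : - s <= u <= s by rewrite us (le_trans ut).
  have ti : - s <= t <= s by rewrite ts (le_trans us).
  have /andP[a1 _] := in1 ui; have /andP[_ b1] := in1 ti; have /andP[x0 _] := th _ ti; have /andP[_ y1] := th _ ui.
  have := WP x0 (acos_anti a1 ut b1) y1; rewrite -!E// mdistC; lra.
- by move=> t /th/W0 h; rewrite subr_ge0 gerBl andbC.
Qed.

Lemma bottom_side : arcs (fun x => f (x, - Num.sqrt (1 - x ^+ 2))) l.
Proof.
have E x : - s <= x <= s -> (x, - Num.sqrt (1 - x ^+ 2)) = (cos (2 * pi - acos x), sin (2 * pi - acos x)).
  move=> /in1 xi; rewrite cosB sinB mulr_natl cos2pi sin2pi acosK ?in_itv// sin_acos//.
  by rewrite !mul0r !mul1r addr0 sub0r.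
have th x : - s <= x <= s -> 0 <= 2 * pi - acos x <= 2 * pi.
  move=> /in1 xi; have [/andP[a b] _] := acos_def xi; have := pi_gt0 R.
  by move=> pp; apply/andP; split; lra.
apply: (@side_arc _ (fun x => W (2 * pi - acos x))).
- apply: slip => [x /circ[]//|x y xs ys]; rewrite prod_normE /= ge_max lexx /= -opprD normrN.
  exact: sqrt_circle_lip.
- move=> u t us ut ts; have ui : - s <= u <= s by rewrite us (le_trans ut).
  have ti : - s <= t <= s by rewrite ts (le_trans us).
  have /andP[a1 _] := in1 ui; have /andP[_ b1] := in1 ti; have /andP[x0 _] := th _ ui; have /andP[_ y1] := th _ ti.
  have h : 2 * pi - acos u <= 2 * pi - acos t by rewrite lerD2l lerN2; exact: acos_anti.
  by have := WP x0 h y1; rewrite -!E.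
- by move=> t /th/W0.
Qed.

Lemma left_side : arcs (fun y => f (- Num.sqrt (1 - y ^+ 2), y)) l.
Proof.
have E x : - s <= x <= s -> (- Num.sqrt (1 - x ^+ 2), x) = (cos (pi - asin x), sin (pi - asin x)).
  move=> /in1 xi; rewrite cosB sinB cospi sinpi asinK ?in_itv// cos_asin//.
  by congr pair; ring.
have th x : - s <= x <= s -> 0 <= pi - asin x <= 2 * pi.
  move=> /in1 xi; have [/andP[a b] _] := asin_def xi; have := pi_gt0 R.
  by move=> pp; apply/andP; split; lra.
apply: (@side_arc _ (fun x => l - W (pi - asin x))).
- apply: slip => [x /circ[]//|x y xs ys]; rewrite prod_normE /= ge_max lexx andbT -opprD normrN.
  exact: sqrt_circle_lip.
- move=> u t us ut ts; have ui : - s <= u <= s by rewrite us (le_trans ut).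
  have ti : - s <= t <= s by rewrite ts (le_trans us).
  have /andP[a1 _] := in1 ui; have /andP[_ b1] := in1 ti; have /andP[x0 _] := th _ ti; have /andP[_ y1] := th _ ui.
  have h : pi - asin t <= pi - asin u by rewrite lerD2l lerN2; exact: asin_mono.
  have := WP x0 h y1; rewrite -!E// mdistC; lra.
- by move=> t /th/W0 h; rewrite subr_ge0 gerBl andbC.
Qed.

(* The right side crosses the point where the parametrization of the loop starts. *)
Lemma right_side : arcs (fun y => f (Num.sqrt (1 - y ^+ 2), y)) (2 * l).
Proof.
have p0 := pi_gt0 R.
pose th (y : R) := if y < 0 then 2 * pi + asin y else asin y.
have E x : - s <= x <= s -> (Num.sqrt (1 - x ^+ 2), x) = (cos (th x), sin (th x)).
  move=> /in1 xi; rewrite /th; case: ifP => _; last by rewrite asinK ?in_itv// cos_asin.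
  by rewrite cosD sinD mulr_natl cos2pi sin2pi asinK ?in_itv// cos_asin// !mul0r !mul1r subr0 add0r.
have a0 : asin 0 = 0 :> R by rewrite -[in LHS]sin0 sinK// in_itv /= oppr_le0 andbb divr_ge0// ltW.
have thI x : - s <= x <= s -> 0 <= th x <= 2 * pi.
  move=> /in1 xi; have [/andP[a b] _] := asin_def xi; case/andP: xi => x0 x1; rewrite /th; case: ltP => h.
    have := asin_mono x0 (ltW h) ler01; rewrite a0; move=> h'; apply/andP; split; lra.
  have := @asin_mono 0 x (lerN10 _) h x1; rewrite a0; move=> h'; apply/andP; split; lra.
have W2 := W0 (introT andP (conj (mulr_ge0 (ler0n _ 2) (ltW p0)) (lexx (2 * pi)))).
have F0 : f (Num.sqrt (1 - 0 ^+ 2), 0) = f (cos 0, sin 0) by rewrite cos0 sin0 expr0n subr0 sqrtr1.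
have F2 : f (cos (2 * pi), sin (2 * pi)) = f (cos 0, sin 0) by rewrite mulr_natl cos2pi sin2pi cos0 sin0.
(* Past the start of the loop the potential continues from [W (2 * pi)], whence the bound
   [2 * l]. *)
apply: (@side_arc _ (fun y => if y < 0 then W (th y) else W (2 * pi) + W (th y))).
- apply: slip => [x /circ[]//|x y xs ys]; rewrite prod_normE /= ge_max lexx andbT.
  exact: sqrt_circle_lip.
- move=> u t us ut ts; have ui : - s <= u <= s by rewrite us (le_trans ut).
  have ti : - s <= t <= s by rewrite ts (le_trans us).
  have /andP[a1 _] := in1 ui; have /andP[_ b1] := in1 ti; have /andP[x0 x1] := thI _ ui; have /andP[z0 z1] := thI _ ti.
  have am := asin_mono a1 ut b1.
  rewrite !E//; have [u0|u0] := ltP u 0; have [t0|t0] := ltP t 0.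
  + by apply: WP => //; rewrite /th u0 t0 lerD2l.
  + have h1 := WP x0 x1 (lexx _); have h2 := WP (lexx 0) z0 z1.
    have h3 := mdist_triangle (f (cos 0, sin 0)) (f (cos (th u), sin (th u))) (f (cos (th t), sin (th t))).
    have h4 : 0 <= W 0 <= l by apply: W0; rewrite lexx mulr_ge0// ltW.
    rewrite F2 in h1; case/andP: h4 => h4 _; lra.
  + absurd_lra.
  + rewrite -addrA lerD2l; apply: WP => //.
    by rewrite /th !ltNge u0 t0.
- move=> t /thI/W0 /andP[h1 h2]; case/andP: W2 => h3 h4; case: ifP => _; apply/andP; split; lra.
Qed.

End CircleArcs.

(** * The Dehn function is at most quadratic *)

Section DehnUpper.
Variables (R : realType) (V : choiceType) (K : complex V) (r n : nat).
Hypotheses (r1 : (1 < r)%N) (n1 : (1 < n)%N).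
Local Notation X := (realization R K).
Local Notation G := (Lambda r n).

(** The four arcs are replaced by arc-length paths at area 0, the bigon they form is filled, and
    [bigon_square] turns the filling into a square. *)
Lemma filling_area_le A (f : R * R -> X) l L : 0 <= A -> 0 <= l -> 0 <= L ->
  (forall N M x y (p q : R -> X), mpath N.+1%:R x y p -> glip 1 p ->
    mpath M.+1%:R x y q -> glip 1 q -> mhom N.+1%:R M.+1%:R (A * (N.+1%:R + M.+1%:R) ^+ 2) p q) ->
  (forall p q, circle p -> circle q -> mdist (f p) (f q) <= L * `|p - q|) ->
  (loop_length f <= l%:E)%E -> (filling_area f <= (A * 64 * (l + 1) ^+ 2)%:E)%E.
Proof.
move=> A0 l0 L0 bf fL fl.
pose s : R := Num.sqrt 2^-1.
have s0 : 0 < s by rewrite sqrtr_gt0 invr_gt0.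
have s2 : s ^+ 2 *+ 2 = 1.
  by rewrite sqr_sqrtr ?invr_ge0// -mulr_natr mulVf.
have [N1 [Q1 [l1 m1 g1 p1 h1]]] := bottom_side s0 s2 L0 fL fl.
have [N2 [Q2 [l2 m2 g2 p2 h2]]] := right_side s0 s2 L0 fL fl.
have [N3 [Q3 [l3 m3 g3 p3 h3]]] := left_side s0 s2 L0 fL fl.
have [N4 [Q4 [l4 m4 g4 p4 h4]]] := top_side s0 s2 L0 fL fl.
have sqE : Num.sqrt (1 - s ^+ 2) = s.
  have -> : 1 - s ^+ 2 = s ^+ 2 by rewrite -s2; ring.
  by rewrite sqrtr_sqr ger0_norm// ltW.
have sqN : Num.sqrt (1 - (- s) ^+ 2) = s by rewrite sqrrN sqE.
rewrite /= ?sqE ?sqN in m1 p1 m2 p2 m3 p3 m4 p4.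
have HA := mhom_trans (mpath_cat p1 p2) (mpath_cat m1 p2) (mpath_cat m1 m2)
  (mhom_catr p1 m1 p2 h1) (mhom_catl m1 p2 m2 h2).
have HB := mhom_trans (mpath_cat p3 p4) (mpath_cat m3 p4) (mpath_cat m3 m4)
  (mhom_catr p3 m3 p4 h3) (mhom_catl m3 p4 m4 h4).
have M1 := mpath_cat m1 m2; have M2 := mpath_cat m3 m4.
have G1 := glip_pcat ler01 m1 m2 g1 g2; have G2 := glip_pcat ler01 m3 m4 g3 g4.
have E1 : N1.+1%:R + N2.+1%:R = (N1 + N2.+1).+1%:R :> R by rewrite -natrD addSn.
have E2 : N3.+1%:R + N4.+1%:R = (N3 + N4.+1).+1%:R :> R by rewrite -natrD addSn.
have M1' := M1; have M2' := M2; rewrite E1 in M1'; rewrite E2 in M2'.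
have HC := bf _ _ _ _ _ _ M1' G1 M2' G2; rewrite -E1 -E2 in HC.
have H := mhom_trans (mpath_cat p1 p2) M1 (mpath_cat p3 p4) HA
  (mhom_trans M1 M2 (mpath_cat p3 p4) HC (mhom_sym HB)).
have {H}H := bigon_square p1 p2 p3 p4 H.
set B := _ + _ in H.
have BE : B <= A * 64 * (l + 1) ^+ 2.
  rewrite /B !addr0 add0r -mulrA ler_wpM2l//.
  (* The four durations add up to at most [5 * l + 8]. *)
  have -> : 64 * (l + 1) ^+ 2 = (8 * (l + 1)) ^+ 2 by ring.
  rewrite ler_sqr ?nnegrE ?addr_ge0 ?mulr_ge0 ?addr_ge0//.
  by clear -l1 l2 l3 l4 l0; lra.
apply: (@le_trans _ _ B%:E); last by rewrite lee_fin.
apply: (square_filling s0 s2).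
have m0 : 0 < (2 * s)^-1 by rewrite invr_gt0 mulr_gt0.
have e0 : (2 * s)^-1 * (- s) + 2^-1 = 0 by field; rewrite gt_eqF.
have e1 : (2 * s)^-1 * s + 2^-1 = 1 by field; rewrite gt_eqF.
have S (b t l' r' : R -> X) (h : sq B ((2 * s)^-1 * (- s) + 2^-1) ((2 * s)^-1 * s + 2^-1) ((2 * s)^-1 * (- s) + 2^-1)
  ((2 * s)^-1 * s + 2^-1) b t l' r') := sq_xaff m0 (sq_yaff m0 h).
rewrite e0 e1 in S.
have eI x : - s <= x <= s -> clamp (- s) s (2 * s * ((2 * s)^-1 * x + 2^-1) - s) = x.
  move=> xs; have -> : 2 * s * ((2 * s)^-1 * x + 2^-1) - s = x by field; rewrite gt_eqF.
  exact: clamp_id.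
apply: sq_ext (S _ _ _ _ H) => x xs /=; by rewrite !(eI x xs).
Qed.

Lemma dehn_le : geometric_model R K G -> exists2 A, 0 <= A & forall l, 0 <= l ->
  (@dehn R V K l <= (A * (l + 1) ^+ 2)%:E)%E.
Proof.
move=> [sc [act [act1M act_iso act_proper [C Ccompact Ccover]]]].
have act1 x : act 1%g x = x by case: (act1M x).
have actM g h x : act (g * h)%g x = act g (act h x) by have [_ H] := act1M x; exact: H.
have [[y0 _] _ _] := sc.
have /fset0Pn[v0 v0y] := face_neq0 (bary_face y0).
have Kv0 : face K [fset v0]%fset by apply: (face_sub (bary_face y0)); rewrite ?fsub1set// -cardfs_gt0 cardfs1.
(* The fundamental set is enlarged so that it contains the base vertex. *)
pose C' := C `|` [set vert y0 v0].
have C'compact : compact C' by apply: compactU => //; exact: compact_set1.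
have C'cover : \bigcup_g (act g @` C') = setT.
  apply/seteqP; split=> // x _; have : (\bigcup_g (act g @` C)) x by rewrite Ccover.
  by move=> [g _ [y Cy yx]]; exists g => //; exists y => //; left.
have C'0 : C' (vert y0 v0) by right.
have [A A0 bf] := bigon_filling r1 n1 act1 actM act_iso act_proper C'compact C'cover sc Kv0 C'0.
exists (A * 64); first by rewrite mulr_ge0.
move=> l l0; apply: ub_ereal_sup => _ [f [[L fL] fl] <-].
apply: (@filling_area_le _ _ _ (Num.max 0 L)) => //; first by rewrite le_max lexx.
move=> p q pc qc; rewrite -lee_fin; apply: le_trans (mdist_le_path_dist _ _) _.
apply: le_trans (fL p q pc qc) _; rewrite lee_fin ler_wpM2r// le_max lexx orbT//.
Qed.

Lemma dehn_dominated : geometric_model R K G -> dominated (@dehn R V K) (fun l => (l ^+ 2)%:E).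
Proof.
move=> /dehn_le[A A0 AP]; exists (A + 1); first by rewrite ltr_wpDl.
move=> x x0; apply: le_trans (AP x x0) _; rewrite -EFinM -EFinD lee_fin.
set c := A + 1; have c1 : 1 <= c by rewrite /c lerDr.
have -> : c * x + c = c * (x + 1) by ring.
have x1 : 0 <= x + 1 by rewrite addr_ge0.
have h1 : (x + 1) ^+ 2 <= (c * (x + 1)) ^+ 2.
  by rewrite ler_sqr ?nnegrE ?mulr_ge0// ?ler_peMl//; lra.
have h2 : A * (x + 1) ^+ 2 <= c * (c * (x + 1)) ^+ 2.
  by apply: ler_pM => //; rewrite ?sqr_ge0// /c lerDl.
have h3 : 0 <= c * (x + 1) by rewrite mulr_ge0//; lra.
by lra.
Qed.

End DehnUpper.

(** * The quadratic lower bound *)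

Section PathJoin.
Variables (R : realType) (V : choiceType) (K : complex V).
Local Notation X := (realization R K).
Implicit Types (x y z : X) (p q : R -> X) (D d : R).

(** The constant [D] is kept apart from the duration, so that durations add along a chain of joins
    at a fixed constant. *)
Definition pjoin D d x y := exists a p, [/\ a <= d, mpath a x y p & glip D p].

Lemma pjoin_path_dist D d x y : 0 <= D -> pjoin D d x y -> (path_dist x y <= (D * d)%:E)%E.
Proof.
move=> D0 [a [p [ad [a0 [_ [p0 p1]]] pD]]].
have := lipc_path_dist D0 (@glip_lipc _ _ _ D p 0 a pD) (lexx 0) a0 (lexx a).
by rewrite p0// p1// subr0 => /le_trans; apply; rewrite lee_fin ler_wpM2l.
Qed.

Lemma pjoin_sym D d x y : pjoin D d x y -> pjoin D d y x.
Proof.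
move=> [a [p [ad pp pD]]]; exists a, (rpath a p); split=> //; first exact: mpath_inv.
exact: glip_rpath.
Qed.

Lemma pjoin_trans D d e x y z : 0 <= D -> pjoin D d x y -> pjoin D e y z -> pjoin D (d + e) x z.
Proof.
move=> D0 [a [p [ad pp pD]]] [b [q [be qq qD]]]; exists (a + b), (pcat a p q).
by split; [exact: lerD|exact: mpath_cat pp qq|exact: glip_pcat pp qq pD qD].
Qed.

Lemma pjoin_le D d e x y : d <= e -> pjoin D d x y -> pjoin D e x y.
Proof. by move=> de [a [p [ad pp pD]]]; exists a, p; split=> //; exact: le_trans de. Qed.

Lemma pjoin_on D p (s t : R) : 0 <= D -> glip D p -> pjoin D `|s - t| (p s) (p t).
Proof.
move=> D0 pD; wlog st : s t / s <= t.
  by move=> H; have [|/ltW] := leP s t; [exact: H|rewrite distrC => /H/pjoin_sym].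
have st0 : 0 <= t - s by rewrite subr_ge0.
rewrite distrC ger0_norm//; pose q u := p (s + clamp 0 (t - s) u).
have qD : glip D q.
  move=> u v uv; have m : clamp 0 (t - s) u <= clamp 0 (t - s) v.
    by rewrite /clamp ge_max le_max lexx /= le_max le_min !ge_min lexx uv !orbT.
  apply: le_trans (pD _ _ _) _; first by rewrite lerD2l.
  rewrite ler_wpM2l//; have := clamp_lip 0 (t - s) v u; move=> /(le_trans (ler_norm _)).
  by rewrite (ger0_norm (x := v - u)) ?subr_ge0//; lra.
exists (t - s), q; split=> //; split=> //; split; first by exists D.
split=> u uu; rewrite /q; first by rewrite clamp_lo// addr0.
by rewrite clamp_hi// addrC subrK.
Qed.

Lemma glip_comp (f : X -> X) D p : preserves_lip f -> 0 <= D -> glip D p -> glip D (f \o p).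
Proof. by move=> fL D0 pD s t st; exact: (fL s t D p D0 (@glip_lipc _ _ _ D p s t pD) s t (lexx s) st (lexx t)). Qed.

Lemma pjoin_compat x y : compat x y -> pjoin 1 (mdist x y) x y.
Proof.
move=> xy; have [d0|dn] := eqVneq (mdist x y) 0.
  have -> : y = x by apply/esym/bary_dist_eq0.
  by exists 0, (fun=> x); split; rewrite ?mdist_ge0//; [exact: mpath_cst|move=> s t st; rewrite mdistxx mul1r subr_ge0].
have d0 : 0 < mdist x y by rewrite lt_def dn mdist_ge0.
pose q t := seg x y (clamp 0 1 (t / mdist x y)).
have qD : glip 1 q.
  move=> s t st; rewrite /q seg_mdist ?clamp_in// mul1r distrC.
  have := clamp_lip 0 1 (t / mdist x y) (s / mdist x y); rewrite -mulrBl normrM.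
  rewrite (ger0_norm (x := t - s)) ?subr_ge0// ger0_norm ?invr_ge0 ?(ltW d0)//.
  by rewrite ler_pdivlMr.
exists (mdist x y), q; split=> //; split; first exact: ltW.
split; first by exists 1.
split=> t tt; rewrite /q; first by rewrite clamp_lo ?seg0// pmulr_lle0// invr_gt0.
by rewrite clamp_hi ?seg1// ler_pdivlMr// mul1r.
Qed.

End PathJoin.

(** * Bounded dimension and coarse coordinates of vertices *)

Section SimplexBound.
Variables (R : realType) (V : choiceType) (K : complex V) (G : groupType).
Local Notation X := (realization R K).
Variable act : G -> X -> X.
Hypothesis act1 : forall x, act 1%g x = x.
Hypothesis actM : forall g h x, act (g * h)%g x = act g (act h x).
Hypothesis act_iso : forall g x y, path_dist (act g x) (act g y) = path_dist x y.
Hypothesis act_proper : forall A : set X, compact A -> finite_set [set g | (act g @` A) `&` A !=set0].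
Variable C : set X.
Hypothesis Ccompact : compact C.
Hypothesis Ccover : \bigcup_g (act g @` C) = setT.

Let lf := geometric_locally_finite act1 actM act_iso act_proper Ccompact Ccover.

(* The vertices of a simplex are a path distance > 1 apart; move them into a fixed finite
   subcomplex, a finite cover of which by small stars separates them. *)
Lemma simplex_bound : exists N : nat, forall x : X, (#|` finsupp x| <= N)%N.
Proof.
have [UC UCP] := compact_supp lf Ccompact.
have two0 : 0 <= 2 :> R by [].
have [U UP] := reach_supp act1 actM act_iso act_proper Ccompact Ccover UC two0.
have cU := @compact_finite_supp R V K U.
pose e (x : X) := sval (cid2 (star_nbhs x)).
have eP x : 0 < e x /\ forall y, mdist x y < e x -> (finsupp x `<=` finsupp y)%fset.
  by rewrite /e; case: cid2.
pose r x := Num.min 2^-1 (e x).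
have r0 x : 0 < r x by rewrite /r lt_min invr_gt0 ltr0n (eP x).1.
have [s [_ H]] := compact_net cU r0.
exists (size s) => x; have [g Cg] := act_cover act1 actM Ccover x.
pose y v := act g^-1%g (vert x v).
have vS v : v \in finsupp x -> face K [fset v]%fset by exact: face1 (bary_face x).
have yU v : v \in finsupp x -> (finsupp (y v) `<=` U)%fset.
  move=> vx; have xv := compat_sub (supp_vert x vx).
  have xv' : compat x (vert x v) by rewrite compatC.
  have cL : lipc 0 1 2 (fun t => act g^-1%g (seg x (vert x v) t)).
    apply: (act_lip act_iso) => //.
    by apply: lipc_le (lipc_seg xv'); exact: mdist_le2.
  have c0 : (finsupp (act g^-1%g (seg x (vert x v) 0)) `<=` UC)%fset by rewrite seg0//; exact: UCP.
  by have := UP _ cL c0 1; rewrite seg1// ler01 lexx; exact.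
pose z v := xget x [set z | z \in s /\ mdist z (y v) < r z].
have zP v : v \in finsupp x -> z v \in s /\ mdist (z v) (y v) < r (z v).
  move=> vx; have [w ws wd] := H _ (yU v vx).
  by apply: (@xgetPex _ x [set z | z \in s /\ mdist z (y v) < r z]); exists w.
have zinj : {in finsupp x &, injective z}.
  move=> v w vx wx E; have [_ dv] := zP v vx; have [_ dw] := zP w wx.
  apply/eqP/negPn/negP => vw; rewrite -E in dw.
  have cmp u : mdist (z v) u < r (z v) -> compat (z v) u.
    by rewrite lt_min => /andP[_ h]; apply: compat_sub; exact: (eP (z v)).2.
  have J := pjoin_trans ler01 (pjoin_sym (pjoin_compat (cmp _ dv))) (pjoin_compat (cmp _ dw)).
  have := pjoin_path_dist ler01 J; rewrite act_iso => /(le_trans (mdist_le_path_dist _ _)).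
  have := coord_mdist (vert x v) (vert x w) v.
  rewrite !vertE ?vS// eqxx (negbTE vw) subr0 normr1 lee_fin mul1r => h1 h2.
  by move: dv dw; rewrite !lt_min => /andP[dv _] /andP[dw _]; lra.
rewrite -(size_map z); apply: uniq_leq_size.
  by rewrite map_inj_in_uniq.
by move=> _ /mapP[v vx ->]; case: (zP v vx).
Qed.

Hypothesis sc : simply_connected R K.
Variables (y0 : X) (v0 : V).
Hypothesis Kv0 : face K [fset v0]%fset.
Local Notation x0 := (vert y0 v0).
Hypothesis Cx0 : C x0.

(** A group element that locates the vertex up to bounded error; its exponents serve as plane
    coordinates of the vertex. *)
Definition vertex_elt v : G := sval (cid (act_cover act1 actM Ccover (vert y0 v))).

(** A path of bounded duration joins the orbit points of [g] and of [vertex_elt v], so their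
    quotient is one of finitely many elements, on which [e] is bounded. *)
Lemma vertex_elt_near (e : G -> int) B : (forall g h, e (g * h)%g = e g + e h) -> 0 <= B ->
  exists2 D0 : R, 0 <= D0 & forall g x v, pjoin B 2 (act g x0) x -> v \in finsupp x ->
    `|(e (vertex_elt v))%:~R - (e g)%:~R| <= D0.
Proof.
move=> eM B0; have [D D0 DP] := compact_track act1 actM act_iso act_proper Ccompact Ccover sc y0 Kv0.
pose E := Num.max 2 (Num.max B D); have E0 : 0 <= E by rewrite le_max ler0n.
(* The path built below lasts 2 + 1 + 2, which is below 6. *)
have T0 : 0 < 6 :> R by [].
have /finite_seqP[s sE] := finite_bounded_moves act1 actM act_iso act_proper Ccompact Ccover Kv0 Cx0 E0 T0.
have [M [M0 MP]] : exists M : R, 0 <= M /\ forall h, h \in s -> `|(e h)%:~R| <= M.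
  elim: (s) => [|h l [M [M0 IH]]]; first by exists 0.
  exists (Num.max `|(e h)%:~R| M); rewrite le_max M0 orbT; split=> // k.
  by rewrite in_cons => /predU1P[->|/IH]; rewrite le_max ?lexx// => ->; rewrite orbT.
exists M => // g x v J vx; set h := vertex_elt v.
have Ch : C (act h^-1%g (vert y0 v)) := svalP (cid (act_cover act1 actM Ccover (vert y0 v))).
have alip := act_lip act_iso.
have eV k : e k^-1%g = - e k.
  have e1 : e 1%g = 0 by have := eM 1%g 1%g; rewrite mulg1; lia.
  by have := eM k k^-1%g; rewrite mulgV e1; lia.
suff : [set` s] (g^-1 * h)%g.
  by move=> /MP; rewrite eM eV rmorphD rmorphN addrC.
rewrite -sE.
have wk F d (a b : X) : F <= E -> pjoin F d a b -> pjoin E d a b.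
  by move=> FE [l [p [? ? pF]]]; exists l, p; split=> //; exact: glip_le pF.
have J1 : pjoin E 2 (act g x0) x by apply: wk J; rewrite !le_max lexx orbT.
have J2 : pjoin E 1 x (vert y0 v).
  have xv : compat x (vert y0 v) by rewrite compatC; exact: compat_sub (supp_vert y0 vx).
  have [sp sg] := mpath_seg xv.
  by apply: (@wk 2); [rewrite le_max lexx|exists 1; eexists; split; [| exact: sp|exact: sg]].
have J3 : pjoin E 2 (vert y0 v) (act h x0).
  have [p pp pD] := DP _ Ch; apply/pjoin_sym; apply: (@wk D); first by rewrite !le_max lexx !orbT.
  exists 2, (act h \o p); split=> //; last exact: (glip_comp (alip _)).
  by have := mpath_comp (alip h) pp; rewrite -actM mulgV act1.
have [a [p [a5 pp pE]]] := pjoin_trans E0 (pjoin_trans E0 J1 J2) J3.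
exists a, (act g^-1%g \o p); split; first by lra.
  by have := mpath_comp (alip g^-1%g) pp; rewrite -!actM mulVg act1.
exact: (glip_comp (alip _)).
Qed.

End SimplexBound.

Section DerivativeTools.
Variable R : realType.

Lemma derive1_near (f h : R -> R) (x e : R) : 0 < e -> (forall t, `|t - x| <= e -> f t = h t) ->
  derive1 f x = derive1 h x.
Proof.
move=> e0 E.
have F : derive1 f x = 1 * derive1 (fun t => h (x + t)) 0.
  apply: (derive1_scale e0) => t te; rewrite mul1r E//.
  by rewrite addrAC subrr add0r.
have H : derive1 h x = 1 * derive1 (fun t => h (x + t)) 0.
  by apply: (derive1_scale e0) => t te; rewrite mul1r.
by rewrite F H.
Qed.

Lemma derive1_lincomb (V : eqType) (s : seq V) (F : V -> R -> R) (a : V -> R) (x : R) :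
  (forall v, v \in s -> derivable (F v) x 1) ->
  derivable (fun t => \sum_(v <- s) a v * F v t) x 1 /\
  derive1 (fun t => \sum_(v <- s) a v * F v t) x = \sum_(v <- s) a v * derive1 (F v) x.
Proof.
elim: s => [|v s IH] H.
  rewrite (_ : (fun t => _) = cst 0); last by apply: boolp.funext => t; rewrite big_nil.
  by rewrite big_nil derive1_cst; split=> //; exact: derivable_cst.
have [|d1 d2] := IH; first by move=> w ws; apply: H; rewrite in_cons ws orbT.
have dv : derivable (F v) x 1 by apply: H; rewrite mem_head.
rewrite (_ : (fun t => _) = (a v \*: F v) + (fun t => \sum_(w <- s) a w * F w t)); last first.
  by apply: boolp.funext => t; rewrite big_cons.
have dz : derivable (a v \*: F v) x 1 by exact: derivableZ.
split; first exact: derivableD.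
by rewrite derive1E deriveD// deriveZ// -!derive1E d2 big_cons.
Qed.

Lemma derive1_min (f : R -> R) (x : R) : derivable f x 1 -> (forall t, f x <= f t) -> derive1 f x = 0.
Proof.
move=> d m; pose h (n : nat) : R := n.+1%:R^-1.
have h0 n : 0 < h n by rewrite invr_gt0.
have hc : h n @[n --> \oo] --> (0 : R) by exact: cvg_harmonic.
have hP n : h n != 0 by rewrite gt_eqF.
have hN n : - h n != 0 by rewrite oppr_eq0.
have hcN : - h n @[n --> \oo] --> (0 : R) by rewrite -oppr0; exact: cvgN.
have X1 := cvg_difference_quotient d hP hc; have X2 := cvg_difference_quotient d hN hcN.
apply/eqP; rewrite eq_le; apply/andP; split.
  apply: (ler_cvg_to X2 (cvg_cst (0 : R))); apply: nearW => n.
  by rewrite invrN mulNr oppr_le0 mulr_ge0 ?invr_ge0 ?subr_ge0// ltW.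
apply: (ler_cvg_to (cvg_cst (0 : R)) X1); apply: nearW => n.
by rewrite mulr_ge0 ?invr_ge0 ?subr_ge0// ltW.
Qed.

(** As [p] and [q] sum to 0, only the differences of [a] and of [b] count. The determinant expands
    into the 2 by 2 minors of [p] and [q], each bounded by the Gram determinant. *)
Lemma gram_bound (V : eqType) (S : seq V) (a b p q : V -> R) (ca cb : R) :
  \sum_(v <- S) p v = 0 -> \sum_(v <- S) q v = 0 ->
  (forall v w, v \in S -> w \in S -> `|a v - a w| <= ca) ->
  (forall v w, v \in S -> w \in S -> `|b v - b w| <= cb) ->
  `|(\sum_(v <- S) a v * p v) * (\sum_(v <- S) b v * q v) -
    (\sum_(v <- S) a v * q v) * (\sum_(v <- S) b v * p v)| <=
  ca * cb * (size S)%:R ^+ 2 * 2 *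
  Num.sqrt ((\sum_(v <- S) p v ^+ 2) * (\sum_(v <- S) q v ^+ 2) - (\sum_(v <- S) p v * q v) ^+ 2).
Proof.
case: S => [|v0 T].
  by move=> _ _ _ _; rewrite !big_nil !mul0r subrr normr0 /= expr0n /= mulr0 !mul0r.
set S := v0 :: T => p0 q0 ha hb; have v0S : v0 \in S by rewrite mem_head.
have shift (a' r : V -> R) : \sum_(v <- S) r v = 0 ->
    \sum_(v <- S) a' v * r v = \sum_(v <- S) (a' v - a' v0) * r v.
  move=> r0; under [RHS]eq_bigr do rewrite mulrBl.
  by rewrite sumrB -mulr_sumr r0 mulr0 subr0.
rewrite (shift a p)// (shift b q)// (shift a q)// (shift b p)//.
set al := fun v => a v - a v0; set be := fun v => b v - b v0.
have E : (\sum_(v <- S) (a v - a v0) * p v) * (\sum_(v <- S) (b v - b v0) * q v) -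
    (\sum_(v <- S) (a v - a v0) * q v) * (\sum_(v <- S) (b v - b v0) * p v) =
    \sum_(v <- S) \sum_(w <- S) al v * be w * (p v * q w - q v * p w).
  rewrite !mulr_suml -sumrB; apply: eq_bigr => v _; rewrite !mulr_sumr -sumrB; apply: eq_bigr => w _.
  by rewrite /al /be; ring.
rewrite E {E}.
set D := _ - _ ^+ 2.
(* Lagrange's identity, with every pair counted twice. *)
have DE : \sum_(v <- S) \sum_(w <- S) (p v * q w - q v * p w) ^+ 2 = 2 * D.
  have e1 : (\sum_(v <- S) p v ^+ 2) * (\sum_(v <- S) q v ^+ 2) =
      \sum_(v <- S) \sum_(w <- S) p v ^+ 2 * q w ^+ 2 by exact: big_distrlr.
  have e2 : (\sum_(v <- S) q v ^+ 2) * (\sum_(v <- S) p v ^+ 2) =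
      \sum_(v <- S) \sum_(w <- S) q v ^+ 2 * p w ^+ 2 by exact: big_distrlr.
  have e3 : (\sum_(v <- S) p v * q v) ^+ 2 =
      \sum_(v <- S) \sum_(w <- S) (p v * q v) * (p w * q w) by rewrite expr2; exact: big_distrlr.
  have -> : 2 * D = (\sum_(v <- S) p v ^+ 2) * (\sum_(v <- S) q v ^+ 2) +
     (\sum_(v <- S) q v ^+ 2) * (\sum_(v <- S) p v ^+ 2) -
     2 * (\sum_(v <- S) p v * q v) ^+ 2 by rewrite /D; ring.
  rewrite e1 e2 e3 mulr_sumr -big_split -sumrB /=; apply: eq_bigr => v _.
  rewrite mulr_sumr -big_split -sumrB /=; apply: eq_bigr => w _; ring.
have mle v w : v \in S -> w \in S -> `|p v * q w - q v * p w| <= 2 * Num.sqrt D.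
  move=> vS wS; have D0 : 0 <= 2 * D.
    by rewrite -DE; apply: sumr_ge0 => *; apply: sumr_ge0 => *; exact: sqr_ge0.
  have D0' : 0 <= D by lra.
  have h : (p v * q w - q v * p w) ^+ 2 <= 2 * D.
    rewrite -DE; apply: (@le_trans _ _ (\sum_(w <- S) (p v * q w - q v * p w) ^+ 2)).
      by rewrite (big_rem w wS) /= lerDl; apply: sumr_ge0 => *; exact: sqr_ge0.
    by rewrite [leRHS](big_rem v vS) /= lerDl; apply: sumr_ge0 => *; apply: sumr_ge0 => *; exact: sqr_ge0.
  rewrite -ler_sqr ?nnegrE ?mulr_ge0 ?sqrtr_ge0// real_normK ?num_real// exprMn sqr_sqrtr//.
  by apply: le_trans h _; lra.
have s0 := sqrtr_ge0 D.
have ca0 : 0 <= ca := le_trans (normr_ge0 _) (ha _ _ v0S v0S).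
have cb0 : 0 <= cb := le_trans (normr_ge0 _) (hb _ _ v0S v0S).
have bnd v w : v \in S -> w \in S -> `|al v * be w * (p v * q w - q v * p w)| <= ca * cb * (2 * Num.sqrt D).
  move=> vS wS; rewrite !normrM; apply: ler_pM; rewrite ?mulr_ge0//; last exact: mle.
  by apply: ler_pM => //; [exact: ha|exact: hb].
have cstsum (k : R) : \sum_(v <- S) k = (size S)%:R * k.
  by rewrite big_const_seq count_predT iter_addr addr0 mulr_natl.
apply: (@le_trans _ _ (\sum_(v <- S) \sum_(w <- S) ca * cb * (2 * Num.sqrt D))).
  apply: le_trans (ler_norm_sum _ _ _) _; rewrite big_seq [leRHS]big_seq; apply: ler_sum => v vS.
  apply: le_trans (ler_norm_sum _ _ _) _; rewrite big_seq [leRHS]big_seq; apply: ler_sum => w wS.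
  exact: bnd.
rewrite !cstsum le_eqVlt; apply/orP; left; apply/eqP; ring.
Qed.

End DerivativeTools.

(** * Lower bound for the area of a filling of the disc *)

Section DiscArea.
Variables (R : realType) (V : choiceType) (K : complex V).
Local Notation X := (realization R K).
Variable s : R.
Hypotheses (s0 : 0 < s) (s2 : s ^+ 2 *+ 2 = 1).
Variables (g : R * R -> X) (L : R) (U : {fset V}) (N : nat) (a b : V -> R) (ca cb a0 a1 b0 b1 : R).
Hypothesis L0 : 0 <= L.
Hypothesis gL : forall p q, disc p -> disc q -> mdist (g p) (g q) <= L * `|p - q|.
Hypothesis gU : forall p, disc p -> (finsupp (g p) `<=` U)%fset.
Hypothesis supN : forall x : X, (#|` finsupp x| <= N)%N.
Hypotheses (ca0 : 0 <= ca) (cb0 : 0 <= cb).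
Hypothesis aS : forall (x : X) v w, v \in finsupp x -> w \in finsupp x -> `|a v - a w| <= ca.
Hypothesis bS : forall (x : X) v w, v \in finsupp x -> w \in finsupp x -> `|b v - b w| <= cb.
Hypothesis cN : ca * cb * N%:R ^+ 2 * 2 <= 1.
Let c (t : R) := Num.sqrt (1 - t ^+ 2).
Hypothesis a_left : forall t, - s <= t <= s -> forall v, v \in finsupp (g (- c t, t)) -> a v = a0.
Hypothesis a_right : forall t, - s <= t <= s -> forall v, v \in finsupp (g (c t, t)) -> a v = a1.
Hypothesis b_bottom : forall t, - s <= t <= s -> forall v, v \in finsupp (g (t, - c t)) -> b v = b0.
Hypothesis b_top : forall t, - s <= t <= s -> forall v, v \in finsupp (g (t, c t)) -> b v = b1.

Let cl := clamp (- s) s.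
Let ss : - s <= s. Proof. by have := s0; lra. Qed.
Let clI t : - s <= cl t <= s. Proof. exact: clamp_in. Qed.
Let cge t : - s <= t <= s -> s <= c t. Proof. exact: sqrt_ge_half. Qed.
Let c0 t : 0 <= c t. Proof. exact: sqrtr_ge0. Qed.
Let cc t : - c t <= c t. Proof. by have := c0 t; lra. Qed.
Let csq t : - s <= t <= s -> c t ^+ 2 = 1 - t ^+ 2. Proof. exact: sqr_sqrt_circle. Qed.
Let s1 : s <= 1. Proof. by have := s2; have := s0; move=> h h'; rewrite leNgt; apply/negP => k; nra. Qed.
Let c1 t : c t <= 1.
Proof. by rewrite -[leRHS]sqrtr1 ler_wsqrtr// gerDl oppr_le0 sqr_ge0. Qed.
Let cs : c s = s.
Proof.
rewrite /c; have -> : 1 - s ^+ 2 = s ^+ 2 by rewrite -s2; ring.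
by rewrite sqrtr_sqr ger0_norm// ltW.
Qed.
Let csN : c (- s) = s. Proof. by rewrite /c sqrrN; exact: cs. Qed.

(* A Lipschitz retraction of the plane onto the disc: outside of the disc it maps to the
   circle and does not depend on one of the two coordinates. *)
Let ret (p : R * R) : R * R :=
  (clamp (- c (cl p.2)) (c (cl p.2)) p.1, clamp (- c (cl p.1)) (c (cl p.1)) p.2).

Let clo t : t <= - s -> cl t = - s. Proof. exact: clamp_lo. Qed.
Let chi t : s <= t -> cl t = s. Proof. exact: clamp_hi. Qed.
Let cid' t : - s <= t <= s -> cl t = t. Proof. exact: clamp_id. Qed.

Let cases (t : R) : t <= - s \/ - s <= t <= s \/ s <= t.
Proof.
have [h|h] := leP t (- s); first by left.
have [h'|h'] := leP s t; first by right; right.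
by right; left; rewrite !ltW.
Qed.

Let ret_id p : disc p -> ret p = p.
Proof.
case: p => x y; rewrite /disc /= => d.
have key u v : u ^+ 2 + v ^+ 2 <= 1 -> - c (cl v) <= u <= c (cl v).
  move=> uv; suff h : `|u| <= c (cl v) by rewrite -ler_norml.
  have u2 : u ^+ 2 <= c (cl v) ^+ 2.
    have [h|[h|h]] := cases v.
    - by rewrite clo// csN; have := s2; have := s0; nra.
    - by rewrite cid'// csq//; lra.
    - by rewrite chi// cs; have := s2; have := s0; nra.
  by rewrite -ler_sqr ?nnegrE// real_normK ?num_real.
have k1 := key x y d; have k2 : - c (cl x) <= y <= c (cl x) by apply: key; rewrite addrC.
by rewrite /ret /= (clamp_id k1) (clamp_id k2).
Qed.

Let ret_disc p : disc (ret p).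
Proof.
case: p => x y; rewrite /ret /disc /=.
have inc u t : clamp (- c u) (c u) t ^+ 2 <= c u ^+ 2.
  have /andP[h1 h2] := clamp_in t (cc u); have := c0 u; nra.
have [hx|[hx|hx]] := cases x.
- rewrite (clo hx) csN; have [hy|[hy|hy]] := cases y.
  + have := inc (cl y) x; have := inc (- s) y; rewrite csN (clo hy) csN; have := s2; lra.
  + rewrite ?(clamp_id hy) ?(cid' hy); have := inc y x; rewrite csq//; lra.
  + have := inc (cl y) x; have := inc (- s) y; rewrite csN (chi hy) cs; have := s2; lra.
- rewrite (cid' hx); have [hy|[hy|hy]] := cases y.
  + rewrite (clo hy) csN ?(clamp_id hx); have := inc x y; rewrite csq//; lra.
  + rewrite (cid' hy); have [d|d] := leP (x ^+ 2 + y ^+ 2) 1.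
      by have := @ret_id (x, y) d; rewrite /ret /= (cid' hx) (cid' hy) => -[-> ->].
    by have := inc x y; have := inc y x; have := sqr_ge0 x; rewrite !csq//; case/andP: hx => ? ?; case/andP: hy => ? ?; have := s2; nra.
  + rewrite (chi hy) cs ?(clamp_id hx); have := inc x y; rewrite csq//; lra.
- rewrite (chi hx) cs; have [hy|[hy|hy]] := cases y.
  + have := inc (cl y) x; have := inc s y; rewrite cs (clo hy) csN; have := s2; lra.
  + rewrite ?(clamp_id hy) ?(cid' hy); have := inc y x; rewrite csq//; lra.
  + have := inc (cl y) x; have := inc s y; rewrite cs (chi hy) cs; have := s2; lra.
Qed.

Let clamp_bound_lip (u v t : R) : 0 <= u -> 0 <= v -> `|clamp (- u) u t - clamp (- v) v t| <= `|u - v|.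
Proof.
move=> u0 v0; wlog uv : u v u0 v0 / u <= v.
  move=> H; have [|/ltW] := leP u v; first exact: H.
  by rewrite distrC (distrC u); exact: H.
have -> : `|u - v| = v - u by rewrite distrC ger0_norm ?subr_ge0.
rewrite ler_norml /clamp.
case: (leP u t) => h1; case: (leP v t) => h2; case: (leP (- u) u) => h3; case: (leP (- v) v) => h4;
 case: (leP (- u) t) => h5; case: (leP (- v) t) => h6; apply/andP; split; lra.
Qed.

Let ret_lip p q : `|ret p - ret q| <= `|p.1 - q.1| + `|p.2 - q.2|.
Proof.
have key (u v u' v' : R) : `|clamp (- c (cl v)) (c (cl v)) u - clamp (- c (cl v')) (c (cl v')) u'| <= `|u - u'| + `|v - v'|.
  have -> : clamp (- c (cl v)) (c (cl v)) u - clamp (- c (cl v')) (c (cl v')) u' =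
    (clamp (- c (cl v)) (c (cl v)) u - clamp (- c (cl v)) (c (cl v)) u') +
    (clamp (- c (cl v)) (c (cl v)) u' - clamp (- c (cl v')) (c (cl v')) u') by ring.
  apply: le_trans (ler_normD _ _) _; apply: lerD; first exact: clamp_lip.
  apply: le_trans (clamp_bound_lip _ (c0 _) (c0 _)) _.
  by apply: le_trans (sqrt_circle_lip s0 s2 (clI v) (clI v')) _; exact: clamp_lip.
case: p q => [x y] [x' y']; rewrite /ret prod_normE /= ge_max; apply/andP; split; first exact: key.
by rewrite [leRHS]addrC; exact: key.
Qed.

Let h (p : R * R) : X := g (ret p).
Let hL p q : mdist (h p) (h q) <= L * (`|p.1 - q.1| + `|p.2 - q.2|).
Proof. by apply: le_trans (gL (ret_disc p) (ret_disc q)) _; rewrite ler_wpM2l//; exact: ret_lip. Qed.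
Let hU p : (finsupp (h p) `<=` U)%fset. Proof. exact: (gU (ret_disc p)). Qed.

(** The affine extension of the vertex function [d] over the simplices, along [h]. *)
Let u (d : V -> R) (p : R * R) : R := \sum_(v <- U) d v * h p v.

Let coord_lip v : lip2 L (fun p => h p v).
Proof. by move=> p q; apply: le_trans (coord_mdist _ _ _) (hL p q). Qed.

Let u_lip (d : V -> R) : exists2 M, 0 <= M & lip2 (M * L) (u d).
Proof.
exists (\sum_(v <- U) `|d v|); first by apply: sumr_ge0.
move=> p q; rewrite /u -sumrB; apply: le_trans (ler_norm_sum _ _ _) _.
rewrite -mulrA mulr_suml; apply: ler_sum => v _.
by rewrite -mulrBr normrM ler_wpM2l//; exact: coord_lip.
Qed.

Let u_cst (d : V -> R) k p : (forall v, v \in finsupp (h p) -> d v = k) -> u d p = k.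
Proof.
move=> H; rewrite /u -[RHS]mulr1 -(bary_sum (hU p)) mulr_sumr; apply: eq_bigr => v _.
have [/H->//|vh] := boolP (v \in finsupp (h p)).
by rewrite fsfun_dflt// !mulr0.
Qed.

Let null_set : exists Z : set (R * R), [/\ measurable Z,
  ((@lebesgue_measure R \x @lebesgue_measure R)%E Z = 0)%E &
  forall p, ~ Z p -> forall v, v \in U ->
    derivable (fun t => h (t, p.2) v) p.1 1 /\ derivable (fun t => h (p.1, t) v) p.2 1].
Proof.
pose mu2 := (@lebesgue_measure R \x @lebesgue_measure R)%E.
suff H (l : seq V) : exists Z : set (R * R), [/\ measurable Z, (mu2 Z = 0)%E &
  forall p, ~ Z p -> forall v, v \in l ->
    derivable (fun t => h (t, p.2) v) p.1 1 /\ derivable (fun t => h (p.1, t) v) p.2 1] by exact: H (U : seq V).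
elim: l => [|v l [Z [mZ Z0 ZP]]].
  by exists set0; split; [exact: measurable0|exact: measure0|move=> p _ v; rewrite in_nil].
pose Z1 := ~` [set p : R * R | derivable (fun t => h (t, p.2) v) p.1 1].
pose Z2 := ~` [set p : R * R | derivable (fun t => h (p.1, t) v) p.2 1].
have m1 : measurable Z1 := measurableC (measurable_derivable1 (coord_lip v)).
have m2 : measurable Z2 := measurableC (measurable_derivable2 (coord_lip v)).
have n1 := (@negligibleP _ _ _ mu2 _ m1).2 (lip2_derivable1_null (coord_lip v)).
have n2 := (@negligibleP _ _ _ mu2 _ m2).2 (lip2_derivable2_null (coord_lip v)).
have n3 := (@negligibleP _ _ _ mu2 _ mZ).2 Z0.
have mm := measurableU _ _ mZ (measurableU _ _ m1 m2).
exists (Z `|` (Z1 `|` Z2)); split=> //.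
  exact: (@negligibleP _ _ _ mu2 _ mm).1 (negligibleU n3 (negligibleU n1 n2)).
move=> p /not_orP[nZ /not_orP[/contrapT d1 /contrapT d2]] w.
rewrite in_cons => /predU1P[->|wl]; [exact: conj d1 d2|exact: ZP p nZ w wl].
Qed.

Let part1 p v := derive1 (fun t => h (t, p.2) v) p.1.
Let part2 p v := derive1 (fun t => h (p.1, t) v) p.2.

Let dx (f : R * R -> R) (p : R * R) := derive1 (fun t => f (t, p.2)) p.1.
Let dy (f : R * R -> R) (p : R * R) := derive1 (fun t => f (p.1, t)) p.2.

Let disc_interior p : p.1 ^+ 2 + p.2 ^+ 2 < 1 -> exists2 e : R, 0 < e &
  forall q, `|q.1 - p.1| <= e -> `|q.2 - p.2| <= e -> disc q.
Proof.
move=> d; set r := p.1 ^+ 2 + p.2 ^+ 2 in d.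
have p1 : `|p.1| <= 1.
  by rewrite -(ler_pXn2r (n := 2)) ?nnegrE// expr1n real_normK ?num_real//; have := sqr_ge0 p.2; rewrite /r in d; lra.
have p2 : `|p.2| <= 1.
  by rewrite -(ler_pXn2r (n := 2)) ?nnegrE// expr1n real_normK ?num_real//; have := sqr_ge0 p.1; rewrite /r in d; lra.
exists ((1 - r) / 6); first by rewrite divr_gt0// subr_gt0.
set e := (1 - r) / 6.
have e0 : 0 <= e by rewrite divr_ge0// subr_ge0 ltW.
have e1 : e <= 1 by rewrite /e ler_pdivrMr//; have := sqr_ge0 p.1; have := sqr_ge0 p.2; rewrite /r; lra.
have key (x y : R) : `|y| <= 1 -> `|x - y| <= e -> x ^+ 2 <= y ^+ 2 + 3 * e.
  by rewrite !ler_norml => /andP[? ?] /andP[? ?]; nra.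
move=> q /(key _ _ p1) h1 /(key _ _ p2) h2; rewrite /disc /=.
have : 6 * e = 1 - r by rewrite /e; field.
by rewrite /r; lra.
Qed.

(** The functions [a] and [b] map the realization to the plane. By [gram_bound] and [cN] the
    composite with [g] has a Jacobian at most that of [g], and [square_area_le] applies to the
    composite. *)
Lemma disc_area_ge : (((a1 - a0) * (b1 - b0))%:E <= area g)%E.
Proof.
have [Ma Ma0 la] := u_lip a; have [Mb Mb0 lb] := u_lip b.
have [Z [mZ Z0 ZP]] := null_set.
have lipw M M' d : M <= M' -> lip2 (M * L) (u d) -> lip2 (M' * L) (u d).
  move=> MM H p q; apply: le_trans (H p q) _; rewrite ler_wpM2r ?addr_ge0//.
  by rewrite ler_wpM2r.
have la' : lip2 (Num.max Ma Mb * L) (u a) by apply: lipw la; rewrite le_max lexx.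
have lb' : lip2 (Num.max Ma Mb * L) (u b) by apply: lipw lb; rewrite le_max lexx orbT.
have mdisc : measurable (@disc R).
  apply: closed_measurable2.
  have -> : @disc R = (fun p : R * R => p.1 ^+ 2 + p.2 ^+ 2) @^-1` [set x | x <= 1] by [].
  apply: closed_comp; last exact: closed_le.
  by move=> p _; apply: cvgD; apply: cvgM; [exact: cvg_fst|exact: cvg_fst|exact: cvg_snd|exact: cvg_snd].
have slo (x : R) : x <= -1 -> x <= - s by move=> h1; have := s1; lra.
have shi (x : R) : 1 <= x -> s <= x by have := s1; lra.
have retl x y : x <= -1 -> ret (x, y) = (- c (cl y), cl y).
  move=> h1; rewrite /ret /= (clo (slo _ h1)) csN clamp_lo//.
  by have := c1 (cl y); lra.
have retr x y : 1 <= x -> ret (x, y) = (c (cl y), cl y).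
  move=> h1; rewrite /ret /= (chi (shi _ h1)) cs clamp_hi//.
  by have := c1 (cl y); lra.
have retb x y : y <= -1 -> ret (x, y) = (cl x, - c (cl x)).
  move=> h1; rewrite /ret /= (clo (slo _ h1)) csN [X in (_, X)]clamp_lo//.
  by have := c1 (cl x); lra.
have rett x y : 1 <= y -> ret (x, y) = (cl x, c (cl x)).
  move=> h1; rewrite /ret /= (chi (shi _ h1)) cs [X in (_, X)]clamp_hi//.
  by have := c1 (cl x); lra.
have hE p q : ret p = ret q -> forall d, u d p = u d q by move=> E d; rewrite /u /h E.
have N11 : (-1 : R) <= -1 := lexx _.
have P11 : (1 : R) <= 1 := lexx _.
(* A coordinate that vanishes at [p] is minimal there, hence has derivative 0; so all sums run over
   the support, whose size is bounded. *)
have supp0 p v : ~ Z p -> v \notin finsupp (h p) -> part1 p v = 0 /\ part2 p v = 0.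
  move=> nZ vp; have hp : h p v = 0 by rewrite fsfun_dflt.
  have [vU|vU] := boolP (v \in U); last first.
    have hz q : h q v = 0 by rewrite fsfun_dflt//; apply: contra vU; exact: (fsubsetP (hU q)).
    have z1 : (fun t => h (t, p.2) v) = cst 0 by apply: boolp.funext => t; rewrite hz.
    have z2 : (fun t => h (p.1, t) v) = cst 0 by apply: boolp.funext => t; rewrite hz.
    by rewrite /part1 /part2 z1 z2 !derive1_cst.
  have [d1 d2] := ZP p nZ v vU; case: p {nZ vp} hp d1 d2 => x y /= hp d1 d2.
  by split; apply: derive1_min => //= t; rewrite hp bary_ge0.
have du d p : ~ Z p -> dx (u d) p = \sum_(v <- finsupp (h p)) d v * part1 p v /\
    dy (u d) p = \sum_(v <- finsupp (h p)) d v * part2 p v.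
  move=> nZ; have [_ e1] := @derive1_lincomb R V U (fun v t => h (t, p.2) v) d p.1 (fun v vU => (ZP p nZ v vU).1).
  have [_ e2] := @derive1_lincomb R V U (fun v t => h (p.1, t) v) d p.2 (fun v vU => (ZP p nZ v vU).2).
  split; rewrite [LHS](e1, e2); apply/esym; rewrite -(big_fset_incl _ (hU p))// => v _ /(supp0 _ _ nZ)[z1 z2].
    by rewrite -/(part1 p v) z1 mulr0.
  by rewrite -/(part2 p v) z2 mulr0.
(* The barycentric coordinates add up to 1, so their partial derivatives add up to 0, as
   [gram_bound] requires. *)
have sum0 p : ~ Z p -> \sum_(v <- finsupp (h p)) part1 p v = 0 /\ \sum_(v <- finsupp (h p)) part2 p v = 0.
  move=> nZ; have [e1 e2] := du (fun=> 1) p nZ.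
  have u1 q : u (fun=> 1) q = 1 by apply: u_cst.
  rewrite /dx /dy in e1 e2.
  have z1 : (fun t => u (fun=> 1) (t, p.2)) = cst 1 by apply: boolp.funext => t; rewrite u1.
  have z2 : (fun t => u (fun=> 1) (p.1, t)) = cst 1 by apply: boolp.funext => t; rewrite u1.
  rewrite z1 derive1_cst in e1; rewrite z2 derive1_cst in e2.
  split; first by rewrite [RHS]e1; apply: eq_bigr => v _; rewrite mul1r.
  by rewrite [RHS]e2; apply: eq_bigr => v _; rewrite mul1r.
(* Outside the disc the retraction is constant in one direction on one side of [p], and the
   determinant vanishes; the circle itself is included. *)
have out p : 1 <= p.1 ^+ 2 + p.2 ^+ 2 -> (forall d, dx (u d) p = 0) \/ (forall d, dy (u d) p = 0).
  case: p => x y /= xy.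
  have one x' y' : 1 <= x' ^+ 2 + y' ^+ 2 -> - s <= y' <= s -> c y' <= `|x'| /\ s <= `|x'|.
    move=> d ys; have h1 : c y' <= `|x'|.
      by rewrite -ler_sqr ?nnegrE// real_normK ?num_real// csq//; lra.
    by split=> //; exact: le_trans (cge ys) h1.
  have [ys|ys] := boolP (- s <= y <= s).
    have [h1 h2] := one _ _ xy ys; left => d; apply: (@derive1_cst_one_side _ _ _ 1) => //.
    have [x0|x0] := leP 0 x; [left|right] => t /andP[t1 t2] /=; apply: hE; rewrite /ret /= (cid' ys).
      rewrite ger0_norm// in h1 h2; have t1' : x <= t := t1.
      by rewrite (chi h2) (chi (le_trans h2 t1')) (clamp_hi (cc y) h1) (clamp_hi (cc y) (le_trans h1 t1')).
    rewrite ltr0_norm// in h1 h2; have t2' : t <= x := t2.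
    have k1 : x <= - s by lra.
    have k2 : x <= - c y by lra.
    by rewrite (clo k1) (clo (le_trans t2' k1)) (clamp_lo (cc y) k2) (clamp_lo (cc y) (le_trans t2' k2)).
  right => d; apply: (@derive1_cst_one_side _ _ _ 1) => //.
  have cx : s < `|y| -> c (cl x) <= `|y|.
    move=> sy; have [xs|xs] := boolP (- s <= x <= s).
      by rewrite cid'//; apply: (one y x _ xs).1; rewrite addrC.
    have [hx|[hx|hx]] := cases x; [by rewrite clo// csN ltW|by rewrite hx in xs|by rewrite chi// cs ltW].
  have sy : s < `|y| by rewrite ltNge ler_norml.
  have {}cx := cx sy.
  have [y0|y0] := leP 0 y; [left|right] => t /andP[t1 t2] /=; apply: hE; rewrite /ret /=.
    rewrite ger0_norm// in cx sy; have t1' : y <= t := t1.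
    by rewrite (chi (ltW sy)) (chi (le_trans (ltW sy) t1')) (clamp_hi (cc (cl x)) cx) (clamp_hi (cc (cl x)) (le_trans cx t1')).
  rewrite ltr0_norm// in cx sy; have t2' : t <= y := t2.
  have k1 : y <= - s by lra.
  have k2 : y <= - c (cl x) by lra.
  by rewrite (clo k1) (clo (le_trans t2' k1)) (clamp_lo (cc (cl x)) k2) (clamp_lo (cc (cl x)) (le_trans t2' k2)).
have outdet p : 1 <= p.1 ^+ 2 + p.2 ^+ 2 -> dx (u a) p * dy (u b) p - dy (u a) p * dx (u b) p = 0.
  by move=> /out[H|H]; rewrite !H ?mul0r ?mulr0 subrr.
rewrite /area; apply: (square_area_le la' lb') (mdisc) _ mZ Z0 _ _ _.
- by move=> x y x1; apply: u_cst; rewrite /h retl//; exact: a_left.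
- by move=> x y x1; apply: u_cst; rewrite /h retr//; exact: a_right.
- by move=> x y x1; apply: u_cst; rewrite /h retb//; exact: b_bottom.
- by move=> x y x1; apply: u_cst; rewrite /h rett//; exact: b_top.
- by move=> x y y1; apply: hE; rewrite !retb.
- by move=> x y y1; apply: hE; rewrite !rett.
- by move=> x y y1; apply: hE; rewrite !retl.
- by move=> x y y1; apply: hE; rewrite !retr.
- move=> [x y]; rewrite /disc /= => d; rewrite !in_itv /=.
  have := sqr_ge0 x; have := sqr_ge0 y => h1 h2.
  by split; apply/andP; split; nra.
- by move=> p _; rewrite sqrtr_ge0.
- move=> p _ _ nZ dp.
  rewrite -[X in `|X|]/(dx (u a) p * dy (u b) p - dy (u a) p * dx (u b) p).
  have [pin|pout] := ltP (p.1 ^+ 2 + p.2 ^+ 2) 1; last by rewrite outdet// normr0 sqrtr_ge0.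
  have [e e0 eP] := disc_interior pin.
  have e00 : `|0 : R| <= e by rewrite normr0 ltW.
  have p1E v : partial1 g p v = part1 p v.
    apply: (derive1_near e0) => t te; rewrite /h ret_id//.
    by apply: eP => //=; rewrite subrr.
  have p2E v : partial2 g p v = part2 p v.
    apply: (derive1_near e0) => t te; rewrite /h ret_id//.
    by apply: eP => //=; rewrite subrr.
  have hp : h p = g p by rewrite /h ret_id.
  have fE (F : V -> R) : (forall v, v \notin finsupp (h p) -> F v = 0) -> fsum F = \sum_(v <- finsupp (h p)) F v.
    move=> H; rewrite /fsum (fsbigE (finsupp (h p)))//.
      by apply: eq_bigl => v; rewrite in_setT.
    by move=> v _; exact: H.
  rewrite jacobianE !fE; last 3 first.
  - by move=> v /(supp0 _ _ nZ)[z1 z2]; rewrite p1E p2E z1 mul0r.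
  - by move=> v /(supp0 _ _ nZ)[z1 z2]; rewrite p2E z2 expr0n.
  - by move=> v /(supp0 _ _ nZ)[z1 z2]; rewrite p1E z1 expr0n.
  have -> : partial1 g p = part1 p by exact: boolp.funext.
  have -> : partial2 g p = part2 p by exact: boolp.funext.
  have [-> ->] := du a p nZ; have [-> ->] := du b p nZ.
  have [s10 s20] := sum0 p nZ.
  apply: le_trans (gram_bound s10 s20 (aS (x := h p)) (bS (x := h p))) _.
  rewrite -[leRHS]mul1r ler_wpM2r ?sqrtr_ge0//; apply: le_trans cN.
  rewrite ler_wpM2r// ler_wpM2l ?mulr_ge0// ler_sqr ?nnegrE// ler_nat.
  exact: supN.
- move=> p _ _ _ /negP; rewrite -ltNge => pout.
  by apply: outdet; exact: ltW.
Qed.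

End DiscArea.

Section CircleLipschitz.
Variable R : realType.

Lemma cos_sin_lip (x y : R) : `|(cos x, sin x) - (cos y, sin y)| <= `|x - y|.
Proof.
wlog xy : x y / y <= x.
  move=> H; have [h|/ltW h] := leP y x; first exact: H.
  by rewrite -normrN opprB [leRHS]distrC; exact: H.
have key (f df : R -> R) : (forall z : R, is_derive z (1 : R) f (df z)) -> (forall z, `|df z| <= 1) -> `|f x - f y| <= `|x - y|.
  move=> fd f1; have [|c _ ->] := @MVT_segment R f df y x xy (fun z _ => fd z).
    apply: continuous_subspaceT => z; apply: differentiable_continuous.
    by apply/derivable1_diffP; case: (fd z).
  by rewrite normrM ler_piMl.
rewrite prod_normE /= ge_max; apply/andP; split.
  apply: (key cos (fun z => - sin z)) => z.
  by rewrite normrN ler_norml sin_geN1 sin_le1.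
by apply: (key sin cos) => z; rewrite ler_norml cos_geN1 cos_le1.
Qed.

End CircleLipschitz.

(** * A loop along four given paths *)

Section SquareLoop.
Variables (R : realType) (V : choiceType) (K : complex V).
Local Notation X := (realization R K).
Variable s : R.
Hypotheses (s0 : 0 < s) (s2 : s ^+ 2 *+ 2 = 1).
Variables (D m : R) (b t l r : R -> X) (x00 x10 x01 x11 : X).
Hypotheses (D0 : 0 <= D) (m0 : 0 < m).
Hypotheses (bb : mpath m x00 x10 b) (tt : mpath m x01 x11 t) (ll : mpath m x00 x01 l) (rr : mpath m x10 x11 r).
Hypotheses (bD : glip D b) (tD : glip D t) (lD : glip D l) (rD : glip D r).

Let ka := m / (2 * s).
Let uu (x : R) := ka * (x + s).
Let ka0 : 0 < ka. Proof. by rewrite divr_gt0// mulr_gt0. Qed.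
Let uuN : uu (- s) = 0. Proof. by rewrite /uu addNr mulr0. Qed.
Let uuP : uu s = m. Proof. by rewrite /uu /ka; field; rewrite gt_eqF. Qed.
Let uuB x y : `|uu x - uu y| = ka * `|x - y|.
Proof. by rewrite /uu -mulrBr opprD addrACA subrr addr0 normrM gtr0_norm. Qed.

(** The circle is cut at the corners of the inscribed square; on each arc the projection to the
    parallel side gives the parameter. *)
Definition square_loop (p : R * R) : X :=
  if p.1 <= - s then l (uu p.2) else if s <= p.1 then r (uu p.2)
  else if p.2 <= 0 then b (uu p.1) else t (uu p.1).

Let b0 : b 0 = x00. Proof. by have [_ [_ [H _]]] := bb; exact: H. Qed.
Let bm : b m = x10. Proof. by have [_ [_ [_ H]]] := bb; exact: H. Qed.
Let t0 : t 0 = x01. Proof. by have [_ [_ [H _]]] := tt; exact: H. Qed.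
Let tm : t m = x11. Proof. by have [_ [_ [_ H]]] := tt; exact: H. Qed.
Let l0 : l 0 = x00. Proof. by have [_ [_ [H _]]] := ll; exact: H. Qed.
Let lm : l m = x01. Proof. by have [_ [_ [_ H]]] := ll; exact: H. Qed.
Let r0 : r 0 = x10. Proof. by have [_ [_ [H _]]] := rr; exact: H. Qed.
Let rm : r m = x11. Proof. by have [_ [_ [_ H]]] := rr; exact: H. Qed.

Let on (p : R -> X) (x y : R) : glip D p -> pjoin D (ka * `|x - y|) (p (uu x)) (p (uu y)).
Proof. by move=> pD; rewrite -uuB; exact: pjoin_on. Qed.

Let oN (p : R -> X) (x : R) : glip D p -> pjoin D (ka * `|x + s|) (p (uu x)) (p 0).
Proof. by move=> pD; have := on x (- s) pD; rewrite uuN opprK. Qed.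

Let oP (p : R -> X) (x : R) : glip D p -> pjoin D (ka * `|x - s|) (p (uu x)) (p m).
Proof. by move=> pD; have := on x s pD; rewrite uuP. Qed.

Let full (p : R -> X) : glip D p -> pjoin D (ka * (2 * s)) (p 0) (p m).
Proof.
move=> pD; have := on (- s) s pD; rewrite uuN uuP.
by have -> : `|- s - s| = 2 * s; [rewrite -opprD normrN gtr0_norm ?addr_gt0//; ring|].
Qed.

Let tri d e (x y z : X) : pjoin D d x y -> pjoin D e y z -> pjoin D (d + e) x z.
Proof. exact: pjoin_trans. Qed.

Let abs1 (p q : R * R) : `|p.1 - q.1| <= `|p - q|.
Proof. by case: p q => [x y] [x' y']; rewrite prod_normE /= le_max lexx. Qed.

Let abs2 (p q : R * R) : `|p.2 - q.2| <= `|p - q|.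
Proof. by case: p q => [x y] [x' y']; rewrite prod_normE /= le_max lexx orbT. Qed.

Let fin (d e : R) (x y : X) : d <= ka * (3 * e) -> pjoin D d x y -> pjoin D (3 * ka * e) x y.
Proof. by move=> de; apply: pjoin_le; apply: le_trans de _; rewrite mulrA [ka * 3]mulrC. Qed.

Let side (p : R * R) : circle p ->
  [\/ p.1 <= - s /\ - s <= p.2 <= s, s <= p.1 /\ - s <= p.2 <= s,
      (- s < p.1 < s) /\ p.2 <= - s | (- s < p.1 < s) /\ s <= p.2].
Proof.
case: p => x y; rewrite /circle /= => xy.
have sq (u v : R) : u ^+ 2 + v ^+ 2 = 1 -> s <= u \/ u <= - s -> - s <= v <= s.
  move=> uv h; have u2 : s ^+ 2 <= u ^+ 2 by have := s0; case: h => h h'; nra.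
  have v2 : v ^+ 2 <= s ^+ 2 by have := s2; lra.
  by rewrite -ler_norml -ler_sqr ?nnegrE ?(ltW s0)// real_normK ?num_real.
have [h|h] := leP x (- s); first by constructor 1; split=> //; apply: (sq x) => //; right.
have [h'|h'] := leP s x; first by constructor 2; split=> //; apply: (sq x) => //; left.
have [y0|y0] := leP y 0.
  constructor 3; split; first exact/andP.
  by rewrite leNgt; apply/negP => h2; have := s2; nra.
constructor 4; split; first exact/andP.
by rewrite leNgt; apply/negP => h2; have := s2; nra.
Qed.

Let loopL p : p.1 <= - s -> square_loop p = l (uu p.2).
Proof. by move=> h; rewrite /square_loop h. Qed.

Let loopR p : s <= p.1 -> square_loop p = r (uu p.2).
Proof. by move=> h; rewrite /square_loop h leNgt (_ : - s < p.1)//; have := s0; lra. Qed.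

Let loopB p : - s < p.1 < s -> p.2 <= 0 -> square_loop p = b (uu p.1).
Proof. by move=> /andP[h1 h2] h; rewrite /square_loop h leNgt h1 leNgt h2. Qed.

Let loopT p : - s < p.1 < s -> 0 < p.2 -> square_loop p = t (uu p.1).
Proof. by move=> /andP[h1 h2] h; rewrite /square_loop (leNgt p.1) h1 (leNgt s) h2 leNgt h. Qed.

Let dist_ge (x y z : R) : z <= x - y -> z <= `|x - y|.
Proof. by move=> h; apply: le_trans h (ler_norm _). Qed.

(** The two points are joined along at most three sides, whose lengths add up to at most three times
    the distance of [p] and [q]. *)
Lemma square_loop_join p q : circle p -> circle q -> pjoin D (3 * ka * `|p - q|) (square_loop p) (square_loop q).
Proof.
wlog : p q / (p.1 <= q.1) => [H cp cq|pq1].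
  by have [h|/ltW h] := leP p.1 q.1; [exact: H|rewrite -normrN opprB; apply/pjoin_sym; exact: H].
move=> cp cq; have h1 := abs1 p q; have h2 := abs2 p q.
have key (c d e : R) : c + d + e <= 3 * `|p - q| -> ka * c + ka * d + ka * e <= ka * (3 * `|p - q|).
  by move=> h; rewrite -!mulrDr ler_pM2l.
have key2 (c d : R) : c + d <= 3 * `|p - q| -> ka * c + ka * d <= ka * (3 * `|p - q|).
  by move=> h; rewrite -mulrDr ler_pM2l.
have key1 (c : R) : c <= `|p - q| -> ka * c <= ka * (3 * `|p - q|).
  by move=> h; rewrite ler_pM2l//; have := normr_ge0 (p - q); lra.
have sl := s0; have N0 := normr_ge0 (p - q).
have a1 := dist_ge (x := q.1) (y := p.1) (lexx _); rewrite distrC in a1.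
have a2 := dist_ge (x := q.2) (y := p.2) (lexx _); rewrite distrC in a2.
have a2' := dist_ge (x := p.2) (y := q.2) (lexx _).
have sp1 (z : R) : - s <= z -> `|z + s| = z + s by move=> h; rewrite ger0_norm//; lra.
have sm1 (z : R) : z <= s -> `|z - s| = s - z by move=> h; rewrite ler0_norm//; lra.
have [[p1 /andP[p2 p3]]|[p1 /andP[p2 p3]]|[pI p3]|[pI p3]] := side cp;
have [[q1 /andP[q2 q3]]|[q1 /andP[q2 q3]]|[qI q3]|[qI q3]] := side cq.
- by rewrite (loopL p1) (loopL q1); apply: fin (on p.2 q.2 lD); exact: key1.
- rewrite (loopL p1) (loopR q1).
  have J := oN p.2 lD; rewrite l0 -b0 in J; have J' := full bD; rewrite bm -r0 in J'.
  apply: fin (tri (tri J J') (pjoin_sym (oN q.2 rD))).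
  by apply: key; rewrite !sp1//; lra.
- have q4 : q.2 <= 0 by lra.
  rewrite (loopL p1) (loopB qI q4); case/andP: qI => q1 q2.
  have J := oN p.2 lD; rewrite l0 -b0 in J.
  apply: fin (tri J (pjoin_sym (oN q.1 bD))).
  by apply: key2; rewrite !sp1//; lra.
- have q4 : 0 < q.2 by lra.
  rewrite (loopL p1) (loopT qI q4); case/andP: qI => q1 q2.
  have J := oP p.2 lD; rewrite lm -t0 in J.
  apply: fin (tri J (pjoin_sym (oN q.1 tD))).
  by apply: key2; rewrite sp1 ?sm1//; lra.
- by exfalso; lra.
- by rewrite (loopR p1) (loopR q1); apply: fin (on p.2 q.2 rD); exact: key1.
- by exfalso; case/andP: qI => q1 q2; lra.
- by exfalso; case/andP: qI => q1 q2; lra.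
- by exfalso; case/andP: pI => q1' q2'; lra.
- have p4 : p.2 <= 0 by lra.
  rewrite (loopB pI p4) (loopR q1); case/andP: pI => p1 p2.
  have J := oP p.1 bD; rewrite bm -r0 in J.
  apply: fin (tri J (pjoin_sym (oN q.2 rD))).
  by apply: key2; rewrite sp1 ?sm1//; lra.
- have p4 : p.2 <= 0 by lra.
  have q4 : q.2 <= 0 by lra.
  by rewrite (loopB pI p4) (loopB qI q4); apply: fin (on p.1 q.1 bD); exact: key1.
- have p4 : p.2 <= 0 by lra.
  have q4 : 0 < q.2 by lra.
  rewrite (loopB pI p4) (loopT qI q4); case/andP: pI => p1 p2; case/andP: qI => q1 q2.
  have J := oN p.1 bD; rewrite b0 -l0 in J; have J' := full lD; rewrite lm -t0 in J'.
  apply: fin (tri (tri J J') (pjoin_sym (oN q.1 tD))).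
  by apply: key; rewrite !sp1//; lra.
- by exfalso; case/andP: pI => q1' q2'; lra.
- have p4 : 0 < p.2 by lra.
  rewrite (loopT pI p4) (loopR q1); case/andP: pI => p1 p2.
  have J := oP p.1 tD; rewrite tm -rm in J.
  apply: fin (tri J (pjoin_sym (oP q.2 rD))).
  by apply: key2; rewrite !sm1//; lra.
- have p4 : 0 < p.2 by lra.
  have q4 : q.2 <= 0 by lra.
  rewrite (loopT pI p4) (loopB qI q4); case/andP: pI => p1 p2; case/andP: qI => q1 q2.
  have J := oN p.1 tD; rewrite t0 -lm in J; have J' := full lD.
  have {}J := tri J (pjoin_sym J'); rewrite l0 -b0 in J.
  apply: fin (tri J (pjoin_sym (oN q.1 bD))).
  by apply: key; rewrite !sp1//; lra.
- have p4 : 0 < p.2 by lra.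
  have q4 : 0 < q.2 by lra.
  by rewrite (loopT pI p4) (loopT qI q4); apply: fin (on p.1 q.1 tD); exact: key1.
Qed.

Let Lf := D * (3 * ka).

Lemma square_loop_path_dist p q : circle p -> circle q ->
  (path_dist (square_loop p) (square_loop q) <= (Lf * `|p - q|)%:E)%E.
Proof. by move=> cp cq; have := pjoin_path_dist D0 (square_loop_join cp cq); rewrite /Lf -!mulrA. Qed.

Lemma square_loop_length : (loop_length square_loop <= (Lf * (2 * pi))%:E)%E.
Proof.
have p0 : 0 <= 2 * pi :> R by rewrite mulr_ge0// pi_ge0.
have Lf0 : 0 <= Lf by rewrite /Lf mulr_ge0// mulr_ge0// ltW.
have := @lipc_length _ _ _ 0 (2 * pi) Lf (fun u => square_loop (cos u, sin u)) p0.
rewrite subr0; apply=> u v _ uv _.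
have ci (w : R) : circle (cos w, sin w) by rewrite /circle /= cos2Dsin2.
rewrite -lee_fin; apply: le_trans (mdist_le_path_dist _ _) _.
apply: le_trans (square_loop_path_dist (ci u) (ci v)) _; rewrite lee_fin ler_wpM2l//.
by apply: le_trans (cos_sin_lip _ _) _; rewrite distrC ger0_norm ?subr_ge0.
Qed.

Let c (t : R) := Num.sqrt (1 - t ^+ 2).

Lemma square_loop_sides (x : R) : - s <= x <= s ->
  [/\ square_loop (- c x, x) = l (uu x), square_loop (c x, x) = r (uu x),
      square_loop (x, - c x) = b (uu x) & square_loop (x, c x) = t (uu x)].
Proof.
move=> xs; have cx : s <= c x := sqrt_ge_half s0 s2 xs; have sl := s0.
have cs : c s = s.
  rewrite /c; have -> : 1 - s ^+ 2 = s ^+ 2 by rewrite -s2; ring.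
  by rewrite sqrtr_sqr ger0_norm// ltW.
have e1 : - c x <= - s by rewrite lerN2.
have csN : c (- s) = s by rewrite /c sqrrN.
case/andP: (xs) => xs1 xs2.
have [xl|xl] := eqVneq x (- s).
  rewrite xl csN uuN; have h : - s <= - s := lexx _.
  split; [by rewrite loopL//= uuN|by rewrite loopR//= uuN|by rewrite loopL//= uuN l0 b0|by rewrite loopL//= uuP lm t0].
have [xr|xr] := eqVneq x s.
  rewrite xr cs uuP; split; [by rewrite loopL//= uuP|by rewrite loopR//= uuP|by rewrite loopR//= uuN r0 bm|by rewrite loopR//= uuP rm tm].
have xI : - s < x < s by rewrite !lt_neqAle xs1 xs2 xr eq_sym xl.
split; [by rewrite loopL|by rewrite loopR|by rewrite loopB//=; lra|by rewrite loopT//=; lra].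
Qed.

End SquareLoop.

Section ClampArithmetic.
Variable R : realType.
Implicit Types k M m u w e : R.

Lemma clamp_scaled_lip k M m u w e : 0 <= k -> `|u - e| <= M -> `|w - e| <= M ->
  `|k * clamp M (m - M) u - k * clamp M (m - M) w| <= k * (2 * M).
Proof.
move=> k0 h1 h2; rewrite -mulrBr normrM (ger0_norm k0) ler_wpM2l//.
apply: le_trans (clamp_lip _ _ _ _) _; move: h1 h2; rewrite !ler_norml => /andP[? ?] /andP[? ?].
by apply/andP; split; lra.
Qed.

Lemma clamp_near_lo M m u : 2 * M <= m -> `|u| <= M -> clamp M (m - M) u = M.
Proof. by move=> mM; rewrite ler_norml => /andP[_ h]; rewrite clamp_lo//; lra. Qed.

Lemma clamp_near_hi M m u : 2 * M <= m -> `|u - m| <= M -> clamp M (m - M) u = m - M.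
Proof. by move=> mM; rewrite ler_norml => /andP[h _]; rewrite clamp_hi//; lra. Qed.

(** The slope of the plane coordinates is chosen small enough that the factor in [gram_bound] is at
    most 1. *)
Lemma slope_bound M N : 0 <= M -> 0 <= N ->
  (4 * (M + 1) * (N + 1))^-1 * (2 * M) * ((4 * (M + 1) * (N + 1))^-1 * (2 * M)) * N ^+ 2 * 2 <= 1.
Proof.
move=> M0 N0; set k := _^-1; have Mp : 0 < M + 1 by lra.
have Np : 0 < N + 1 by lra.
have T0 : k * (2 * M) * N <= 2^-1.
  have -> : k * (2 * M) * N = 2 * M * N / (4 * (M + 1) * (N + 1)) by rewrite /k; ring.
  rewrite ler_pdivrMr ?mulr_gt0//.
  have h1 : 2 * M * N <= 2 * (M + 1) * (N + 1) by apply: ler_pM; rewrite ?mulr_ge0//; lra.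
  lra.
have k0 : 0 <= k by rewrite invr_ge0 !mulr_ge0//; lra.
have T1 : 0 <= k * (2 * M) * N by rewrite !mulr_ge0.
have -> : k * (2 * M) * (k * (2 * M)) * N ^+ 2 * 2 = (k * (2 * M) * N) ^+ 2 * 2 by ring.
by move: (k * (2 * M) * N) T0 T1 => t T0 T1; nra.
Qed.

End ClampArithmetic.

(** * The Dehn function is at least quadratic *)

Section DehnLower.
Variables (R : realType) (V : choiceType) (K : complex V) (r n : nat).
Hypotheses (r1 : (1 < r)%N) (n1 : (1 < n)%N).
Local Notation X := (realization R K).
Local Notation G := (Lambda r n).

Lemma wordval_nseq m (a : 'I_r * 'I_n * bool) : wordval (nseq m a) = (lval a ^+ m)%g.
Proof. by elim: m => [|m IH] /=; rewrite ?expg0// IH expgS. Qed.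

Lemma cexp_expg i p (g : G) m : cexp i p (g ^+ m)%g = cexp i p g *+ m.
Proof. by elim: m => [|m IH]; rewrite ?expg0 ?(cexp1 r1)// expgS (cexpM r1) IH mulrS. Qed.

Variable act : G -> X -> X.
Hypothesis act1 : forall x, act 1%g x = x.
Hypothesis actM : forall g h x, act (g * h)%g x = act g (act h x).
Hypothesis act_iso : forall g x y, path_dist (act g x) (act g y) = path_dist x y.
Hypothesis act_proper : forall A : set X, compact A -> finite_set [set g | (act g @` A) `&` A !=set0].
Variable C : set X.
Hypothesis Ccompact : compact C.
Hypothesis Ccover : \bigcup_g (act g @` C) = setT.
Hypothesis sc : simply_connected R K.
Variables (y0 : X) (v0 : V).
Hypothesis Kv0 : face K [fset v0]%fset.
Local Notation x0 := (vert y0 v0).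
Hypothesis Cx0 : C x0.

Let alip : forall g, preserves_lip (act g).
Proof. by move=> g; exact: act_lip. Qed.

Lemma pjoin_comp (f : X -> X) D d x y : preserves_lip f -> 0 <= D -> pjoin D d x y -> pjoin D d (f x) (f y).
Proof.
move=> fL D0 [a [p [ad pp pD]]]; exists a, (f \o p); split=> //; first exact: mpath_comp.
exact: glip_comp.
Qed.

Lemma nseq_near (P : 'I_r * 'I_n -> R -> X) D m a (u : R) :
  (forall s, mpath 1 x0 (act (cgen s.1 s.2) x0) (P s)) -> 0 <= D -> (forall w, glip D (wpath act x0 P w)) ->
  exists j, pjoin D 1 (act (lval a ^+ j)%g x0) (wpath act x0 P (nseq m a) u).
Proof.
move=> Pm D0 DP; have triv d x : 0 <= d -> pjoin D d x x.
  move=> d0; exists 0, (fun=> x); split=> //; first exact: mpath_cst.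
  by move=> s t st; rewrite mdistxx mulr_ge0// subr_ge0.
elim: m u => [|m IH] u; first by exists 0; rewrite expg0 act1; exact: triv.
have [u1|u1] := leP u 1.
  exists 0; rewrite expg0 act1.
  have [_ [_ [p0 _]]] := wpath_mpath act1 actM alip Pm (nseq m.+1 a).
  have [u0|u0] := leP u 0; first by rewrite p0//; exact: triv.
  have J := pjoin_on 0 u D0 (DP (nseq m.+1 a)); rewrite (p0 0 (lexx 0)) in J.
  apply: pjoin_le J; by rewrite sub0r normrN ger0_norm// ltW.
have [j J] := IH (u - 1); exists j.+1.
rewrite expgS actM /= /pcat leNgt u1 /=.
exact: pjoin_comp (alip _) D0 J.
Qed.

(** The disc is swept by radial curves from its center, to which [reach_supp] applies. *)
Lemma lipschitz_disc_supp (g : R * R -> X) L : 0 <= L ->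
  (forall p q, disc p -> disc q -> mdist (g p) (g q) <= L * `|p - q|) ->
  exists U : {fset V}, forall p, disc p -> (finsupp (g p) `<=` U)%fset.
Proof.
move=> L0 gL; have [U UP] := reach_supp act1 actM act_iso act_proper Ccompact Ccover (finsupp (g (0, 0))) L0.
exists U => -[x y] d; rewrite /disc /= in d.
have x1 : `|x| <= 1 by rewrite -(ler_pXn2r (n := 2)) ?nnegrE// expr1n real_normK ?num_real//; have := sqr_ge0 y; lra.
have y1 : `|y| <= 1 by rewrite -(ler_pXn2r (n := 2)) ?nnegrE// expr1n real_normK ?num_real//; have := sqr_ge0 x; lra.
pose c (t : R) := g (t * x, t * y).
have cd (t : R) : 0 <= t -> t <= 1 -> disc (t * x, t * y).
  move=> t0 t1; rewrite /disc /= !exprMn -mulrDr mulr_ile1 ?sqr_ge0 ?addr_ge0 ?sqr_ge0//.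
  by rewrite expr_le1.
have cL : lipc 0 1 L c.
  move=> s t s0 st t1; have s1 := le_trans st t1; have t0 := le_trans s0 st.
  apply: le_trans (gL _ _ (cd s s0 s1) (cd t t0 t1)) _; rewrite ler_wpM2l// prod_normE /=.
  rewrite -!mulrBl !normrM distrC (ger0_norm (x := t - s)) ?subr_ge0//.
  by rewrite ge_max !ler_piMr ?subr_ge0.
have c0 : (finsupp (c 0) `<=` finsupp (g (0, 0)))%fset by rewrite /c !mul0r.
by have := UP c cL c0 1; rewrite /c !mul1r ler01 lexx; exact.
Qed.

Section Wide.
Variables (P : 'I_r * 'I_n -> R -> X) (D B : R) (N : nat) (i0 : 'I_r) (p0 p1 : 'I_n) (ve : V -> G) (M : R).
Hypothesis Pm : forall s, mpath 1 x0 (act (cgen s.1 s.2) x0) (P s).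
Hypotheses (D0 : 0 <= D) (DB : D <= B).
Hypothesis DP : forall w, glip D (wpath act x0 P w).
Hypothesis NP : forall x : X, (#|` finsupp x| <= N)%N.
Hypothesis p01 : p0 != p1.
Hypothesis M0 : 0 <= M.
Hypothesis near1 : forall g x v, pjoin B 2 (act g x0) x -> v \in finsupp x ->
  `|(cexp i0 p0 (ve v))%:~R - (cexp i0 p0 g)%:~R| <= M.
Hypothesis near2 : forall g x v, pjoin B 2 (act g x0) x -> v \in finsupp x ->
  `|(cexp i0 p1 (ve v))%:~R - (cexp i0 p1 g)%:~R| <= M.
Hypothesis trk : forall x, exists g, pjoin B 2 (act g x0) x.

Let toB d (x y : X) : pjoin D d x y -> pjoin B d x y.
Proof. by move=> [a [p [ad pp pD]]]; exists a, p; split=> //; exact: glip_le pD. Qed.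

Let near_word m a u : exists j, pjoin B 2 (act (lval a ^+ j)%g x0) (wpath act x0 P (nseq m a) u).
Proof.
have [j J] := nseq_near m a u Pm D0 DP; exists j; apply: toB; apply: pjoin_le J.
by rewrite ler1n.
Qed.

Let B0 : 0 <= B. Proof. exact: le_trans DB. Qed.

Let near_word2 g m a u : exists j, pjoin B 2 (act (g * lval a ^+ j)%g x0) ((act g \o wpath act x0 P (nseq m a)) u).
Proof. by have [j J] := near_word m a u; exists j; rewrite actM; exact: pjoin_comp. Qed.

Let ka : R := (4 * (M + 1) * (N%:R + 1))^-1.
Let ka0 : 0 < ka. Proof. by rewrite invr_gt0 !mulr_gt0// ltr_wpDl. Qed.

Let cexp_pow i p j q k : cexp i p (cgen j q ^+ k : G)%g = if (i == j) && (p == q) then Posz k else 0.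
Proof.
rewrite cexp_expg (cexp_gen r1); case: ifP => _; last by rewrite mul0rn.
by rewrite (_ : true%:R = 1 :> int)// natz.
Qed.

Let s : R := Num.sqrt 2^-1.
Let s0 : 0 < s. Proof. by rewrite sqrtr_gt0 invr_gt0. Qed.
Let s2 : s ^+ 2 *+ 2 = 1. Proof. by rewrite sqr_sqrtr ?invr_ge0// -mulr_natr mulVf. Qed.

(** Clamping to [M, m - M] absorbs the error [M] of the coarse coordinates: on the sides of the loop
    the functions take exactly constant values. *)
Let a1 (m : nat) v : R := ka * clamp M (m%:R - M) (cexp i0 p0 (ve v))%:~R.
Let a2 (m : nat) v : R := ka * clamp M (m%:R - M) (cexp i0 p1 (ve v))%:~R.

Let a1S m (x : X) v w : v \in finsupp x -> w \in finsupp x -> `|a1 m v - a1 m w| <= ka * (2 * M).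
Proof. by move=> vx wx; have [h J] := trk x; exact: clamp_scaled_lip (ltW ka0) (near1 J vx) (near1 J wx). Qed.

Let a2S m (x : X) v w : v \in finsupp x -> w \in finsupp x -> `|a2 m v - a2 m w| <= ka * (2 * M).
Proof. by move=> vx wx; have [h J] := trk x; exact: clamp_scaled_lip (ltW ka0) (near2 J vx) (near2 J wx). Qed.

Let xa : 'I_r * 'I_n * bool := ((i0, p0), false).
Let ya : 'I_r * 'I_n * bool := ((i0, p1), false).

Let lo1 m g x v : 2 * M <= m%:R -> pjoin B 2 (act g x0) x -> v \in finsupp x -> cexp i0 p0 g = 0 -> a1 m v = ka * M.
Proof.
move=> mM J vx g0; have := near1 J vx; rewrite g0 subr0 => h.
by rewrite /a1 clamp_near_lo.
Qed.

Let lo2 m g x v : 2 * M <= m%:R -> pjoin B 2 (act g x0) x -> v \in finsupp x -> cexp i0 p1 g = 0 -> a2 m v = ka * M.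
Proof.
move=> mM J vx g0; have := near2 J vx; rewrite g0 subr0 => h.
by rewrite /a2 clamp_near_lo.
Qed.

Let hi1 m g x v : 2 * M <= m%:R -> pjoin B 2 (act g x0) x -> v \in finsupp x -> cexp i0 p0 g = Posz m -> a1 m v = ka * (m%:R - M).
Proof.
move=> mM J vx g0; have := near1 J vx; rewrite g0 -pmulrn => h.
by rewrite /a1 clamp_near_hi.
Qed.

Let hi2 m g x v : 2 * M <= m%:R -> pjoin B 2 (act g x0) x -> v \in finsupp x -> cexp i0 p1 g = Posz m -> a2 m v = ka * (m%:R - M).
Proof.
move=> mM J vx g0; have := near2 J vx; rewrite g0 -pmulrn => h.
by rewrite /a2 clamp_near_hi.
Qed.

(** Powers of generators from two factors commute, so the four paths close up. On opposite sides of
    the loop one of the two exponents is fixed at 0 and at [m], which gives the boundary conditions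
    of [disc_area_ge]. *)
Lemma wide_loop (m : nat) : 2 * M <= m%:R -> (0 < m)%N ->
  exists f : R * R -> X, [/\ lipschitz_map (@circle R) f,
    (loop_length f <= (D * (3 * (2 * s)^-1) * (2 * pi) * m%:R)%:E)%E &
    ((ka ^+ 2 * (m%:R - 2 * M) ^+ 2)%:E <= filling_area f)%E].
Proof.
move=> mM m0; have mR : 0 < m%:R :> R by rewrite ltr0n.
pose Xm : G := (cgen i0 p0 ^+ m)%g; pose Ym : G := (cgen i0 p1 ^+ m)%g.
have XY : (Xm * Ym = Ym * Xm)%g by apply: commuteX2; exact: cgen_commute.
pose b := wpath act x0 P (nseq m xa); pose l := wpath act x0 P (nseq m ya).
have bm : mpath m%:R x0 (act Xm x0) b.
  by have := wpath_mpath act1 actM alip Pm (nseq m xa); rewrite wordval_nseq size_nseq.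
have lm : mpath m%:R x0 (act Ym x0) l.
  by have := wpath_mpath act1 actM alip Pm (nseq m ya); rewrite wordval_nseq size_nseq.
have tm := mpath_comp (alip Ym) bm; rewrite -actM -XY in tm.
have rm := mpath_comp (alip Xm) lm; rewrite -actM in rm.
have bD : glip D b := DP (nseq m xa); have lD : glip D l := DP (nseq m ya).
have tD := glip_comp (alip Ym) D0 bD; have rD := glip_comp (alip Xm) D0 lD.
have nb u : exists j, pjoin B 2 (act (cgen i0 p0 ^+ j)%g x0) (b u) := near_word m xa u.
have nl u : exists j, pjoin B 2 (act (cgen i0 p1 ^+ j)%g x0) (l u) := near_word m ya u.
have nt u : exists j, pjoin B 2 (act (Ym * cgen i0 p0 ^+ j)%g x0) ((act Ym \o b) u) := near_word2 Ym m xa u.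
have nr u : exists j, pjoin B 2 (act (Xm * cgen i0 p1 ^+ j)%g x0) ((act Xm \o l) u) := near_word2 Xm m ya u.
move: (act Ym \o b) (act Xm \o l) tm rm tD rD nt nr => t q tm rm tD rD nt nr.
move: b l bm lm bD lD nb nl => b l bm lm bD lD nb nl.
pose f := square_loop s m%:R b t l q.
have fS := square_loop_sides s0 s2 bm tm lm rm.
exists f; split.
- by exists (D * (3 * (m%:R / (2 * s)))) => z z' cz cz'; exact: (square_loop_path_dist s0 s2 D0 mR bm tm lm rm bD tD lD rD cz cz').
- have := square_loop_length s0 s2 D0 mR bm tm lm rm bD tD lD rD.
  move=> /le_trans; apply; rewrite lee_fin le_eqVlt; apply/orP; left; apply/eqP.
  by clear; ring.
apply: le_ereal_inf_tmp => _ [g [[L gL] gf] <-].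
pose L' := Num.max 0 L; have L0 : 0 <= L' by rewrite le_max lexx.
have gL' p q' : disc p -> disc q' -> mdist (g p) (g q') <= L' * `|p - q'|.
  move=> pd qd; rewrite -lee_fin; apply: le_trans (mdist_le_path_dist _ _) _.
  apply: le_trans (gL p q' pd qd) _; rewrite lee_fin; apply: ler_wpM2r; first exact: normr_ge0.
  by rewrite le_max lexx orbT.
have [U gU] := lipschitz_disc_supp L0 gL'.
have cir (z : R) : - s <= z <= s -> [/\ circle (z, Num.sqrt (1 - z ^+ 2)), circle (z, - Num.sqrt (1 - z ^+ 2)),
  circle (Num.sqrt (1 - z ^+ 2), z) & circle (- Num.sqrt (1 - z ^+ 2), z)].
  by move=> /(sqr_sqrt_circle s2) E; split; rewrite /circle /= ?sqrrN E; ring.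
have e1 j : cexp i0 p0 (cgen i0 p1 ^+ j : G)%g = 0 by rewrite cexp_pow (negbTE p01) andbF.
have e2 j : cexp i0 p1 (cgen i0 p0 ^+ j : G)%g = 0 by rewrite cexp_pow eq_sym (negbTE p01) andbF.
have e3 j : cexp i0 p0 (Xm * cgen i0 p1 ^+ j)%g = Posz m.
  by rewrite (cexpM r1) e1 addr0 cexp_pow !eqxx.
have e4 j : cexp i0 p1 (Ym * cgen i0 p0 ^+ j)%g = Posz m.
  by rewrite (cexpM r1) e2 addr0 cexp_pow !eqxx.
have -> : ka ^+ 2 * (m%:R - 2 * M) ^+ 2 = (ka * (m%:R - M) - ka * M) * (ka * (m%:R - M) - ka * M) by clear; ring.
apply: (@disc_area_ge R V K s s0 s2 g L' U N (a1 m) (a2 m) (ka * (2 * M)) (ka * (2 * M)) (ka * M) (ka * (m%:R - M)) (ka * M) (ka * (m%:R - M)) L0 gL' gU NP).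
- exact: mulr_ge0 (ltW ka0) (mulr_ge0 (ler0n _ 2) M0).
- exact: mulr_ge0 (ltW ka0) (mulr_ge0 (ler0n _ 2) M0).
- by move=> x v w; exact: a1S.
- by move=> x v w; exact: a2S.
- exact: slope_bound.
- move=> z zs v; have [_ _ _ ct] := cir z zs; rewrite (gf _ ct) /f; have [-> _ _ _] := fS z zs => vx.
  by have [j J] := nl (m%:R / (2 * s) * (z + s)); exact: lo1 mM J vx (e1 j).
- move=> z zs v; have [_ _ ct _] := cir z zs; rewrite (gf _ ct) /f; have [_ -> _ _] := fS z zs => vx.
  by have [j J] := nr (m%:R / (2 * s) * (z + s)); exact: hi1 mM J vx (e3 j).
- move=> z zs v; have [_ ct _ _] := cir z zs; rewrite (gf _ ct) /f; have [_ _ -> _] := fS z zs => vx.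
  by have [j J] := nb (m%:R / (2 * s) * (z + s)); exact: lo2 mM J vx (e2 j).
- move=> z zs v; have [ct _ _ _] := cir z zs; rewrite (gf _ ct) /f; have [_ _ _ ->] := fS z zs => vx.
  by have [j J] := nt (m%:R / (2 * s) * (z + s)); exact: hi2 mM J vx (e4 j).
Qed.

End Wide.

Lemma wide_loops : exists k M0 C1 : R, [/\ 0 < k, 0 <= M0, 0 <= C1 & forall m : nat, 2 * M0 <= m%:R -> (0 < m)%N ->
  exists f : R * R -> X, [/\ lipschitz_map (@circle R) f, (loop_length f <= (C1 * m%:R)%:E)%E &
    ((k * (m%:R - 2 * M0) ^+ 2)%:E <= filling_area f)%E]].
Proof.
have [N NP] := simplex_bound act1 actM act_iso act_proper Ccompact Ccover.
pose i0 : 'I_r := Ordinal (ltnW r1); pose p0 : 'I_n := Ordinal (ltnW n1); pose p1 : 'I_n := Ordinal n1.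
have p01 : p0 != p1 by [].
have letters (s : 'I_r * 'I_n) : exists p, mpath 1 x0 (act (cgen s.1 s.2) x0) p.
  by have [D _ [p pp _]] := lipschitz_connected act1 actM act_iso act_proper Ccompact Ccover sc y0 Kv0 (act (cgen s.1 s.2) x0); exists p.
pose P s := sval (cid (letters s)).
have Pm s : mpath 1 x0 (act (cgen s.1 s.2) x0) (P s) := svalP (cid (letters s)).
have [D D0 DP] := wpath_glip act1 actM alip Pm.
have [Dt Dt0 DtP] := compact_track act1 actM act_iso act_proper Ccompact Ccover sc y0 Kv0.
pose B := Num.max D Dt; have B0 : 0 <= B by rewrite le_max D0.
pose ve v := vertex_elt act1 actM Ccover y0 v.
have [M1 M10 MP1] := vertex_elt_near act1 actM act_iso act_proper Ccompact Ccover sc Kv0 Cx0 (cexpM r1 i0 p0) B0.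
have [M2 M20 MP2] := vertex_elt_near act1 actM act_iso act_proper Ccompact Ccover sc Kv0 Cx0 (cexpM r1 i0 p1) B0.
pose M := Num.max M1 M2; have M0 : 0 <= M by rewrite le_max M10.
have toB D' d (x y : X) : D' <= B -> pjoin D' d x y -> pjoin B d x y.
  by move=> DB [a [p [ad pp pD]]]; exists a, p; split=> //; exact: glip_le pD.
have DB : D <= B by rewrite le_max lexx.
have near1 g x v : pjoin B 2 (act g x0) x -> v \in finsupp x -> `|(cexp i0 p0 (ve v))%:~R - (cexp i0 p0 g)%:~R| <= M.
  by move=> J vx; apply: le_trans (MP1 g x v J vx) _; rewrite le_max lexx.
have near2 g x v : pjoin B 2 (act g x0) x -> v \in finsupp x -> `|(cexp i0 p1 (ve v))%:~R - (cexp i0 p1 g)%:~R| <= M.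
  by move=> J vx; apply: le_trans (MP2 g x v J vx) _; rewrite le_max lexx orbT.
have trk x : exists g, pjoin B 2 (act g x0) x.
  have [g Cg] := act_cover act1 actM Ccover x; have [p pp pD] := DtP _ Cg.
  exists g; apply: (toB Dt); first by rewrite le_max lexx orbT.
  have := pjoin_comp (alip g) Dt0 (ex_intro _ 2 (ex_intro _ p (And3 (lexx 2) pp pD))).
  by rewrite -actM mulgV act1.
have c12 : 1 <= 2 :> R by rewrite ler1n.
have H := wide_loop Pm D0 DB DP NP p01 M0 near1 near2 trk.
pose s : R := Num.sqrt 2^-1.
have s0 : 0 < s by rewrite sqrtr_gt0 invr_gt0.
exists ((4 * (M + 1) * (N%:R + 1))^-1 ^+ 2), M, (D * (3 * (2 * s)^-1) * (2 * pi)); split=> //.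
- by rewrite exprn_gt0// invr_gt0 !mulr_gt0// ltr_wpDl.
- apply: mulr_ge0; last by rewrite mulr_ge0// pi_ge0.
  by rewrite mulr_ge0// mulr_ge0// invr_ge0 mulr_ge0// ltW.
Qed.

Lemma square_dominated : dominated (fun l : R => (l ^+ 2)%:E) (@dehn R V K).
Proof.
have [k [M [C1 [k0 M0 C10 H]]]] := wide_loops.
pose c := k^-1 + C1 * (2 * M + 3) + 1.
have ki : 0 < k^-1 by rewrite invr_gt0.
have CM : 0 <= C1 * (2 * M + 3) by rewrite mulr_ge0//; lra.
exists c; first by rewrite /c; lra.
(* This choice makes [m - 2 * M] at least [x], while [m] stays below [x + 2 * M + 2], linear in
   [x]. *)
move=> x x0; pose m := (Num.truncn x + Num.truncn (2 * M) + 2)%N.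
have t1 : x < (Num.truncn x)%:R + 1 by rewrite natr1; exact: truncnS_gt.
have t2 : 2 * M < (Num.truncn (2 * M))%:R + 1 by rewrite natr1; exact: truncnS_gt.
have t3 : (Num.truncn x)%:R <= x by rewrite truncn_le.
have t4 : (Num.truncn (2 * M))%:R <= 2 * M by rewrite truncn_le mulr_ge0.
have mE : m%:R = (Num.truncn x)%:R + (Num.truncn (2 * M))%:R + 2 :> R by rewrite /m !natrD.
have mM : 2 * M <= m%:R by rewrite mE; lra.
have mp : (0 < m)%N by rewrite /m addn2.
have [f [fL fl fA]] := H m mM mp.
have mx : x <= m%:R - 2 * M by rewrite mE; lra.
have dl : ((k * x ^+ 2)%:E <= @dehn R V K (c * x + c)%R)%E.
  apply: le_trans (_ : (k * (m%:R - 2 * M) ^+ 2)%:E <= _)%E.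
    by rewrite lee_fin ler_pM2l// ler_sqr ?nnegrE//; lra.
  apply: le_trans fA _; apply: ereal_sup_ubound; exists f => //; split=> //.
  apply: le_trans fl _; rewrite lee_fin.
  have h1 : C1 * m%:R <= C1 * (x + (2 * M + 2)) by rewrite ler_wpM2l// mE; lra.
  have h2 : C1 * x <= c * x.
    rewrite ler_wpM2r// /c; have h3 : C1 <= C1 * (2 * M + 3) by rewrite ler_peMr//; lra.
    by lra.
  have h4 : C1 * (2 * M + 2) <= c.
    rewrite /c; have h3 : C1 * (2 * M + 2) <= C1 * (2 * M + 3) by rewrite ler_wpM2l//; lra.
    by lra.
  by lra.
have c0 : 0 <= c by rewrite /c; lra.
apply: (@le_trans _ _ (c%:E * (k * x ^+ 2)%:E)%E).
  rewrite -EFinM lee_fin mulrA ler_peMl ?sqr_ge0//.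
  have -> : c * k = k^-1 * k + (C1 * (2 * M + 3) + 1) * k by rewrite /c; ring.
  by rewrite mulVf ?gt_eqF// lerDl mulr_ge0// ?ltW//; lra.
apply: (@le_trans _ _ (c%:E * @dehn R V K (c * x + c)%R)%E); first by rewrite lee_wpmul2l.
by rewrite leeDl// lee_fin addr_ge0// mulr_ge0.
Qed.

End DehnLower.

(** * A geometric model *)

Section ContinuousGluing.
Variables (R : realType) (V : choiceType) (K : complex V).
Local Notation X := (realization R K).
Implicit Types (f g : R * R -> X).

Lemma continuousP2 f : (forall p e, 0 < e -> exists2 d, 0 < d & forall q, `|q.1 - p.1| < d -> `|q.2 - p.2| < d ->
  mdist (f p) (f q) < e) <-> continuous f.
Proof.
split=> [H p|cf p e e0].
  apply/cvg_ballP => e e0; have [d d0 dP] := H p e e0.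
  near=> q; change (mdist (f p) (f q) < e); apply: dP.
    rewrite distrC; near: q; exists ([set z | `|p.1 - z| < d], [set: R]) => /=; last by move=> [a b] [].
    by split; [exact: (nbhsx_ballx p.1 d d0)|exact: filterT].
  rewrite distrC; near: q; exists ([set: R], [set z | `|p.2 - z| < d]) => /=; last by move=> [a b] [].
  by split; [exact: filterT|exact: (nbhsx_ballx p.2 d d0)].
have /cvg_ballP/(_ e e0) := cf p.
rewrite nearE => /nbhs_ballP[d /= d0 dP]; exists d => // q q1 q2.
have H : ball (f p) e (f q); last exact: H.
apply: dP.
by split; rewrite /ball /= distrC.
Unshelve. all: by end_near. Qed.

Lemma continuous_glue (phi : R * R -> R) f g : continuous phi -> continuous f -> continuous g ->
  (forall p, phi p = 0 -> f p = g p) -> continuous (fun p => if phi p <= 0 then f p else g p).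
Proof.
move=> cphi /continuousP2 cf /continuousP2 cg E; apply/continuousP2 => p e e0.
have phiP (P : set R) : open P -> P (phi p) -> exists2 d, 0 < d & forall q, `|q.1 - p.1| < d -> `|q.2 - p.2| < d -> P (phi q).
  move=> oP Pp; have := cphi p P (open_nbhs_nbhs (conj oP Pp)).
  rewrite nbhs_filterE => /nbhs_ballP[d /= d0 dP]; exists d => // q q1 q2.
  by apply: dP; split; rewrite /ball /= distrC.
have [d1 d10 D1] := cf p e e0; have [d2 d20 D2] := cg p e e0.
have m0 : 0 < Num.min d1 d2 by rewrite lt_min d10.
have [h|h|h] := ltgtP (phi p) 0.
- have [d d0 D] := phiP [set x | x < 0] (@open_lt _ 0) h.
  exists (Num.min d d1); first by rewrite lt_min d0.
  move=> q; rewrite !lt_min => /andP[a1 a2] /andP[b1 b2].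
  by rewrite (ltW (D q a1 b1 : phi q < 0)); exact: D1.
- have [d d0 D] := phiP [set x | 0 < x] (@open_gt _ 0) h.
  exists (Num.min d d2); first by rewrite lt_min d0.
  move=> q; rewrite !lt_min => /andP[a1 a2] /andP[b1 b2].
  by rewrite leNgt (D q a1 b1 : 0 < phi q) /=; exact: D2.
exists (Num.min d1 d2) => // q; rewrite !lt_min => /andP[a1 a2] /andP[b1 b2].
by case: ifP => _; [exact: D1|rewrite E//; exact: D2].
Qed.

Lemma continuous_lip2 (g : R -> R -> X) L : 0 <= L ->
  (forall x y x' y', mdist (g x y) (g x' y') <= L * (`|x - x'| + `|y - y'|)) -> continuous (fun p => g p.1 p.2).
Proof.
move=> L0 gL; apply/continuousP2 => p e e0; have L1 : 0 < 2 * L + 1 by lra.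
exists (e / (2 * L + 1)); first by rewrite divr_gt0.
move=> q; rewrite !ltr_pdivlMr// => q1 q2; apply: le_lt_trans (gL _ _ _ _) _.
rewrite (distrC p.1) (distrC p.2); have := normr_ge0 (q.1 - p.1); have := normr_ge0 (q.2 - p.2).
by move: `|q.1 - p.1| `|q.2 - p.2| q1 q2 => u v q1 q2 v0 u0; nra.
Qed.

Lemma continuous_seg (p q : R -> X) : continuous p -> continuous q -> (forall t, compat (p t) (q t)) ->
  continuous (fun z : R * R => seg (p z.2) (q z.2) (clamp 0 1 z.1)).
Proof.
move=> cp cq pq; apply/continuousP2 => -[s t] e e0.
have e2 : 0 < e / 3 by rewrite divr_gt0.
have /cvg_ballP/(_ _ e2) := cp t; rewrite nearE => /nbhs_ballP[d1 /= d10 D1].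
have /cvg_ballP/(_ _ e2) := cq t; rewrite nearE => /nbhs_ballP[d2 /= d20 D2].
exists (Num.min (e / 6) (Num.min d1 d2)); first by rewrite !lt_min d10 d20 divr_gt0.
move=> [s' t'] /=; rewrite !lt_min => /andP[s1 _] /andP[_ /andP[t1 t2]].
apply: le_lt_trans (mdist_triangle (seg (p t') (q t') (clamp 0 1 s)) _ _) _.
have c1 := clamp_in s ler01; have c2 := clamp_in s' ler01.
have h1 := seg_convex (pq t) (pq t') c1.
rewrite distrC in t1 t2.
have p1 : mdist (p t) (p t') < e / 3 by have := D1 t' t1; rewrite ballEmdist.
have q1 : mdist (q t) (q t') < e / 3 by have := D2 t' t2; rewrite ballEmdist.
have h2 : mdist (seg (p t') (q t') (clamp 0 1 s)) (seg (p t') (q t') (clamp 0 1 s')) <= `|s' - s| * 2.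
  rewrite seg_mdist//; apply: ler_pM; rewrite ?normr_ge0 ?mdist_ge0//; last exact: mdist_le2.
  by rewrite distrC; exact: clamp_lip.
have := mdist_ge0 (p t) (p t'); have := mdist_ge0 (q t) (q t').
move: c1 => /andP[c1 c1']; move: (clamp 0 1 s) c1 c1' h1 h2 => u u0 u1 h1 h2 m1 m2.
apply: le_lt_trans (lerD h1 h2) _.
move: (mdist (p t) (p t')) (mdist (q t) (q t')) p1 q1 m1 m2 h1 => a b a1 b1 b0 a0 _.
by move: `|s' - s| s1 => w w1; nra.
Qed.

Lemma continuous_clamp (a b : R) (phi : R * R -> R) : continuous phi -> continuous (fun p => clamp a b (phi p)).
Proof.
move=> cphi p; apply/cvgrPdist_lt => e e0.
have /cvgrPdist_lt/(_ e e0) := cphi p; apply: filterS => q.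
by apply: le_lt_trans; exact: clamp_lip.
Qed.

Lemma continuous_clamped (c : R -> X) : {within `[0, 1], continuous c} -> continuous (fun t => c (clamp 0 1 t)).
Proof.
move=> cc t; have cI (u : R) : 0 <= clamp 0 1 u <= 1 := clamp_in u ler01.
have inI (u : R) : (`[0, 1]%classic : set R) (clamp 0 1 u) by rewrite /= in_itv; exact: cI.
have /subspace_continuousP/(_ _ (inI t)) H := cc.
apply/cvg_ballP => e e0.
have /cvg_ballP/(_ e e0) := H; rewrite near_withinE => /nbhs_ballP[d d0 dP].
apply/nbhs_ballP; exists d; first exact: d0.
move=> u tu; apply: (dP (clamp 0 1 u)); last exact: inI.
by rewrite /ball /=; apply: le_lt_trans tu; exact: clamp_lip.
Qed.

(* A free homotopy F (0 <= h <= 2) whose two boundary tracks agree and whose last curve is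
   constant: go around the other three sides, then shorten the track. *)
Lemma based_contraction (F : R * R -> X) (sg : R -> X) (z : X) : continuous F ->
  (forall h, F (h, 0) = sg h /\ F (h, 1) = sg h) -> (forall u, F (2, u) = z) ->
  exists H : R * R -> X, [/\ continuous H, forall t, t \in `[0, 1] -> H (0, t) = F (0, t),
    forall t, t \in `[0, 1] -> H (1, t) = sg 0 &
    forall s, s \in `[0, 1] -> H (s, 0) = sg 0 /\ H (s, 1) = sg 0].
Proof.
move=> cF Fsg F2.
(* The path around the other three sides: [m] climbs to height 2, stays there and returns, while [w]
   crosses from 0 to 1 during the stay. [H1] interpolates to this path up to time 1/2, and [H2] then
   shortens the track. *)
pose m (t : R) := Num.min 2 (Num.min (6 * t) (6 * (1 - t))).
pose w (t : R) := clamp 0 1 (3 * t - 1).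
pose H1 (p : R * R) := F (2 * p.1 * m p.2, (1 - 2 * p.1) * p.2 + 2 * p.1 * w p.2).
pose H2 (p : R * R) := F (Num.min (4 - 4 * p.1) (m p.2), 0).
have c1 : continuous (fun p : R * R => p.1) by move=> p; exact: cvg_fst.
have c2 : continuous (fun p : R * R => p.2) by move=> p; exact: cvg_snd.
have cc (k : R) : continuous (fun p : R * R => k) by move=> p; exact: cvg_cst.
have cM (f g : R * R -> R) : continuous f -> continuous g -> continuous (fun p => f p * g p).
  by move=> cf cg p; apply: cvgM; [exact: cf|exact: cg].
have cD (f g : R * R -> R) : continuous f -> continuous g -> continuous (fun p => f p + g p).
  by move=> cf cg p; apply: cvgD; [exact: cf|exact: cg].
have cN (f : R * R -> R) : continuous f -> continuous (fun p => - f p).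
  by move=> cf p; apply: cvgN; exact: cf.
have cmin (f g : R * R -> R) : continuous f -> continuous g -> continuous (fun p => Num.min (f p) (g p)).
  by move=> cf cg p; apply: continuous_min; [exact: cf|exact: cg].
have cm : continuous (fun p : R * R => m p.2).
  have k1 : continuous (fun p : R * R => 6 * p.2) by apply: cM; [exact: cc|exact: c2].
  have k2 : continuous (fun p : R * R => 6 * (1 - p.2)).
    by apply: cM; [exact: cc|apply: cD; [exact: cc|exact: (cN _ c2)]].
  exact: (cmin _ _ (cc 2) (cmin _ _ k1 k2)).
have cw : continuous (fun p : R * R => w p.2).
  by apply: continuous_clamp; apply: cD; [apply: cM; [exact: cc|exact: c2]|exact: cc].
have c2p : continuous (fun p : R * R => 2 * p.1) by apply: cM; [exact: cc|exact: c1].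
have cpair (f g : R * R -> R) : continuous f -> continuous g -> continuous (fun p => F (f p, g p)).
  move=> cf cg p; apply: (@continuous_comp _ _ _ (fun p => (f p, g p)) F); last exact: cF.
  by have H := cvg_pair (cf p) (cg p); exact: H.
have cH1 : continuous H1.
  apply: cpair; first exact: (cM _ _ c2p cm).
  exact: (cD _ _ (cM _ _ (cD _ _ (cc 1) (cN _ c2p)) c2) (cM _ _ c2p cw)).
have cH2 : continuous H2.
  apply: cpair; last exact: cc.
  exact: (cmin _ _ (cD _ _ (cc 4) (cN _ (cM _ _ (cc 4) c1))) cm).
have cphi : continuous (fun p : R * R => p.1 - 2^-1) by apply: cD; [exact: c1|exact: cc].
have m0 : m 0 = 0 by rewrite /m mulr0 subr0 mulr1 [Num.min 0 _]min_l ?min_r.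
have m1 : m 1 = 0 by rewrite /m subrr mulr0 mulr1 [Num.min 6 _]min_r ?min_r.
have w0 : w 0 = 0 by rewrite /w clamp_lo// mulr0 sub0r; lra.
have w1 : w 1 = 1 by rewrite /w clamp_hi// mulr1; lra.
have glue p : p.1 - 2^-1 = 0 -> H1 p = H2 p.
  case: p => s t /= /subr0_eq sE; rewrite /H1 /H2 /= sE.
  have -> : 2 * 2^-1 = 1 :> R by rewrite divff.
  rewrite !mul1r subrr mul0r add0r.
  have -> : Num.min (4 - 4 * 2^-1) (m t) = m t.
    have -> : 4 - 4 * 2^-1 = 2 :> R by field.
    by rewrite min_r// /m ge_min lexx.
  have [h|h] := leP t (3^-1).
    have -> : w t = 0 by rewrite /w clamp_lo//; lra.
    by [].
  have [h'|h'] := leP (2 / 3) t.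
    have -> : w t = 1 by rewrite /w clamp_hi//; lra.
    by have [-> ->] := Fsg (m t).
  have -> : m t = 2 by rewrite /m min_l// le_min; apply/andP; split; lra.
  by rewrite !F2.
exists (fun p => if p.1 - 2^-1 <= 0 then H1 p else H2 p); split.
- exact: (continuous_glue cphi cH1 cH2 glue).
- move=> t _ /=; rewrite sub0r oppr_le0 invr_ge0 ler0n /H1 /=.
  by rewrite mulr0 !mul0r subr0 mul1r addr0.
- move=> t; rewrite in_itv /= => /andP[t0 t1].
  rewrite ifF; last by apply/negbTE; rewrite -ltNge; lra.
  rewrite /H2 /= mulr1 subrr min_l; first by have [-> _] := Fsg 0.
  by rewrite /m !le_min; apply/and3P; split; lra.
move=> s; rewrite in_itv /= => /andP[s0 s1].
split; case: ifP => _; rewrite /H1 /H2 /=.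
- by rewrite m0 w0 !mulr0 addr0; have [-> _] := Fsg 0.
- by rewrite m0 min_r; [have [-> _] := Fsg 0|lra].
- rewrite m1 w1 mulr0 !mulr1 subrK; by have [_ ->] := Fsg 0.
- by rewrite m1 min_r; [have [-> _] := Fsg 0|lra].
Qed.

Lemma scaled_in01 (M t : R) : 0 <= M -> 0 <= t <= 1 -> 0 <= M * t <= M.
Proof. by move=> M0 /andP[t0 t1]; rewrite mulr_ge0//= ler_piMr. Qed.

Lemma mulr_div_cancel_pos (M t : R) : 0 < M -> M * t / M = t.
Proof. by move=> M0; rewrite mulrC mulKf ?gt_eqF. Qed.

(** The base point [x] may lie inside a simplex, so the contraction is at first a free homotopy:
    straight to the polygon [e], then along the given homotopy. [based_contraction] fixes the base
    point afterwards. *)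
Lemma loop_contraction x v M A (c e : R -> X) :
  {within `[0, 1], continuous c} /\ c 0 = x /\ c 1 = x -> 0 < M -> mpath M v v e ->
  (forall t, 0 <= t <= 1 -> compat (c t) (e (M * t))) -> mhom M 0 A e (fun=> v) ->
  exists H : R * R -> X,
   [/\ {within [set p | p.1 \in `[0, 1] /\ p.2 \in `[0, 1]], continuous H},
      forall t, t \in `[0, 1] -> H (0, t) = c t,
      forall t, t \in `[0, 1] -> H (1, t) = x
    & forall s, s \in `[0, 1] -> H (s, 0) = x /\ H (s, 1) = x].
Proof.
move=> [cc [c0 c1]] M0 [_ [[D D0 eD] [e0 e1]]] cE [T [T0 MT _ [g [Lg [[Lg0 [gx gy]] _ g1 g2]]]]].
have cI (t : R) : 0 <= clamp 0 1 t <= 1 := clamp_in t ler01.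
have ce t : compat (c (clamp 0 1 t)) (e (M * clamp 0 1 t)) := cE _ (cI t).
pose ch (t : R) := c (clamp 0 1 t).
have cch : continuous ch := continuous_clamped cc.
pose pol t := e (M * clamp 0 1 t).
have cpol : continuous pol.
  have DM : 0 <= D * M by rewrite mulr_ge0// ltW.
  have lipP s t : mdist (pol s) (pol t) <= D * M * `|s - t|.
    wlog st : s t / clamp 0 1 s <= clamp 0 1 t.
      move=> H; have [|/ltW] := leP (clamp 0 1 s) (clamp 0 1 t); first exact: H.
      by rewrite mdistC distrC; exact: H.
    apply: le_trans (eD _ _ _) _; first by rewrite ler_wpM2l// ltW.
    rewrite -mulrBr -!mulrA ler_wpM2l// ler_wpM2l ?(ltW M0)//.
    by apply: le_trans (ler_norm _) _; rewrite (distrC s); exact: clamp_lip.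
  move=> t; apply/cvg_ballP => ee e00; apply/nbhs_ballP; exists (ee / (D * M + 1)) => /=.
    by rewrite divr_gt0// ltr_wpDl.
  move=> s; rewrite /ball /= ltr_pdivlMr ?ltr_wpDl// => h; change (mdist (pol t) (pol s) < ee).
  apply: le_lt_trans (lipP _ _) _; apply: le_lt_trans h; rewrite mulrC ler_wpM2l//; lra.
have cmp t : compat (ch t) (pol t) by exact: ce.
pose F1 (z : R * R) := seg (ch z.2) (pol z.2) (clamp 0 1 z.1).
have cF1 : continuous F1 by exact: continuous_seg.
pose gh a b := g (clamp 0 T a) (clamp 0 1 b).
have TI t : 0 <= clamp 0 T t <= T := clamp_in t T0.
have ghL a b a' b' : mdist (gh a b) (gh a' b') <= Lg * (`|a - a'| + `|b - b'|).
  apply: le_trans (mdist_triangle (gh a' b) _ _) _; rewrite mulrDr; apply: lerD.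
    apply: le_trans (lipcP Lg0 (gx _ (cI b)) (TI a) (TI a')) _; rewrite ler_wpM2l//; exact: clamp_lip.
  apply: le_trans (lipcP Lg0 (gy _ (TI a')) (cI b) (cI b')) _; rewrite ler_wpM2l//; exact: clamp_lip.
have cgh := continuous_lip2 Lg0 ghL.
(* During the first half of [1, 2], [al] stretches the duration from [M] to [T], which only appends
   rest at [v]; during the second half, [be] runs the homotopy. *)
pose al (z : R * R) := clamp 0 1 (2 * (z.1 - 1)); pose be (z : R * R) := clamp 0 1 (2 * (z.1 - 1) - 1).
pose ps (z : R * R) := ((1 - al z) * M + al z * T) * clamp 0 1 z.2.
pose F2 z := gh (ps z) (be z).
have k1 : continuous (fun p : R * R => p.1) by move=> p; exact: cvg_fst.
have k2 : continuous (fun p : R * R => p.2) by move=> p; exact: cvg_snd.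
have kc (k' : R) : continuous (fun p : R * R => k') by move=> p; exact: cvg_cst.
have kM (a b : R * R -> R) : continuous a -> continuous b -> continuous (fun p => a p * b p).
  by move=> ca cb p; apply: cvgM; [exact: ca|exact: cb].
have kB (a b : R * R -> R) : continuous a -> continuous b -> continuous (fun p => a p - b p).
  by move=> ca cb p; apply: cvgB; [exact: ca|exact: cb].
have kD (a b : R * R -> R) : continuous a -> continuous b -> continuous (fun p => a p + b p).
  by move=> ca cb p; apply: cvgD; [exact: ca|exact: cb].
have k3 := kM _ _ (kc 2) (kB _ _ k1 (kc 1)).
have cal : continuous al := continuous_clamp k3.
have cbe : continuous be := continuous_clamp (kB _ _ k3 (kc 1)).
have cps : continuous ps.
  exact: (kM _ _ (kD _ _ (kM _ _ (kB _ _ (kc 1) cal) (kc M)) (kM _ _ cal (kc T))) (continuous_clamp k2)).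
have cF2 : continuous F2.
  move=> p; apply: (@continuous_comp _ _ _ (fun p => (ps p, be p)) (fun q => gh q.1 q.2)); last exact: cgh.
  by have H := cvg_pair (cps p) (cbe p); exact: H.
have MT0 : 0 <= M <= T by rewrite MT ltW.
have psI z : 0 <= ps z <= T.
  have /andP[a0 a1] : 0 <= al z <= 1 := clamp_in _ ler01; have /andP[b0 b1] := cI z.2.
  rewrite /ps; move: (al z) (clamp 0 1 z.2) a0 a1 b0 b1 => a b a0 a1 b0 b1.
  have h1 : 0 <= (1 - a) * M + a * T by rewrite addr_ge0 ?mulr_ge0 ?subr_ge0// ltW.
  have h2 : (1 - a) * M + a * T <= T.
    have -> : (1 - a) * M + a * T = T - (1 - a) * (T - M) by ring.
    by rewrite gerBl mulr_ge0 ?subr_ge0.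
  by rewrite mulr_ge0//= (le_trans _ h2)// ler_piMr.
have ghE z : F2 z = g (ps z) (be z).
  by rewrite /F2 /gh (clamp_id (psI z)) (clamp_id (clamp_in _ ler01)).
have beI z : 0 <= be z <= 1 := clamp_in _ ler01.
pose F z := if z.1 - 1 <= 0 then F1 z else F2 z.
have glue (z : R * R) : z.1 - 1 = 0 -> F1 z = F2 z.
  case: z => h u /= /subr0_eq ->; rewrite ghE /F1 /ps /al /be /= subrr mulr0 sub0r.
  rewrite (clamp_hi ler01 (lexx 1)) (clamp_lo ler01 (lexx 0)) (clamp_lo ler01 (lerN10 R : -1 <= 0)).
  rewrite seg1// subr0 mul1r mul0r addr0 /pol.
  have /andP[u0 u1] := cI u; have [|-> _] := g1 (M * clamp 0 1 u); last by [].
  by rewrite mulr_ge0 ?(ltW M0)//= (le_trans _ MT)// ler_piMr// ltW.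
have cF : continuous F by exact: (continuous_glue (kB _ _ k1 (kc 1)) cF1 cF2 glue).
have ch0 : ch 0 = x by rewrite /ch (clamp_lo ler01 (lexx 0)).
have ch1 : ch 1 = x by rewrite /ch (clamp_hi ler01 (lexx 1)).
have pol0 : pol 0 = v by rewrite /pol (clamp_lo ler01 (lexx 0)) mulr0 e0.
have pol1 : pol 1 = v by rewrite /pol (clamp_hi ler01 (lexx 1)) mulr1 e1.
have F20 h : F2 (h, 0) = v.
  rewrite ghE /ps /= (clamp_lo ler01 (lexx 0)) mulr0; have [-> _] := g2 _ (beI (h, 0)).
  by rewrite e0.
have F21 h : F2 (h, 1) = v.
  rewrite ghE; have [hh|hh] := leP (2 * (h - 1)) 1.
    have bE : be (h, 1) = 0 by rewrite /be /= clamp_lo//; lra.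
    rewrite bE; have [-> _] := g1 _ (psI (h, 1)); rewrite e1//.
    rewrite /ps /= (clamp_hi ler01 (lexx 1)) mulr1.
    have /andP[a0 a1] : 0 <= al (h, 1) <= 1 := clamp_in _ ler01.
    move: (al (h, 1)) a0 a1 => a a0 a1.
    have -> : (1 - a) * M + a * T = M + a * (T - M) by ring.
    by rewrite lerDl mulr_ge0// subr_ge0.
  have aE : al (h, 1) = 1 by rewrite /al /= clamp_hi// ltW.
  rewrite /ps aE /= (clamp_hi ler01 (lexx 1)) subrr mul0r add0r mul1r mulr1.
  by have [_ ->] := g2 _ (beI (h, 1)); rewrite e1.
pose sg h := F (h, 0).
have Fsg h : F (h, 0) = sg h /\ F (h, 1) = sg h.
  split=> //; rewrite /sg /F /=; case: ifP => _; last by rewrite F20 F21.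
  by rewrite /F1 /= ch0 ch1 pol0 pol1.
have Fend u : F (2, u) = v.
  rewrite /F /= ifF; last by apply/negbTE; rewrite -ltNge; lra.
  have bE : be (2, u) = 1 by rewrite /be /= clamp_hi//; lra.
  by rewrite ghE bE; have [_ ->] := g1 _ (psI (2, u)).
have F0 t : F (0, t) = ch t.
  by rewrite /F /= sub0r oppr_le0 ler01 /F1 /= (clamp_lo ler01 (lexx 0)) seg0.
have sg0 : sg 0 = x by rewrite /sg F0.
have [H [cH H0 H1 H2]] := based_contraction cF Fsg Fend.
exists H; rewrite sg0 in H1 H2; split=> //; first exact: continuous_subspaceT.
move=> t tt; rewrite H0// F0 /ch; congr c; apply: clamp_id.
by move: tt; rewrite in_itv.
Qed.

End ContinuousGluing.

(** * The Rips complex as a geometric model *)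

Section Rips.
Variables (r n : nat).
Local Notation G := (Lambda r n).
Local Notation L := ('I_r * 'I_n)%type.

(* The relators of word_area have length at most 8, so each of them spans a simplex. *)
Definition near_elt (g h : G) := exists2 w : words L, (size w <= 8)%N & (g * wordval w)%g = h.

Lemma near_elt_refl g : near_elt g g.
Proof. by exists [::] => //; rewrite mulg1. Qed.

Lemma near_elt_sym g h : near_elt g h -> near_elt h g.
Proof.
move=> [w w8 <-]; exists (wordV w); first by rewrite size_rev size_map.
by rewrite wordval_inv mulgK.
Qed.

Lemma near_elt_mull k g h : near_elt g h -> near_elt (k * g)%g (k * h)%g.
Proof. by move=> [w w8 <-]; exists w => //; rewrite mulgA. Qed.

Lemma near_elt_finite g : finite_set [set h | near_elt g h].
Proof.
apply: (@sub_finite_set _ _ [set` [seq (g * wordval (val w : words L))%g | w <- enum {: 8.-bseq (L * bool)}]]).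
  move=> h [w w8 <-]; apply/mapP; exists (Bseq w8) => //.
  by rewrite mem_enum.
exact: finite_seq.
Qed.

Definition rips_face : pred {fset G} := fun s =>
  (s != fset0) && `[< forall g h, g \in s -> h \in s -> near_elt g h >].

Lemma rips_face_neq0 s : rips_face s -> s != fset0.
Proof. by case/andP. Qed.

Lemma rips_face_sub s t : rips_face s -> (t `<=` s)%fset -> t != fset0 -> rips_face t.
Proof.
move=> /andP[_ /asboolP H] /fsubsetP ts t0; apply/andP; split=> //; apply/asboolP => g h gt ht.
by apply: H; exact: ts.
Qed.

Definition rips : complex G := Complex rips_face_neq0 rips_face_sub.

Lemma rips_face1 g : face rips [fset g]%fset.
Proof.
apply/andP; split; first by rewrite -cardfs_gt0 cardfs1.
by apply/asboolP => a b; rewrite !inE => /eqP -> /eqP ->; exact: near_elt_refl.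
Qed.

Lemma rips_locally_finite v : finite_set [set w | face rips [fset v; w]%fset].
Proof.
apply: sub_finite_set (near_elt_finite v) => w /andP[_ /asboolP H].
by apply: H; rewrite !inE eqxx ?orbT.
Qed.

Variable R : realType.
Local Notation X := (realization R rips).
Implicit Types (x y z : X) (g h : G).

Definition ract g x : X := xget x [set y : X | forall v, y v = x (g^-1 * v)%g].

Lemma ractE g x v : ract g x v = x (g^-1 * v)%g.
Proof.
rewrite /ract; case: xgetP => [z _ ->//|no]; exfalso.
pose S := [fset (g * u)%g | u in finsupp x]%fset.
have inS u : (u \in S) = ((g^-1 * u)%g \in finsupp x).
  apply/imfsetP/idP => [[w /= wx ->]|ux]; first by rewrite mulKg.
  by exists (g^-1 * u)%g => //=; rewrite mulVKg.
have [||||y yE] := @bary_exists R G rips S (fun u => x (g^-1 * u)%g).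
- have /andP[x0 /asboolP xn] := bary_face x; apply/andP; split.
    have [w wx] := bary_neq0 x; apply/fset0Pn; exists (g * w)%g; rewrite inS mulKg//.
  apply/asboolP => a b; rewrite !inS => ha hb.
  by have := near_elt_mull g (xn _ _ ha hb); rewrite !mulVKg.
- by move=> u _; exact: bary_ge0.
- by move=> u; rewrite inS => ux; rewrite fsfun_dflt.
- rewrite big_imfset /=; last by move=> a b _ _; exact: mulgI.
  rewrite -[RHS](bary_sum (fsubset_refl (finsupp x))); apply: eq_bigr => u _.
  by rewrite mulKg.
- by apply: (no y).
Qed.

Lemma ract_supp g x v : (v \in finsupp (ract g x)) = ((g^-1 * v)%g \in finsupp x).
Proof. by rewrite -!bary_gt0 ractE. Qed.

Lemma ract1 x : ract 1%g x = x.
Proof. by apply: bary_ext => v; rewrite ractE invg1 mul1g. Qed.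

Lemma ractM g h x : ract (g * h)%g x = ract g (ract h x).
Proof. by apply: bary_ext => v; rewrite !ractE invgM mulgA. Qed.

Lemma ract_mdist g x y : mdist (ract g x) (ract g y) = mdist x y.
Proof.
pose U := (finsupp x `|` finsupp y)%fset.
pose S := [fset (g * u)%g | u in U]%fset.
have sub z : (finsupp z `<=` U)%fset -> (finsupp (ract g z) `<=` S)%fset.
  move=> /fsubsetP zU; apply/fsubsetP => u; rewrite ract_supp => /zU uz.
  by apply/imfsetP; exists (g^-1 * u)%g => //=; rewrite mulVKg.
rewrite (@mdistE R G rips S) ?sub ?fsubsetUl ?fsubsetUr//.
rewrite (@mdistE R G rips U) ?fsubsetUl ?fsubsetUr//.
congr Num.sqrt; rewrite big_imfset /=; last by move=> a b _ _; exact: mulgI.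
by apply: eq_bigr => u _; rewrite !ractE mulKg.
Qed.

Lemma ract_continuous g : continuous (ract g).
Proof.
move=> x; have FF : Filter (ract g @ nbhs x) by apply: fmap_filter; exact: nbhs_filter.
apply/(@fcvg_ballP R X (ract g @ nbhs x) FF (ract g x)) => e e0.
apply: (@filterS _ (nbhs x) _ (ball x e)); last exact: nbhsx_ballx.
by move=> y; rewrite !ballEmdist /= ract_mdist.
Qed.

Lemma ract_path_dist_le g x y : (path_dist (ract g x) (ract g y) <= path_dist x y)%E.
Proof.
apply: le_ereal_inf_tmp => _ [c [cc c0 c1] <-].
apply: ereal_inf_lbound; exists (ract g \o c).
  split; rewrite /= ?c0 ?c1//.
  apply/subspace_continuousP => t tI; have /subspace_continuousP/(_ t tI) H := cc.
  exact: (cvg_comp _ _ H (@ract_continuous g (c t))).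
congr ereal_sup; apply/seteqP; split=> _ [s sP <-]; exists s => //; congr EFin;
  by apply: eq_bigr => i _; rewrite /= ract_mdist.
Qed.

Lemma ract_path_dist g x y : path_dist (ract g x) (ract g y) = path_dist x y.
Proof.
apply/eqP; rewrite eq_le ract_path_dist_le /=.
by have := ract_path_dist_le g^-1%g (ract g x) (ract g y); rewrite -!ractM mulVg !ract1.
Qed.

(** A compact set has finitely many vertices, and [g] is a quotient of two of them, whence
    properness. Translating a vertex of the support to 1 moves any point into the finite ball around
    1, whence cocompactness. *)
Lemma ract_geometric : geometric_action ract.
Proof.
split.
- by move=> x; split; [exact: ract1|move=> g h; exact: ractM].
- by move=> g x y; exact: ract_path_dist.
- move=> A cA; have [U UP] := compact_supp rips_locally_finite cA.
  apply: (@sub_finite_set _ _ [set` [seq (a * b^-1)%g | a <- U, b <- U]]); last exact: finite_seq.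
  move=> g [_ [[x Ax <-] Agx]]; have [v vx] := bary_neq0 x.
  apply/allpairsP; exists ((g * v)%g, v); split=> /=; last by rewrite mulgK.
    by apply: (fsubsetP (UP _ Agx)); rewrite ract_supp mulKg.
  exact: (fsubsetP (UP _ Ax)).
have /finite_fsetP[S SE] := near_elt_finite 1%g.
exists [set x : X | (finsupp x `<=` S)%fset]; first exact: compact_finite_supp.
apply/seteqP; split=> // x _; have [v vx] := bary_neq0 x.
exists v => //; exists (ract v^-1%g x); last by rewrite -ractM mulgV ract1.
apply/fsubsetP => u; rewrite ract_supp invgK => ux.
have /andP[_ /asboolP xn] := bary_face x.
have : [set` S] u by rewrite -SE /=; have := near_elt_mull v^-1%g (xn _ _ vx ux); rewrite mulVg mulKg.
by [].
Qed.

Lemma ract_lip g : preserves_lip (ract g).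
Proof. by apply: act_lip => h x y; exact: ract_path_dist. Qed.

Lemma realization_inhabited : exists x : X, True.
Proof.
have [||||x _] := @bary_exists R G rips [fset 1%g]%fset (fun u => (u == 1%g)%:R); last by exists x.
- exact: rips_face1.
- by move=> u; rewrite inE => ->.
- by move=> u; rewrite inE => /negbTE ->.
by rewrite big_seq_fset1 eqxx.
Qed.

Variable y0 : X.
Local Notation vt := (vert y0).
Local Notation x0 := (vt 1%g).

Lemma ract_vert g v : ract g (vt v) = vt (g * v)%g.
Proof.
apply: bary_ext => u; rewrite ractE !vertE ?rips_face1//; congr ((nat_of_bool _)%:R).
by apply/idP/idP => /eqP; [move=> <-; rewrite mulVKg|move=> ->; rewrite mulKg].
Qed.

Lemma near_adj v w : near_elt v w -> adj rips v w.
Proof.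
move=> vw; apply/andP; split; first by apply/fset0Pn; exists v; rewrite !inE eqxx.
apply/asboolP => a b; rewrite !inE => /orP[/eqP ->|/eqP ->] /orP[/eqP ->|/eqP ->] //;
  by [exact: near_elt_refl|exact: near_elt_sym].
Qed.

Let P (s : L) : R -> X := edge y0 1%g (cgen s.1 s.2).

Let near_gen (s : L) : near_elt 1%g (cgen s.1 s.2).
Proof. by exists (letter s) => //; rewrite mul1g wordval_letter. Qed.

Let Pm s : mpath 1 x0 (ract (cgen s.1 s.2) x0) (P s).
Proof. by rewrite ract_vert mulg1; apply: mpath_edge; apply: near_adj. Qed.

Local Notation wp := (wpath ract x0 P).

Lemma edge_supp v w t u : adj rips v w -> u \in finsupp (edge y0 v w t) -> u = v \/ u = w.
Proof.
move=> vw /(fsubsetP (seg_supp (adj_compat y0 vw) (clamp_in _ ler01))).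
by rewrite !vert_supp ?rips_face1// !inE => /orP[/eqP|/eqP]; [left|right].
Qed.

Let wpath_supp w t v : v \in finsupp (wp w t) -> exists2 i, (i <= size w)%N & v = wordval (take i w).
Proof.
elim: w t v => [|a w IH] t v /=.
  by rewrite vert_supp ?rips_face1// inE => /eqP ->; exists 0.
rewrite /pcat; case: leP => _.
  case: a => s [|]; rewrite /lpath /lval /=; last first.
    move=> /(edge_supp (near_adj (near_gen s)))[->|->]; first by exists 0.
    by exists 1 => //=; rewrite take0 /= mulg1.
  rewrite ract_supp invgK /rpath => /(edge_supp (near_adj (near_gen s)))[E|E].
    by exists 1 => //=; rewrite take0 /= mulg1; apply: (mulgI (cgen s.1 s.2)); rewrite E mulgV.
  by exists 0 => //=; apply: (mulgI (cgen s.1 s.2)); rewrite E mulg1.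
rewrite ract_supp => /IH[i iw E]; exists i.+1 => //=.
by rewrite -E mulVKg.
Qed.

(** Two prefixes of [w] differ by a subword of length at most 8, so all vertices along the path span
    one simplex. *)
Let compat_word g w x y : (size w <= 8)%N ->
  (forall v, v \in finsupp x -> exists2 i, (i <= size w)%N & v = (g * wordval (take i w))%g) ->
  (forall v, v \in finsupp y -> exists2 i, (i <= size w)%N & v = (g * wordval (take i w))%g) -> compat x y.
Proof.
move=> w8 hx hy.
pose S := seq_fset tt [seq (g * wordval (take i w))%g | i <- iota 0 (size w).+1].
have inS v : (exists2 i, (i <= size w)%N & v = (g * wordval (take i w))%g) -> v \in S.
  by move=> [i iw ->]; rewrite seq_fsetE; apply/mapP; exists i; rewrite // mem_iota.
have Sf : face rips S.
  apply/andP; split; first by apply/fset0Pn; exists (g * wordval (take 0 w))%g; apply: inS; exists 0.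
  apply/asboolP => a b; rewrite !seq_fsetE => /mapP[i + ->] /mapP[j + ->].
  rewrite !mem_iota /= !add0n !ltnS => iw jw; apply: near_elt_mull.
  wlog ij : i j iw jw / (i <= j)%N.
    by move=> H; have [|/ltnW] := leqP i j; [exact: H|move=> ji; apply: near_elt_sym; exact: H].
  exists (drop i (take j w)).
    by rewrite size_drop size_takel// (leq_trans (leq_subr _ _))// (leq_trans jw).
  by rewrite -wordval_cat -{1}(take_takel w ij) cat_take_drop.
by apply: compat_face Sf _ _; apply/fsubsetP => v /[dup] vv; [move=> /hx|move=> /hy]; exact: inS.
Qed.

Let wp_lip : exists2 D : R, 2 <= D & forall w, glip D (wp w).
Proof.
have [D D0 DP] := wpath_glip ract1 ractM ract_lip Pm.
exists (Num.max 2 D); first by rewrite le_max lexx.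
by move=> w; apply: glip_le (DP w); rewrite le_max lexx orbT.
Qed.

(** The path of such a word lies in a simplex that contains the base vertex, and contracts to it
    along segments. *)
Let short_word : exists2 A : R, 0 <= A & forall w, (size w <= 8)%N -> wordval w = 1%g -> whom ract x0 P A w [::].
Proof.
have [D D2 DP] := wp_lip; have D0 : 0 <= D by rewrite (le_trans _ D2).
exists (D * 2 * (8 - 0)); first by rewrite mulr_ge0 ?mulr_ge0// subr0.
move=> w w8 w1; split=> //; exists 8; split=> //; first by rewrite ler_nat.
have [_ [_ [p0 p1]]] := wpath_mpath ract1 ractM ract_lip Pm w.
apply: lhom_straight => //.
- exact: glip_lipc (DP w).
- by apply: lipc_cst.
- move=> t _; apply: (@compat_word 1%g w) => // v.
    by move=> /wpath_supp[i iw ->]; exists i; rewrite ?mul1g.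
  by rewrite vert_supp ?rips_face1// inE => /eqP ->; exists 0; rewrite // take0 mulg1.
- by rewrite p0.
- by rewrite p1 ?w1 ?ract1// ler_nat.
Qed.

Hypotheses (r1 : (1 < r)%N) (n1 : (1 < n)%N).

Let filling : exists2 B : R, 0 <= B & forall w, wordval w = 1%g -> whom ract x0 P (B * ((size w)%:R + 1) ^+ 2) w [::].
Proof.
have [A A0 AP] := short_word.
apply: (word_filling r1 n1 ract1 ractM ract_lip Pm A0) => [i j p q pq|i j p q]; apply: AP.
- by [].
- rewrite /commg /conjg !(wordvalM, wordvalV, wordval_letter) /=.
  by apply/eqP/commgP; exact: cgen_commute.
- by [].
- rewrite /commg /conjg !(wordvalM, wordvalV, wordval_letter) /=.
  by apply/eqP; rewrite divg_eq1; apply/eqP; exact: (cgen_comm_factor i j p q).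
Qed.

Let word_mpath v w : mpath (size w)%:R (vt v) (vt (v * wordval w)%g) (ract v \o wp w).
Proof.
have := mpath_comp (ract_lip v) (wpath_mpath ract1 ractM ract_lip Pm w).
by rewrite !ract_vert !mulg1.
Qed.

(** An edge joins elements that differ by a word of length at most 8, and the edge and the path of
    that word lie in a common simplex. *)
Let edge_word v w : adj rips v w -> exists u A, [/\ (v * wordval u)%g = w &
  mhom 1 (size u)%:R A (edge y0 v w) (ract v \o wp u)].
Proof.
move=> vw; have [u u8 uE] : near_elt v w.
  by have /andP[_ /asboolP H] := vw; apply: H; rewrite !inE eqxx ?orbT.
have [D D2 DP] := wp_lip; have D0 : 0 <= D by rewrite (le_trans _ D2).
have [_ [_ [p0 p1]]] := word_mpath v u; have [_ [_ [e0 e1]]] := mpath_edge y0 vw.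
exists u, (D * 2 * (8 - 0)); split=> //; exists 8; split=> //; [by rewrite ler1n|by rewrite ler_nat|].
have Ce := adj_compat y0 vw.
have [_ eD] := mpath_seg Ce.
have pl : lipc 0 8 D (edge y0 v w) := @glip_lipc _ _ _ D _ 0 8 (glip_le D2 eD).
have ql : lipc 0 8 D (ract v \o wp u) := @glip_lipc _ _ _ D _ 0 8 (glip_comp (ract_lip v) D0 (DP u)).
have cq t : 0 <= t <= 8 -> compat (edge y0 v w t) ((ract v \o wp u) t).
  move=> _; apply: (@compat_word v u); first exact: u8.
    move=> a /(edge_supp vw)[->|->]; first by exists 0; rewrite // take0 mulg1.
    by exists (size u); rewrite // take_size.
  move=> a; rewrite /= ract_supp => /wpath_supp[i iu E]; exists i; first exact: iu.
  by rewrite -E mulVKg.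
have q0 : edge y0 v w 0 = (ract v \o wp u) 0 by rewrite (e0 0 (lexx 0)) (p0 0 (lexx 0)).
have q1 : edge y0 v w 8 = (ract v \o wp u) 8.
  have l1 : 1 <= 8 :> R by rewrite ler1n.
  have l2 : (size u)%:R <= 8 :> R by rewrite ler_nat.
  by rewrite (e1 8 l1) (p1 8 l2) uE.
exact: (lhom_straight D0 (ler0n R 8) pl ql cq q0 q1).
Qed.

Let edges_word v s : path (adj rips) v s -> exists w A, [/\ (v * wordval w)%g = last v s &
  mhom (size s)%:R (size w)%:R A (epath y0 v s) (ract v \o wp w)].
Proof.
elim: s v => [|w s IH] v /=.
  move=> _; exists [::], 0; split; first by rewrite mulg1.
  have -> : ract v \o wp [::] = (fun=> vt v) by apply: boolp.funext => t; rewrite /= ract_vert mulg1.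
  exact: mhom_refl (mpath_cst _ (lexx 0)).
move=> /andP[vw ws]; have [u [A [uE uH]]] := edge_word vw; have [w' [A' [E H]]] := IH w ws.
exists (u ++ w'), (A + A'); split; first by rewrite wordval_cat mulgA uE.
rewrite (wpath_cat ract1 ractM ract_lip Pm) pcat_comp act_comp; last exact: ractM.
rewrite uE size_cat natrD -nat1r.
have m1 := mpath_edge y0 vw; have m2 := word_mpath v u; rewrite uE in m2.
have m3 := mpath_epath y0 ws; have m4 := word_mpath w w'; rewrite E in m4.
exact: (mhom_trans (mpath_cat m1 m3) (mpath_cat m2 m3) (mpath_cat m2 m4)
  (mhom_catr m1 m2 m3 uH) (mhom_catl m2 m3 m4 H)).
Qed.

(** The loop spells a word of value 1, which [word_filling] contracts. Here the area is irrelevant: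
    the contraction serves simple connectivity. *)
Lemma edge_loop_contraction v s : path (adj rips) v s -> last v s = v ->
  exists A, mhom (size s)%:R 0 A (epath y0 v s) (fun=> vt v).
Proof.
move=> vs sl; have [w [A [E H]]] := edges_word vs; have [B _ BP] := filling.
rewrite sl in E; have w1 : wordval w = 1%g by apply: (mulgI v); rewrite E mulg1.
have [_ /(mhom_comp (ract_lip v)) F] := BP w w1.
have cE : ract v \o wp [::] = (fun=> vt v) by apply: boolp.funext => t; rewrite /= ract_vert mulg1.
rewrite cE in F; have m1 := mpath_epath y0 vs; rewrite sl in m1.
have m2 := word_mpath v w; rewrite E in m2.
eexists; exact: (mhom_trans m1 m2 (mpath_cst (vt v) (lexx 0)) H F).
Qed.

Lemma rips_connected x y : exists c, path_between x y c.
Proof.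
have [v vx] := bary_neq0 x; have [w wy] := bary_neq0 y.
have [u uE] := lambda_word (v^-1 * w)%g.
have cx : compat x (vt v) by rewrite compatC; exact: compat_sub (supp_vert y0 vx).
have cy : compat (vt w) y by exact: compat_sub (supp_vert y0 wy).
have [m1 _] := mpath_seg cx; have [m3 _] := mpath_seg cy.
have m2 := word_mpath v u; rewrite uE mulVKg in m2.
have M := mpath_cat m1 (mpath_cat m2 m3).
have a0 : 0 < 1 + ((size u)%:R + 1) :> R by rewrite ltr_wpDr// addr_ge0.
have [_ [[D D0 cD] [c0 c1]]] := mpath_scale a0 M.
exists (fun t => pcat 1 (fun t => seg x (vt v) (clamp 0 1 t)) (pcat (size u)%:R (ract v \o wp u)
  (fun t => seg (vt w) y (clamp 0 1 t))) ((1 + ((size u)%:R + 1)) * t)).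
split; first exact: lipc_continuous (@glip_lipc _ _ _ D _ 0 1 cD).
  by apply: c0.
by apply: c1.
Qed.

(** The polygon of a fine subdivision stays in the simplices of the loop, so the loop can be pushed
    straight to an edge loop. *)
Lemma rips_loop x (c : R -> X) : path_between x x c ->
  exists H : R * R -> X,
   [/\ {within [set p | p.1 \in `[0, 1] /\ p.2 \in `[0, 1]], continuous H},
      forall t, t \in `[0, 1] -> H (0, t) = c t,
      forall t, t \in `[0, 1] -> H (1, t) = x
    & forall s, s \in `[0, 1] -> H (s, 0) = x /\ H (s, 1) = x].
Proof.
move=> [cc c0 c1].
have c01 : compact (`[0, 1]%classic : set R) by exact: segment_compact.
have [U UP] := compact_supp rips_locally_finite (continuous_compact cc c01).
have inI (t : R) : 0 <= t <= 1 -> (`[0, 1]%classic : set R) t by move=> h; rewrite /= in_itv.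
have cU (t : R) : 0 <= t <= 1 -> (finsupp (c t) `<=` U)%fset by move=> h; apply: UP; exists t => //; exact: inI.
have U0 : 0 < (#|` U|)%:R^-1 :> R.
  rewrite invr_gt0 ltr0n cardfs_gt0; apply/fset0Pn; have [v vc] := bary_neq0 (c 0).
  by exists v; apply: (fsubsetP (cU 0 _)); rewrite ?lexx ?ler01.
have [k nP] := uniform_continuity c01 cc U0.
pose M := k.+2; have M0 : 0 < M%:R :> R by rewrite ltr0n.
pose f (t : R) := c (t / M%:R).
have fin (t : R) : 0 <= t <= M%:R -> 0 <= t / M%:R <= 1.
  by move=> /andP[t0 tM]; rewrite divr_ge0 ?(ltW M0)//= ler_pdivrMr// mul1r.
have fU : supported U M f by move=> t /fin/cU.
have ff : nearby U M f f.
  move=> s t sM tM st; apply: nP; [exact/inI/fin|exact/inI/fin|].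
  rewrite /ball /= -mulrBl normrM (ger0_norm (x := M%:R^-1)) ?invr_ge0//.
  apply: (@le_lt_trans _ _ (1 * M%:R^-1)); first by rewrite ler_wpM2r ?invr_ge0.
  by rewrite mul1r ltf_pV2 ?posrE ?ltr0n// ltr_nat.
have f0 : f 0 = x by rewrite /f mul0r.
have fM : f M%:R = x by rewrite /f divff ?gt_eqF.
pose v := pickv U x; pose es := verts U M f.
have pE : polygon y0 U M f = epath y0 v es by rewrite /polygon f0.
have esp : path (adj rips) v es by have := approx_path fU ff; rewrite f0.
have esl : last v es = v.
  transitivity (pickv U (f M%:R)); last by rewrite fM.
  transitivity (nth (pickv U (f 0)) (pickv U (f 0) :: es) M); last by apply: verts_nth; exact: leqnn.
  by rewrite f0 -/v (last_nth v) size_verts.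
have [A eA] := edge_loop_contraction esp esl.
have em := mpath_epath y0 esp; rewrite esl size_verts in em; rewrite size_verts in eA.
apply: (loop_contraction (conj cc (conj c0 c1)) M0 em _ eA) => t t01.
have tM : 0 <= M%:R * t <= M%:R := scaled_in01 (ltW M0) t01.
have h := approx_supp y0 fU ff ff tM; rewrite pE /f (mulr_div_cancel_pos t M0) in h.
by rewrite compatC; exact: (compat_sub h).
Qed.

End Rips.

Lemma lambda_model (R : realType) (r n : nat) : (1 < r)%N -> (1 < n)%N ->
  exists (V : choiceType) (K : complex V), geometric_model R K (Lambda r n).
Proof.
move=> r1 n1; exists (Lambda r n), (rips r n); split; last first.
  by exists (@ract r n R); exact: ract_geometric.
have [y0 _] := realization_inhabited r n R.
split; first by exists y0.
  exact: rips_connected y0.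
exact: (rips_loop y0 r1 n1).
Qed.

Theorem proposition4p1 (R : realType) (r n : nat) (hr : (2 <= r)%N)
    (hn : (2 <= n)%N) :
  group_dehn_equiv (Lambda r n) (fun l : R => (l ^+ 2)%:E).
Proof.
split; first exact: lambda_model.
move=> V K HK; split; first exact: (dehn_dominated hr hn HK).
have [sc [act [act1M act_iso act_proper [C Ccompact Ccover]]]] := HK.
have act1 x : act 1%g x = x by case: (act1M x).
have actM g h x : act (g * h)%g x = act g (act h x) by have [_ H] := act1M x; exact: H.
have [[y0 _] _ _] := sc.
have [v0 v0y] := bary_neq0 y0.
have Kv0 : face K [fset v0]%fset := face1 (bary_face y0) v0y.
have C'compact : compact (C `|` [set vert y0 v0]).
  by apply: compactU => //; exact: compact_set1.
have C'cover : \bigcup_g (act g @` (C `|` [set vert y0 v0])) = setT.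
  apply/seteqP; split=> // x _; have : (\bigcup_g (act g @` C)) x by rewrite Ccover.
  by move=> [g _ [y Cy yx]]; exists g => //; exists y => //; left.
have C'0 : (C `|` [set vert y0 v0]) (vert y0 v0) by right.
exact: (square_dominated hr hn act1 actM act_iso act_proper C'compact C'cover sc Kv0 C'0).
Qed.
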